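(* Assume the Riemann Hypothesis. Then \[ |M(x)| \le 0.6\sqrt{x}\exp\left(\frac{5.2251\log x}{\log\log\left(\frac{3e}{2}\sqrt{x}\right)}+\log\log x\right)\quad\text{for } x\ge 10^{10^{4.487}}, \] and, for every integer $k\ge2$, \[ \left|Q_k(x)-\frac{x}{\zeta(k)}\right| \le 0.1\,x^{\frac{1}{k+1}}\exp\left(\frac{7.525\log x}{2(k+1)\log\log\left(\frac{3e}{2}x^{\frac{1}{2(k+1)}}\right)}+\frac{(7.492k+8.25)\log x}{(k+1)\log\log\left(\frac{3e}{2}x^{\frac{1}{k+1}}\right)}+2\log\log x\right) \] for $x\ge 10^{(k+1)10^{23.147}}$. Moreover, for each triple $(\alpha,X,A)$ in the list $(0.999,4.487,0.517)$, $(0.99,4.543,0.505)$, $(0.9,5.255,0.408)$, $(0.85,5.837,0.362)$, $(0.8,6.654,0.322)$, $(0.75,7.865,0.286)$, $(0.7,9.798,0.254)$, $(0.65,13.003,0.227)$, $(0.6,19.53,0.202)$, $(0.55,39.121,0.179)$ we have $|M(x)|\le A x^{\alpha}\log x$ for all $x\ge 10^{10^{X}}$; and for each triple $(\beta,Y,B)$ in the list $(0.4999,23.147,0.0852)$, $(0.499,23.273,0.0850)$, $(0.49,24.628,0.0826)$, $(0.48,26.326,0.0799)$, $(0.47,28.276,0.0774)$, $(0.46,30.534,0.0750)$, $(0.45,33.179,0.0726)$, $(0.44,36.314,0.0704)$, $(0.4,58.29,0.0622)$, $(0.35,234.21,0.0533)$ we have $\left|Q_2(x)-\frac{x}{\zeta(2)}\right|\le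 B x^{\beta}\log^2 x$ for all $x\ge 10^{3\cdot 10^{Y}}$.
   Context: $\mu$ is the Möbius function and $M(x)=\sum_{n\le x}\mu(n)$ is the Mertens function. For an integer $k\ge2$, a positive integer is $k$-free if it is not divisible by $p^k$ for any prime $p$; $Q_k(x)$ denotes the number of $k$-free positive integers not exceeding $x\ge1$. $\zeta$ is the Riemann zeta-function; the Riemann Hypothesis asserts all nontrivial zeros of $\zeta$ have real part $1/2$. *)

(* Defs.v *)
From Stdlib Require Import Reals ZArith List.
From Coquelicot Require Import Coquelicot.
From mathcomp Require Import ssreflect ssrbool ssrnat seq div prime.

(* [kfreeb k n] : no prime p has p^k dividing n.  For n >= 1 any prime p with
   p^k | n (k >= 1) satisfies p <= n, so checking p in 0..n is exhaustive. *)
Definition kfreeb (k n : nat) : bool :=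
  all (fun p => ~~ (prime p && (expn p k %| n))) (iota 0%nat n.+1).

Definition mobius (n : nat) : Z :=
  if eqn n 0%nat then Z0
  else if kfreeb 2%nat n then (if odd (size (primes n)) then Zneg xH else Zpos xH)
  else Z0.

(* floor of a real number, as a nat (0 for negative reals) *)
Definition floor_nat (x : R) : nat := Z.to_nat (Int_part x).

Fixpoint mertens_nat (N : nat) : Z :=
  match N with
  | O => Z0
  | S m => (mertens_nat m + mobius (S m))%Z
  end.

Definition Mertens (x : R) : R := IZR (mertens_nat (floor_nat x)).

Fixpoint count_kfree (k N : nat) : nat :=
  match N with
  | O => O
  | S m => Nat.add (count_kfree k m) (if kfreeb k (S m) then 1%nat else 0%nat)
  end.

Definition Qk (k : nat) (x : R) : R := INR (count_kfree k (floor_nat x)).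

Definition zeta_real (k : nat) : R := Series (fun n => / (INR (S n)) ^ k).

Definition cpow (a : R) (z : C) : C :=
  (exp (Re z * ln a) * cos (Im z * ln a), exp (Re z * ln a) * sin (Im z * ln a))%R.

Definition eta_term (s : C) (n : nat) : C :=
  Cmult (RtoC ((-1) ^ n)) (cpow (INR (S n)) (Copp s)).

(* [zeta_value s z] : for Re s > 0 (s not a zero of 1 - 2^{1-s}), the
   analytically continued zeta function takes the value z at s, using
   zeta(s) = eta(s) / (1 - 2^{1-s}). *)
Definition zeta_value (s z : C) : Prop :=
  exists e : C, is_series (eta_term s) e /\
    z = Cdiv e (Cminus (RtoC 1) (cpow 2 (Cminus (RtoC 1) s))).

Definition RiemannHypothesis : Prop :=
  forall s : C, (0 < Re s < 1)%R -> zeta_value s (RtoC 0) -> Re s = (1/2)%R.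

Open Scope R_scope.
Import ListNotations.

Definition M_table : list (R * R * R) :=
  [ (999/1000, 4487/1000, 517/1000); (99/100, 4543/1000, 505/1000);
    (9/10, 5255/1000, 408/1000); (85/100, 5837/1000, 362/1000);
    (8/10, 6654/1000, 322/1000); (75/100, 7865/1000, 286/1000);
    (7/10, 9798/1000, 254/1000); (65/100, 13003/1000, 227/1000);
    (6/10, 1953/100, 202/1000); (55/100, 39121/1000, 179/1000) ]%list.

Definition Q2_table : list (R * R * R) :=
  [ (4999/10000, 23147/1000, 852/10000); (499/1000, 23273/1000, 850/10000);
    (49/100, 24628/1000, 826/10000); (48/100, 26326/1000, 799/10000);
    (47/100, 28276/1000, 774/10000); (46/100, 30534/1000, 750/10000);
    (45/100, 33179/1000, 726/10000); (44/100, 36314/1000, 704/10000);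
    (4/10, 5829/100, 622/10000); (35/100, 23421/100, 533/10000) ]%list.

(* Main.v *)
(* Put f(s) = (s - 1) zeta(s) and E = f'/f; under RH, E is holomorphic on Re s > 1/2.

   Reflecting in a vertical line Re s = be > 1/2 and using the maximum principle, Re E is bounded
   below by - ln |t| - O(1) there; hence (Borel-Caratheodory for E) the size of E at abscissa 1/2 + a/2
   is at most 4 times the size at 1/2 + a, up to a logarithm.  Conversely, for Y = exp lam,
   (s - 1)(E(s) + sum_{n <= Y} Lambda(n) n^(-s)) - 1 times Y^s is O(s) to the far right, so the
   maximum principle in the half plane Re s >= 1/2 + b bounds E(1/2 + 2b + it) by the Dirichlet
   polynomial plus exp (- lam b) times the supremum on the left line.  With a large parameter l, u = ln l,
   lam = 3 u / 2 and b = 2 / u the two steps together are a contraction and give E = O(omega) on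
   Re s = 1/2 + b, omega(t) = ln (exp l + |t|), with an explicit constant.  Integrating Re E towards Re s = 3/2 yields
   |zeta|, 1/|zeta| <= exp (omega / (2 u)) up to the pole, for Re s >= 1/2 + 4/u.

   A smoothed Perron formula on the line 1/2 + 4/u then bounds sum_{n <= N} mu(n) n^(-i tau), and
   M(x) is the case tau = 0.  For Q_k, write the indicator of the k-free integers as the sum of
   mu(d) over d^k | n.  The d up to y = x^(1/(k+1)) are treated trivially; for the others
   Perron's formula is applied to zeta(s) sum_d mu(d) d^(-ks), where the sum over d is bounded by
   partial summation from the twisted sums of mu.  The resulting error terms are
   exp (ln x / 2 + 17/4 ln x / ln (ln x / 2)) up to ln x and y exp (6 ln x / ln ln y), which are
   smaller than the stated ones in the stated ranges. *)
Require Import Defs.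
From Stdlib Require Import Reals ZArith List.
From Coquelicot Require Import Coquelicot.
From Stdlib Require Import Lra Lia Psatz.
Open Scope R_scope.

(* Inside [C_scope] the components of a literal pair would be parsed as complex numbers. *)
Local Notation cc x y := (@pair R R x%R y%R).

(** Classically the lower bound for Re E is the positivity of Re 1/(s - rho) in the partial
    fractions of zeta'/zeta, which rest on the Hadamard product and Stirling's formula. The
    reflection argument replaces both: it asks only for polynomial growth of f, a lower bound far to
    the right, and absence of zeros. Cauchy's formula on rectangles and the mean values on circles
    rest in turn on one device, the dilation of a closed contour about a point. The parameters
    balance as follows. The step to the left loses a factor 4, the step to the right gains exp (-
    lam b) = exp (-3), and 4 exp (-3) < 1. The Dirichlet polynomial has size about exp (lam / 2) =
    exp (3 u / 4) up to a power of u, hence stays below omega >= exp u. In the Mertens exponent 17/4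
    = 4 + 1/4: the line of integration lies 4/u to the right of 1/2, and 1/zeta on it contributes
    omega / (2 u) with omega = ln x / 2. For k-free integers 25/6 = 8/3 + 3/2 comes from the line of
    integration and from three factors exp (omega / (2 u)) with omega = ln x; raising it to 6 pays
    for all remaining factors. *)

Lemma Cmod_sub_comm (a b : C) : Cmod (a - b) = Cmod (b - a).
Proof. rewrite <- Cmod_opp. f_equal. ring. Qed.

Lemma Cmod_tri_sub (a b c : C) : Cmod (a - c) <= Cmod (a - b) + Cmod (b - c).
Proof. replace (a - c)%C with ((a - b) + (b - c))%C by ring. apply Cmod_triangle. Qed.

Lemma Cmod_rev (a b : C) : Cmod a - Cmod b <= Cmod (a - b).
Proof.
  pose proof (Cmod_triangle (a - b) b). replace (a - b + b)%C with a in H by ring. lra.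
Qed.

Lemma Cmod_minus_le (a b : C) : Cmod (a - b) <= Cmod a + Cmod b.
Proof. unfold Cminus. eapply Rle_trans; [apply Cmod_triangle|]. rewrite Cmod_opp. lra. Qed.

Lemma Rabs_Re_le (z : C) : Rabs (Re z) <= Cmod z.
Proof. eapply Rle_trans; [|apply Rmax_Cmod]. apply Rmax_l. Qed.

Lemma Rabs_Im_le (z : C) : Rabs (Im z) <= Cmod z.
Proof. eapply Rle_trans; [|apply Rmax_Cmod]. apply Rmax_r. Qed.

Lemma Re_le_Cmod (z : C) : Re z <= Cmod z.
Proof. eapply Rle_trans; [apply Rle_abs|apply Rabs_Re_le]. Qed.

Lemma Cmod_le_abs (z : C) : Cmod z <= Rabs (Re z) + Rabs (Im z).
Proof.
  destruct z as [x y]; simpl.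
  replace (x, y) with (RtoC x + RtoC y * Ci)%C.
  - eapply Rle_trans; [apply Cmod_triangle|]. rewrite Cmod_mult, !Cmod_R, Cmod_Ci. lra.
  - unfold RtoC, Ci, Cplus, Cmult; simpl. f_equal; ring.
Qed.

Lemma Cmod_sqr (z : C) : Cmod z * Cmod z = Re z * Re z + Im z * Im z.
Proof.
  unfold Cmod. rewrite sqrt_sqrt.
  - destruct z; simpl; ring.
  - destruct z; simpl. nra.
Qed.

Lemma C_eta (a b : C) : Re a = Re b -> Im a = Im b -> a = b.
Proof. destruct a, b; simpl; intros; subst; reflexivity. Qed.

Lemma Cmod_conj (z : C) : Cmod (Cconj z) = Cmod z.
Proof. unfold Cmod, Cconj; destruct z; simpl. f_equal. ring. Qed.

(** * The complex exponential *)

Definition cexp (z : C) : C := (exp (Re z) * cos (Im z), exp (Re z) * sin (Im z)).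

Lemma cexp_plus (a b : C) : cexp (a + b) = (cexp a * cexp b)%C.
Proof.
  destruct a as [a1 a2], b as [b1 b2]; unfold cexp, Cmult; simpl.
  rewrite exp_plus, cos_plus, sin_plus. f_equal; ring.
Qed.

Lemma cexp_0 : cexp 0 = 1%C.
Proof. unfold cexp; simpl. rewrite exp_0, cos_0, sin_0. unfold RtoC. f_equal; ring. Qed.

Lemma Cmod_cexp (z : C) : Cmod (cexp z) = exp (Re z).
Proof.
  unfold cexp, Cmod; simpl.
  replace (_ + _) with (exp (Re z) * exp (Re z)).
  - apply sqrt_square. left; apply exp_pos.
  - pose proof (sin2_cos2 (Im z)) as H; unfold Rsqr in H. 
    replace (exp (Re z) * exp (Re z)) with (exp (Re z) * exp (Re z) * (sin (Im z) * sin (Im z) + cos (Im z) * cos (Im z))) by (rewrite H; ring).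
    ring.
Qed.

Lemma cexp_neq_0 (z : C) : cexp z <> 0%C.
Proof. apply Cmod_gt_0. rewrite Cmod_cexp. apply exp_pos. Qed.

Lemma cexp_R (x : R) : cexp (RtoC x) = RtoC (exp x).
Proof. unfold cexp, RtoC; simpl. rewrite cos_0, sin_0. f_equal; ring. Qed.

Lemma cexp_conj (z : C) : cexp (Cconj z) = Cconj (cexp z).
Proof. unfold cexp, Cconj; destruct z; simpl. rewrite cos_neg, sin_neg. f_equal; ring. Qed.

(** * Continuity and differentiability of complex-valued functions *)

(** The source is an arbitrary uniform space because paths on R, functions on [R * R] (for
    differentiation under the integral) and functions on C all occur. [Cctn] is the version on C
    with balls in [Cmod]; [Cctn_ctn] identifies the two. *)
Definition ctn {T : UniformSpace} (f : T -> C) (x : T) : Prop :=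
  forall eps, 0 < eps -> locally x (fun y => Cmod (f y - f x) < eps).

Definition Cctn (F : C -> C) (z : C) : Prop :=
  forall eps, 0 < eps -> exists d, 0 < d /\
    forall w, Cmod (w - z) < d -> Cmod (F w - F z) < eps.

(** The linear approximation form avoids difference quotients, so the point w = z needs no exclusion
    and the chain rule has no special case. *)
Definition cder (F : C -> C) (z l : C) : Prop :=
  forall eps, 0 < eps -> exists d, 0 < d /\
    forall w, Cmod (w - z) < d -> Cmod (F w - F z - (w - z) * l) <= eps * Cmod (w - z).

Definition rder (f : R -> C) (t : R) (l : C) : Prop :=
  forall eps, 0 < eps -> exists d, 0 < d /\
    forall u, Rabs (u - t) < d -> Cmod (f u - f t - RtoC (u - t) * l) <= eps * Rabs (u - t).

Lemma ctn_const {T : UniformSpace} (c : C) (x : T) : ctn (fun _ => c) x.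
Proof.
  intros e He. apply filter_forall. intros y.
  replace (c - c)%C with (RtoC 0) by ring. rewrite Cmod_0. exact He.
Qed.

Lemma ctn_plus {T : UniformSpace} (f g : T -> C) (x : T) :
  ctn f x -> ctn g x -> ctn (fun y => (f y + g y)%C) x.
Proof.
  intros Hf Hg e He. assert (He2 : 0 < e / 2) by lra.
  generalize (filter_and _ _ (Hf (e / 2) He2) (Hg (e / 2) He2)).
  apply filter_imp. intros y [H1 H2].
  replace (f y + g y - (f x + g x))%C with ((f y - f x) + (g y - g x))%C by ring.
  eapply Rle_lt_trans; [apply Cmod_triangle|]. lra.
Qed.

Lemma ctn_mult {T : UniformSpace} (f g : T -> C) (x : T) :
  ctn f x -> ctn g x -> ctn (fun y => (f y * g y)%C) x.
Proof.
  intros Hf Hg e He.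
  set (A := Cmod (f x)). set (B := Cmod (g x)).
  assert (HA : 0 <= A) by apply Cmod_ge_0. assert (HB : 0 <= B) by apply Cmod_ge_0.
  set (d := Rmin 1 (e / (A + B + 2))).
  assert (Hd : 0 < d).
  { unfold d. apply Rmin_case; [lra|]. apply Rdiv_lt_0_compat; lra. }
  assert (Hd1 : d <= 1) by apply Rmin_l.
  assert (Hd2 : d * (A + B + 2) <= e).
  { pose proof (Rmin_r 1 (e / (A + B + 2))) as H. fold d in H.
    apply (Rmult_le_compat_r (A + B + 2)) in H; [|lra].
    unfold Rdiv in H. rewrite Rmult_assoc, Rinv_l, Rmult_1_r in H; lra. }
  generalize (filter_and _ _ (Hf d Hd) (Hg d Hd)).
  apply filter_imp. intros y [H1 H2].
  replace (f y * g y - f x * g x)%C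
    with ((f y - f x) * (g y - g x) + f x * (g y - g x) + (f y - f x) * g x)%C by ring.
  eapply Rle_lt_trans; [apply Cmod_triangle|].
  eapply Rle_lt_trans; [apply Rplus_le_compat_r, Cmod_triangle|].
  rewrite !Cmod_mult. fold A B.
  pose proof (Cmod_ge_0 (f y - f x)). pose proof (Cmod_ge_0 (g y - g x)). nra.
Qed.

Lemma ctn_comp {T : UniformSpace} (F : C -> C) (f : T -> C) (x : T) :
  Cctn F (f x) -> ctn f x -> ctn (fun y => F (f y)) x.
Proof.
  intros HF Hf e He. destruct (HF e He) as [d [Hd H]].
  generalize (Hf d Hd). apply filter_imp. auto.
Qed.

Lemma ctn_ext {T : UniformSpace} (f g : T -> C) (x : T) :
  (forall y, f y = g y) -> ctn f x -> ctn g x.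
Proof.
  intros E H e He. generalize (H e He). apply filter_imp. intros y. now rewrite !E.
Qed.

Lemma ctn_pair {T : UniformSpace} (f g : T -> R) (x : T) :
  continuous f x -> continuous g x -> ctn (fun y => (f y, g y)) x.
Proof.
  intros Hf Hg e He.
  assert (He2 : 0 < e / 2) by lra.
  pose proof (proj1 (filterlim_locally f (f x)) Hf (mkposreal _ He2)) as H1.
  pose proof (proj1 (filterlim_locally g (g x)) Hg (mkposreal _ He2)) as H2.
  generalize (filter_and _ _ H1 H2). apply filter_imp.
  intros y [A B]. change (Rabs (f y - f x) < e / 2) in A. change (Rabs (g y - g x) < e / 2) in B.
  eapply Rle_lt_trans; [apply Cmod_le_abs|].
  simpl. unfold Rminus in A, B. lra.
Qed.

Lemma ctn_RtoC {T : UniformSpace} (f : T -> R) (x : T) :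
  continuous f x -> ctn (fun y => RtoC (f y)) x.
Proof. intros H. apply ctn_pair; [exact H|apply continuous_const]. Qed.

Lemma ctn_Re {T : UniformSpace} (f : T -> C) (x : T) :
  ctn f x -> continuous (fun y => Re (f y)) x.
Proof.
  intros H. apply filterlim_locally. intros e.
  generalize (H e (cond_pos e)). apply filter_imp. intros y Hy.
  change (Rabs (Re (f y) - Re (f x)) < e).
  eapply Rle_lt_trans; [|exact Hy].
  replace (Re (f y) - Re (f x)) with (Re (f y - f x)) by (destruct (f y), (f x); simpl; ring).
  apply Rabs_Re_le.
Qed.

Lemma ctn_Im {T : UniformSpace} (f : T -> C) (x : T) :
  ctn f x -> continuous (fun y => Im (f y)) x.
Proof.
  intros H. apply filterlim_locally. intros e.
  generalize (H e (cond_pos e)). apply filter_imp. intros y Hy.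
  change (Rabs (Im (f y) - Im (f x)) < e).
  eapply Rle_lt_trans; [|exact Hy].
  replace (Im (f y) - Im (f x)) with (Im (f y - f x)) by (destruct (f y), (f x); simpl; ring).
  apply Rabs_Im_le.
Qed.

Lemma cder_Cctn (F : C -> C) (z l : C) : cder F z l -> Cctn F z.
Proof.
  intros H e He. destruct (H 1 Rlt_0_1) as [d [Hd Hw]].
  pose proof (Cmod_ge_0 l) as Hl.
  exists (Rmin d (e / (Cmod l + 2))). split.
  - apply Rmin_case; [exact Hd|]. apply Rdiv_lt_0_compat; lra.
  - intros w Hlt.
    assert (H1 : Cmod (w - z) < d) by (eapply Rlt_le_trans; [exact Hlt|apply Rmin_l]).
    assert (H2 : Cmod (w - z) < e / (Cmod l + 2)) by (eapply Rlt_le_trans; [exact Hlt|apply Rmin_r]).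
    apply (Rmult_lt_compat_r (Cmod l + 2)) in H2; [|lra].
    unfold Rdiv in H2. rewrite Rmult_assoc, Rinv_l, Rmult_1_r in H2; [|lra].
    specialize (Hw w H1).
    replace (F w - F z)%C with ((F w - F z - (w - z) * l) + (w - z) * l)%C by ring.
    eapply Rle_lt_trans; [apply Cmod_triangle|]. rewrite Cmod_mult.
    pose proof (Cmod_ge_0 (w - z)). nra.
Qed.

Lemma cder_const (c z : C) : cder (fun _ => c) z 0.
Proof.
  intros e He. exists 1. split; [lra|]. intros w _.
  replace (c - c - (w - z) * 0)%C with (RtoC 0) by ring. rewrite Cmod_0.
  pose proof (Cmod_ge_0 (w - z)). nra.
Qed.

Lemma cder_id (z : C) : cder (fun w => w) z 1.
Proof.
  intros e He. exists 1. split; [lra|]. intros w _.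
  replace (w - z - (w - z) * 1)%C with (RtoC 0) by ring. rewrite Cmod_0.
  pose proof (Cmod_ge_0 (w - z)). nra.
Qed.

Lemma cder_plus (F G : C -> C) (z a b : C) :
  cder F z a -> cder G z b -> cder (fun w => (F w + G w)%C) z (a + b).
Proof.
  intros HF HG e He.
  destruct (HF (e / 2) ltac:(lra)) as [d1 [Hd1 H1]].
  destruct (HG (e / 2) ltac:(lra)) as [d2 [Hd2 H2]].
  exists (Rmin d1 d2). split; [apply Rmin_case; auto|]. intros w Hw.
  specialize (H1 w (Rlt_le_trans _ _ _ Hw (Rmin_l _ _))).
  specialize (H2 w (Rlt_le_trans _ _ _ Hw (Rmin_r _ _))).
  replace (F w + G w - (F z + G z) - (w - z) * (a + b))%C
    with ((F w - F z - (w - z) * a) + (G w - G z - (w - z) * b))%C by ring.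
  eapply Rle_trans; [apply Cmod_triangle|]. lra.
Qed.

Lemma cder_mult (F G : C -> C) (z a b : C) :
  cder F z a -> cder G z b -> cder (fun w => (F w * G w)%C) z (a * G z + F z * b).
Proof.
  intros HF HG e He.
  set (A := Cmod (F z)). set (B := Cmod (G z)). set (L := Cmod a).
  assert (HA : 0 <= A) by apply Cmod_ge_0. assert (HB : 0 <= B) by apply Cmod_ge_0.
  assert (HL : 0 <= L) by apply Cmod_ge_0.
  set (k := e / (A + B + L + 1)).
  assert (Hk : 0 < k) by (apply Rdiv_lt_0_compat; lra).
  assert (Hke : k * (A + B + L + 1) = e) by (unfold k; field; lra).
  destruct (HF (Rmin k 1) ltac:(apply Rmin_case; lra)) as [d1 [Hd1 H1]].
  destruct (HG k Hk) as [d2 [Hd2 H2]].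
  destruct (cder_Cctn _ _ _ HG k Hk) as [d3 [Hd3 H3]].
  exists (Rmin d1 (Rmin d2 d3)). split; [repeat apply Rmin_case; auto|]. intros w Hw.
  assert (W1 : Cmod (w - z) < d1) by (eapply Rlt_le_trans; [exact Hw|apply Rmin_l]).
  assert (W2 : Cmod (w - z) < d2) by (eapply Rlt_le_trans; [exact Hw|eapply Rle_trans; [apply Rmin_r|apply Rmin_l]]).
  assert (W3 : Cmod (w - z) < d3) by (eapply Rlt_le_trans; [exact Hw|eapply Rle_trans; [apply Rmin_r|apply Rmin_r]]).
  specialize (H1 w W1). specialize (H2 w W2). specialize (H3 w W3).
  replace (F w * G w - F z * G z - (w - z) * (a * G z + F z * b))%C
    with ((F w - F z - (w - z) * a) * G z + (F w - F z - (w - z) * a) * (G w - G z)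
       + F z * (G w - G z - (w - z) * b) + (w - z) * a * (G w - G z))%C by ring.
  eapply Rle_trans; [apply Cmod_triangle|]. eapply Rle_trans; [apply Rplus_le_compat_r, Cmod_triangle|].
  eapply Rle_trans; [apply Rplus_le_compat_r, Rplus_le_compat_r, Cmod_triangle|].
  rewrite !Cmod_mult; fold A B L.
  assert (Hk1 : Rmin k 1 <= k) by apply Rmin_l. assert (Hk2 : Rmin k 1 <= 1) by apply Rmin_r.
  pose proof (Cmod_ge_0 (w - z)) as Hz. set (m := Cmod (w - z)) in *.
  set (p := Cmod (F w - F z - (w - z) * a)) in *. assert (0 <= p) by apply Cmod_ge_0.
  set (q := Cmod (G w - G z)) in *. assert (0 <= q) by apply Cmod_ge_0.
  assert (P1 : p <= k * m) by nra. assert (P2 : p <= m) by nra.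
  assert (p * B <= k * m * B) by nra. assert (p * q <= m * k) by nra.
  assert (A * Cmod (G w - G z - (w - z) * b) <= A * (k * m)) by nra.
  assert (m * L * q <= m * L * k) by (apply Rmult_le_compat_l; [nra|lra]).
  rewrite <- Hke. nra.
Qed.

Lemma cder_ext (F G : C -> C) (z a b : C) :
  (forall w, F w = G w) -> a = b -> cder F z a -> cder G z b.
Proof. intros E <- H e He. destruct (H e He) as [d [Hd Hw]]. exists d; split; auto. intros w. rewrite <- !E. auto. Qed.

Lemma cder_opp (F : C -> C) (z a : C) : cder F z a -> cder (fun w => (- F w)%C) z (- a).
Proof.
  intros H. eapply cder_ext; [| |exact (cder_mult _ _ _ _ _ (cder_const (Copp 1) z) H)].
  - intros w; cbv beta; ring.
  - cbv beta; ring.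
Qed.

Lemma cder_minus (F G : C -> C) (z a b : C) :
  cder F z a -> cder G z b -> cder (fun w => (F w - G w)%C) z (a - b).
Proof. intros. apply cder_plus; [auto|apply cder_opp; auto]. Qed.

Lemma cder_comp (F G : C -> C) (z a b : C) :
  cder G z b -> cder F (G z) a -> cder (fun w => F (G w)) z (a * b).
Proof.
  intros HG HF e He.
  set (A := Cmod a). set (B := Cmod b).
  assert (HA : 0 <= A) by apply Cmod_ge_0. assert (HB : 0 <= B) by apply Cmod_ge_0.
  set (k := e / (A + B + 1)).
  assert (Hk : 0 < k) by (apply Rdiv_lt_0_compat; lra).
  assert (Hke : k * (A + B + 1) = e) by (unfold k; field; lra).
  destruct (HF k Hk) as [d1 [Hd1 H1]].
  destruct (HG (Rmin k 1) ltac:(apply Rmin_case; lra)) as [d2 [Hd2 H2]].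
  destruct (cder_Cctn _ _ _ HG d1 Hd1) as [d3 [Hd3 H3]].
  exists (Rmin d2 d3). split; [repeat apply Rmin_case; auto|]. intros w Hw.
  specialize (H2 w (Rlt_le_trans _ _ _ Hw (Rmin_l _ _))).
  specialize (H3 w (Rlt_le_trans _ _ _ Hw (Rmin_r _ _))).
  specialize (H1 (G w) H3).
  replace (F (G w) - F (G z) - (w - z) * (a * b))%C
   with ((F (G w) - F (G z) - (G w - G z) * a) + (G w - G z - (w - z) * b) * a)%C by ring.
  eapply Rle_trans; [apply Cmod_triangle|]. rewrite Cmod_mult. fold A.
  assert (Hk1 : Rmin k 1 <= k) by apply Rmin_l. assert (Hk2 : Rmin k 1 <= 1) by apply Rmin_r.
  pose proof (Cmod_ge_0 (w - z)) as Hz. set (m := Cmod (w - z)) in *.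
  set (p := Cmod (G w - G z - (w - z) * b)) in *. assert (0 <= p) by apply Cmod_ge_0.
  assert (Q : Cmod (G w - G z) <= p + m * B).
  { replace (G w - G z)%C with ((G w - G z - (w - z) * b) + (w - z) * b)%C by ring.
    eapply Rle_trans; [apply Cmod_triangle|]. rewrite Cmod_mult. fold p m B. lra. }
  assert (p <= k * m) by nra. assert (p <= m) by nra.
  rewrite <- Hke. nra.
Qed.

Lemma Cinv_cder (z : C) : z <> 0%C -> cder Cinv z (- (/ z * / z)).
Proof.
  intros Hz e He. set (m := Cmod z). assert (Hm : 0 < m) by (apply Cmod_gt_0; auto).
  exists (Rmin (m / 2) (e * (m * m * m) / 2)). split.
  { apply Rmin_case; [lra|]. apply Rdiv_lt_0_compat; [|lra]. repeat apply Rmult_lt_0_compat; auto. }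
  intros w Hw.
  assert (W1 : Cmod (w - z) < m / 2) by (eapply Rlt_le_trans; [exact Hw|apply Rmin_l]).
  assert (W2 : Cmod (w - z) < e * (m * m * m) / 2) by (eapply Rlt_le_trans; [exact Hw|apply Rmin_r]).
  assert (Hwm : m / 2 < Cmod w).
  { pose proof (Cmod_rev z w). rewrite Cmod_sub_comm in H. fold m in H. lra. }
  assert (Hw0 : w <> 0%C) by (apply Cmod_gt_0; lra).
  replace (/ w - / z - (w - z) * - (/ z * / z))%C with ((w - z) * (w - z) * (/ w * / z * / z))%C by (field; auto).
  rewrite !Cmod_mult, !Cmod_inv by auto. fold m.
  set (q := Cmod (w - z)) in *. assert (0 <= q) by apply Cmod_ge_0.
  replace (q * q * (/ Cmod w * / m * / m)) with (q * (q / (Cmod w * m * m))) by (field; split; lra).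
  rewrite (Rmult_comm e). apply Rmult_le_compat_l; [auto|].
  apply Rle_div_l; [repeat apply Rmult_lt_0_compat; lra|].
  assert (m / 2 * (m * m) <= Cmod w * (m * m)) by (apply Rmult_le_compat_r; nra). nra.
Qed.

Lemma cder_inv (F : C -> C) (z a : C) : F z <> 0%C -> cder F z a ->
  cder (fun w => / F w)%C z (- (/ F z * / F z) * a).
Proof. intros H0 H. apply (cder_comp Cinv F); [exact H|apply Cinv_cder; exact H0]. Qed.

(** The upper half follows from exp x * exp (-x) = 1 and the tangent bound exp (-x) >= 1 - x. *)
Lemma exp_2nd (x : R) : Rabs x <= 1 / 2 -> Rabs (exp x - 1 - x) <= 2 * x ^ 2.
Proof.
  intros H. apply Rabs_le_between in H.
  pose proof (exp_ineq1_le x). pose proof (exp_ineq1_le (- x)).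
  assert (exp x * exp (- x) = 1) by (rewrite <- exp_plus, Rplus_opp_r; apply exp_0).
  pose proof (exp_pos x).
  assert (exp x * (1 - x) <= 1) by nra.
  assert (exp x <= 1 + x + 2 * x ^ 2) by nra.
  apply Rabs_le. nra.
Qed.

(** By the half-angle formula cos y - 1 = -2 sin^2 (y/2), and |sin v| <= |v|. *)
Lemma cos_1st (y : R) : Rabs (cos y - 1) <= y ^ 2.
Proof.
  assert (E : cos y - 1 = - 2 * (sin (y / 2) * sin (y / 2))).
  { replace y with (2 * (y / 2)) at 1 by field. rewrite cos_2a_sin. ring. }
  rewrite E, Rabs_mult, (Rabs_left (- 2)) by lra.
  assert (S : sin (y / 2) * sin (y / 2) <= (y / 2) * (y / 2)).
  { assert (A : Rabs (sin (y / 2)) <= Rabs (y / 2)).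
    { destruct (Rle_lt_dec 0 (y / 2)) as [P|P].
      - rewrite (Rabs_pos_eq (y/2)) by auto. apply Rabs_le. 
        pose proof (SIN_bound (y/2)).
        destruct (Req_dec (y/2) 0) as [->|Q]; [rewrite sin_0; lra|].
        pose proof (sin_lt_x (y/2) ltac:(lra)).
        destruct (Rle_lt_dec (y/2) PI).
        + pose proof (sin_ge_0 (y/2) P r). lra.
        + pose proof PI2_1. lra.
      - replace (y/2) with (- - (y/2)) by ring. rewrite sin_neg, Rabs_Ropp, (Rabs_Ropp (- (y / 2))).
        set (v := - (y / 2)) in *. assert (0 < v) by (unfold v; lra).
        rewrite (Rabs_pos_eq v) by lra. apply Rabs_le.
        pose proof (SIN_bound v).
        pose proof (sin_lt_x v ltac:(lra)).
        destruct (Rle_lt_dec v PI).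
        + pose proof (sin_ge_0 v ltac:(lra) r). lra.
        + pose proof PI2_1. lra. }
    apply Rsqr_le_abs_1 in A. exact A. }
  rewrite Rabs_pos_eq by (apply Rle_0_sqr). nra.
Qed.

Lemma sin_2nd (y : R) : Rabs y <= 1 -> Rabs (sin y - y) <= y ^ 2.
Proof.
  intros H.
  assert (P : forall x, 0 <= x <= 1 -> Rabs (sin x - x) <= x ^ 2).
  { intros x Hx. destruct (Req_dec x 0) as [->|N]; [rewrite sin_0, Rminus_0_r, Rabs_R0; lra|].
    pose proof (sin_lt_x x ltac:(lra)).
    assert (B : x - x ^ 3 / 6 <= sin x).
    { pose proof (pre_sin_bound x 0 ltac:(lra) ltac:(lra)) as [B _].
      unfold sin_approx in B. simpl in B. unfold sin_term in B. simpl in B. lra. }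
    apply Rabs_le. nra. }
  destruct (Rle_lt_dec 0 y).
  - apply P. rewrite Rabs_pos_eq in H; lra.
  - replace (sin y - y) with (- (sin (- y) - - y)) by (rewrite sin_neg; ring).
    rewrite Rabs_Ropp. replace (y ^ 2) with ((- y) ^ 2) by ring. apply P.
    rewrite Rabs_left in H; lra.
Qed.

Lemma cexp_2nd (h : C) : Cmod h <= 1 / 2 -> Cmod (cexp h - 1 - h) <= 20 * (Cmod h * Cmod h).
Proof.
  intros H. destruct h as [x y].
  pose proof (Rabs_Re_le (x, y)) as Hx. pose proof (Rabs_Im_le (x, y)) as Hy. simpl in Hx, Hy.
  rewrite Cmod_sqr. simpl.
  eapply Rle_trans; [apply Cmod_le_abs|]. unfold cexp; simpl.
  pose proof (exp_2nd x ltac:(lra)) as E. pose proof (cos_1st y) as Cy. pose proof (sin_2nd y ltac:(lra)) as Sy.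
  assert (X : Rabs x <= 1 / 2) by lra. assert (Y : Rabs y <= 1 / 2) by lra.
  apply Rabs_le_between in E, Cy, Sy, X, Y.
  pose proof (exp_pos x).
  assert (E3 : exp x <= 3) by nra.
  assert (A1 : Rabs (exp x * cos y + - 1 + - x) <= 2 * x ^ 2 + 3 * y ^ 2) by (apply Rabs_le; nra).
  assert (A2 : Rabs (exp x * sin y - y) <= 3 * y ^ 2 + 3 * (x ^ 2 + y ^ 2)).
  { replace (exp x * sin y - y) with (exp x * (sin y - y) + (exp x - 1) * y) by ring.
    eapply Rle_trans; [apply Rabs_triang|]. rewrite !Rabs_mult.
    apply Rplus_le_compat.
    - rewrite (Rabs_pos_eq (exp x)) by lra. assert (Rabs (sin y - y) <= y ^ 2) by (apply Rabs_le; lra).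
      pose proof (Rabs_pos (sin y - y)). nra.
    - assert (Rabs (exp x - 1) <= 2 * Rabs x).
      { destruct (Rle_lt_dec 0 x).
        - rewrite (Rabs_pos_eq x) by auto. apply Rabs_le; nra.
        - rewrite (Rabs_left x) by auto. apply Rabs_le; nra. }
      pose proof (Rabs_pos x). pose proof (Rabs_pos y).
      assert (Rabs (exp x - 1) * Rabs y <= 2 * Rabs x * Rabs y) by (apply Rmult_le_compat_r; auto).
      rewrite <- (pow2_abs x), <- (pow2_abs y). nra. }
  replace (exp x * cos y + - (1) + - x) with (exp x * cos y + - 1 + - x) by ring.
  replace (exp x * sin y + - 0 + - y) with (exp x * sin y - y) by ring. nra.
Qed.

Lemma cexp_cder (z : C) : cder cexp z (cexp z).
Proof.
  intros e He. set (m := Cmod (cexp z)). assert (Hm : 0 < m) by (apply Cmod_gt_0, cexp_neq_0).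
  exists (Rmin (1 / 2) (e / (20 * m))). split.
  { apply Rmin_case; [lra|]. apply Rdiv_lt_0_compat; lra. }
  intros w Hw.
  assert (W1 : Cmod (w - z) < 1 / 2) by (eapply Rlt_le_trans; [exact Hw|apply Rmin_l]).
  assert (W2 : Cmod (w - z) < e / (20 * m)) by (eapply Rlt_le_trans; [exact Hw|apply Rmin_r]).
  apply (Rmult_lt_compat_r (20 * m)) in W2; [|lra].
  unfold Rdiv in W2. rewrite Rmult_assoc, Rinv_l, Rmult_1_r in W2 by lra.
  replace (cexp w - cexp z - (w - z) * cexp z)%C with (cexp z * (cexp (w - z) - 1 - (w - z)))%C.
  - rewrite Cmod_mult. fold m. pose proof (cexp_2nd (w - z) ltac:(lra)).
    pose proof (Cmod_ge_0 (w - z)). nra.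
  - replace (cexp w) with (cexp z * cexp (w - z))%C; [ring|].
    rewrite <- cexp_plus. f_equal. ring.
Qed.

Lemma cder_cexp (F : C -> C) (z a : C) : cder F z a -> cder (fun w => cexp (F w)) z (cexp (F z) * a).
Proof. intros H. apply (cder_comp cexp F); [exact H|apply cexp_cder]. Qed.

Lemma rder_comp (F : C -> C) (g : R -> C) (t : R) (a b : C) :
  rder g t b -> cder F (g t) a -> rder (fun u => F (g u)) t (a * b).
Proof.
  intros HG HF e He.
  set (A := Cmod a). set (B := Cmod b).
  assert (HA : 0 <= A) by apply Cmod_ge_0. assert (HB : 0 <= B) by apply Cmod_ge_0.
  set (k := e / (A + B + 1)).
  assert (Hk : 0 < k) by (apply Rdiv_lt_0_compat; lra).
  assert (Hke : k * (A + B + 1) = e) by (unfold k; field; lra).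
  destruct (HF k Hk) as [d1 [Hd1 H1]].
  destruct (HG (Rmin k 1) ltac:(apply Rmin_case; lra)) as [d2 [Hd2 H2]].
  assert (Hd3 : 0 < d1 / (B + 1)) by (apply Rdiv_lt_0_compat; lra).
  assert (Hd3' : d1 / (B + 1) * (B + 1) = d1) by (field; lra).
  exists (Rmin d2 (d1 / (B + 1))). split; [repeat apply Rmin_case; auto|]. intros u Hu.
  assert (U1 := Rlt_le_trans _ _ _ Hu (Rmin_l _ _)).
  assert (U2 := Rlt_le_trans _ _ _ Hu (Rmin_r _ _)).
  specialize (H2 u U1).
  assert (Hk1 : Rmin k 1 <= k) by apply Rmin_l. assert (Hk2 : Rmin k 1 <= 1) by apply Rmin_r.
  pose proof (Rabs_pos (u - t)) as Hz. set (m := Rabs (u - t)) in *.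
  set (p := Cmod (g u - g t - RtoC (u - t) * b)) in *. assert (0 <= p) by apply Cmod_ge_0.
  assert (Q : Cmod (g u - g t) <= p + m * B).
  { replace (g u - g t)%C with ((g u - g t - RtoC (u - t) * b) + RtoC (u - t) * b)%C by ring.
    eapply Rle_trans; [apply Cmod_triangle|]. rewrite Cmod_mult, Cmod_R. fold p m B. lra. }
  assert (p <= k * m) by nra. assert (p <= m) by nra.
  assert (Cmod (g u - g t) < d1) by nra.
  assert (Hgu : Cmod (g u - g t) < d1) by nra. specialize (H1 (g u) Hgu).
  replace (F (g u) - F (g t) - RtoC (u - t) * (a * b))%C
   with ((F (g u) - F (g t) - (g u - g t) * a) + (g u - g t - RtoC (u - t) * b) * a)%C by ring.
  eapply Rle_trans; [apply Cmod_triangle|]. rewrite Cmod_mult. fold A p.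
  rewrite <- Hke. nra.
Qed.

Lemma rder_of_is_derive (f g : R -> R) (t a b : R) :
  is_derive f t a -> is_derive g t b -> rder (fun u => (f u, g u)) t (a, b).
Proof.
  intros Hf Hg e He.
  destruct Hf as [_ Hf]. destruct Hg as [_ Hg].
  assert (He2 : 0 < e / 2) by lra.
  specialize (Hf t (fun P H => H) (mkposreal _ He2)).
  specialize (Hg t (fun P H => H) (mkposreal _ He2)).
  destruct Hf as [d1 H1]. destruct Hg as [d2 H2].
  exists (Rmin d1 d2). split; [apply Rmin_case; apply cond_pos|]. intros u Hu.
  specialize (H1 u (Rlt_le_trans _ _ _ Hu (Rmin_l _ _))).
  specialize (H2 u (Rlt_le_trans _ _ _ Hu (Rmin_r _ _))).
  change (Rabs (f u - f t - (u - t) * a) <= e / 2 * Rabs (u - t)) in H1.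
  change (Rabs (g u - g t - (u - t) * b) <= e / 2 * Rabs (u - t)) in H2.
  eapply Rle_trans; [apply Cmod_le_abs|]. simpl.
  replace (f u + - f t + - ((u - t) * a - 0 * b)) with (f u - f t - (u - t) * a) by ring.
  replace (g u + - g t + - ((u - t) * b + 0 * a)) with (g u - g t - (u - t) * b) by ring. lra.
Qed.

Lemma is_derive_eps (f : R -> R) (t l : R) :
  (forall eps, 0 < eps -> exists d, 0 < d /\ forall u, Rabs (u - t) < d ->
     Rabs (f u - f t - (u - t) * l) <= eps * Rabs (u - t)) -> is_derive f t l.
Proof.
  intros H. apply is_derive_Reals. intros e He. destruct (H (e / 2) ltac:(lra)) as [d [Hd Hu]].
  exists (mkposreal d Hd). intros h Hh Hb. simpl in Hb. specialize (Hu (t + h)).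
  replace (t + h - t) with h in Hu by ring. specialize (Hu Hb).
  replace ((f (t + h) - f t) / h - l) with ((f (t + h) - f t - h * l) / h) by (field; auto).
  rewrite Rabs_div by auto. apply Rlt_div_l; [apply Rabs_pos_lt; auto|].
  pose proof (Rabs_pos_lt h Hh). nra.
Qed.

Lemma rder_Re (f : R -> C) (t : R) (l : C) : rder f t l -> is_derive (fun u => Re (f u)) t (Re l).
Proof.
  intros H. apply is_derive_eps. intros e He. destruct (H e He) as [d [Hd Hu]].
  exists d; split; auto. intros u Hlt. eapply Rle_trans; [|apply (Hu u Hlt)].
  eapply Rle_trans; [|apply Rabs_Re_le]. right. f_equal.
  destruct (f u), (f t), l; simpl; ring.
Qed.

Lemma rder_Im (f : R -> C) (t : R) (l : C) : rder f t l -> is_derive (fun u => Im (f u)) t (Im l).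
Proof.
  intros H. apply is_derive_eps. intros e He. destruct (H e He) as [d [Hd Hu]].
  exists d; split; auto. intros u Hlt. eapply Rle_trans; [|apply (Hu u Hlt)].
  eapply Rle_trans; [|apply Rabs_Im_le]. right. f_equal.
  destruct (f u), (f t), l; simpl; ring.
Qed.

Lemma rder_ctn (f : R -> C) (t : R) (l : C) : rder f t l -> ctn f t.
Proof.
  intros H.
  apply ctn_ext with (f := fun u => (Re (f u), Im (f u))).
  { intros y; destruct (f y); reflexivity. }
  apply ctn_pair; apply (ex_derive_continuous (K := R_AbsRing) (V := R_NormedModule)).
  - exists (Re l). apply rder_Re; auto.
  - exists (Im l). apply rder_Im; auto.
Qed.

Lemma rder_affine (p v : C) (t : R) : rder (fun u => (p + RtoC u * v)%C) t v.
Proof.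
  intros e He. exists 1. split; [lra|]. intros u _.
  replace (p + RtoC u * v - (p + RtoC t * v) - RtoC (u - t) * v)%C with (RtoC 0).
  - rewrite Cmod_0. pose proof (Rabs_pos (u - t)). nra.
  - rewrite RtoC_minus. ring.
Qed.

Lemma rder_ext (f g : R -> C) (t : R) (a b : C) :
  (forall u, f u = g u) -> a = b -> rder f t a -> rder g t b.
Proof. intros E <- H e He. destruct (H e He) as [d [Hd Hw]]. exists d; split; auto. intros w. rewrite <- !E. auto. Qed.

(** Restriction to the horizontal line through z reduces this to uniqueness of real derivatives. *)
Lemma cder_unique (F : C -> C) (z a b : C) : cder F z a -> cder F z b -> a = b.
Proof.
  intros Ha Hb.
  assert (E0 : (z + RtoC 0 * 1)%C = z) by ring. rewrite <- E0 in Ha, Hb.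
  assert (Ra := rder_comp F (fun u => (z + RtoC u * 1)%C) 0 a 1 (rder_affine z 1 0) Ha).
  assert (Rb := rder_comp F (fun u => (z + RtoC u * 1)%C) 0 b 1 (rder_affine z 1 0) Hb).
  apply C_eta.
  - rewrite <- (Cmult_1_r a), <- (Cmult_1_r b).
    rewrite <- (is_derive_unique _ _ _ (rder_Re _ _ _ Ra)), <- (is_derive_unique _ _ _ (rder_Re _ _ _ Rb)). reflexivity.
  - rewrite <- (Cmult_1_r a), <- (Cmult_1_r b).
    rewrite <- (is_derive_unique _ _ _ (rder_Im _ _ _ Ra)), <- (is_derive_unique _ _ _ (rder_Im _ _ _ Rb)). reflexivity.
Qed.

(** * Integrals of complex-valued functions on an interval *)

Definition CI (f : R -> C) (a b : R) : C :=
  (RInt (fun t => Re (f t)) a b, RInt (fun t => Im (f t)) a b).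

Definition con (f : R -> C) (a b : R) : Prop := forall t, a <= t <= b -> ctn f t.

Lemma ex_RInt_cont (f : R -> R) (a b : R) : a <= b ->
  (forall t, a <= t <= b -> continuous f t) -> ex_RInt f a b.
Proof.
  intros H Hf. apply (ex_RInt_continuous (V := R_CompleteNormedModule)).
  intros z Hz. rewrite Rmin_left, Rmax_right in Hz by auto. auto.
Qed.

Lemma con_Re f a b : a <= b -> con f a b -> ex_RInt (fun t => Re (f t)) a b.
Proof. intros H Hf. apply ex_RInt_cont; auto. intros; apply ctn_Re; auto. Qed.

Lemma con_Im f a b : a <= b -> con f a b -> ex_RInt (fun t => Im (f t)) a b.
Proof. intros H Hf. apply ex_RInt_cont; auto. intros; apply ctn_Im; auto. Qed.

Lemma CI_ext f g a b : a <= b -> (forall t, a <= t <= b -> f t = g t) -> CI f a b = CI g a b.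
Proof.
  intros H E. unfold CI. f_equal; apply RInt_ext; intros x Hx;
  rewrite Rmin_left, Rmax_right in Hx by auto; rewrite E; auto; lra.
Qed.

Lemma CI_plus f g a b : a <= b -> con f a b -> con g a b ->
  CI (fun t => (f t + g t)%C) a b = (CI f a b + CI g a b)%C.
Proof.
  intros H Hf Hg. apply C_eta; simpl.
  - rewrite <- (RInt_plus (V := R_CompleteNormedModule)) by (apply con_Re; auto). reflexivity.
  - rewrite <- (RInt_plus (V := R_CompleteNormedModule)) by (apply con_Im; auto). reflexivity.
Qed.

Lemma CI_scal (c : C) f a b : a <= b -> con f a b ->
  CI (fun t => (c * f t)%C) a b = (c * CI f a b)%C.
Proof.
  intros H Hf. pose proof (con_Re _ _ _ H Hf) as H1. pose proof (con_Im _ _ _ H Hf) as H2.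
  destruct c as [x y]. apply C_eta; simpl; apply is_RInt_unique.
  - apply (is_RInt_minus (V := R_NormedModule) (fun t => x * Re (f t)) (fun t => y * Im (f t))).
    + apply (is_RInt_scal (V := R_NormedModule) (fun t => Re (f t)) a b x). apply (RInt_correct (V := R_CompleteNormedModule)); auto.
    + apply (is_RInt_scal (V := R_NormedModule) (fun t => Im (f t)) a b y). apply (RInt_correct (V := R_CompleteNormedModule)); auto.
  - apply (is_RInt_plus (V := R_NormedModule) (fun t => x * Im (f t)) (fun t => y * Re (f t))).
    + apply (is_RInt_scal (V := R_NormedModule) (fun t => Im (f t)) a b x). apply (RInt_correct (V := R_CompleteNormedModule)); auto.
    + apply (is_RInt_scal (V := R_NormedModule) (fun t => Re (f t)) a b y). apply (RInt_correct (V := R_CompleteNormedModule)); auto.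
Qed.

Lemma con_scal c f a b : con f a b -> con (fun t => (c * f t)%C) a b.
Proof. intros H t Ht. apply ctn_mult; [apply ctn_const|auto]. Qed.

Lemma con_plus f g a b : con f a b -> con g a b -> con (fun t => (f t + g t)%C) a b.
Proof. intros H K t Ht. apply ctn_plus; auto. Qed.

Lemma CI_minus f g a b : a <= b -> con f a b -> con g a b ->
  CI (fun t => (f t - g t)%C) a b = (CI f a b - CI g a b)%C.
Proof.
  intros H Hf Hg.
  rewrite (CI_ext _ (fun t => (f t + Copp 1 * g t)%C)) by (auto; intros; ring).
  rewrite CI_plus, CI_scal; auto. ring. apply con_scal; auto.
Qed.

Lemma CI_const (c : C) a b : CI (fun _ => c) a b = (RtoC (b - a) * c)%C.
Proof.
  unfold CI. rewrite !RInt_const. destruct c; unfold scal, Cmult, RtoC; simpl. unfold mult; simpl. f_equal; ring.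
Qed.

(** Multiplying by the conjugate of the integral I turns |I|^2 into the integral of the real
    function Re (conj I * f), which is at most |I| g; then |I| is cancelled. *)
Lemma Cmod_CI_le f (g : R -> R) a b : a <= b -> con f a b -> ex_RInt g a b ->
  (forall t, a <= t <= b -> Cmod (f t) <= g t) -> Cmod (CI f a b) <= RInt g a b.
Proof.
  intros H Hf Hg L. set (I := CI f a b).
  assert (G0 : 0 <= RInt g a b).
  { apply RInt_ge_0; auto. intros x Hx. eapply Rle_trans; [apply Cmod_ge_0|apply L; lra]. }
  destruct (Req_dec (Cmod I) 0) as [E|E]; [lra|].
  assert (P : 0 < Cmod I) by (pose proof (Cmod_ge_0 I); lra).
  assert (Q : Cmod I * Cmod I <= Cmod I * RInt g a b).
  { rewrite Cmod_sqr.
    replace (Re I * Re I + Im I * Im I) with (Re (Cconj I * I)) by (destruct I; simpl; ring).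
    unfold I at 2. rewrite <- CI_scal by auto. simpl.
    change (Cmod I * RInt g a b) with (scal (Cmod I) (RInt g a b)).
    rewrite <- (RInt_scal (V := R_CompleteNormedModule) g a b (Cmod I)) by auto.
    apply RInt_le; auto.
    - apply (con_Re (fun t => (Cconj I * f t)%C)); auto. apply con_scal; auto.
    - apply (ex_RInt_scal (V := R_NormedModule)); auto.
    - intros x Hx. change (Re (Cconj I * f x) <= Cmod I * g x).
      eapply Rle_trans; [apply Re_le_Cmod|]. rewrite Cmod_mult, Cmod_conj.
      apply Rmult_le_compat_l; [lra|]. apply L; lra. }
  nra.
Qed.

Lemma Cmod_CI_const f (M : R) a b : a <= b -> con f a b ->
  (forall t, a <= t <= b -> Cmod (f t) <= M) -> Cmod (CI f a b) <= M * (b - a).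
Proof.
  intros H Hf L. eapply Rle_trans; [apply (Cmod_CI_le f (fun _ => M)); auto|].
  - apply ex_RInt_const.
  - rewrite RInt_const. unfold scal; simpl; unfold mult; simpl. lra.
Qed.

Lemma CI_FTC F f a b : a <= b -> (forall t, a <= t <= b -> rder F t (f t)) -> con f a b ->
  CI f a b = (F b - F a)%C.
Proof.
  intros H HF Hf. apply C_eta; simpl; apply is_RInt_unique.
  - apply (is_RInt_derive (V := R_CompleteNormedModule) (fun t => Re (F t))); intros x Hx;
    rewrite Rmin_left, Rmax_right in Hx by auto; [apply rder_Re|apply ctn_Re]; auto.
  - apply (is_RInt_derive (V := R_CompleteNormedModule) (fun t => Im (F t))); intros x Hx;
    rewrite Rmin_left, Rmax_right in Hx by auto; [apply rder_Im|apply ctn_Im]; auto.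
Qed.

(** Differentiation under the integral sign with all neighbourhoods replaced by one [eta]. The range
    of t is widened by [eta] because joint continuity of the partial derivative at the endpoints
    looks at values of t on both sides. *)
Lemma RInt_param (u v : R -> R -> R) a b x eta : 0 < eta -> a <= b ->
  (forall r t, Rabs (r - x) < eta -> a - eta < t < b + eta -> is_derive (fun s => u s t) r (v r t)) ->
  (forall t, a <= t <= b -> continuous (fun p : R * R => v (fst p) (snd p)) (x, t)) ->
  (forall r t, Rabs (r - x) < eta -> a <= t <= b -> continuous (u r) t) ->
  is_derive (fun r => RInt (u r) a b) x (RInt (v x) a b).
Proof.
  intros He Hab Hd Hc Hu.
  replace (RInt (v x) a b) with (RInt (fun t => Derive (fun s => u s t) x) a b).
  - apply is_derive_RInt_param.
    + exists (mkposreal _ He). intros r Hr t Ht. rewrite Rmin_left, Rmax_right in Ht by auto.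
      exists (v r t). apply Hd; [exact Hr|lra].
    + intros t Ht. rewrite Rmin_left, Rmax_right in Ht by auto.
      apply continuity_2d_pt_ext_loc with (f := v).
      * exists (mkposreal _ He). intros r s Hr Hs. simpl in Hr, Hs.
        symmetry. apply is_derive_unique. apply Hd; auto.
        apply Rabs_lt_between' in Hs. lra.
      * apply continuity_2d_pt_filterlim. apply (Hc t Ht).
    + exists (mkposreal _ He). intros r Hr. apply (ex_RInt_cont (fun t => u r t)); auto.
  - apply RInt_ext. intros t Ht. rewrite Rmin_left, Rmax_right in Ht by auto.
    apply is_derive_unique. apply Hd; [rewrite Rminus_diag, Rabs_R0; auto|lra].
Qed.

Lemma CI_param (phi psi : R -> R -> C) a b x eta : 0 < eta -> a <= b ->
  (forall r t, Rabs (r - x) < eta -> a - eta < t < b + eta -> rder (fun s => phi s t) r (psi r t)) ->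
  (forall t, a <= t <= b -> ctn (fun p : R * R => psi (fst p) (snd p)) (x, t)) ->
  (forall r t, Rabs (r - x) < eta -> a <= t <= b -> ctn (phi r) t) ->
  rder (fun r => CI (phi r) a b) x (CI (psi x) a b).
Proof.
  intros He Hab Hd Hc Hu. unfold CI. apply rder_of_is_derive.
  - apply (RInt_param (fun r t => Re (phi r t)) (fun r t => Re (psi r t)) a b x eta); auto.
    + intros. apply rder_Re; auto.
    + intros. apply (ctn_Re (fun p : R * R => psi (fst p) (snd p))); auto.
    + intros. apply ctn_Re; auto.
  - apply (RInt_param (fun r t => Im (phi r t)) (fun r t => Im (psi r t)) a b x eta); auto.
    + intros. apply rder_Im; auto.
    + intros. apply (ctn_Im (fun p : R * R => psi (fst p) (snd p))); auto.
    + intros. apply ctn_Im; auto.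
Qed.

(** Continuity of the derivative is part of the notion, so that Cauchy's formula follows by
    differentiating an integral, without Goursat's theorem. *)
Definition hol (D : C -> Prop) (F F' : C -> C) : Prop :=
  forall z, D z -> cder F z (F' z) /\ Cctn F' z.

Lemma rder_scal_path (p v : C) (r : R) : rder (fun s => (p + RtoC s * v)%C) r v.
Proof. apply rder_affine. Qed.

Lemma ctn_fst (x : R * R) : ctn (fun p : R * R => RtoC (fst p)) x.
Proof. apply ctn_RtoC. apply continuous_fst. Qed.

Lemma ctn_snd_comp (g : R -> C) (x : R * R) : ctn g (snd x) -> ctn (fun p : R * R => g (snd p)) x.
Proof.
  intros H e He. specialize (H e He).
  destruct x as [x y]. simpl in H.
  apply (continuous_snd (U := R_UniformSpace) (V := R_UniformSpace) x y _ H).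
Qed.

Lemma ctn_dilate (p : C) (g : R -> C) (r t : R) : ctn g t ->
  ctn (fun q : R * R => (p + RtoC (fst q) * g (snd q))%C) (r, t).
Proof.
  intros H. apply ctn_plus; [apply ctn_const|]. apply ctn_mult; [apply ctn_fst|].
  apply ctn_snd_comp. exact H.
Qed.

Lemma Cinv_Cctn (z : C) : z <> 0%C -> Cctn Cinv z.
Proof. intros H. eapply cder_Cctn. apply Cinv_cder. exact H. Qed.

(** A contour p + g is shrunk towards p by the factor r. Differentiating F (p + r g) in r produces a
    factor g, which cancels the 1/g of the Cauchy kernel. By [dilation_FTC], r times the result is a
    difference of endpoint values of F, so it vanishes over a closed contour. *)
Lemma dilation (D : C -> Prop) (F F' : C -> C) (p : C) (g g' : R -> C) a b x eta :
  0 < eta -> a <= b -> hol D F F' ->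
  (forall r t, Rabs (r - x) < eta -> a - eta < t < b + eta -> D (p + RtoC r * g t)%C) ->
  (forall t, a - eta < t < b + eta -> g t <> 0%C /\ rder g t (g' t) /\ ctn g' t) ->
  rder (fun r => CI (fun t => F (p + RtoC r * g t) * (g' t * / g t))%C a b) x
       (CI (fun t => F' (p + RtoC x * g t) * g' t)%C a b).
Proof.
  intros He Hab HF HD Hg.
  apply (CI_param (fun r t => F (p + RtoC r * g t) * (g' t * / g t))%C
                  (fun r t => F' (p + RtoC r * g t) * g' t)%C a b x eta); auto.
  - intros r t Hr Ht. destruct (Hg t Ht) as [G0 [G1 G2]].
    pose proof (rder_comp F (fun s => (p + RtoC s * g t)%C) r (F' (p + RtoC r * g t)%C) (g t)
      (rder_scal_path p (g t) r) (proj1 (HF _ (HD r t Hr Ht)))) as K.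
    pose proof (rder_comp (fun z => z * (g' t * / g t))%C _ r (g' t * / g t)%C _ K) as K2.
    assert (K3 : cder (fun z : C => (z * (g' t * / g t))%C) (F (p + RtoC r * g t)%C) (g' t * / g t)%C).
    { eapply cder_ext; [intros; reflexivity| |apply cder_mult; [apply cder_id|apply (cder_const (g' t * / g t))]].
      cbv beta; ring. }
    specialize (K2 K3). eapply rder_ext; [intros; reflexivity| |exact K2].
    field. auto.
  - intros t Ht. destruct (Hg t ltac:(lra)) as [G0 [G1 G2]]. apply rder_ctn in G1.
    apply ctn_mult.
    + apply (ctn_comp F' (fun q : R * R => (p + RtoC (fst q) * g (snd q))%C)); [|apply ctn_dilate; auto].
      simpl. apply HF. apply HD; [rewrite Rminus_diag, Rabs_R0; auto|lra].
    + apply ctn_snd_comp. auto.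
  - intros r t Hr Ht. destruct (Hg t ltac:(lra)) as [G0 [G1 G2]]. apply rder_ctn in G1.
    apply ctn_mult; [|apply ctn_mult; [auto|apply ctn_comp; [apply Cinv_Cctn; auto|auto]]].
    apply ctn_comp.
    + eapply cder_Cctn, HF. apply HD; [auto|lra].
    + apply ctn_plus; [apply ctn_const|]. apply ctn_mult; [apply ctn_const|auto].
Qed.

Lemma dilation_FTC (D : C -> Prop) (F F' : C -> C) (p : C) (g g' : R -> C) a b r :
  a <= b -> hol D F F' ->
  (forall t, a <= t <= b -> D (p + RtoC r * g t)%C) ->
  (forall t, a <= t <= b -> rder g t (g' t) /\ ctn g' t) ->
  (RtoC r * CI (fun t => F' (p + RtoC r * g t) * g' t)%C a b)%C =
  (F (p + RtoC r * g b) - F (p + RtoC r * g a))%C.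
Proof.
  intros Hab HF HD Hg.
  assert (Q : forall t, a <= t <= b -> rder (fun s => (p + RtoC r * g s)%C) t (RtoC r * g' t)%C).
  { intros t Ht. 
    pose proof (rder_comp (fun z => p + RtoC r * z)%C g t (RtoC r) (g' t) (proj1 (Hg t Ht))) as K.
    apply K. eapply cder_ext; [intros; reflexivity| |apply cder_plus; [apply (cder_const p)|apply cder_mult; [apply (cder_const (RtoC r))|apply cder_id]]].
    cbv beta; ring. }
  assert (Cn : con (fun t => F' (p + RtoC r * g t) * g' t)%C a b).
  { intros t Ht. apply ctn_mult; [|apply Hg; auto]. apply ctn_comp.
    - apply HF; auto.
    - eapply rder_ctn. apply Q; auto. }
  rewrite <- CI_scal by auto.
  apply (CI_FTC (fun t => F (p + RtoC r * g t)%C)); auto.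
  - intros t Ht. eapply rder_ext; [intros; reflexivity| |apply (rder_comp F (fun s => (p + RtoC r * g s)%C)); [apply Q; auto|apply HF; auto]].
    ring.
  - apply con_scal; auto.
Qed.

Lemma rder_zero_const (K : R -> C) (a b : R) : a < b ->
  (forall t, a <= t <= b -> rder K t 0) -> K a = K b.
Proof.
  intros H HK. apply C_eta.
  - apply (eq_is_derive (fun t => Re (K t))); auto. intros t Ht. apply (rder_Re _ _ _ (HK t Ht)).
  - apply (eq_is_derive (fun t => Im (K t))); auto. intros t Ht. apply (rder_Im _ _ _ (HK t Ht)).
Qed.

Lemma rder_plus f g t a b : rder f t a -> rder g t b -> rder (fun u => (f u + g u)%C) t (a + b)%C.
Proof.
  intros HF HG e He.
  destruct (HF (e / 2) ltac:(lra)) as [d1 [Hd1 H1]].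
  destruct (HG (e / 2) ltac:(lra)) as [d2 [Hd2 H2]].
  exists (Rmin d1 d2). split; [apply Rmin_case; auto|]. intros w Hw.
  specialize (H1 w (Rlt_le_trans _ _ _ Hw (Rmin_l _ _))).
  specialize (H2 w (Rlt_le_trans _ _ _ Hw (Rmin_r _ _))).
  replace (f w + g w - (f t + g t) - RtoC (w - t) * (a + b))%C
    with ((f w - f t - RtoC (w - t) * a) + (g w - g t - RtoC (w - t) * b))%C by ring.
  eapply Rle_trans; [apply Cmod_triangle|]. lra.
Qed.

Lemma rder_scal c f t a : rder f t a -> rder (fun u => (c * f u)%C) t (c * a)%C.
Proof.
  intros H. apply (rder_comp (fun z => c * z)%C f t c a H).
  eapply cder_ext; [intros; reflexivity| |apply cder_mult; [apply (cder_const c)|apply cder_id]].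
  cbv beta; ring.
Qed.

Lemma rder_const c t : rder (fun _ => c) t 0.
Proof. eapply rder_ext; [| |apply (rder_affine c 0 t)]; intros; cbv beta; ring. Qed.

Lemma rder_RtoC t : rder RtoC t 1.
Proof. eapply rder_ext; [| |apply (rder_affine 0 1 t)]; intros; cbv beta; ring. Qed.

(** ** Cauchy's formula on a rectangle *)

Definition horiz (y : R) (t : R) : C := (t, y).
Definition vert (x : R) (t : R) : C := (x, t).

Lemma horiz_rder y p t : rder (fun t => (horiz y t - p)%C) t 1.
Proof.
  eapply rder_ext; [| |apply (rder_affine ((0, y) - p)%C 1 t)]; intros; auto.
  apply C_eta; destruct p; simpl; ring.
Qed.

Lemma vert_rder x p t : rder (fun t => (vert x t - p)%C) t Ci.
Proof.
  eapply rder_ext; [| |apply (rder_affine ((x, 0) - p)%C Ci t)]; intros; auto.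
  apply C_eta; destruct p; simpl; ring.
Qed.

(** The primitive is the complex logarithm written with [ln] and [atan]; since v <> 0 the line
    misses the origin and no branch has to be chosen. *)
Lemma CI_inv_line (c v : R) a b : v <> 0 -> a <= b ->
  CI (fun t => / ((t - c)%R, v))%C a b =
  ((/ 2 * (ln ((b - c)^2 + v^2) - ln ((a - c)^2 + v^2)))%R, (- (atan ((b - c) / v) - atan ((a - c) / v)))%R).
Proof.
  intros Hv H.
  assert (V2 : 0 < v ^ 2) by (apply pow2_gt_0; auto).
  assert (P : forall t, 0 < (t - c)^2 + v^2) by (intros t; pose proof (pow2_ge_0 (t - c)); lra).
  assert (Cn : con (fun t => / ((t - c)%R, v))%C a b).
  { intros t _. apply ctn_comp.
    - apply Cinv_Cctn. intros E. apply (f_equal Im) in E. simpl in E. auto.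
    - apply ctn_pair; [|apply continuous_const]. apply (continuous_minus (V := R_NormedModule)); [apply continuous_id|apply continuous_const]. }
  apply (CI_FTC (fun t => (/ 2 * ln ((t - c)^2 + v^2), - atan ((t - c) / v)))) in Cn; auto.
  - rewrite Cn. apply C_eta; simpl; ring.
  - intros t _. unfold Cinv. simpl.
    apply rder_of_is_derive.
    + auto_derive; [apply P|]. field. specialize (P t). simpl in P. lra.
    + auto_derive; auto. specialize (P t). field. repeat split; auto; simpl in *; nra.
Qed.

Lemma atan_inv_sum (x : R) : 0 < x -> atan x + atan (/ x) = PI / 2.
Proof. intros H. rewrite (atan_inv x H). lra. Qed.

Section Rect.
Variables (F F' : C -> C) (p : C) (x0 x1 y0 y1 ep : R).
Hypothesis Hep : 0 < ep.
Hypothesis Hx : x0 < Re p < x1.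
Hypothesis Hy : y0 < Im p < y1.
Hypothesis HF : hol (fun z => x0 - ep < Re z < x1 + ep) F F'.

Let px := Re p.
Let py := Im p.

(** Derivatives at r = 0 and r = 1 are two-sided, so dilations slightly outside [0, 1] must also
    keep the sides inside the strip of holomorphy. *)
Lemma rect_dom (z : C) (r : R) : x0 - ep / 4 <= Re z <= x1 + ep / 4 ->
  - (ep / (4 * (x1 - x0 + ep))) < r < 1 + ep / (4 * (x1 - x0 + ep)) ->
  x0 - ep < Re (p + RtoC r * (z - p)) < x1 + ep.
Proof.
  intros Hz Hr. set (k := ep / (4 * (x1 - x0 + ep))) in *.
  assert (Hk : k * (x1 - x0 + ep) = ep / 4) by (unfold k; field; lra).
  assert (0 < k) by (apply Rdiv_lt_0_compat; lra).
  replace (Re (p + RtoC r * (z - p))) with (Re p + r * (Re z - Re p)) by (destruct p, z; simpl; ring).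
  assert (- (x1 - x0 + ep) <= Re z - Re p <= x1 - x0 + ep) by lra.
  destruct (Rle_lt_dec 0 (Re z - Re p)); split; nra.
Qed.

Lemma rect_piece (g g' : R -> C) a b x : a <= b ->
  (forall t, a - ep / 4 < t < b + ep / 4 -> x0 - ep / 4 <= Re (p + g t) <= x1 + ep / 4) ->
  (forall t, a - Rmin (ep/4) (Rmin (Rmin (px - x0) (x1 - px)) (Rmin (py - y0) (y1 - py))) < t < b + Rmin (ep/4) (Rmin (Rmin (px - x0) (x1 - px)) (Rmin (py - y0) (y1 - py))) -> g t <> 0%C /\ rder g t (g' t) /\ ctn g' t) ->
  0 <= x <= 1 ->
  rder (fun r => CI (fun t => F (p + RtoC r * g t) * (g' t * / g t))%C a b) x
       (CI (fun t => F' (p + RtoC x * g t) * g' t)%C a b)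
  /\ (RtoC x * CI (fun t => F' (p + RtoC x * g t) * g' t)%C a b)%C =
  (F (p + RtoC x * g b) - F (p + RtoC x * g a))%C.
Proof.
  intros Hab Hd Hg Hx01. set (m := Rmin (ep/4) _) in Hg.
  assert (Hm : 0 < m) by (unfold m, px, py; repeat apply Rmin_case; lra).
  assert (Hm4 : m <= ep / 4) by apply Rmin_l.
  set (k := ep / (4 * (x1 - x0 + ep))).
  assert (Hk : 0 < k) by (apply Rdiv_lt_0_compat; lra).
  assert (HD : forall r t, - k < r < 1 + k -> a - m < t < b + m -> x0 - ep < Re (p + RtoC r * g t) < x1 + ep).
  { intros r t Hr Ht. replace (g t) with ((p + g t) - p)%C by ring.
    apply rect_dom; auto. apply Hd. lra. }
  split.
  - apply (dilation (fun z => x0 - ep < Re z < x1 + ep) F F' p g g' a b x (Rmin m k)); auto.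
    + apply Rmin_case; auto.
    + pose proof (Rmin_l m k). pose proof (Rmin_r m k).
      intros r t Hr Ht. apply Rabs_lt_between' in Hr. apply HD; lra.
    + pose proof (Rmin_l m k). intros t Ht. apply Hg. lra.
  - apply (dilation_FTC (fun z => x0 - ep < Re z < x1 + ep)); auto.
    + intros t Ht. apply HD; lra.
    + intros t Ht. apply Hg. lra.
Qed.

Definition rect_K (r : R) : C :=
  (CI (fun t => F (p + RtoC r * (horiz y0 t - p)) * (1 * / (horiz y0 t - p))) x0 x1
  + CI (fun t => F (p + RtoC r * (vert x1 t - p)) * (Ci * / (vert x1 t - p))) y0 y1
  + Copp 1 * CI (fun t => F (p + RtoC r * (horiz y1 t - p)) * (1 * / (horiz y1 t - p))) x0 x1
  + Copp 1 * CI (fun t => F (p + RtoC r * (vert x0 t - p)) * (Ci * / (vert x0 t - p))) y0 y1)%C.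

Lemma horiz_neq y t : y <> py -> (horiz y t - p)%C <> 0%C.
Proof. intros H E. apply (f_equal Im) in E. unfold py in H. destruct p; simpl in *. lra. Qed.

Lemma vert_neq x t : x <> px -> (vert x t - p)%C <> 0%C.
Proof. intros H E. apply (f_equal Re) in E. unfold px in H. destruct p; simpl in *. lra. Qed.

Lemma rect_K_der (x : R) : 0 <= x <= 1 -> rder rect_K x 0.
Proof.
  intros H01.
  assert (A : forall y, y = y0 \/ y = y1 -> _) by (intros y Hyy;
    apply (rect_piece (fun t => (horiz y t - p)%C) (fun _ => 1%C) x0 x1 x); auto; [lra| |];
    [ intros t Ht; replace (p + (horiz y t - p))%C with (horiz y t) by ring; simpl; lra
    | intros t _; split; [apply horiz_neq; unfold py; destruct Hyy; subst; lra|split; [apply horiz_rder|apply ctn_const]]]).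
  assert (B : forall xx, xx = x0 \/ xx = x1 -> _) by (intros y Hyy;
    apply (rect_piece (fun t => (vert y t - p)%C) (fun _ => Ci) y0 y1 x); auto; [lra| |];
    [ intros t Ht; replace (p + (vert y t - p))%C with (vert y t) by ring; simpl; destruct Hyy; subst; lra
    | intros t _; split; [apply vert_neq; unfold px; destruct Hyy; subst; lra|split; [apply vert_rder|apply ctn_const]]]).
  destruct (A y0 (or_introl eq_refl)) as [a1 a2]. destruct (A y1 (or_intror eq_refl)) as [b1 b2].
  destruct (B x0 (or_introl eq_refl)) as [c1 c2]. destruct (B x1 (or_intror eq_refl)) as [d1 d2].
  clear A B. cbv beta in *.
  eapply rder_ext; [intros u; reflexivity| |].
  2:{ unfold rect_K. apply rder_plus; [apply rder_plus; [apply rder_plus|]|]; [exact a1|exact d1|apply rder_scal; exact b1|apply rder_scal; exact c1]. }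
  set (I1 := CI _ _ _) in a2. set (I2 := CI _ _ _) in b2. set (I3 := CI _ _ _) in c2. set (I4 := CI _ _ _) in d2.
  (* For x <> 0 the endpoint values cancel around the rectangle once multiplied by x. At x = 0 that
     factor cannot be divided out; there the four integrals are F' p times the oriented sides, which
     add up to zero. *)
  destruct (Req_dec x 0) as [E|E].
  - unfold I1, I2, I3, I4. rewrite E.
    assert (Q : forall (g : R -> C) c u v, u <= v -> CI (fun t => F' (p + RtoC 0 * g t) * c)%C u v = (RtoC (v - u) * (F' p * c))%C).
    { intros g c u v Huv. rewrite <- CI_const. apply CI_ext; auto. intros t _. f_equal. f_equal. ring. }
    rewrite (Q (fun t => (horiz y0 t - p)%C)), (Q (fun t => (horiz y1 t - p)%C)), (Q (fun t => (vert x0 t - p)%C)), (Q (fun t => (vert x1 t - p)%C)) by lra. ring.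
  - assert (X : RtoC x <> 0%C) by (intros X; apply RtoC_inj in X; auto).
    assert (Z : (RtoC x * (I1 + I4 + Copp 1 * I2 + Copp 1 * I3))%C = 0%C).
    { replace (RtoC x * (I1 + I4 + Copp 1 * I2 + Copp 1 * I3))%C with (RtoC x * I1 + RtoC x * I4 - RtoC x * I2 - RtoC x * I3)%C by ring.
      rewrite a2, b2, c2, d2. unfold horiz, vert. ring. }
    assert (Hc : forall w : C, (RtoC x * w)%C = 0%C -> w = 0%C).
    { intros w Hw. replace w with (/ RtoC x * (RtoC x * w))%C by (field; auto). rewrite Hw. ring. }
    apply Hc. etransitivity; [|exact Z]. unfold I1, I2, I3, I4. ring.
Qed.

(** The logarithms cancel at the corners, and the eight arctangents pair up as atan v + atan (1/v),
    four right angles in all. *)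
Lemma rect_winding : 
  (CI (fun t => 1 * / (horiz y0 t - p)) x0 x1 + CI (fun t => Ci * / (vert x1 t - p)) y0 y1
  + Copp 1 * CI (fun t => 1 * / (horiz y1 t - p)) x0 x1 + Copp 1 * CI (fun t => Ci * / (vert x0 t - p)) y0 y1)%C
  = (RtoC (2 * PI) * Ci)%C.
Proof.
  assert (H1 : forall y, y <> py -> CI (fun t => (1 * / (horiz y t - p))%C) x0 x1 = CI (fun t => / ((t - px)%R, (y - py)%R))%C x0 x1).
  { intros y Hyy. apply CI_ext; [lra|]. intros t _. rewrite Cmult_1_l. f_equal. }
  assert (H2 : forall x, x <> px -> CI (fun t => (Ci * / (vert x t - p))%C) y0 y1 = CI (fun t => / ((t - py)%R, (- (x - px))%R))%C y0 y1).
  { intros x Hxx. apply CI_ext; [lra|]. intros t _.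
    assert (N : (vert x t - p)%C <> 0%C) by (apply vert_neq; auto).
    replace ((t - py)%R, (- (x - px))%R) with (- Ci * (vert x t - p))%C.
    - assert (Nc : (- Ci)%C <> 0%C) by (intros X; apply (f_equal Im) in X; simpl in X; lra).
      transitivity (/ (- Ci) * / (vert x t - p))%C; [|field; split; [auto|apply Ci_nz]]. f_equal.
      apply C_eta; simpl; field.
    - unfold px, py. destruct p. apply C_eta; simpl; ring. }
  unfold px, py in *.
  rewrite !H1 by lra. rewrite !H2 by lra. clear H1 H2.
  rewrite !CI_inv_line by lra.
  apply C_eta; simpl.
  - replace (- (x1 - Re p) * (- (x1 - Re p) * 1)) with ((x1 - Re p) * ((x1 - Re p) * 1)) by ring.
    replace (- (x0 - Re p) * (- (x0 - Re p) * 1)) with ((x0 - Re p) * ((x0 - Re p) * 1)) by ring.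
    rewrite (Rplus_comm ((y1 - Im p) * _) ((x1 - Re p) * _)), (Rplus_comm ((y0 - Im p) * _) ((x1 - Re p) * _)),
     (Rplus_comm ((y1 - Im p) * _) ((x0 - Re p) * _)), (Rplus_comm ((y0 - Im p) * _) ((x0 - Re p) * _)). ring.
  - set (A := Re p - x0). set (B := x1 - Re p). set (U := Im p - y0). set (W := y1 - Im p).
    assert (0 < A) by (unfold A; lra). assert (0 < B) by (unfold B; lra).
    assert (0 < U) by (unfold U; lra). assert (0 < W) by (unfold W; lra).
    replace (x0 - Re p) with (- A) by (unfold A; ring). replace (y0 - Im p) with (- U) by (unfold U; ring).
    replace (B / - U) with (- (B / U)) by (field; lra). replace (- A / - U) with (A / U) by (field; lra).
    replace (W / - B) with (- (W / B)) by (field; lra). replace (- U / - B) with (U / B) by (field; lra).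
    replace (- A / W) with (- (A / W)) by (field; lra).
    replace (W / - - A) with (W / A) by (field; lra). replace (- U / - - A) with (- (U / A)) by (field; lra).
    rewrite !atan_opp.
    pose proof (atan_inv_sum (B / U) ltac:(apply Rdiv_lt_0_compat; auto)) as E1.
    pose proof (atan_inv_sum (A / U) ltac:(apply Rdiv_lt_0_compat; auto)) as E2.
    pose proof (atan_inv_sum (B / W) ltac:(apply Rdiv_lt_0_compat; auto)) as E3.
    pose proof (atan_inv_sum (A / W) ltac:(apply Rdiv_lt_0_compat; auto)) as E4.
    replace (/ (B / U)) with (U / B) in E1 by (field; lra). replace (/ (A / U)) with (U / A) in E2 by (field; lra).
    replace (/ (B / W)) with (W / B) in E3 by (field; lra). replace (/ (A / W)) with (W / A) in E4 by (field; lra).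
    lra.
Qed.

(** [rect_K] is constant on [0, 1]. At 1 it is the contour integral, and at 0 the rectangle has
    shrunk to p, leaving F p times the winding integral. *)
Theorem cauchy_rect :
  (CI (fun t => F (horiz y0 t) * / (horiz y0 t - p)) x0 x1
  + Ci * CI (fun t => F (vert x1 t) * / (vert x1 t - p)) y0 y1
  - CI (fun t => F (horiz y1 t) * / (horiz y1 t - p)) x0 x1
  - Ci * CI (fun t => F (vert x0 t) * / (vert x0 t - p)) y0 y1)%C
  = (RtoC (2 * PI) * Ci * F p)%C.
Proof.
  assert (E := rder_zero_const rect_K 0 1 Rlt_0_1 rect_K_der). unfold rect_K in E.
  assert (CH : forall y, y <> py -> con (fun t => F (horiz y t) * / (horiz y t - p))%C x0 x1).
  { intros y N t Ht. apply ctn_mult.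
    - apply ctn_comp; [eapply cder_Cctn, HF; simpl; lra|]. eapply ctn_ext; [|eapply rder_ctn, (horiz_rder y 0 t)]. intros; simpl; ring.
    - apply ctn_comp; [apply Cinv_Cctn, horiz_neq; auto|]. eapply rder_ctn, horiz_rder. }
  assert (CV : forall x, x <> px -> x0 <= x <= x1 -> con (fun t => F (vert x t) * / (vert x t - p))%C y0 y1).
  { intros x N Hxx t Ht. apply ctn_mult.
    - apply ctn_comp; [eapply cder_Cctn, HF; simpl; lra|]. eapply ctn_ext; [|eapply rder_ctn, (vert_rder x 0 t)]. intros; simpl; ring.
    - apply ctn_comp; [apply Cinv_Cctn, vert_neq; auto|]. eapply rder_ctn, vert_rder. }
  assert (CH1 : forall y, y <> py -> con (fun t => 1 * / (horiz y t - p))%C x0 x1).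
  { intros y N t Ht. apply ctn_mult; [apply ctn_const|]. apply ctn_comp; [apply Cinv_Cctn, horiz_neq; auto|]. eapply rder_ctn, horiz_rder. }
  assert (CV1 : forall x, x <> px -> con (fun t => Ci * / (vert x t - p))%C y0 y1).
  { intros x N t Ht. apply ctn_mult; [apply ctn_const|]. apply ctn_comp; [apply Cinv_Cctn, vert_neq; auto|]. eapply rder_ctn, vert_rder. }
  assert (Z0 : forall (g : R -> C) (h : R -> C) u v, u <= v -> con h u v ->
    CI (fun t => F (p + RtoC 0 * g t) * h t)%C u v = (F p * CI h u v)%C).
  { intros g h u v Huv Ch. rewrite <- CI_scal by auto. apply CI_ext; auto. intros t _. f_equal. f_equal. ring. }
  rewrite (Z0 (fun t => (horiz y0 t - p)%C)), (Z0 (fun t => (horiz y1 t - p)%C)),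
   (Z0 (fun t => (vert x0 t - p)%C)), (Z0 (fun t => (vert x1 t - p)%C)) in E; try lra;
   try (apply CH1; unfold py; lra); try (apply CV1; unfold px; lra).
  transitivity (F p * (RtoC (2 * PI) * Ci))%C; [|ring].
  rewrite <- rect_winding.
  transitivity (F p * CI (fun t => 1 * / (horiz y0 t - p)) x0 x1 +
    F p * CI (fun t => Ci * / (vert x1 t - p)) y0 y1 +
    Copp 1 * (F p * CI (fun t => 1 * / (horiz y1 t - p)) x0 x1) +
    Copp 1 * (F p * CI (fun t => Ci * / (vert x0 t - p)) y0 y1))%C; [|ring].
  rewrite E.
  rewrite <- !CI_scal by (first [lra | apply CV; unfold px; lra]).
  replace (CI (fun t => F (horiz y0 t) * / (horiz y0 t - p))%C x0 x1) with
    (CI (fun t => F (p + RtoC 1 * (horiz y0 t - p)) * (1 * / (horiz y0 t - p)))%C x0 x1).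
  2:{ apply CI_ext; [lra|]. intros t _. replace (p + 1 * (horiz y0 t - p))%C with (horiz y0 t) by ring. ring. }
  replace (CI (fun t => F (horiz y1 t) * / (horiz y1 t - p))%C x0 x1) with
    (CI (fun t => F (p + RtoC 1 * (horiz y1 t - p)) * (1 * / (horiz y1 t - p)))%C x0 x1).
  2:{ apply CI_ext; [lra|]. intros t _. replace (p + 1 * (horiz y1 t - p))%C with (horiz y1 t) by ring. ring. }
  replace (CI (fun t => Ci * (F (vert x0 t) * / (vert x0 t - p)))%C y0 y1) with
    (CI (fun t => F (p + RtoC 1 * (vert x0 t - p)) * (Ci * / (vert x0 t - p)))%C y0 y1).
  2:{ apply CI_ext; [lra|]. intros t _. replace (p + 1 * (vert x0 t - p))%C with (vert x0 t) by ring. ring. }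
  replace (CI (fun t => Ci * (F (vert x1 t) * / (vert x1 t - p)))%C y0 y1) with
    (CI (fun t => F (p + RtoC 1 * (vert x1 t - p)) * (Ci * / (vert x1 t - p)))%C y0 y1).
  2:{ apply CI_ext; [lra|]. intros t _. replace (p + 1 * (vert x1 t - p))%C with (vert x1 t) by ring. ring. }
  ring.
Qed.
End Rect.

(** * Closure properties of continuity and holomorphy *)

Lemma Cctn_ctn (F : C -> C) (z : C) : Cctn F z <-> ctn (T := C_UniformSpace) F z.
Proof.
  split; intros H e He.
  - destruct (H e He) as [d [Hd Hw]]. assert (Hd2 : 0 < d / 2) by lra.
    exists (mkposreal _ Hd2). intros w [A B]. apply Hw.
    change (Rabs (fst w - fst z) < d / 2) in A. change (Rabs (snd w - snd z) < d / 2) in B.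
    eapply Rle_lt_trans; [apply Cmod_le_abs|]. destruct w, z; simpl in *. unfold Rminus in *. lra.
  - destruct (H e He) as [d Hw]. exists d. split; [apply cond_pos|]. intros w Hlt. apply Hw. split.
    + change (Rabs (fst w - fst z) < d). eapply Rle_lt_trans; [|exact Hlt].
      eapply Rle_trans; [|apply (Rabs_Re_le (w - z))]. destruct w, z; simpl. unfold Rminus. lra.
    + change (Rabs (snd w - snd z) < d). eapply Rle_lt_trans; [|exact Hlt].
      eapply Rle_trans; [|apply (Rabs_Im_le (w - z))]. destruct w, z; simpl. unfold Rminus. lra.
Qed.

Lemma Cctn_const c z : Cctn (fun _ => c) z.
Proof. apply Cctn_ctn, ctn_const. Qed.

Lemma Cctn_mult F G z : Cctn F z -> Cctn G z -> Cctn (fun w => F w * G w)%C z.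
Proof. rewrite !Cctn_ctn. apply ctn_mult. Qed.

Lemma Cctn_plus F G z : Cctn F z -> Cctn G z -> Cctn (fun w => F w + G w)%C z.
Proof. rewrite !Cctn_ctn. apply ctn_plus. Qed.

Lemma Cctn_comp F G z : Cctn G z -> Cctn F (G z) -> Cctn (fun w => F (G w)) z.
Proof. intros HG HF. apply Cctn_ctn. apply ctn_comp; auto. apply Cctn_ctn; auto. Qed.

Lemma Cctn_opp F z : Cctn F z -> Cctn (fun w => - F w)%C z.
Proof.
  intros H. apply (Cctn_ctn (fun w => - F w)%C).
  apply ctn_ext with (f := fun w => (Copp 1 * F w)%C); [intros; ring|].
  apply ctn_mult; [apply ctn_const|]. apply Cctn_ctn; auto.
Qed.

Lemma Cctn_minus F G z : Cctn F z -> Cctn G z -> Cctn (fun w => F w - G w)%C z.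
Proof. intros. apply Cctn_plus; auto. apply Cctn_opp; auto. Qed.

Lemma Cctn_inv (F : C -> C) (z : C) : F z <> 0%C -> Cctn F z -> Cctn (fun w => / F w)%C z.
Proof. intros N H. apply (Cctn_comp Cinv F); auto. apply Cinv_Cctn; auto. Qed.

Lemma hol_plus D F F' G G' : hol D F F' -> hol D G G' ->
  hol D (fun z => F z + G z)%C (fun z => F' z + G' z)%C.
Proof. intros HF HG z Hz. destruct (HF z Hz), (HG z Hz). split; [apply cder_plus|apply Cctn_plus]; auto. Qed.

Lemma hol_mult D F F' G G' : hol D F F' -> hol D G G' ->
  hol D (fun z => F z * G z)%C (fun z => F' z * G z + F z * G' z)%C.
Proof.
  intros HF HG z Hz. destruct (HF z Hz), (HG z Hz). split; [apply cder_mult; auto|].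
  apply Cctn_plus; apply Cctn_mult; auto; eapply cder_Cctn; eauto.
Qed.

Lemma hol_const D c : hol D (fun _ => c) (fun _ => 0%C).
Proof. intros z _. split; [apply cder_const|apply Cctn_const]. Qed.

Lemma hol_id D : hol D (fun z => z) (fun _ => 1%C).
Proof. intros z _. split; [apply cder_id|apply Cctn_const]. Qed.

Lemma hol_ext D F F' G : (forall z, F z = G z) -> hol D F F' -> hol D G F'.
Proof.
  intros E H z Hz. destruct (H z Hz). split; auto. eapply cder_ext; [exact E|reflexivity|auto].
Qed.

Lemma hol_minus D F F' G G' : hol D F F' -> hol D G G' ->
  hol D (fun z => F z - G z)%C (fun z => F' z - G' z)%C.
Proof. intros HF HG z Hz. destruct (HF z Hz), (HG z Hz). split; [apply cder_minus|apply Cctn_minus]; auto. Qed.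

Lemma hol_inv D F F' : hol D F F' -> (forall z, D z -> F z <> 0%C) ->
  hol D (fun z => / F z)%C (fun z => - (/ F z * / F z) * F' z)%C.
Proof.
  intros HF HN z Hz. destruct (HF z Hz). split; [apply cder_inv; auto|].
  assert (Cctn F z) by (eapply cder_Cctn; eauto).
  apply Cctn_mult; auto. apply Cctn_opp. apply Cctn_mult; apply Cctn_inv; auto.
Qed.

Lemma hol_cexp D F F' : hol D F F' -> hol D (fun z => cexp (F z)) (fun z => cexp (F z) * F' z)%C.
Proof.
  intros HF z Hz. destruct (HF z Hz). split; [apply cder_cexp; auto|].
  apply Cctn_mult; auto. apply Cctn_comp; [eapply cder_Cctn; eauto|eapply cder_Cctn, cexp_cder].
Qed.

Lemma hol_comp_affine (D D' : C -> Prop) F F' (a b : C) : hol D' F F' -> (forall z, D z -> D' (a + b * z)%C) ->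
  hol D (fun z => F (a + b * z))%C (fun z => F' (a + b * z) * b)%C.
Proof.
  intros HF HD z Hz. destruct (HF _ (HD z Hz)).
  assert (A : cder (fun w => a + b * w)%C z b).
  { eapply cder_ext; [intros; reflexivity| |apply cder_plus; [apply (cder_const a)|apply cder_mult; [apply (cder_const b)|apply cder_id]]].
    cbv beta; ring. }
  split.
  - apply (cder_comp F (fun w => a + b * w)%C); auto.
  - apply Cctn_mult; [|apply Cctn_const]. apply (Cctn_comp F' (fun w => a + b * w)%C); auto.
    eapply cder_Cctn; eauto.
Qed.

Lemma hol_sub (D D' : C -> Prop) F F' : (forall z, D z -> D' z) -> hol D' F F' -> hol D F F'.
Proof. intros H HF z Hz. apply HF; auto. Qed.

Lemma hol_pow D F F' n : hol D F F' -> exists G', hol D (fun z => F z ^ n)%C G'.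
Proof.
  intros HF. induction n as [|n [G' IH]].
  - exists (fun _ => 0%C). eapply hol_ext; [|apply (hol_const D 1%C)]. reflexivity.
  - eexists. eapply hol_ext; [|apply (hol_mult D F F' _ _ HF IH)]. reflexivity.
Qed.

Lemma con_horiz F F' (D : C -> Prop) y a b : hol D F F' -> (forall t, a <= t <= b -> D (horiz y t)) ->
  con (fun t => F (horiz y t)) a b.
Proof.
  intros HF HD t Ht. apply ctn_comp; [eapply cder_Cctn, HF; auto|].
  eapply ctn_ext; [|eapply rder_ctn, (horiz_rder y 0 t)]. intros; simpl; ring.
Qed.

Lemma con_vert F F' (D : C -> Prop) x a b : hol D F F' -> (forall t, a <= t <= b -> D (vert x t)) ->
  con (fun t => F (vert x t)) a b.
Proof.
  intros HF HD t Ht. apply ctn_comp; [eapply cder_Cctn, HF; auto|].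
  eapply ctn_ext; [|eapply rder_ctn, (vert_rder x 0 t)]. intros; simpl; ring.
Qed.

(** Bernoulli's inequality: for q > 1 the powers grow at least linearly in n. *)
Lemma bounded_powers (q c : R) : 0 <= q -> (forall n : nat, q ^ n <= c) -> q <= 1.
Proof.
  intros Hq H. destruct (Rle_lt_dec q 1) as [|L]; [auto|exfalso].
  assert (B : forall n, 1 + INR n * (q - 1) <= q ^ n).
  { induction n; [simpl; lra|]. rewrite S_INR. simpl. pose proof (pos_INR n).
    assert (0 <= INR n * ((q - 1) * (q - 1))) by (apply Rmult_le_pos; nra). nra. }
  destruct (archimed (c / (q - 1))) as [A _].
  assert (Hc : 1 <= c) by (specialize (H O); simpl in H; lra).
  assert (P : 0 < c / (q - 1)) by (apply Rdiv_lt_0_compat; lra).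
  specialize (B (Z.to_nat (up (c / (q - 1))))). specialize (H (Z.to_nat (up (c / (q - 1))))).
  rewrite INR_IZR_INZ, Z2Nat.id in B by (apply le_IZR; lra).
  apply (Rmult_lt_compat_r (q - 1)) in A; [|lra].
  replace (c / (q - 1) * (q - 1)) with c in A by (field; lra). lra.
Qed.

(* Landau's trick: apply Cauchy's formula to [F^n] and let [n] tend to infinity, so
   that the constant coming from the perimeter disappears. *)
Theorem maxmod (F F' : C -> C) (p : C) (x0 x1 y0 y1 ep M : R) :
  0 < ep -> x0 < Re p < x1 -> y0 < Im p < y1 ->
  hol (fun z => x0 - ep < Re z < x1 + ep) F F' -> 0 < M ->
  (forall t, x0 <= t <= x1 -> Cmod (F (horiz y0 t)) <= M) ->
  (forall t, x0 <= t <= x1 -> Cmod (F (horiz y1 t)) <= M) ->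
  (forall t, y0 <= t <= y1 -> Cmod (F (vert x0 t)) <= M) ->
  (forall t, y0 <= t <= y1 -> Cmod (F (vert x1 t)) <= M) ->
  Cmod (F p) <= M.
Proof.
  intros Hep Hx Hy HF HM B1 B2 B3 B4.
  set (d := Rmin (Rmin (Re p - x0) (x1 - Re p)) (Rmin (Im p - y0) (y1 - Im p))).
  assert (Hd : 0 < d) by (unfold d; repeat apply Rmin_case; lra).
  assert (d1 : d <= Re p - x0) by (unfold d; eapply Rle_trans; [apply Rmin_l|apply Rmin_l]).
  assert (d2 : d <= x1 - Re p) by (unfold d; eapply Rle_trans; [apply Rmin_l|apply Rmin_r]).
  assert (d3 : d <= Im p - y0) by (unfold d; eapply Rle_trans; [apply Rmin_r|apply Rmin_l]).
  assert (d4 : d <= y1 - Im p) by (unfold d; eapply Rle_trans; [apply Rmin_r|apply Rmin_r]).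
  assert (Dh : forall y t, y = y0 \/ y = y1 -> d <= Cmod (horiz y t - p)).
  { intros y t Hyy. eapply Rle_trans; [|apply Rabs_Im_le].
    replace (Im (horiz y t - p)) with (y - Im p) by (destruct p; reflexivity).
    destruct Hyy; subst; [rewrite Rabs_left|rewrite Rabs_right]; lra. }
  assert (Dv : forall x t, x = x0 \/ x = x1 -> d <= Cmod (vert x t - p)).
  { intros x t Hxx. eapply Rle_trans; [|apply Rabs_Re_le].
    replace (Re (vert x t - p)) with (x - Re p) by (destruct p; reflexivity).
    destruct Hxx; subst; [rewrite Rabs_left|rewrite Rabs_right]; lra. }
  set (c := 2 * ((x1 - x0) + (y1 - y0)) / d).
  assert (Q : forall n, Cmod (F p) ^ n <= c * M ^ n).
  { intros n. destruct (hol_pow _ F F' n HF) as [G' HG].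
    pose proof (cauchy_rect _ G' p x0 x1 y0 y1 ep Hep Hx Hy HG) as E.
    assert (Pt : forall z, Cmod (F z) <= M -> d <= Cmod (z - p) -> Cmod (F z ^ n * / (z - p)) <= M ^ n / d).
    { intros z H1 H2. assert (Nz : (z - p)%C <> 0%C) by (apply Cmod_gt_0; lra).
      rewrite Cmod_mult, Cmod_pow, Cmod_inv by auto. unfold Rdiv.
      apply Rmult_le_compat; [apply pow_le, Cmod_ge_0|left; apply Rinv_0_lt_compat; lra| |apply Rinv_le_contravar; lra].
      apply pow_incr. split; [apply Cmod_ge_0|auto]. }
    assert (Ch : forall y, y = y0 \/ y = y1 -> con (fun t => F (horiz y t) ^ n * / (horiz y t - p))%C x0 x1).
    { intros y Hyy t Ht. apply ctn_mult; [apply (con_horiz _ _ _ y x0 x1 HG); auto; intros; simpl; lra|].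
      apply (ctn_comp Cinv (fun t => (horiz y t - p)%C)); [|eapply rder_ctn, horiz_rder].
      apply Cinv_Cctn, Cmod_gt_0. specialize (Dh y t Hyy). lra. }
    assert (Cv : forall x, x = x0 \/ x = x1 -> con (fun t => F (vert x t) ^ n * / (vert x t - p))%C y0 y1).
    { intros x Hxx t Ht. apply ctn_mult; [apply (con_vert _ _ _ x y0 y1 HG); auto; intros; simpl; destruct Hxx; subst; lra|].
      apply (ctn_comp Cinv (fun t => (vert x t - p)%C)); [|eapply rder_ctn, vert_rder].
      apply Cinv_Cctn, Cmod_gt_0. specialize (Dv x t Hxx). lra. }
    assert (I1 := Cmod_CI_const _ (M ^ n / d) x0 x1 ltac:(lra) (Ch y0 (or_introl eq_refl)) (fun t Ht => Pt _ (B1 t Ht) (Dh _ t (or_introl eq_refl)))).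
    assert (I2 := Cmod_CI_const _ (M ^ n / d) x0 x1 ltac:(lra) (Ch y1 (or_intror eq_refl)) (fun t Ht => Pt _ (B2 t Ht) (Dh _ t (or_intror eq_refl)))).
    assert (I3 := Cmod_CI_const _ (M ^ n / d) y0 y1 ltac:(lra) (Cv x0 (or_introl eq_refl)) (fun t Ht => Pt _ (B3 t Ht) (Dv _ t (or_introl eq_refl)))).
    assert (I4 := Cmod_CI_const _ (M ^ n / d) y0 y1 ltac:(lra) (Cv x1 (or_intror eq_refl)) (fun t Ht => Pt _ (B4 t Ht) (Dv _ t (or_intror eq_refl)))).
    cbv beta in *.
    assert (T : Cmod (RtoC (2 * PI) * Ci * F p ^ n) <= M ^ n / d * (x1 - x0) + M ^ n / d * (y1 - y0) + M ^ n / d * (x1 - x0) + M ^ n / d * (y1 - y0)).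
    { rewrite <- E. eapply Rle_trans; [apply Cmod_minus_le|]. rewrite (Cmod_mult Ci (CI _ y0 y1)), Cmod_Ci, Rmult_1_l.
      eapply Rle_trans; [apply Rplus_le_compat_r, Cmod_minus_le|].
      eapply Rle_trans; [apply Rplus_le_compat_r, Rplus_le_compat_r, Cmod_triangle|].
      rewrite (Cmod_mult Ci (CI _ y0 y1)), Cmod_Ci, Rmult_1_l. lra. }
    rewrite !Cmod_mult, Cmod_R, Cmod_Ci, Cmod_pow, Rabs_pos_eq in T by (pose proof PI_RGT_0; lra).
    pose proof PI2_1. pose proof (pow_le _ n (Cmod_ge_0 (F p))).
    unfold c. replace (2 * (x1 - x0 + (y1 - y0)) / d * M ^ n) with (M ^ n / d * (x1 - x0) + M ^ n / d * (y1 - y0) + M ^ n / d * (x1 - x0) + M ^ n / d * (y1 - y0)) by (field; lra).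
    nra. }
  assert (R1 : Cmod (F p) / M <= 1).
  { apply (bounded_powers _ c).
    - apply Rdiv_le_0_compat; [apply Cmod_ge_0|auto].
    - intros n. unfold Rdiv. rewrite Rpow_mult_distr, pow_inv.
      apply (Rmult_le_reg_r (M ^ n)); [apply pow_lt; auto|]. rewrite Rmult_assoc, Rinv_l, Rmult_1_r; [auto|].
      apply pow_nonzero; lra. }
  apply Rle_div_l in R1; lra.
Qed.

(** ** Mean values on circles *)

Definition circ (t : R) : C := cexp (Ci * RtoC t).

Lemma circ_rder t : rder circ t (Ci * circ t)%C.
Proof.
  unfold circ. eapply rder_ext; [intros; reflexivity| |apply (rder_comp cexp (fun t => Ci * RtoC t)%C t (cexp (Ci * RtoC t)) (Ci * 1))].
  - ring.
  - apply rder_scal, rder_RtoC.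
  - apply cexp_cder.
Qed.

Lemma Cmod_circ t : Cmod (circ t) = 1.
Proof. unfold circ. rewrite Cmod_cexp. simpl. replace (0 * t - 1 * 0) with 0 by ring. apply exp_0. Qed.

Lemma circ_neq_0 t : circ t <> 0%C.
Proof. apply cexp_neq_0. Qed.

Lemma circ_2PI : circ (2 * PI) = circ 0.
Proof.
  unfold circ, cexp. simpl. replace (0 * 0 + 1 * (2 * PI)) with (2 * PI) by ring.
  replace (0 * 0 + 1 * 0) with 0 by ring. rewrite cos_2PI, sin_2PI, cos_0, sin_0.
  replace (0 * (2 * PI) - 1 * 0) with (0 * 0 - 1 * 0) by ring. reflexivity.
Qed.

Lemma circ_ctn t : ctn circ t.
Proof. eapply rder_ctn, circ_rder. Qed.

Lemma disc_dil (p : C) (r t rho : R) : Rabs r < rho -> Cmod (p + RtoC r * circ t - p) < rho.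
Proof.
  intros H. replace (p + RtoC r * circ t - p)%C with (RtoC r * circ t)%C by ring.
  rewrite Cmod_mult, Cmod_R, Cmod_circ. lra.
Qed.

(** [circ] is a closed path, so the dilation argument makes the integral independent of the radius;
    at radius 0 it is the value at the centre. *)
Lemma mean_value (F F' : C -> C) (p : C) (rho r : R) : 0 <= r < rho ->
  hol (fun z => Cmod (z - p) < rho) F F' ->
  CI (fun t => F (p + RtoC r * circ t))%C 0 (2 * PI) = (RtoC (2 * PI) * F p)%C.
Proof.
  intros Hr HF. pose proof PI_RGT_0 as HPI.
  (* The last factor is the constant i, kept as g'/g to fit [dilation]. *)
  set (K := fun s => CI (fun t => F (p + RtoC s * circ t) * ((Ci * circ t) * / circ t))%C 0 (2 * PI)).
  assert (Cn : forall s, Rabs s < rho -> con (fun t => F (p + RtoC s * circ t))%C 0 (2 * PI)).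
  { intros s Hs t _. apply ctn_comp; [eapply cder_Cctn, HF, disc_dil; auto|].
    apply ctn_plus; [apply ctn_const|apply ctn_mult; [apply ctn_const|apply circ_ctn]]. }
  assert (EK : forall s, Rabs s < rho -> K s = (Ci * CI (fun t => F (p + RtoC s * circ t))%C 0 (2 * PI))%C).
  { intros s Hs. unfold K. rewrite <- CI_scal by (auto; lra).
    apply CI_ext; [lra|]. intros t _. field. apply circ_neq_0. }
  assert (K0 : K 0 = (Ci * (RtoC (2 * PI) * F p))%C).
  { rewrite EK by (rewrite Rabs_R0; lra). f_equal.
    replace (2 * PI) with (2 * PI - 0) at 2 by ring. rewrite <- CI_const.
    apply CI_ext; [lra|]. intros t _. f_equal. ring. }
  assert (DK : forall s, 0 <= s <= r -> rder K s 0).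
  { intros s Hs.
    assert (Hsr : Rabs s < rho) by (rewrite Rabs_pos_eq; lra).
    pose proof (dilation (fun z => Cmod (z - p) < rho) F F' p circ (fun t => Ci * circ t)%C 0 (2 * PI) s (rho - Rabs s)) as A.
    eapply rder_ext; [intros; reflexivity| |apply A; auto; try lra].
    - destruct (Req_dec s 0) as [->|Ns].
      + transitivity (F' p * CI (fun t => Ci * circ t)%C 0 (2 * PI))%C.
        * rewrite <- CI_scal; [|lra|intros t _; apply ctn_mult; [apply ctn_const|apply circ_ctn]].
          apply CI_ext; [lra|]. intros t _. f_equal. f_equal. ring.
        * rewrite (CI_FTC circ); [|lra|intros; apply circ_rder|intros t _; apply ctn_mult; [apply ctn_const|apply circ_ctn]].
          rewrite circ_2PI. ring.
      + pose proof (dilation_FTC (fun z => Cmod (z - p) < rho) F F' p circ (fun t => Ci * circ t)%C 0 (2 * PI) s) as B.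
        rewrite circ_2PI in B.
        assert (X : RtoC s <> 0%C) by (intros X; apply RtoC_inj in X; auto).
        transitivity (/ RtoC s * (RtoC s * CI (fun t => F' (p + RtoC s * circ t) * (Ci * circ t)) 0 (2 * PI)))%C; [field; auto|].
        rewrite B; auto; [ring|lra| |].
        * intros; apply disc_dil; auto.
        * intros; split; [apply circ_rder|apply ctn_mult; [apply ctn_const|apply circ_ctn]].
    - intros u t Hu _. apply disc_dil. replace u with ((u - s) + s) by ring.
      eapply Rle_lt_trans; [apply Rabs_triang|]. lra.
    - intros t _. split; [apply circ_neq_0|split; [apply circ_rder|apply ctn_mult; [apply ctn_const|apply circ_ctn]]]. }
  assert (E : K r = K 0).
  { destruct (Req_dec r 0) as [->|]; [reflexivity|]. symmetry. apply rder_zero_const; [lra|auto]. }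
  rewrite K0, EK in E by (rewrite Rabs_pos_eq; lra).
  set (I := CI _ _ _) in *. transitivity (- Ci * (Ci * I))%C.
  - transitivity (- (Ci * Ci) * I)%C; [|ring]. replace (- (Ci * Ci))%C with (RtoC 1); [ring|].
    apply C_eta; simpl; ring.
  - rewrite E. transitivity (- (Ci * Ci) * (RtoC (2 * PI) * F p))%C; [ring|].
    replace (- (Ci * Ci))%C with (RtoC 1); [ring|]. apply C_eta; simpl; ring.
Qed.

Lemma CI_circ_pow n : (0 < n)%nat -> CI (fun t => circ t ^ n)%C 0 (2 * PI) = 0%C.
Proof.
  intros Hn. pose proof PI_RGT_0.
  pose proof (mean_value (fun z => z ^ n)%C) as M.
  destruct (hol_pow (fun z => Cmod (z - 0) < 2) (fun z => z) (fun _ => 1%C) n (hol_id _)) as [G' HG].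
  specialize (M G' 0%C 2 1 ltac:(lra) HG). cbv beta in M.
  transitivity (CI (fun t : R => ((0 + 1 * circ t) ^ n)%C) 0 (2 * PI)).
  - apply CI_ext; [lra|]. intros t _. f_equal. ring.
  - rewrite M. destruct n; [lia|]. rewrite Cpow_S. ring.
Qed.

(** The mean value property of F (z) (z - p)^n, which vanishes at p. *)
Lemma moment (F F' : C -> C) (p : C) (rho r : R) n : 0 <= r < rho -> (0 < n)%nat ->
  hol (fun z => Cmod (z - p) < rho) F F' ->
  CI (fun t => F (p + RtoC r * circ t) * circ t ^ n)%C 0 (2 * PI) = 0%C.
Proof.
  intros Hr Hn HF. pose proof PI_RGT_0 as HPI.
  assert (Cp : con (fun t => circ t ^ n)%C 0 (2 * PI)).
  { intros t _. destruct (hol_pow (fun _ => True) (fun z => z) (fun _ => 1%C) n (hol_id _)) as [G' HG].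
    apply (ctn_comp (fun z => z ^ n)%C circ); [eapply cder_Cctn, HG; auto|apply circ_ctn]. }
  destruct (Req_dec r 0) as [->|N].
  - transitivity (F p * CI (fun t => circ t ^ n)%C 0 (2 * PI))%C.
    + rewrite <- CI_scal; auto; [|lra]. apply CI_ext; [lra|]. intros t _. f_equal. f_equal. ring.
    + rewrite CI_circ_pow by auto. ring.
  - destruct (hol_pow (fun z => Cmod (z - p) < rho) (fun z => z - p)%C (fun _ => (1 - 0)%C) n) as [G' HG].
    { apply hol_minus; [apply hol_id|apply hol_const]. }
    pose proof (mean_value _ _ p rho r Hr (hol_mult _ _ _ _ _ HF HG)) as M. cbv beta in M.
    assert (X : (RtoC r ^ n)%C <> 0%C) by (apply Cpow_nz; intros X; apply RtoC_inj in X; auto).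
    transitivity (/ RtoC r ^ n * CI (fun t : R => (F (p + RtoC r * circ t) * (p + RtoC r * circ t - p) ^ n)%C) 0 (2 * PI))%C.
    + rewrite <- CI_scal; [|lra|].
      * apply CI_ext; [lra|]. intros t _. replace (p + RtoC r * circ t - p)%C with (RtoC r * circ t)%C by ring.
        rewrite Cpow_mult_l. field. auto.
      * intros t Ht. pose proof (hol_mult _ _ _ _ _ HF HG) as Hh.
        apply (ctn_comp (fun z => F z * (z - p) ^ n)%C (fun t => p + RtoC r * circ t)%C).
        -- eapply cder_Cctn, Hh. apply disc_dil. rewrite Rabs_pos_eq; lra.
        -- apply ctn_plus; [apply ctn_const|apply ctn_mult; [apply ctn_const|apply circ_ctn]].
    + rewrite M. replace (p - p)%C with (RtoC 0) by ring. destruct n; [lia|].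
      rewrite (Cpow_S (RtoC 0)), Cmult_0_l, !Cmult_0_r. reflexivity.
Qed.

(* [E] is the complex gradient of the real function [u]: locally [u] is the real part
   of a primitive of [E].  It covers [u = ln |F|], [E = F'/F] without any logarithm. *)
Definition cgrad (u : C -> R) (z e : C) : Prop :=
  forall eps, 0 < eps -> exists d, 0 < d /\
    forall w, Cmod (w - z) < d -> Rabs (u w - u z - Re ((w - z) * e)) <= eps * Cmod (w - z).

Lemma cgrad_Re F z l : cder F z l -> cgrad (fun w => Re (F w)) z l.
Proof.
  intros H e He. destruct (H e He) as [d [Hd Hw]]. exists d. split; auto. intros w Hlt.
  eapply Rle_trans; [|apply (Hw w Hlt)]. eapply Rle_trans; [|apply Rabs_Re_le].
  right. f_equal.
Qed.

Lemma cgrad_path (u : C -> R) (g : R -> C) t e v : cgrad u (g t) e -> rder g t v ->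
  is_derive (fun s => u (g s)) t (Re (e * v)).
Proof.
  intros Hu Hg. apply is_derive_eps. intros ep Hep.
  assert (K : rder (fun s => RtoC (u (g s))) t (RtoC (Re (e * v)))).
  { intros k Hk.
    set (A := Cmod e). set (B := Cmod v).
    assert (HA : 0 <= A) by apply Cmod_ge_0. assert (HB : 0 <= B) by apply Cmod_ge_0.
    set (q := k / (A + B + 1)).
    assert (Hq : 0 < q) by (apply Rdiv_lt_0_compat; lra).
    assert (Hqe : q * (A + B + 1) = k) by (unfold q; field; lra).
    destruct (Hu q Hq) as [d1 [Hd1 H1]].
    destruct (Hg (Rmin q 1) ltac:(apply Rmin_case; lra)) as [d2 [Hd2 H2]].
    assert (Hd3 : 0 < d1 / (B + 1)) by (apply Rdiv_lt_0_compat; lra).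
    assert (Hd3' : d1 / (B + 1) * (B + 1) = d1) by (field; lra).
    exists (Rmin d2 (d1 / (B + 1))). split; [repeat apply Rmin_case; auto|]. intros s Hs.
    assert (U1 := Rlt_le_trans _ _ _ Hs (Rmin_l _ _)).
    assert (U2 := Rlt_le_trans _ _ _ Hs (Rmin_r _ _)).
    specialize (H2 s U1).
    assert (Hk1 : Rmin q 1 <= q) by apply Rmin_l. assert (Hk2 : Rmin q 1 <= 1) by apply Rmin_r.
    pose proof (Rabs_pos (s - t)) as Hz. set (m := Rabs (s - t)) in *.
    set (p := Cmod (g s - g t - RtoC (s - t) * v)) in *. assert (0 <= p) by apply Cmod_ge_0.
    assert (Q : Cmod (g s - g t) <= p + m * B).
    { replace (g s - g t)%C with ((g s - g t - RtoC (s - t) * v) + RtoC (s - t) * v)%C by ring.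
      eapply Rle_trans; [apply Cmod_triangle|]. rewrite Cmod_mult, Cmod_R. fold p m B. lra. }
    assert (p <= q * m) by nra. assert (p <= m) by nra.
    assert (Hgu : Cmod (g s - g t) < d1) by nra. specialize (H1 (g s) Hgu).
    rewrite <- !RtoC_minus, <- RtoC_mult, <- RtoC_minus, Cmod_R.
    replace (u (g s) - u (g t) - (s - t) * Re (e * v)) with
      ((u (g s) - u (g t) - Re ((g s - g t) * e)) + Re ((g s - g t - RtoC (s - t) * v) * e))
      by (destruct (g s), (g t), v, e; simpl; ring).
    eapply Rle_trans; [apply Rabs_triang|].
    assert (Rabs (Re ((g s - g t - RtoC (s - t) * v) * e)) <= p * A).
    { eapply Rle_trans; [apply Rabs_Re_le|]. rewrite Cmod_mult. fold p A. lra. }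
    rewrite <- Hqe. nra. }
  destruct (K ep Hep) as [d [Hd Hs]]. exists d; split; auto. intros s Hs'. specialize (Hs s Hs').
  rewrite <- !RtoC_minus, <- RtoC_mult, <- RtoC_minus, Cmod_R in Hs. exact Hs.
Qed.

Lemma cgrad_continuous (u : C -> R) (g : R -> C) t e : cgrad u (g t) e -> ctn g t ->
  continuous (fun s => u (g s)) t.
Proof.
  intros Hu Hg. apply filterlim_locally. intros ep.
  destruct (Hu 1 Rlt_0_1) as [d [Hd Hw]].
  set (k := Rmin d (ep / (2 + Cmod e))). pose proof (Cmod_ge_0 e).
  assert (Hk : 0 < k) by (apply Rmin_case; auto; apply Rdiv_lt_0_compat; [apply cond_pos|lra]).
  generalize (Hg k Hk). apply filter_imp. intros s Hs.
  change (Rabs (u (g s) - u (g t)) < ep).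
  specialize (Hw (g s) (Rlt_le_trans _ _ _ Hs (Rmin_l _ _))).
  assert (L : Cmod (g s - g t) < ep / (2 + Cmod e)) by (eapply Rlt_le_trans; [exact Hs|apply Rmin_r]).
  apply Rlt_div_r in L; [|lra].
  replace (u (g s) - u (g t)) with ((u (g s) - u (g t) - Re ((g s - g t) * e)) + Re ((g s - g t) * e)) by ring.
  eapply Rle_lt_trans; [apply Rabs_triang|].
  assert (Rabs (Re ((g s - g t) * e)) <= Cmod (g s - g t) * Cmod e).
  { eapply Rle_trans; [apply Rabs_Re_le|]. rewrite Cmod_mult. lra. }
  pose proof (Cmod_ge_0 (g s - g t)). nra.
Qed.

Lemma RInt_eq (f g : R -> R) a b : (forall t, f t = g t) -> RInt f a b = RInt g a b.
Proof. intros H. apply RInt_ext. intros t _. apply H. Qed.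

Lemma ctn_conj {T : UniformSpace} (f : T -> C) x : ctn f x -> ctn (fun y => Cconj (f y)) x.
Proof.
  intros H e He. generalize (H e He). apply filter_imp. intros y Hy.
  replace (Cconj (f y) - Cconj (f x))%C with (Cconj (f y - f x)).
  - rewrite Cmod_conj. exact Hy.
  - destruct (f y), (f x); apply C_eta; simpl; ring.
Qed.

Lemma CI_conj f a b : a <= b -> con f a b -> CI (fun t => Cconj (f t)) a b = Cconj (CI f a b).
Proof.
  intros H Hf. apply C_eta; simpl; [reflexivity|].
  change (- RInt (fun t => Im (f t)) a b) with (opp (RInt (fun t => Im (f t)) a b)).
  rewrite <- (RInt_opp (V := R_CompleteNormedModule)) by (apply con_Im; auto).
  reflexivity.
Qed.

Section BC.
Variables (u : C -> R) (E E' : C -> C) (p : C) (rho : R).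
Hypothesis HE : hol (fun z => Cmod (z - p) < rho) E E'.
Hypothesis Hu : forall z, Cmod (z - p) < rho -> cgrad u z (E z).

Lemma u_path s t : Rabs s < rho -> is_derive (fun r => u (p + RtoC r * circ t)%C) s (Re (E (p + RtoC s * circ t)%C * circ t)).
Proof.
  intros Hs. apply (cgrad_path u (fun r => (p + RtoC r * circ t)%C)); [apply Hu, disc_dil; auto|].
  apply rder_affine.
Qed.

Lemma circ_path_ctn s t : ctn (fun t => (p + RtoC s * circ t)%C) t.
Proof. apply ctn_plus; [apply ctn_const|apply ctn_mult; [apply ctn_const|apply circ_ctn]]. Qed.

Lemma grad_circle (w : R -> C) s : Rabs s < rho -> (forall t, ctn w t) ->
  rder (fun s => CI (fun t => RtoC (u (p + RtoC s * circ t)%C) * w t)%C 0 (2 * PI)) s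
    (CI (fun t => RtoC (Re (E (p + RtoC s * circ t) * circ t)) * w t)%C 0 (2 * PI)).
Proof.
  intros Hs Hw. pose proof PI_RGT_0.
  apply (CI_param (fun s t => RtoC (u (p + RtoC s * circ t)%C) * w t)%C
     (fun s t => RtoC (Re (E (p + RtoC s * circ t) * circ t)) * w t)%C 0 (2 * PI) s (rho - Rabs s)); try lra.
  - intros r t Hr Ht.
    assert (Hr2 : Rabs r < rho) by (replace r with ((r - s) + s) by ring; eapply Rle_lt_trans; [apply Rabs_triang|lra]).
    eapply rder_ext; [intros x; apply Cmult_comm|apply Cmult_comm|]. apply rder_scal.
    apply (rder_of_is_derive (fun r => u (p + RtoC r * circ t)%C) (fun _ => 0)); [apply u_path; auto|].
    apply (is_derive_const (K := R_AbsRing) (V := R_NormedModule)).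
  - intros t Ht. apply ctn_mult; [|apply ctn_snd_comp; apply Hw].
    apply ctn_RtoC. apply (ctn_Re (fun q : R * R => E (p + RtoC (fst q) * circ (snd q)) * circ (snd q))%C).
    apply ctn_mult; [|apply ctn_snd_comp, circ_ctn].
    apply (ctn_comp E (fun q : R * R => p + RtoC (fst q) * circ (snd q))%C).
    + eapply cder_Cctn, HE. simpl. apply disc_dil; auto.
    + apply ctn_dilate, circ_ctn.
  - intros r t Hr Ht.
    assert (Hr2 : Rabs r < rho) by (replace r with ((r - s) + s) by ring; eapply Rle_lt_trans; [apply Rabs_triang|lra]).
    apply ctn_mult; [|apply Hw]. apply ctn_RtoC.
    apply (cgrad_continuous u (fun t => p + RtoC r * circ t)%C t _ (Hu _ (disc_dil _ _ t _ Hr2))).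
    apply circ_path_ctn.
Qed.

Lemma E_circ_con s : Rabs s < rho -> con (fun t => E (p + RtoC s * circ t))%C 0 (2 * PI).
Proof.
  intros Hs t _. apply ctn_comp; [eapply cder_Cctn, HE, disc_dil; auto|apply circ_path_ctn].
Qed.

Lemma u_circ_con s (w : R -> C) : Rabs s < rho -> (forall t, ctn w t) ->
  con (fun t => RtoC (u (p + RtoC s * circ t)%C) * w t)%C 0 (2 * PI).
Proof.
  intros Hs Hw t _. apply ctn_mult; [|apply Hw]. apply ctn_RtoC.
  apply (cgrad_continuous u (fun t => p + RtoC s * circ t)%C t _ (Hu _ (disc_dil _ _ t _ Hs))). apply circ_path_ctn.
Qed.

(** The mean value property of the harmonic function u. Its mean over a circle has radial derivative
    equal to the real part of the first moment of E, which is zero. *)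
Lemma u_mean r : 0 <= r < rho ->
  CI (fun t => RtoC (u (p + RtoC r * circ t)%C) * 1)%C 0 (2 * PI) = RtoC (2 * PI * u p).
Proof.
  intros Hr. pose proof PI_RGT_0.
  set (J := fun s => CI (fun t => RtoC (u (p + RtoC s * circ t)%C) * 1)%C 0 (2 * PI)).
  assert (J0 : J 0 = RtoC (2 * PI * u p)).
  { unfold J. transitivity (CI (fun _ => RtoC (u p)) 0 (2 * PI)).
    - apply CI_ext; [lra|]. intros t _. rewrite Cmult_1_r. do 2 f_equal. ring.
    - rewrite CI_const, <- RtoC_mult. f_equal. ring. }
  rewrite <- J0. fold (J r). destruct (Req_dec r 0) as [->|N]; [reflexivity|].
  symmetry. apply rder_zero_const; [lra|]. intros s Hs.
  assert (Hs2 : Rabs s < rho) by (rewrite Rabs_pos_eq; lra).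
  eapply rder_ext; [intros; reflexivity| |apply (grad_circle (fun _ => 1%C) s Hs2 (fun t => ctn_const _ _))].
  assert (M := moment E E' p rho s 1 ltac:(lra) ltac:(lia) HE).
  apply C_eta.
  - simpl. transitivity (Re (CI (fun t : R => (E (p + s * circ t) * circ t ^ 1)%C) 0 (2 * PI))); [|rewrite M; reflexivity].
    unfold CI; simpl. apply RInt_eq. intros t. ring.
  - simpl. transitivity (RInt (fun _ => 0) 0 (2 * PI)).
    + apply RInt_eq. intros; ring.
    + rewrite RInt_const. unfold scal; simpl; unfold mult; simpl. ring.
Qed.

(** The radial derivative of this Fourier coefficient has integrand Re (E c) conj c = (E + conj (E
    c^2)) / 2 on the unit circle. The second half integrates to zero by [moment], the first is a
    mean value, so the derivative is the constant pi E(p). *)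
Lemma u_moment r : 0 <= r < rho ->
  CI (fun t => RtoC (u (p + RtoC r * circ t)%C) * Cconj (circ t))%C 0 (2 * PI) = (RtoC (PI * r) * E p)%C.
Proof.
  intros Hr. pose proof PI_RGT_0.
  assert (Cc : forall t, ctn (fun t => Cconj (circ t)) t) by (intros t; apply ctn_conj, circ_ctn).
  set (J := fun s => CI (fun t => RtoC (u (p + RtoC s * circ t)%C) * Cconj (circ t))%C 0 (2 * PI)).
  assert (J0 : J 0 = 0%C).
  { unfold J. transitivity (CI (fun t => RtoC (u p) * Cconj (circ t))%C 0 (2 * PI)).
    - apply CI_ext; [lra|]. intros t _. do 3 f_equal. ring.
    - rewrite CI_scal; [|lra|intros t _; auto].
      replace (CI (fun t => Cconj (circ t)) 0 (2 * PI)) with (RtoC 0); [ring|].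
      rewrite CI_conj; [|lra|intros t _; apply circ_ctn].
      replace (CI circ 0 (2 * PI)) with (CI (fun t => circ t ^ 1)%C 0 (2 * PI)).
      + rewrite CI_circ_pow by lia. apply C_eta; simpl; ring.
      + apply CI_ext; [lra|]. intros; apply Cpow_1_r. }
  assert (DJ : forall s, 0 <= s <= r -> rder J s (RtoC PI * E p)%C).
  { intros s Hs.
    assert (Hs2 : Rabs s < rho) by (rewrite Rabs_pos_eq; lra).
    eapply rder_ext; [intros; reflexivity| |apply (grad_circle _ s Hs2 Cc)].
    assert (M := moment E E' p rho s 2 ltac:(lra) ltac:(lia) HE).
    assert (M0 := mean_value E E' p rho s ltac:(lra) HE).
    assert (C2 : con (fun t => E (p + RtoC s * circ t) * circ t ^ 2)%C 0 (2 * PI)).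
    { intros t Ht. apply ctn_mult; [apply (E_circ_con s); auto|].
      apply ctn_ext with (f := fun t => (circ t * circ t)%C); [intros; simpl; ring|apply ctn_mult; apply circ_ctn]. }
    transitivity (CI (fun t => RtoC (/ 2) * E (p + RtoC s * circ t) + RtoC (/ 2) * Cconj (E (p + RtoC s * circ t) * circ t ^ 2))%C 0 (2 * PI)).
    - apply CI_ext; [lra|]. intros t _.
      assert (CC : (Cconj (circ t) * circ t)%C = 1%C).
      { apply C_eta; simpl; [|ring]. pose proof (Cmod_sqr (circ t)) as Q. rewrite Cmod_circ in Q. simpl in Q. lra. }
      set (X := E (p + RtoC s * circ t)%C). set (c := circ t) in *.
      assert (R1 : forall z : C, RtoC (Re z) = (RtoC (/ 2) * (z + Cconj z))%C) by (intros z; apply C_eta; destruct z; simpl; field).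
      rewrite R1.
      replace (Cconj (X * c ^ 2)) with (Cconj X * Cconj c * Cconj c)%C by (destruct X, c; apply C_eta; simpl; ring).
      replace (Cconj (X * c)) with (Cconj X * Cconj c)%C by (destruct X, c; apply C_eta; simpl; ring).
      transitivity (RtoC (/ 2) * (X * (Cconj c * c) + Cconj X * Cconj c * Cconj c))%C; [ring|]. rewrite CC. ring.
    - rewrite CI_plus; [|lra|apply con_scal, E_circ_con; auto|apply con_scal; intros t Ht; apply ctn_conj; apply C2; auto].
      rewrite !CI_scal; [|lra|intros t Ht; apply ctn_conj; apply C2; auto|lra|apply E_circ_con; auto].
      rewrite CI_conj by (auto; lra). rewrite M, M0.
      apply C_eta; simpl; field. }
  fold (J r).
  assert (Z : (J r + Copp (RtoC PI * E p) * RtoC r)%C = (J 0 + Copp (RtoC PI * E p) * RtoC 0)%C).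
  { destruct (Req_dec r 0) as [->|N]; [reflexivity|].
    symmetry. apply (rder_zero_const (fun s => (J s + Copp (RtoC PI * E p) * RtoC s)%C)); [lra|].
    intros s Hs. eapply rder_ext; [intros; reflexivity| |apply rder_plus; [apply DJ; auto|apply rder_scal, rder_RtoC]].
    ring. }
  rewrite J0 in Z. rewrite RtoC_mult.
  transitivity (J r + Copp (RtoC PI * E p) * RtoC r + RtoC PI * E p * RtoC r)%C; [ring|]. rewrite Z. ring.
Qed.

(* Borel--Caratheodory for the derivative: the antiholomorphic part of [u] has no
   first Fourier coefficient, so [E p] is an integral of [u - B], which has one sign. *)
Theorem borel_caratheodory r B : 0 < r < rho ->
  (forall z, Cmod (z - p) = r -> u z <= B) -> Cmod (E p) <= 2 / r * (B - u p).
Proof.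
  intros Hr HB. pose proof PI_RGT_0.
  assert (Hr2 : Rabs r < rho) by (rewrite Rabs_pos_eq; lra).
  assert (Cc : forall t, ctn (fun t => Cconj (circ t)) t) by (intros t; apply ctn_conj, circ_ctn).
  assert (Z : CI (fun t => RtoC B * Cconj (circ t))%C 0 (2 * PI) = 0%C).
  { rewrite CI_scal; [|lra|intros t _; auto].
    rewrite CI_conj; [|lra|intros t _; apply circ_ctn].
    replace (CI circ 0 (2 * PI)) with (CI (fun t => circ t ^ 1)%C 0 (2 * PI)).
    - rewrite CI_circ_pow by lia. apply C_eta; simpl; ring.
    - apply CI_ext; [lra|]. intros; apply Cpow_1_r. }
  assert (K : CI (fun t => RtoC (u (p + RtoC r * circ t)%C) * Cconj (circ t) - RtoC B * Cconj (circ t))%C 0 (2 * PI) = (RtoC (PI * r) * E p)%C).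
  { rewrite CI_minus; [|lra|apply u_circ_con; auto|intros t _; apply ctn_mult; [apply ctn_const|auto]].
    rewrite Z, u_moment by lra. ring. }
  assert (Ub : forall t, u (p + RtoC r * circ t)%C <= B).
  { intros t. apply HB. replace (p + RtoC r * circ t - p)%C with (RtoC r * circ t)%C by ring.
    rewrite Cmod_mult, Cmod_R, Cmod_circ, Rabs_pos_eq; lra. }
  assert (EU : ex_RInt (fun t => u (p + RtoC r * circ t)%C) 0 (2 * PI)).
  { apply ex_RInt_cont; [lra|]. intros t _.
    apply (cgrad_continuous u (fun t => p + RtoC r * circ t)%C t _ (Hu _ (disc_dil _ _ t _ Hr2))). apply circ_path_ctn. }
  assert (Mu : RInt (fun t => u (p + RtoC r * circ t)%C) 0 (2 * PI) = 2 * PI * u p).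
  { pose proof (f_equal Re (u_mean r ltac:(lra))) as Q. simpl in Q. rewrite <- Q.
    apply RInt_eq. intros; ring. }
  assert (L : Cmod (RtoC (PI * r) * E p) <= RInt (fun t => B - u (p + RtoC r * circ t)%C) 0 (2 * PI)).
  { rewrite <- K. apply Cmod_CI_le; [lra| | |].
    - intros t Ht. apply (ctn_plus (fun t => RtoC (u (p + RtoC r * circ t)%C) * Cconj (circ t))%C); [apply u_circ_con; auto|].
      apply ctn_ext with (f := fun t => (Copp (RtoC B) * Cconj (circ t))%C); [intros; ring|apply ctn_mult; [apply ctn_const|auto]].
    - apply (ex_RInt_minus (V := R_NormedModule) (fun _ => B)); [apply ex_RInt_const|auto].
    - intros t _. replace (RtoC (u (p + RtoC r * circ t)%C) * Cconj (circ t) - RtoC B * Cconj (circ t))%C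
        with (RtoC (u (p + RtoC r * circ t)%C - B) * Cconj (circ t))%C by (rewrite RtoC_minus; ring).
      rewrite Cmod_mult, Cmod_conj, Cmod_circ, Cmod_R. specialize (Ub t). rewrite Rabs_left1; lra. }
  rewrite (RInt_minus (V := R_CompleteNormedModule) (fun _ => B)) in L; [|apply ex_RInt_const|auto].
  rewrite RInt_const, Mu in L. unfold minus, plus, opp, scal in L; simpl in L; unfold mult in L; simpl in L.
  rewrite Cmod_mult, Cmod_R, Rabs_pos_eq in L by (apply Rmult_le_pos; lra).
  apply (Rmult_le_reg_l (PI * r)); [nra|].
  replace (PI * r * (2 / r * (B - u p))) with (2 * PI * (B - u p)) by (field; lra). lra.
Qed.
End BC.

(** * The gradient of ln |z| *)

Lemma ln_2nd (x : R) : Rabs x <= 1 / 2 -> Rabs (ln (1 + x) - x) <= 2 * x ^ 2.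
Proof.
  intros H. apply Rabs_le_between in H.
  assert (A : ln (1 + x) <= x).
  { rewrite <- (ln_exp x) at 2. apply ln_le; [lra|]. apply exp_ineq1_le. }
  assert (B : x - 2 * x ^ 2 <= ln (1 + x)).
  { assert (Q : - ln (1 + x) <= - x / (1 + x)).
    { rewrite <- ln_Rinv by lra. replace (/ (1 + x)) with (1 + - x / (1 + x)) by (field; lra).
      set (y := - x / (1 + x)).
      assert (0 < 1 + y) by (unfold y; replace (1 + - x / (1 + x)) with (/ (1 + x)) by (field; lra); apply Rinv_0_lt_compat; lra).
      rewrite <- (ln_exp y) at 2. apply ln_le; [lra|]. apply exp_ineq1_le. }
    assert (- x / (1 + x) <= - x + 2 * x ^ 2).
    { apply Rle_div_l; [lra|]. nra. }
    lra. }
  apply Rabs_le. nra.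
Qed.

Lemma ln_Cmod (z : C) : ln (Cmod z) = / 2 * ln (Re z * Re z + Im z * Im z).
Proof.
  destruct (Req_dec (Cmod z) 0) as [E|E].
  - pose proof (Cmod_sqr z) as Q. rewrite E in Q. rewrite E, <- Q.
    replace (0 * 0) with 0 by ring.
    unfold ln. destruct (Rlt_dec 0 0); [exfalso; lra|ring].
  - assert (0 < Cmod z) by (pose proof (Cmod_ge_0 z); lra).
    rewrite <- Cmod_sqr, ln_mult by auto. field.
Qed.

(** With w = z (1 + h) the difference is ln |1 + h| = (1/2) ln (1 + 2 Re h + |h|^2), and [ln_2nd]
    isolates Re h. *)
Lemma cgrad_ln (z : C) : z <> 0%C -> cgrad (fun w => ln (Cmod w)) z (/ z)%C.
Proof.
  intros Hz e He. set (m := Cmod z). assert (Hm : 0 < m) by (apply Cmod_gt_0; auto).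
  exists (Rmin (m / 8) (e * (m * m) / 20)). split.
  { apply Rmin_case; [lra|]. apply Rdiv_lt_0_compat; [|lra]. repeat apply Rmult_lt_0_compat; auto. }
  intros w Hw.
  assert (W1 : Cmod (w - z) < m / 8) by (eapply Rlt_le_trans; [exact Hw|apply Rmin_l]).
  assert (W2 : Cmod (w - z) < e * (m * m) / 20) by (eapply Rlt_le_trans; [exact Hw|apply Rmin_r]).
  set (h := ((w - z) * / z)%C).
  assert (Hh : Cmod h = Cmod (w - z) / m) by (unfold h; rewrite Cmod_mult, Cmod_inv; auto).
  assert (H8 : Cmod h <= 1 / 8) by (rewrite Hh; apply Rle_div_l; lra).
  assert (H20 : Cmod h <= e * m / 20) by (rewrite Hh; apply Rle_div_l; nra).
  assert (Ew : w = (z * (1 + h))%C) by (unfold h; field; auto).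
  assert (N1 : (1 + h)%C <> 0%C).
  { intros X. assert (Cmod h = 1) by (replace h with (Copp 1) by (rewrite <- (Cplus_0_l (Copp 1)), <- X; ring); rewrite Cmod_opp, Cmod_1; auto). lra. }
  assert (El : ln (Cmod w) - ln (Cmod z) = ln (Cmod (1 + h))).
  { rewrite Ew, Cmod_mult, ln_mult; [ring|auto|apply Cmod_gt_0; auto]. }
  change (Rabs ((ln (Cmod w) - ln (Cmod z)) - Re h) <= e * Cmod (w - z)).
  rewrite El, ln_Cmod.
  pose proof (Rabs_Re_le h) as R1. pose proof (Rabs_Im_le h) as R2. pose proof (Cmod_sqr h) as R3. pose proof (Cmod_ge_0 h) as R4.
  assert (R5 := Rabs_le_between (Re h) (Cmod h)). apply R5 in R1. clear R5.
  set (X := 2 * Re h + Cmod h * Cmod h).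
  replace (Re (1 + h) * Re (1 + h) + Im (1 + h) * Im (1 + h)) with (1 + X) by (unfold X; rewrite R3; destruct h; simpl; ring).
  assert (HX : Rabs X <= 1 / 2) by (apply Rabs_le; unfold X; nra).
  pose proof (ln_2nd X HX) as L.
  replace (/ 2 * ln (1 + X) - Re h) with (/ 2 * (ln (1 + X) - X) + / 2 * (Cmod h * Cmod h)) by (unfold X; field).
  eapply Rle_trans; [apply Rabs_triang|]. rewrite !Rabs_mult, (Rabs_pos_eq (/ 2)) by lra.
  rewrite (Rabs_pos_eq (Cmod h)) by auto.
  assert (X2 : X ^ 2 <= 9 * (Cmod h * Cmod h)).
  { assert (Rabs X <= 3 * Cmod h) by (apply Rabs_le; unfold X; nra).
    rewrite <- pow2_abs. pose proof (Rabs_pos X). nra. }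
  replace (Cmod (w - z)) with (m * Cmod h) by (rewrite Hh; field; lra).
  assert (10 * (Cmod h * Cmod h) <= e * (m * Cmod h)).
  { nra. }
  pose proof (Rmult_le_pos _ _ R4 R4). lra.
Qed.

(** * Finite sums and series of complex numbers *)

Fixpoint csum (a : nat -> C) (N : nat) : C :=
  match N with O => RtoC 0 | S n => (csum a n + a n)%C end.

Fixpoint rsum (a : nat -> R) (N : nat) : R :=
  match N with O => 0 | S n => rsum a n + a n end.

Lemma rsum_sum_n a N : rsum a (S N) = sum_n a N.
Proof.
  induction N as [|N IH].
  - rewrite sum_O. simpl. lra.
  - rewrite sum_Sn, <- IH. reflexivity.
Qed.

Lemma csum_Re a N : Re (csum a N) = rsum (fun n => Re (a n)) N.
Proof. induction N; simpl; [reflexivity|]. rewrite <- IHN. destruct (csum a N), (a N); reflexivity. Qed.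

Lemma csum_Im a N : Im (csum a N) = rsum (fun n => Im (a n)) N.
Proof. induction N; simpl; [reflexivity|]. rewrite <- IHN. destruct (csum a N), (a N); reflexivity. Qed.

Lemma csum_le a (M : nat -> R) N : (forall n, (n < N)%nat -> Cmod (a n) <= M n) -> Cmod (csum a N) <= rsum M N.
Proof.
  intros H. induction N as [|N IH]; simpl; [rewrite Cmod_0; lra|].
  eapply Rle_trans; [apply Cmod_triangle|]. apply Rplus_le_compat; [apply IH; intros; apply H; lia|apply H; lia].
Qed.

Lemma rsum_le a b N : (forall n, (n < N)%nat -> a n <= b n) -> rsum a N <= rsum b N.
Proof.
  intros H. induction N as [|N IH]; simpl; [lra|].
  apply Rplus_le_compat; [apply IH; intros; apply H; lia|apply H; lia].
Qed.

Lemma rsum_ext a b N : (forall n, (n < N)%nat -> a n = b n) -> rsum a N = rsum b N.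
Proof. intros H. induction N as [|N IH]; simpl; [lra|]. rewrite IH, H; auto. Qed.

Lemma csum_ext a b N : (forall n, (n < N)%nat -> a n = b n) -> csum a N = csum b N.
Proof. intros H. induction N as [|N IH]; simpl; [auto|]. rewrite IH, H; auto. Qed.

Lemma csum_plus a b N : csum (fun n => a n + b n)%C N = (csum a N + csum b N)%C.
Proof. induction N as [|N IH]; simpl; [ring|]. rewrite IH. ring. Qed.

Lemma csum_scal c a N : csum (fun n => c * a n)%C N = (c * csum a N)%C.
Proof. induction N as [|N IH]; simpl; [ring|]. rewrite IH. ring. Qed.

Lemma rsum_scal c a N : rsum (fun n => c * a n) N = c * rsum a N.
Proof. induction N as [|N IH]; simpl; [ring|]. rewrite IH. ring. Qed.

Lemma rsum_plus a b N : rsum (fun n => a n + b n) N = rsum a N + rsum b N.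
Proof. induction N as [|N IH]; simpl; [ring|]. rewrite IH. ring. Qed.

Lemma rsum_nonneg a N : (forall n, 0 <= a n) -> 0 <= rsum a N.
Proof. intros H. induction N; simpl; [lra|]. specialize (H N). lra. Qed.

Lemma rsum_mono a N M : (forall n, 0 <= a n) -> (N <= M)%nat -> rsum a N <= rsum a M.
Proof. intros H HN. induction HN; [lra|]. simpl. specialize (H m). lra. Qed.

Definition csums (a : nat -> C) (l : C) : Prop :=
  forall eps, 0 < eps -> exists N0, forall N, (N0 <= N)%nat -> Cmod (csum a N - l) < eps.

(** A total function: it is the sum of the series only once convergence [csums] has been shown,
    usually by [csums_dom]. *)
Definition CSeries (a : nat -> C) : C := (Series (fun n => Re (a n)), Series (fun n => Im (a n))).

Lemma is_series_rsum a l : is_series a l ->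
  forall eps, 0 < eps -> exists N0, forall N, (N0 <= N)%nat -> Rabs (rsum a N - l) < eps.
Proof.
  intros H e He. destruct (proj1 (filterlim_locally _ _) H (mkposreal e He)) as [N0 HN].
  exists (S N0). intros [|N] Hl; [lia|]. rewrite rsum_sum_n. apply (HN N). lia.
Qed.

Lemma csums_dom (a : nat -> C) (M : nat -> R) : (forall n, Cmod (a n) <= M n) -> ex_series M ->
  csums a (CSeries a).
Proof.
  intros H HM.
  assert (E1 : ex_series (fun n => Re (a n))).
  { apply (ex_series_le (V := R_CompleteNormedModule)) with (b := M); auto. intros n. eapply Rle_trans; [apply Rabs_Re_le|auto]. }
  assert (E2 : ex_series (fun n => Im (a n))).
  { apply (ex_series_le (V := R_CompleteNormedModule)) with (b := M); auto. intros n. eapply Rle_trans; [apply Rabs_Im_le|auto]. }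
  apply Series_correct in E1, E2.
  intros e He. destruct (is_series_rsum _ _ E1 (e / 2) ltac:(lra)) as [N1 H1].
  destruct (is_series_rsum _ _ E2 (e / 2) ltac:(lra)) as [N2 H2].
  exists (max N1 N2). intros N HN. specialize (H1 N ltac:(lia)). specialize (H2 N ltac:(lia)).
  rewrite <- csum_Re in H1. rewrite <- csum_Im in H2.
  eapply Rle_lt_trans; [apply Cmod_le_abs|].
  replace (Re (csum a N - CSeries a)) with (Re (csum a N) - Series (fun n => Re (a n))) by (destruct (csum a N); reflexivity).
  replace (Im (csum a N - CSeries a)) with (Im (csum a N) - Series (fun n => Im (a n))) by (destruct (csum a N); reflexivity).
  lra.
Qed.

Lemma csums_le (a : nat -> C) l B : csums a l -> (exists N1, forall N, (N1 <= N)%nat -> Cmod (csum a N) <= B) -> Cmod l <= B.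
Proof.
  intros H [N1 HB]. apply Rnot_lt_le. intros L.
  destruct (H (Cmod l - B) ltac:(lra)) as [N0 HN]. specialize (HN (max N0 N1) ltac:(lia)). specialize (HB (max N0 N1) ltac:(lia)).
  pose proof (Cmod_rev l (csum a (max N0 N1))). rewrite Cmod_sub_comm in H0. lra.
Qed.

Lemma csums_unique a l l' : csums a l -> csums a l' -> l = l'.
Proof.
  intros H H'. apply Ceq_minus. apply Cmod_eq_0. apply Rle_antisym; [|apply Cmod_ge_0].
  apply Rnot_lt_le. intros L.
  destruct (H (Cmod (l - l') / 2) ltac:(lra)) as [N0 HN]. destruct (H' (Cmod (l - l') / 2) ltac:(lra)) as [N1 HN1].
  specialize (HN (max N0 N1) ltac:(lia)). specialize (HN1 (max N0 N1) ltac:(lia)).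
  pose proof (Cmod_tri_sub l (csum a (max N0 N1)) l'). rewrite (Cmod_sub_comm l (csum a _)) in H0. lra.
Qed.

Lemma csums_plus a b l m : csums a l -> csums b m -> csums (fun n => a n + b n)%C (l + m)%C.
Proof.
  intros H H' e He. destruct (H (e / 2) ltac:(lra)) as [N0 HN]. destruct (H' (e / 2) ltac:(lra)) as [N1 HN1].
  exists (max N0 N1). intros N HM. specialize (HN N ltac:(lia)). specialize (HN1 N ltac:(lia)).
  rewrite csum_plus. replace (csum a N + csum b N - (l + m))%C with ((csum a N - l) + (csum b N - m))%C by ring.
  eapply Rle_lt_trans; [apply Cmod_triangle|lra].
Qed.

Lemma csums_scal c a l : csums a l -> csums (fun n => c * a n)%C (c * l)%C.
Proof.
  intros H e He. pose proof (Cmod_ge_0 c).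
  destruct (H (e / (Cmod c + 1))) as [N0 HN]; [apply Rdiv_lt_0_compat; lra|].
  exists N0. intros N HM. specialize (HN N HM). rewrite csum_scal.
  replace (c * csum a N - c * l)%C with (c * (csum a N - l))%C by ring. rewrite Cmod_mult.
  apply Rlt_div_r in HN; [|lra]. pose proof (Cmod_ge_0 (csum a N - l)). nra.
Qed.

Lemma csums_ext a b l : (forall n, a n = b n) -> csums a l -> csums b l.
Proof.
  intros E H e He. destruct (H e He) as [N0 HN]. exists N0. intros N HM.
  rewrite <- (csum_ext a b N); auto.
Qed.

Lemma rsum_le_Series M N : (forall n, 0 <= M n) -> ex_series M -> rsum M N <= Series M.
Proof.
  intros H HM. apply Rnot_lt_le. intros L. apply Series_correct in HM.
  destruct (is_series_rsum _ _ HM (rsum M N - Series M) ltac:(lra)) as [N0 HN].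
  specialize (HN (max N N0) ltac:(lia)). pose proof (rsum_mono M N (max N N0) H ltac:(lia)).
  apply Rabs_lt_between in HN. lra.
Qed.

Lemma csums_dom_le (a : nat -> C) (M : nat -> R) l : (forall n, Cmod (a n) <= M n) -> ex_series M ->
  csums a l -> Cmod l <= Series M.
Proof.
  intros H HM Hl. apply (csums_le a l); auto. exists O. intros N _.
  eapply Rle_trans; [apply csum_le; intros; apply H|]. apply rsum_le_Series; auto.
  intros n. eapply Rle_trans; [apply Cmod_ge_0|apply H].
Qed.

(** ** Termwise differentiation *)

Lemma mean_value_ineq (F F' : C -> C) (z w : C) M : (forall v, cder F v (F' v) /\ Cctn F' v) ->
  (forall t, 0 <= t <= 1 -> Cmod (F' (z + RtoC t * (w - z))%C) <= M) ->
  Cmod (F w - F z) <= M * Cmod (w - z).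
Proof.
  intros HF HM.
  assert (Cn : con (fun t => F' (z + RtoC t * (w - z)) * (w - z))%C 0 1).
  { intros t _. apply ctn_mult; [|apply ctn_const]. apply (ctn_comp F' (fun t => z + RtoC t * (w - z))%C); [apply HF|].
    eapply rder_ctn, rder_affine. }
  pose proof (CI_FTC (fun t => F (z + RtoC t * (w - z))%C) _ 0 1 ltac:(lra)
    (fun t _ => rder_comp F _ t _ _ (rder_affine z (w - z) t) (proj1 (HF _))) Cn) as E. cbv beta in E.
  replace (z + 1 * (w - z))%C with w in E by ring. replace (z + 0 * (w - z))%C with z in E by ring.
  rewrite <- E. eapply Rle_trans; [apply (Cmod_CI_const _ (M * Cmod (w - z)) 0 1); [lra|auto|]|lra].
  intros t Ht. rewrite Cmod_mult. apply Rmult_le_compat_r; [apply Cmod_ge_0|auto].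
Qed.

Lemma taylor2 (F F' F'' : C -> C) (z w : C) M : (forall v, cder F v (F' v) /\ cder F' v (F'' v) /\ Cctn F'' v) ->
  (forall t, 0 <= t <= 1 -> Cmod (F'' (z + RtoC t * (w - z))%C) <= M) ->
  Cmod (F w - F z - (w - z) * F' z) <= M * (Cmod (w - z) * Cmod (w - z)).
Proof.
  intros HF HM.
  pose proof (mean_value_ineq (fun v => F v - v * F' z)%C (fun v => F' v - F' z)%C z w (M * Cmod (w - z))) as Q.
  replace (F w - F z - (w - z) * F' z)%C with (F w - w * F' z - (F z - z * F' z))%C by ring.
  rewrite <- Rmult_assoc. apply Q; clear Q.
  - intros v. destruct (HF v) as [A [B _]]. split.
    + apply cder_minus; auto. eapply cder_ext; [intros; reflexivity| |apply cder_mult; [apply cder_id|apply (cder_const (F' z))]].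
      cbv beta; ring.
    + apply Cctn_minus; [eapply cder_Cctn; eauto|apply Cctn_const].
  - intros t Ht.
    assert (M0 : 0 <= M) by (eapply Rle_trans; [apply Cmod_ge_0|apply (HM 0); lra]).
    eapply Rle_trans; [apply (mean_value_ineq F' F'' z _ M)|].
    + intros v. apply HF.
    + intros s Hs. replace (z + RtoC s * (z + RtoC t * (w - z) - z))%C with (z + RtoC (s * t) * (w - z))%C.
      * apply HM. nra.
      * rewrite RtoC_mult. ring.
    + apply Rmult_le_compat_l; auto. replace (z + RtoC t * (w - z) - z)%C with (RtoC t * (w - z))%C by ring.
      rewrite Cmod_mult, Cmod_R, Rabs_pos_eq by lra. pose proof (Cmod_ge_0 (w - z)). nra.
Qed.

(** An entire function listed with all its derivatives. Explicit towers take the place of the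
    theorem that holomorphic functions are infinitely differentiable. *)
Definition tower (g : nat -> C -> C) : Prop := forall j z, cder (g j) z (g (S j) z).

Lemma tower_ctn g j z : tower g -> Cctn (g j) z.
Proof. intros H. eapply cder_Cctn, H. Qed.

(** Each differentiation gives up r of the radius: [borel_caratheodory] for the real part of the
    previous derivative costs 2/r times an oscillation of at most twice its bound, hence 4/r. *)
Lemma cauchy_est (g : nat -> C -> C) (z0 : C) (rho M r : R) : tower g -> 0 < r ->
  (forall z, Cmod (z - z0) < rho -> Cmod (g O z) <= M) ->
  forall j z, Cmod (z - z0) < rho - INR j * r -> Cmod (g j z) <= M * (4 / r) ^ j.
Proof.
  intros Hg Hr HM j. induction j as [|j IH]; intros z Hz.
  - simpl in *. rewrite Rmult_1_r. apply HM. lra.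
  - rewrite S_INR in Hz.
    assert (Hz0 : Cmod (z - z0) < rho - INR j * r) by lra.
    set (B := M * (4 / r) ^ j).
    pose proof (borel_caratheodory (fun w => Re (g j w)) (g (S j)) (g (S (S j))) z (r + 1)) as Q.
    eapply Rle_trans; [apply (Q) with (r := r) (B := B)|].
    + intros w _. split; [apply Hg|apply tower_ctn; auto].
    + intros w _. apply cgrad_Re. apply Hg.
    + lra.
    + intros w Hw. eapply Rle_trans; [apply Re_le_Cmod|]. apply IH.
      eapply Rle_lt_trans; [apply (Cmod_tri_sub w z z0)|]. lra.
    + pose proof (IH z Hz0) as I0. fold B in I0. pose proof (Rabs_Re_le (g j z)) as R1.
      assert (- Re (g j z) <= B) by (pose proof (Rle_abs (- Re (g j z))); rewrite Rabs_Ropp in H; lra).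
      simpl pow. replace (M * (4 / r * (4 / r) ^ j)) with (2 / r * (2 * B)) by (unfold B; field; lra).
      apply Rmult_le_compat_l; [apply Rlt_le, Rdiv_lt_0_compat; lra|lra].
Qed.

Section SeriesTower.
Variables (g : nat -> nat -> C -> C) (z0 : C) (rho : R) (M : nat -> R).
Hypothesis Hg : forall n, tower (g n).
Hypothesis Hrho : 0 < rho.
Hypothesis HM : forall n z, Cmod (z - z0) < rho -> Cmod (g n O z) <= M n.
Hypothesis HS : ex_series M.

Lemma M_nonneg n : 0 <= M n.
Proof.
  eapply Rle_trans; [apply Cmod_ge_0|apply (HM n z0)].
  replace (z0 - z0)%C with (RtoC 0) by ring. rewrite Cmod_0. auto.
Qed.

Lemma series_bound j : exists K, 0 <= K /\ forall n z, Cmod (z - z0) < rho / 2 -> Cmod (g n j z) <= K * M n.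
Proof.
  set (r := rho / (2 * (INR j + 1))). pose proof (pos_INR j).
  assert (Hr : 0 < r) by (apply Rdiv_lt_0_compat; lra).
  exists ((4 / r) ^ j). split; [apply pow_le, Rlt_le, Rdiv_lt_0_compat; lra|].
  intros n z Hz. rewrite Rmult_comm. apply (cauchy_est (g n) z0 rho (M n) r (Hg n) Hr (HM n)).
  assert (INR j * r <= rho / 2).
  { unfold r. replace (rho / 2) with ((INR j + 1) * (rho / (2 * (INR j + 1)))) by (field; lra).
    apply Rmult_le_compat_r; [fold r; lra|lra]. }
  lra.
Qed.

Lemma series_conv j z : Cmod (z - z0) < rho / 2 -> csums (fun n => g n j z) (CSeries (fun n => g n j z)).
Proof.
  intros Hz. destruct (series_bound j) as [K [HK H]].
  apply csums_dom with (M := fun n => K * M n).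
  - intros n. auto.
  - apply (ex_series_scal (V := R_NormedModule) K); auto.
Qed.

(** The terms have second-order Taylor remainders at most K M n |w - z0|^2, because [series_bound]
    controls the derivative two steps higher uniformly near z0; these remainders are summable. *)
Theorem series_cder j : cder (fun z => CSeries (fun n => g n j z)) z0 (CSeries (fun n => g n (S j) z0)).
Proof.
  intros e He. destruct (series_bound (S (S j))) as [K [HK H]].
  set (A := K * Series M). 
  assert (HA : 0 <= A).
  { apply Rmult_le_pos; auto. apply (Rle_trans _ (rsum M 0)); [simpl; lra|]. apply rsum_le_Series; auto. apply M_nonneg. }
  exists (Rmin (rho / 2) (e / (A + 1))). split; [apply Rmin_case; [lra|apply Rdiv_lt_0_compat; lra]|].
  intros w Hw.
  assert (W1 : Cmod (w - z0) < rho / 2) by (eapply Rlt_le_trans; [exact Hw|apply Rmin_l]).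
  assert (W2 : Cmod (w - z0) < e / (A + 1)) by (eapply Rlt_le_trans; [exact Hw|apply Rmin_r]).
  assert (Z0 : Cmod (z0 - z0) < rho / 2).
  { replace (z0 - z0)%C with (RtoC 0) by ring. rewrite Cmod_0. lra. }
  pose proof (csums_plus _ _ _ _ (csums_plus _ _ _ _ (series_conv j w W1) (csums_scal (Copp 1) _ _ (series_conv j z0 Z0)))
     (csums_scal (- (w - z0)) _ _ (series_conv (S j) z0 Z0))) as S1. cbv beta in S1.
  set (d := Cmod (w - z0)) in *. assert (Hd0 : 0 <= d) by apply Cmod_ge_0.
  replace (CSeries (fun n => g n j w) - CSeries (fun n => g n j z0) - (w - z0) * CSeries (fun n => g n (S j) z0))%C
   with (CSeries (fun n => g n j w) + Copp 1 * CSeries (fun n => g n j z0) + - (w - z0) * CSeries (fun n => g n (S j) z0))%C by ring.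
  apply Rle_trans with (Series (fun n => (K * (d * d)) * M n)).
  - apply (csums_dom_le _ (fun n => (K * (d * d)) * M n)) in S1; auto.
    + intros n. replace (g n j w + Copp 1 * g n j z0 + - (w - z0) * g n (S j) z0)%C
        with (g n j w - g n j z0 - (w - z0) * g n (S j) z0)%C by ring.
      eapply Rle_trans; [apply (taylor2 (g n j) (g n (S j)) (g n (S (S j))) z0 w (K * M n))|].
      * intros v. repeat split; try apply Hg. apply tower_ctn; auto.
      * intros t Ht. apply H. replace (z0 + RtoC t * (w - z0) - z0)%C with (RtoC t * (w - z0))%C by ring.
        rewrite Cmod_mult, Cmod_R, Rabs_pos_eq by lra. fold d. nra.
      * fold d. lra.
    + apply (ex_series_scal (V := R_NormedModule) (K * (d * d))); auto.
  - rewrite Series_scal_l. apply Rlt_div_r in W2; [|lra].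
    replace (K * (d * d) * Series M) with (A * d * d) by (unfold A; ring). nra.
Qed.
End SeriesTower.

(* [rp x p] is x^(-p) and [cp x s] is x^(-s): note the sign. *)
Definition rp (x p : R) : R := exp (- p * ln x).
Definition cp (x : R) (s : C) : C := cexp (- s * RtoC (ln x)).

Lemma rp_pos x p : 0 < rp x p.
Proof. apply exp_pos. Qed.

Lemma rp_plus x p q : rp x (p + q) = rp x p * rp x q.
Proof. unfold rp. rewrite <- exp_plus. f_equal. ring. Qed.

Lemma rp_0 x : rp x 0 = 1.
Proof. unfold rp. replace (- 0 * ln x) with 0 by ring. apply exp_0. Qed.

Lemma rp_1 x : 0 < x -> rp x 1 = / x.
Proof. intros H. unfold rp. replace (- (1) * ln x) with (- ln x) by ring. rewrite exp_Ropp, exp_ln; auto. Qed.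

Lemma rp_m1 x : 0 < x -> rp x (-1) = x.
Proof. intros H. unfold rp. replace (- -1 * ln x) with (ln x) by ring. apply exp_ln; auto. Qed.

Lemma ln_nonneg x : 1 <= x -> 0 <= ln x.
Proof. intros H. rewrite <- ln_1. apply ln_le; lra. Qed.

Lemma exp_le a b : a <= b -> exp a <= exp b.
Proof. intros [H| ->]; [left; apply exp_increasing; auto|right; reflexivity]. Qed.

Lemma rp_le_exp x p q : 1 <= x -> p <= q -> rp x q <= rp x p.
Proof. intros H Hp. unfold rp. apply ln_nonneg in H. apply exp_le. nra. Qed.

Lemma rp_le_base x y p : 0 < x -> x <= y -> 0 <= p -> rp y p <= rp x p.
Proof. intros H Hp Hq. unfold rp. assert (ln x <= ln y) by (apply ln_le; lra). apply exp_le. nra. Qed.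

Lemma rp_mult x y p : 0 < x -> 0 < y -> rp (x * y) p = rp x p * rp y p.
Proof. intros. unfold rp. rewrite ln_mult, <- exp_plus; auto. f_equal; ring. Qed.

Lemma Cmod_cp x s : Cmod (cp x s) = rp x (Re s).
Proof. unfold cp, rp. rewrite Cmod_cexp. f_equal. destruct s; simpl. ring. Qed.

Lemma cp_plus x s t : cp x (s + t) = (cp x s * cp x t)%C.
Proof. unfold cp. rewrite <- cexp_plus. f_equal. ring. Qed.

Lemma cp_mult x y s : 0 < x -> 0 < y -> cp (x * y) s = (cp x s * cp y s)%C.
Proof. intros. unfold cp. rewrite <- cexp_plus, ln_mult, RtoC_plus; auto. f_equal; ring. Qed.

Lemma cp_R x p : cp x (RtoC p) = RtoC (rp x p).
Proof. unfold cp, rp. rewrite <- RtoC_opp, <- RtoC_mult. apply cexp_R. Qed.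

Lemma cp_1 s : cp 1 s = 1%C.
Proof. unfold cp. rewrite ln_1. replace (- s * RtoC 0)%C with (RtoC 0) by ring. apply cexp_0. Qed.

(** ** Sums of [n^(-p)] *)

(** From ln (x + 1) - ln x >= 1 / (x + 1) and exp v >= 1 + v. It plays the part of the integral
    test. *)
Lemma rp_telescope (n : nat) q : (1 <= n)%nat -> 0 < q ->
  q * rp (INR (S n)) (q + 1) <= rp (INR n) q - rp (INR (S n)) q.
Proof.
  intros Hn Hq. rewrite S_INR. set (x := INR n). assert (Hx : 1 <= x) by (apply (le_INR 1); auto).
  rewrite rp_plus, rp_1 by lra.
  replace (rp x q) with (rp (x + 1) q * exp (q * (ln (x + 1) - ln x))).
  2:{ unfold rp. rewrite <- exp_plus. f_equal. ring. }
  pose proof (rp_pos (x + 1) q).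
  assert (E : / (x + 1) <= ln (x + 1) - ln x).
  { assert (L : ln (x / (x + 1)) <= x / (x + 1) - 1).
    { assert (0 < x / (x + 1)) by (apply Rdiv_lt_0_compat; lra).
      rewrite <- (ln_exp (x / (x + 1) - 1)). apply ln_le; auto.
      pose proof (exp_ineq1_le (x / (x + 1) - 1)). lra. }
    rewrite ln_div in L by lra. replace (x / (x + 1) - 1) with (- / (x + 1)) in L by (field; lra). lra. }
  pose proof (exp_ineq1_le (q * (ln (x + 1) - ln x))). 
  assert (q * / (x + 1) <= q * (ln (x + 1) - ln x)) by (apply Rmult_le_compat_l; lra). nra.
Qed.

Lemma rp_sum_tail (N n : nat) q : (1 <= N)%nat -> 0 < q ->
  rsum (fun m => rp (INR (S (N + m))) (q + 1)) n <= / q * (rp (INR N) q - rp (INR (N + n)) q).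
Proof.
  intros HN Hq. induction n as [|n IH].
  - rewrite Nat.add_0_r. simpl. lra.
  - cbn [rsum]. pose proof (rp_telescope (N + n) q ltac:(lia) Hq) as T.
    apply (Rmult_le_compat_l (/ q)) in T; [|left; apply Rinv_0_lt_compat; auto].
    rewrite <- Rmult_assoc, Rinv_l, Rmult_1_l in T by lra. replace (S (N + n)) with (N + S n)%nat in * by lia. lra.
Qed.

Lemma rp_sum_le (n : nat) q : 0 < q -> rsum (fun m => rp (INR (S m)) (q + 1)) n <= 1 + / q.
Proof.
  intros Hq. assert (Hi : 0 < / q) by (apply Rinv_0_lt_compat; auto).
  destruct n as [|n]; [simpl; lra|].
  assert (E : rsum (fun m => rp (INR (S m)) (q + 1)) (S n) = 1 + rsum (fun m => rp (INR (S (1 + m))) (q + 1)) n).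
  { induction n as [|n IH].
    - simpl. unfold rp. rewrite ln_1, Rmult_0_r, exp_0. lra.
    - change (rsum (fun m => rp (INR (S m)) (q + 1)) (S (S n))) with (rsum (fun m => rp (INR (S m)) (q + 1)) (S n) + rp (INR (S (S n))) (q + 1)).
      rewrite IH. change (rsum (fun m => rp (INR (S (1 + m))) (q + 1)) (S n)) with (rsum (fun m => rp (INR (S (1 + m))) (q + 1)) n + rp (INR (S (1 + n))) (q + 1)).
      cbn [Nat.add]. lra. }
  rewrite E. pose proof (rp_sum_tail 1 n q ltac:(lia) Hq). pose proof (rp_pos (INR (1 + n)) q).
  assert (R1 : rp (INR 1) q = 1) by (unfold rp; simpl; rewrite ln_1, Rmult_0_r, exp_0; auto).
  rewrite R1 in H. nra.
Qed.

Lemma ex_series_bounded (a : nat -> R) B : (forall n, 0 <= a n) -> (forall N, rsum a N <= B) -> ex_series a.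
Proof.
  intros H HB. apply (ex_series_equiv_0 a) || idtac.
  destruct (ex_finite_lim_seq_incr (sum_n a) B) as [l Hl].
  - intros n. rewrite sum_Sn. unfold plus; simpl. specialize (H (S n)). lra.
  - intros n. rewrite <- rsum_sum_n. apply HB.
  - exists l. exact Hl.
Qed.

Lemma ex_series_rp q : 0 < q -> ex_series (fun n => rp (INR (S n)) (q + 1)).
Proof.
  intros Hq. apply (ex_series_bounded _ (1 + / q)).
  - intros; apply Rlt_le, rp_pos.
  - intros; apply rp_sum_le; auto.
Qed.

(** ** The entire function [(s - 1) zeta s] *)

(** The j-th derivative of (al s + be) exp (- c s) by Leibniz' rule. For j = 0 the spurious [pred]
    is harmless, since its term carries the factor [INR 0]. *)
Definition Tt (al be : C) (c : R) (j : nat) (s : C) : C :=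
  (((al * s + be) * (- RtoC c) ^ j + RtoC (INR j) * al * (- RtoC c) ^ (pred j)) * cexp (- s * RtoC c))%C.

Lemma cder_lin (a b : C) z : cder (fun s => a * s + b)%C z a.
Proof.
  eapply cder_ext; [intros; reflexivity| |apply cder_plus; [apply cder_mult; [apply (cder_const a)|apply cder_id]|apply (cder_const b)]].
  cbv beta; ring.
Qed.

Lemma Tt_tower al be c : tower (Tt al be c).
Proof.
  intros j z. unfold Tt.
  assert (A : cder (fun s => (al * s + be) * (- RtoC c) ^ j + RtoC (INR j) * al * (- RtoC c) ^ (pred j))%C z (al * (- RtoC c) ^ j)).
  { eapply cder_ext; [| |apply (cder_lin (al * (- RtoC c) ^ j) (be * (- RtoC c) ^ j + RtoC (INR j) * al * (- RtoC c) ^ (pred j)))]; [intros; cbv beta; ring|reflexivity]. }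
  assert (B : cder (fun s => cexp (- s * RtoC c)) z (cexp (- z * RtoC c) * (- RtoC c))).
  { apply (cder_cexp (fun s => - s * RtoC c)%C). eapply cder_ext; [| |apply (cder_lin (- RtoC c) 0)]; [intros; cbv beta; ring|reflexivity]. }
  eapply cder_ext; [intros; reflexivity| |apply cder_mult; [exact A|exact B]].
  cbv beta. rewrite (Cpow_S _ j). simpl pred. rewrite S_INR, RtoC_plus.
  destruct j; simpl pred; [simpl INR; simpl Cpow; ring|rewrite !Cpow_S; ring].
Qed.

(* trapezoidal remainders: (s-1) times the error of the trapezoidal rule for x^(-s)
   on [n+1, n+2], and its derivatives in s *)
Definition gz (n : nat) (j : nat) (s : C) : C :=
  (Tt (RtoC (/ 2)) (- RtoC (/ 2)) (ln (INR (S n))) j s + Tt (RtoC (/ 2)) (- RtoC (/ 2)) (ln (INR (S (S n)))) j s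
   + Tt 0 (- RtoC (INR (S n))) (ln (INR (S n))) j s + Tt 0 (RtoC (INR (S (S n)))) (ln (INR (S (S n)))) j s)%C.

Lemma gz_tower n : tower (gz n).
Proof. intros j z. unfold gz. repeat apply cder_plus; apply Tt_tower. Qed.

Lemma gz_0 n s : gz n 0 s = ((s - 1) * (RtoC (/ 2) * (cp (INR (S n)) s + cp (INR (S (S n))) s))
   - RtoC (INR (S n)) * cp (INR (S n)) s + RtoC (INR (S (S n))) * cp (INR (S (S n))) s)%C.
Proof. unfold gz, Tt, cp. simpl pred. simpl (INR 0). rewrite !Cpow_S || idtac. simpl Cpow. ring. Qed.

(** The trapezoidal error is a second-order quantity, so the exponent rises from Re s to Re s + 2.
    The sum over n therefore converges for Re s > -1, and continuation past the line Re s = 1 needs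
    no functional equation. *)
Lemma gz_bound n s : -2 < Re s ->
  Cmod (gz n 0 s) <= / 2 * (Cmod (s - 1) * Cmod s * Cmod (s + 1)) * rp (INR (S n)) (Re s + 2).
Proof.
  intros Hs. rewrite gz_0. set (x := INR (S n)). assert (Hx : 1 <= x) by (apply (le_INR 1); lia).
  set (M := / 2 * (Cmod (s - 1) * Cmod s * Cmod (s + 1)) * rp x (Re s + 2)).
  set (phi := fun t : R => cp (x + t) s).
  set (phi1 := fun t : R => (- s * RtoC (/ (x + t)) * phi t)%C).
  set (phi2 := fun t : R => (s * (s + 1) * RtoC (/ (x + t) * / (x + t)) * phi t)%C).
  assert (D1 : forall t, 0 <= t -> rder phi t (phi1 t)).
  { intros t Ht. unfold phi, phi1, cp.
    assert (L : rder (fun t => - s * RtoC (ln (x + t)))%C t (- s * RtoC (/ (x + t)))%C).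
    { apply rder_scal. apply (rder_of_is_derive (fun t => ln (x + t)) (fun _ => 0) t (/ (x + t)) 0).
      - auto_derive; [lra|]. field. lra.
      - apply (is_derive_const (K := R_AbsRing) (V := R_NormedModule)). }
    eapply rder_ext; [intros; reflexivity| |apply (rder_comp cexp _ t _ _ L (cexp_cder _))]. cbv beta. unfold phi, cp. ring. }
  assert (Di : forall t, 0 <= t -> rder (fun t => RtoC (/ (x + t))) t (- RtoC (/ (x + t) * / (x + t)))%C).
  { intros t Ht. eapply rder_ext; [intros; reflexivity| |apply (rder_of_is_derive (fun t => / (x + t)) (fun _ => 0) t (- (/ (x + t) * / (x + t))) 0)].
    - rewrite <- RtoC_opp. reflexivity.
    - auto_derive; [lra|]. field. lra.
    - apply (is_derive_const (K := R_AbsRing) (V := R_NormedModule)). }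
  assert (rder_mult : forall f g t a b, rder f t a -> rder g t b -> rder (fun u => f u * g u)%C t (a * g t + f t * b)%C).
  { intros f g t a b Hf Hg.
    destruct (f t) as [f1 f2] eqn:Ef. destruct (g t) as [g1 g2] eqn:Eg. destruct a as [a1 a2], b as [b1 b2].
    pose proof (rder_Re _ _ _ Hf) as F1. pose proof (rder_Im _ _ _ Hf) as F2.
    pose proof (rder_Re _ _ _ Hg) as G1. pose proof (rder_Im _ _ _ Hg) as G2. simpl in F1, F2, G1, G2.
    eapply rder_ext; [| |apply (rder_of_is_derive (fun u => Re (f u) * Re (g u) - Im (f u) * Im (g u)) (fun u => Re (f u) * Im (g u) + Im (f u) * Re (g u)) t
      ((a1 * Re (g t) + Re (f t) * b1) - (a2 * Im (g t) + Im (f t) * b2)) ((a1 * Im (g t) + Re (f t) * b2) + (a2 * Re (g t) + Im (f t) * b1)))].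
    - intros u. reflexivity.
    - rewrite Ef, Eg. apply C_eta; simpl; ring.
    - apply (is_derive_minus (V := R_NormedModule)); apply (is_derive_mult (K := R_AbsRing)); auto; intros; apply Rmult_comm.
    - apply (is_derive_plus (V := R_NormedModule)); apply (is_derive_mult (K := R_AbsRing)); auto; intros; apply Rmult_comm. }
  assert (D2 : forall t, 0 <= t -> rder phi1 t (phi2 t)).
  { intros t Ht. eapply rder_ext; [intros; reflexivity| |apply rder_mult; [apply rder_scal, Di; auto|apply D1; auto]].
    unfold phi1, phi2. rewrite !RtoC_mult. ring. }
  (* (s - 1) times the trapezoidal error on [x, x + t]: the integral of v^(-s) times 1 - s is a
     difference of v^(1 - s), which stays meaningful at s = 1. [H] and its derivative vanish at t =
     0, so two integrations of [H2] give the bound. *)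
  set (H := fun t : R => ((s - 1) * RtoC (/ 2) * (RtoC t * (phi 0 + phi t)) + RtoC (x + t) * phi t - RtoC x * phi 0)%C).
  set (H1 := fun t : R => ((s - 1) * RtoC (/ 2) * (phi 0 - phi t + RtoC t * phi1 t))%C).
  set (H2 := fun t : R => ((s - 1) * RtoC (/ 2) * (RtoC t * phi2 t))%C).
  assert (E1 : forall t, 0 <= t -> rder H t (H1 t)).
  { intros t Ht. unfold H.
    assert (Dx : rder (fun t => RtoC (x + t)) t 1).
    { eapply rder_ext; [| |apply (rder_affine (RtoC x) 1 t)]; [intros; rewrite RtoC_plus; ring|reflexivity]. }
    eapply rder_ext; [intros; reflexivity| |].
    2:{ apply rder_plus; [apply rder_plus; [apply rder_scal; apply rder_mult; [apply rder_RtoC|apply rder_plus; [apply rder_const|apply D1; auto]]|apply rder_mult; [exact Dx|apply D1; auto]]|apply rder_const]. }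
    unfold H1, phi1. cbv beta.
    assert (X : (RtoC (x + t) * RtoC (/ (x + t)))%C = 1%C) by (rewrite <- RtoC_mult; f_equal; field; lra).
    transitivity ((s - 1) * RtoC (/ 2) * (phi 0 + phi t + RtoC t * (- s * RtoC (/ (x + t)) * phi t)) + (phi t - s * (RtoC (x + t) * RtoC (/ (x + t))) * phi t))%C; [ring|].
    rewrite X.
    replace (phi t - s * 1 * phi t)%C with (- ((s - 1) * (RtoC (/ 2) * 2)) * phi t)%C.
    - ring.
    - rewrite <- RtoC_mult. replace (/ 2 * 2) with 1 by field. ring. }
  assert (E2 : forall t, 0 <= t -> rder H1 t (H2 t)).
  { intros t Ht. unfold H1.
    assert (Dm : rder (fun u => - phi u)%C t (- phi1 t)%C).
    { eapply rder_ext; [| |apply (rder_scal (Copp 1) _ _ _ (D1 t Ht))]; [intros; cbv beta; ring|ring]. }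
    eapply rder_ext; [intros; reflexivity| |].
    2:{ apply rder_scal. apply rder_plus; [apply rder_plus; [apply rder_const|exact Dm]|apply rder_mult; [apply rder_RtoC|apply D2; auto]]. }
    unfold H2. ring. }
  assert (Cphi : forall t, 0 <= t -> ctn phi t) by (intros; eapply rder_ctn; apply D1; auto).
  assert (CR : forall t, ctn RtoC t) by (intros; eapply rder_ctn; apply rder_RtoC).
  assert (CH1 : forall t, 0 <= t -> ctn H1 t) by (intros; eapply rder_ctn; apply E2; auto).
  assert (CH2 : forall t, 0 <= t -> ctn H2 t).
  { intros t Ht. unfold H2. apply ctn_mult; [apply ctn_const|]. apply ctn_mult; [apply CR|]. unfold phi2.
    apply ctn_mult; [|auto]. apply ctn_mult; [apply ctn_const|].
    apply ctn_ext with (f := fun t => (RtoC (/ (x + t)) * RtoC (/ (x + t)))%C); [intros; rewrite RtoC_mult; auto|].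
    apply ctn_mult; eapply rder_ctn, Di; auto. }
  assert (B2 : forall t, 0 <= t <= 1 -> Cmod (H2 t) <= M).
  { intros t Ht. unfold H2, phi2, M. rewrite !Cmod_mult, !Cmod_R. unfold phi. rewrite Cmod_cp.
    rewrite (Rabs_pos_eq (/ 2)) by lra. rewrite (Rabs_pos_eq t) by lra.
    assert (Hi : 0 < / (x + t)) by (apply Rinv_0_lt_compat; lra).
    rewrite (Rabs_pos_eq (/ (x + t) * / (x + t))) by nra.
    assert (Q : / (x + t) * / (x + t) * rp (x + t) (Re s) <= rp x (Re s + 2)).
    { replace (/ (x + t) * / (x + t) * rp (x + t) (Re s)) with (rp (x + t) (Re s + 2)).
      - apply rp_le_base; lra.
      - replace (Re s + 2) with (1 + 1 + Re s) by ring. rewrite !rp_plus, !rp_1; lra. }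
    replace (Cmod (s - 1) * / 2 * (t * (Cmod s * Cmod (s + 1) * (/ (x + t) * / (x + t)) * rp (x + t) (Re s)))) with
     (/ 2 * (Cmod (s - 1) * Cmod s * Cmod (s + 1)) * (t * (/ (x + t) * / (x + t) * rp (x + t) (Re s)))) by ring.
    apply Rmult_le_compat_l.
    - repeat apply Rmult_le_pos; try apply Cmod_ge_0. lra.
    - assert (0 <= / (x + t) * / (x + t) * rp (x + t) (Re s)) by (repeat apply Rmult_le_pos; try lra; apply Rlt_le, rp_pos). nra. }
  assert (M0 : 0 <= M) by (eapply Rle_trans; [apply Cmod_ge_0|apply (B2 0); lra]).
  assert (B1 : forall t, 0 <= t <= 1 -> Cmod (H1 t) <= M).
  { intros t Ht.
    pose proof (CI_FTC H1 H2 0 t ltac:(lra) (fun u Hu => E2 u (proj1 Hu)) (fun u Hu => CH2 u (proj1 Hu))) as E.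
    assert (Z : H1 0 = 0%C) by (unfold H1; ring). rewrite Z in E. replace (H1 t - 0)%C with (H1 t) in E by ring. rewrite <- E.
    eapply Rle_trans; [apply (Cmod_CI_const _ M); [lra|intros u Hu; apply CH2; lra|intros; apply B2; lra]|]. nra. }
  pose proof (CI_FTC H H1 0 1 ltac:(lra) (fun u Hu => E1 u (proj1 Hu)) (fun u Hu => CH1 u (proj1 Hu))) as E.
  assert (Z : (H 1 - H 0)%C = ((s - 1) * (RtoC (/ 2) * (cp x s + cp (INR (S (S n))) s)) - RtoC x * cp x s + RtoC (INR (S (S n))) * cp (INR (S (S n))) s)%C).
  { unfold H, phi. replace (INR (S (S n))) with (x + 1) by (unfold x; rewrite (S_INR (S n)); auto).
    replace (x + 0) with x by ring. ring. }
  rewrite <- Z, <- E. eapply Rle_trans; [apply (Cmod_CI_const _ M); [lra|intros u Hu; apply CH1; lra|auto]|]. lra.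
Qed.

(** The part 1 + (s - 1)/2 of (s - 1) zeta(s): the integral over [1, infinity) and the endpoint term
    at 1, followed by the derivatives in s. *)
Definition Pz (j : nat) (s : C) : C :=
  match j with O => (1 + (s - 1) * RtoC (/ 2))%C | 1%nat => RtoC (/ 2) | _ => 0%C end.

(* [zf j] is the j-th derivative of (s - 1) zeta(s), which has no pole at 1. *)
Definition zf (j : nat) (s : C) : C := (Pz j s + CSeries (fun n => gz n j s))%C.

Lemma gz_bound_disc (z0 : C) : - 3 / 4 < Re z0 -> forall n z, Cmod (z - z0) < 1 / 8 ->
  Cmod (gz n 0 z) <= / 2 * ((Cmod z0 + 2) * (Cmod z0 + 2) * (Cmod z0 + 2)) * rp (INR (S n)) (1 / 8 + 1).
Proof.
  intros H0 n z Hz. pose proof (Rabs_Re_le (z - z0)) as R1.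
  replace (Re (z - z0)) with (Re z - Re z0) in R1 by (destruct z, z0; simpl; ring).
  assert (R2 : Rabs (Re z - Re z0) < 1 / 8) by lra. apply Rabs_lt_between in R2.
  eapply Rle_trans; [apply gz_bound; lra|].
  assert (C0 : Cmod z <= Cmod z0 + 1 / 8).
  { replace z with (z0 + (z - z0))%C at 1 by ring. eapply Rle_trans; [apply Cmod_triangle|lra]. }
  assert (C1 : Cmod (z - 1) <= Cmod z0 + 2) by (eapply Rle_trans; [apply Cmod_minus_le|rewrite Cmod_1; lra]).
  assert (C2 : Cmod (z + 1) <= Cmod z0 + 2) by (eapply Rle_trans; [apply Cmod_triangle|rewrite Cmod_1; lra]).
  pose proof (Cmod_ge_0 z). pose proof (Cmod_ge_0 z0). pose proof (Cmod_ge_0 (z - 1)). pose proof (Cmod_ge_0 (z + 1)).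
  apply Rmult_le_compat.
  - repeat apply Rmult_le_pos; lra.
  - apply Rlt_le, rp_pos.
  - apply Rmult_le_compat_l; [lra|]. apply Rmult_le_compat; auto; [apply Rmult_le_pos; auto|].
    apply Rmult_le_compat; auto; lra.
  - apply rp_le_exp; [apply (le_INR 1); lia|lra].
Qed.

Lemma ex_series_gz c : ex_series (fun n => c * rp (INR (S n)) (1 / 8 + 1)).
Proof. apply (ex_series_scal (V := R_NormedModule) c). apply ex_series_rp. lra. Qed.

Lemma Pz_tower : tower Pz.
Proof.
  intros [|[|j]] z; unfold Pz.
  - eapply cder_ext; [| |apply (cder_lin (RtoC (/ 2)) (1 - RtoC (/ 2)) z)]; [intros; cbv beta; ring|reflexivity].
  - apply cder_const.
  - apply cder_const.
Qed.

Theorem zf_cder j z : - 3 / 4 < Re z -> cder (zf j) z (zf (S j) z).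
Proof.
  intros H. unfold zf. apply cder_plus; [apply Pz_tower|].
  apply (series_cder gz z (1 / 8) _ gz_tower ltac:(lra) (gz_bound_disc z H)). apply ex_series_gz.
Qed.

Lemma gz_csums z : - 3 / 4 < Re z -> csums (fun n => gz n 0 z) (CSeries (fun n => gz n 0 z)).
Proof.
  intros H. apply (series_conv gz z (1 / 8) _ gz_tower ltac:(lra) (gz_bound_disc z H)).
  - apply ex_series_gz.
  - replace (z - z)%C with (RtoC 0) by ring. rewrite Cmod_0. lra.
Qed.

(** The cube comes from the factor (s - 1) s (s + 1) in [gz_bound]; any polynomial bound would serve
    the later maximum principles. *)
Lemma zf_growth z : - 1 / 2 <= Re z -> Cmod (zf 0 z) <= 3 * (Cmod z + 1) ^ 3.
Proof.
  intros H. unfold zf. eapply Rle_trans; [apply Cmod_triangle|].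
  pose proof (Cmod_ge_0 z) as Z0.
  assert (A : Cmod (Pz 0 z) <= 1 + (Cmod z + 1) / 2).
  { simpl. eapply Rle_trans; [apply Cmod_triangle|]. rewrite Cmod_1, Cmod_mult, Cmod_R, Rabs_pos_eq by lra.
    pose proof (Cmod_minus_le z 1). rewrite Cmod_1 in H0. lra. }
  set (c := / 2 * (Cmod (z - 1) * Cmod z * Cmod (z + 1))).
  assert (Hc : 0 <= c) by (unfold c; repeat apply Rmult_le_pos; try apply Cmod_ge_0; lra).
  assert (B : Cmod (CSeries (fun n => gz n 0 z)) <= c * 3).
  { apply (csums_le _ _ _ (gz_csums z ltac:(lra))). exists O. intros N _.
    eapply Rle_trans; [apply (csum_le _ (fun n => c * rp (INR (S n)) (1 / 2 + 1)))|].
    - intros n _. eapply Rle_trans; [apply gz_bound; lra|]. fold c. apply Rmult_le_compat_l; auto.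
      apply rp_le_exp; [apply (le_INR 1); lia|lra].
    - rewrite rsum_scal. apply Rmult_le_compat_l; auto. pose proof (rp_sum_le N (1 / 2) ltac:(lra)). lra. }
  assert (Dc : c <= / 2 * (Cmod z + 1) ^ 3).
  { unfold c. apply Rmult_le_compat_l; [lra|].
    pose proof (Cmod_minus_le z 1). pose proof (Cmod_triangle z 1). rewrite Cmod_1 in *.
    pose proof (Cmod_ge_0 (z - 1)). pose proof (Cmod_ge_0 (z + 1)).
    simpl. rewrite Rmult_1_r, <- Rmult_assoc. apply Rmult_le_compat; try lra; [apply Rmult_le_pos; auto|].
    apply Rmult_le_compat; lra. }
  assert (1 <= (Cmod z + 1) ^ 3) by (apply pow_R1_Rle; lra).
  assert (Cmod z + 1 <= (Cmod z + 1) ^ 3) by (simpl; nra). lra.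
Qed.

Definition zsum (N : nat) (s : C) : C := csum (fun n => cp (INR (S n)) s) N.

(** The integrals telescope and leave endpoint terms. The identity holds for every s, and so serves
    to the right of 1, at s = 1, and in the critical strip. *)
Lemma zf_partial N s : (Pz 0 s + csum (fun n => gz n 0 s) N)%C =
  ((s - 1) * zsum (S N) s - (s - 1) * RtoC (/ 2) * cp (INR (S N)) s + RtoC (INR (S N)) * cp (INR (S N)) s)%C.
Proof.
  induction N as [|N IH].
  - unfold zsum. simpl csum. simpl Pz. replace (INR 1) with 1 by reflexivity. rewrite cp_1.
    replace (RtoC 1) with (RtoC (/ 2) + RtoC (/ 2))%C at 1 by (rewrite <- RtoC_plus; f_equal; field).
    replace ((s - 1) * (0 + 1) - (s - 1) * RtoC (/ 2) * 1 + 1 * 1)%C with ((s - 1) * (1 - RtoC (/ 2)) + 1)%C by ring.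
    replace (1 - RtoC (/ 2))%C with (RtoC (/ 2)) by (rewrite <- RtoC_minus; f_equal; field).
    replace (RtoC (/ 2) + RtoC (/ 2))%C with (RtoC 1) by (rewrite <- RtoC_plus; f_equal; field). ring.
  - simpl csum. rewrite Cplus_assoc, IH, gz_0.
    change (zsum (S (S N)) s) with (zsum (S N) s + cp (INR (S (S N))) s)%C.
    assert (hh : (RtoC (/ 2) + RtoC (/ 2))%C = 1%C) by (rewrite <- RtoC_plus; f_equal; field).
    set (h := RtoC (/ 2)) in *. set (c' := cp (INR (S (S N))) s).
    replace ((s - 1) * (zsum (S N) s + c'))%C with ((s - 1) * zsum (S N) s + (s - 1) * (h + h) * c')%C by (rewrite hh; ring).
    ring.
Qed.

(** * Arithmetic of the Möbius and von Mangoldt functions *)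

(** Divisibility in terms of the standard library, so that the arithmetic identities can be used
    outside the ssreflect module; [dvE] is the bridge. *)
Definition dv (q n : nat) : bool := Nat.eqb (Nat.modulo n q) 0.

Definition mu (n : nat) : R := IZR (mobius n).

Module Arithmetic.
From mathcomp Require Import ssreflect ssrfun ssrbool eqtype ssrnat seq div prime.

(** The von Mangoldt function: n > 1 is a prime power exactly when it equals the full power of its
    least prime divisor. *)
Definition vm (n : nat) : R :=
  if [&& (1 < n)%N & n == (pdiv n ^ logn (pdiv n) n)%N] then ln (INR (pdiv n)) else 0.

Lemma dvE q n : (0 < q)%N -> dv q n = (q %| n).
Proof.
  move=> Hq. rewrite /dv. apply/idP/idP.
  - move=> /Nat.eqb_eq H. apply/dvdnP. exists (Nat.div n q).
    have Hq' : q <> 0%nat by move=> E; rewrite E in Hq.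
    have := Nat.div_mod_eq n q. rewrite H. rewrite -multE => E. rewrite {1}E. lia.
  - move=> /dvdnP [k ->]. apply/Nat.eqb_eq. rewrite -multE. apply Nat.Div0.mod_mul.
Qed.

Lemma kfreebP k n : reflect (forall p, prime p -> (p <= n)%N -> ~~ (p ^ k %| n)%N) (kfreeb k n).
Proof.
  apply: (iffP allP) => H p.
  - move=> pp pn. have := H p. rewrite mem_iota add0n ltnS leq0n pn /= => /(_ isT). by rewrite pp.
  - rewrite mem_iota add0n ltnS /= => pn. apply/negP => /andP [pp D]. by move: (H p pp pn); rewrite D.
Qed.

Lemma kfreeb_prime k n p : (0 < k)%N -> (0 < n)%N -> kfreeb k n -> prime p -> ~~ (p ^ k %| n)%N.
Proof.
  move=> k0 n0 /kfreebP H pp. case: (leqP p n) => pn; first exact: H.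
  apply/negP => D. have := dvdn_leq n0 D. rewrite leqNgt => /negP; apply.
  apply: (leq_trans pn). rewrite -{1}(expn1 p). by rewrite leq_exp2l ?prime_gt1.
Qed.

Lemma kfreeb_false k n : kfreeb k n = false -> exists2 p, prime p & (p ^ k %| n)%N.
Proof.
  move=> /negbT /allPn [p _]. rewrite negbK => /andP [pp D]. by exists p.
Qed.

Lemma mobius_mul_dvd p c : prime p -> (0 < c)%N -> (p %| c)%N -> mobius (p * c) = 0%Z.
Proof.
  move=> pp c0 D. rewrite /mobius.
  have pc0 : (0 < p * c)%N by rewrite muln_gt0 prime_gt0.
  have -> : eqn (p * c)%N 0 = false by apply/negbTE; rewrite -lt0n.
  case E: (kfreeb 2 (p * c)) => //.
  have := kfreeb_prime 2 (p * c) p isT pc0 E pp. by rewrite expnS expn1 dvdn_mul.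
Qed.

Lemma primes_mul_coprime p c : prime p -> (0 < c)%N -> ~~ (p %| c)%N -> size (primes (p * c)) = (size (primes c)).+1.
Proof.
  move=> pp c0 D.
  have E : perm_eq (primes (p * c)) (p :: primes c).
  { apply: uniq_perm; first exact: primes_uniq.
    - by rewrite /= primes_uniq andbT mem_primes pp c0 /=.
    - move=> q. rewrite in_cons primesM //; last exact: prime_gt0. by rewrite primes_prime // inE. }
  by rewrite (perm_size E).
Qed.

Lemma kfreeb2_mul p c : prime p -> (0 < c)%N -> ~~ (p %| c)%N -> kfreeb 2 (p * c) = kfreeb 2 c.
Proof.
  move=> pp c0 D. have pc0 : (0 < p * c)%N by rewrite muln_gt0 prime_gt0.
  apply/idP/idP => H.
  - apply/kfreebP => q qp qc. apply/negP => Q.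
    have := kfreeb_prime 2 (p * c) q isT pc0 H qp. by rewrite dvdn_mull.
  - apply/kfreebP => q qp qc. apply/negP => Q.
    have := kfreeb_prime 2 c q isT c0 H qp => /negP; apply.
    case: (eqVneq q p) => E.
    + subst q. move: Q. rewrite expnS expn1 dvdn_pmul2l ?prime_gt0 // => Q. by rewrite Q in D.
    + rewrite Gauss_dvdr in Q => //. apply: coprimeXl. by rewrite prime_coprime // dvdn_prime2.
Qed.

Lemma mobius_mul_ndvd p c : prime p -> (0 < c)%N -> ~~ (p %| c)%N -> mobius (p * c) = (- mobius c)%Z.
Proof.
  move=> pp c0 D. rewrite /mobius.
  have pc0 : (0 < p * c)%N by rewrite muln_gt0 prime_gt0.
  have -> : eqn (p * c)%N 0 = false by apply/negbTE; rewrite -lt0n.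
  have -> : eqn c 0 = false by apply/negbTE; rewrite -lt0n.
  rewrite kfreeb2_mul // primes_mul_coprime //=. case: (kfreeb 2 c) => //. by case: (odd _).
Qed.

Lemma mu_le1 n : Rabs (mu n) <= 1.
Proof.
  rewrite /mu /mobius. case: (eqn n 0); first by rewrite Rabs_R0; lra.
  case: (kfreeb 2 n); last by rewrite Rabs_R0; lra.
  case: (odd _).
  - rewrite Rabs_left; lra.
  - rewrite Rabs_R1; lra.
Qed.

Lemma vm_bounds n : (1 <= n)%coq_nat -> 0 <= vm n <= ln (INR n).
Proof.
  move=> Hn. rewrite /vm. have L : 0 <= ln (INR n) by apply: ln_nonneg; apply (le_INR 1).
  case: ifP => [/andP [n1 _]|_]; last lra.
  have P1 : (1 <= pdiv n)%coq_nat by apply/leP; apply: pdiv_gt0.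
  have P2 : (pdiv n <= n)%coq_nat by apply/leP; apply: pdiv_leq; apply: ltnW.
  split; first by apply: ln_nonneg; apply (le_INR 1).
  apply: ln_le; last by apply: le_INR. apply: lt_0_INR; lia.
Qed.

Lemma pdiv_ppow p j : prime p -> (0 < j)%N -> pdiv (p ^ j) = p.
Proof. move=> pp j0. case: j j0 => // j _. by rewrite pdiv_pfactor. Qed.

Lemma vm_ppow p j : prime p -> (0 < j)%N -> vm (p ^ j) = ln (INR p).
Proof.
  move=> pp j0. rewrite /vm pdiv_ppow // pfactorK // eqxx andbT.
  by rewrite -{1}(expn0 p) ltn_exp2l ?prime_gt1 // j0.
Qed.

(** Passing from m to p m creates exactly one new prime power divisor, p to the exponent of p in m
    plus one. *)
Lemma vm_step (p m d : nat) : prime p -> (0 < m)%N -> (0 < d)%N ->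
  (if dv d (p * m) then vm d else 0) =
  (if dv d m then vm d else 0) + (if Nat.eqb d (p ^ (logn p m).+1) then ln (INR p) else 0).
Proof.
  move=> pp m0 d0. rewrite !dvE //. 
  have pm0 : (0 < p * m)%N by rewrite muln_gt0 prime_gt0.
  have Eq : Nat.eqb d (p ^ (logn p m).+1) = (d == (p ^ (logn p m).+1)%N).
  { apply/idP/idP; first by move=> /Nat.eqb_eq ->. by move=> /eqP ->; apply/Nat.eqb_eq. }
  rewrite Eq. case: (boolP [&& (1 < d)%N & d == (pdiv d ^ logn (pdiv d) d)%N]) => [/andP [d1 /eqP Ed]|N].
  - set q := pdiv d in Ed. set j := logn q d in Ed.
    have qp : prime q by apply: pdiv_prime.
    have j0 : (0 < j)%N by rewrite /j logn_gt0 mem_primes qp d0 pdiv_dvd.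
    have V : vm d = ln (INR q) by rewrite Ed vm_ppow.
    rewrite V Ed !pfactor_dvdn // lognM //; last exact: prime_gt0.
    case: (eqVneq q p) => [E|E].
    + rewrite E (logn_prime p pp) eqxx add1n. rewrite eqn_exp2l ?prime_gt1 //.
      rewrite leq_eqVlt ltnS. case: eqP => [->|_] /=; first by rewrite ltnn; lra.
      by case: ifP => _; lra.
    + rewrite (logn_prime q pp) (negbTE E) add0n.
      case: eqP => [E2|_]; last by case: ifP => _; lra.
      have : (q %| p ^ (logn p m).+1)%N by rewrite -E2 -{1}(expn1 q) dvdn_exp2l.
      by rewrite Euclid_dvdX // dvdn_prime2 // (negbTE E).
  - have V : vm d = 0 by rewrite /vm (negbTE N).
    rewrite V. case: eqP => [E|_]; last by do 2 case: ifP => _; lra.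
    exfalso. move/negP: N; apply. rewrite E pdiv_ppow // pfactorK // eqxx andbT.
    by rewrite -{1}(expn0 p) ltn_exp2l ?prime_gt1.
Qed.

Lemma rsum_single (a : R) k N : (k < N)%coq_nat -> rsum (fun n => if Nat.eqb n k then a else 0) N = a.
Proof.
  move=> H. have Z : forall M, (M <= k)%coq_nat -> rsum (fun n => if Nat.eqb n k then a else 0) M = 0.
  { elim=> [|M IH] HM //=. rewrite IH; last lia. case: (Nat.eqb_spec M k); [lia|]. move=> _; lra. }
  elim: N H => [|N IH] H; first lia. simpl. case: (Nat.eqb_spec N k) => [E|E].
  - rewrite Z; [lra|lia].
  - rewrite IH; [lra|lia].
Qed.

(** Strong induction, splitting off the least prime factor: [vm_step] adds ln p on the left. The
    free bound M lets every n of a finite range share one summation range. *)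
Lemma vm_sum n M : (1 <= n)%coq_nat -> (n <= M)%coq_nat ->
  rsum (fun d => if dv (S d) n then vm (S d) else 0) M = ln (INR n).
Proof.
  move: M. have [k] := ubnP n. elim: k n => // k IH n nk M n1 nM.
  have n0 : (0 < n)%N by apply/leP.
  case: (eqVneq n 1%N) => [E|E].
  - subst n. rewrite /= ln_1. transitivity (rsum (fun _ => 0 * 0) M).
    + apply: rsum_ext => d _. rewrite dvE // dvdn1. case: eqP => [[->]|_]; [rewrite /vm /=; lra|lra].
    + rewrite rsum_scal. lra.
  - have n2 : (1 < n)%N by rewrite ltn_neqAle eq_sym E n0.
    set p := pdiv n. have pp : prime p by apply: pdiv_prime.
    have [m Em] := dvdnP (pdiv_dvd n). rewrite -/p mulnC in Em.
    have m0 : (0 < m)%N by move: n0; rewrite Em muln_gt0 => /andP [].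
    have mn : (m < n)%N by rewrite Em ltn_Pmull ?prime_gt1.
    have Hb : (p ^ (logn p m).+1 <= n)%N.
    { rewrite expnS Em leq_mul2l. apply/orP; right. apply: dvdn_leq => //. by rewrite pfactor_dvdn. }
    have IHm := IH m _ M _ _.
    transitivity (rsum (fun d => (if dv (S d) m then vm (S d) else 0) + (if Nat.eqb d (p ^ (logn p m).+1).-1 then ln (INR p) else 0)) M).
    + apply: rsum_ext => d _. rewrite Em vm_step //. f_equal.
      have P0 : (0 < p ^ (logn p m).+1)%N by rewrite expn_gt0 prime_gt0.
      case: (Nat.eqb_spec d (p ^ (logn p m).+1).-1) => [Ed|Ed]; case: (Nat.eqb_spec (S d) (p ^ (logn p m).+1)) => Ed2 //; exfalso.
      * apply: Ed2. by rewrite Ed prednK.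
      * apply: Ed. by rewrite -Ed2.
    + rewrite rsum_plus IHm.
      * rewrite rsum_single.
        -- rewrite Em -multE mult_INR ln_mult; [lra|apply: lt_0_INR; apply/ltP; exact: prime_gt0|apply: lt_0_INR; by apply/ltP].
        -- have P0 : (0 < p ^ (logn p m).+1)%N by rewrite expn_gt0 prime_gt0.
           apply/ltP. rewrite prednK //. apply: leq_trans Hb _. by apply/leP.
      * apply: leq_trans mn _. by rewrite -ltnS.
      * by apply/leP.
      * apply: Nat.le_trans nM. apply/leP. by apply: ltnW.
Qed.

Lemma rsum_multiples (F : nat -> R) p M : (0 < p)%N ->
  rsum (fun d => if dv p (S d) then F (S d) else 0) M = rsum (fun c => F (p * S c)%N) (M %/ p).
Proof.
  move=> p0. elim: M => [|M IH]; first by rewrite div0n.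
  cbn [rsum]. rewrite IH dvE //. case: (boolP (p %| M.+1)) => D.
  - rewrite divnS // D add1n. cbn [rsum]. f_equal. f_equal. 
    rewrite -{1}(divnK D) divnS // D add1n. by rewrite mulnC.
  - rewrite divnS // (negbTE D) add0n. lra.
Qed.

(** If p^k divides n, the contributions of c and p c with p not dividing c cancel, and p c with p
    dividing c has Möbius value 0. If n is k-free only d = 1 survives. *)
Lemma mobius_kfree k n M : (1 <= k)%coq_nat -> (1 <= n)%coq_nat -> (n <= M)%coq_nat ->
  rsum (fun d => if dv (expn (S d) k) n then mu (S d) else 0) M = (if kfreeb k n then 1 else 0).
Proof.
  move=> /leP k0 /leP n0 /leP nM.
  have EX : forall d, (0 < (d.+1) ^ k)%N by move=> d; rewrite expn_gt0.
  case E: (kfreeb k n).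
  - transitivity (rsum (fun d => if Nat.eqb d 0 then 1 else 0) M).
    + apply: rsum_ext => d _. rewrite dvE //. case: d => [|d] /=; first by rewrite exp1n dvd1n.
      case: ifP => // D. exfalso.
      have := kfreeb_prime k n (pdiv d.+2) k0 n0 E (pdiv_prime _) => /(_ isT) /negP; apply.
      apply: dvdn_trans D. apply: dvdn_exp2r. exact: pdiv_dvd.
    + apply: rsum_single. apply/ltP. by apply: leq_trans nM.
  - have [p pp D] := kfreeb_false _ _ E.
    have p0 := prime_gt0 pp.
    set F := fun d => if dv (expn d k) n then mu d else 0.
    transitivity (rsum (fun d => (if dv p (S d) then F (S d) else 0) + (if dv p (S d) then 0 else F (S d))) M).
    { apply: rsum_ext => d _. rewrite -/(F (S d)). case: (dv p (S d)); lra. }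
    rewrite rsum_plus (rsum_multiples F) //.
    have L : (M %/ p <= M)%N by apply: leq_div.
    have Key : forall c, (0 < c)%N -> ~~ (p %| c)%N -> (c ^ k %| n)%N -> ((p * c) ^ k %| n)%N.
    { move=> c c0 Hc Hd. rewrite expnMn. rewrite Gauss_dvd ?D ?Hd //.
      apply: coprimeXl. apply: coprimeXr. by rewrite prime_coprime. }
    (* The pairing needs the partner p c in the range. It always is: c^k | n with p not dividing c
       forces (p c)^k | n, so p c <= n <= M. *)
    have Ext : rsum (fun d => if dv p (S d) then 0 else F (S d)) M = rsum (fun d => if dv p (S d) then 0 else F (S d)) (M %/ p).
    { have Z : forall j, (M %/ p <= j)%N -> (j <= M)%N -> rsum (fun d => if dv p (S d) then 0 else F (S d)) j = rsum (fun d => if dv p (S d) then 0 else F (S d)) (M %/ p).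
      { elim=> [|j IH] H1 H2; first by move: H1; rewrite leqn0 => /eqP ->.
        case: (eqVneq (M %/ p) j.+1) => [->|N] //.
        have H3 : (M %/ p <= j)%N by rewrite -ltnS ltn_neqAle N.
        cbn [rsum]. rewrite IH //; last by apply: ltnW. rewrite dvE //.
        case: (boolP (p %| j.+1)) => Hj; first by lra.
        rewrite /F dvE //. case: ifP => Hk; last by lra.
        exfalso. have := Key j.+1 (ltn0Sn j) Hj Hk. move=> /(dvdn_leq n0) B.
        have : (p * j.+1 <= M)%N.
        { apply: leq_trans nM. apply: leq_trans B. rewrite -{1}(expn1 (p * j.+1)). by rewrite leq_pexp2l // muln_gt0 p0. }
        rewrite mulnC -leq_divRL // => B2. by move: (leq_ltn_trans H3 B2); rewrite ltnn. }
      by apply: Z. }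
    rewrite Ext -rsum_plus. transitivity (rsum (fun _ => 0 * 0) (M %/ p)); last by rewrite rsum_scal; lra.
    apply: rsum_ext => c _. rewrite (dvE p) // /F.
    case: (boolP (p %| c.+1)) => Hc.
    + rewrite /mu mobius_mul_dvd //. case: ifP => _; lra.
    + rewrite /mu mobius_mul_ndvd // opp_IZR !dvE // ?expn_gt0 ?muln_gt0 ?p0 //.
      case: (boolP (c.+1 ^ k %| n)) => H1.
      * rewrite Key //. lra.
      * case: ifP => H2; last by lra. exfalso. move/negP: H1; apply. apply: dvdn_trans H2.
        rewrite expnMn. by apply: dvdn_mull.
Qed.

Lemma expn_pow a k : expn a k = Nat.pow a k.
Proof. elim: k => [|k IH] //=. by rewrite expnS IH -multE. Qed.

Lemma kfreeb_1 n : (1 <= n)%coq_nat -> kfreeb 1 n = Nat.eqb n 1.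
Proof.
  move=> /leP n0. case: (Nat.eqb_spec n 1) => [->|N] //.
  apply/negbTE/negP => H. have n1 : (1 < n)%N by rewrite ltn_neqAle n0 andbT; apply/eqP => E; apply: N.
  have := kfreeb_prime 1 n (pdiv n) isT n0 H (pdiv_prime n1). by rewrite expn1 pdiv_dvd.
Qed.
End Arithmetic.
Import Arithmetic.

(** ** Dirichlet series *)

Lemma csum_zero N : csum (fun _ => 0%C) N = 0%C.
Proof. induction N; simpl; auto. rewrite IHN. ring. Qed.

Lemma csum_exch (A : nat -> nat -> C) N M :
  csum (fun n => csum (fun d => A n d) M) N = csum (fun d => csum (fun n => A n d) N) M.
Proof.
  induction N as [|N IH]; simpl.
  - symmetry. apply csum_zero.
  - rewrite IH, <- csum_plus. reflexivity.
Qed.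

Lemma csum_multiples q (F : nat -> C) N : (1 <= q)%nat ->
  csum (fun n => if dv q (S n) then F (S n) else 0%C) N = csum (fun m => F (q * S m)%nat) (N / q).
Proof.
  intros Hq. induction N as [|N IH]; [rewrite Nat.Div0.div_0_l; reflexivity|].
  cbn [csum]. rewrite IH. unfold dv.
  pose proof (Nat.div_mod_eq N q) as E1. pose proof (Nat.div_mod_eq (S N) q) as E2.
  pose proof (Nat.mod_upper_bound N q ltac:(lia)) as B1. pose proof (Nat.mod_upper_bound (S N) q ltac:(lia)) as B2.
  destruct (Nat.eqb_spec (S N mod q) 0) as [Z|Z].
  - rewrite Z in E2. assert (E : (S N / q = S (N / q))%nat) by nia.
    rewrite E. cbn [csum]. f_equal. f_equal. nia.
  - assert (E : (S N / q = N / q)%nat) by nia. rewrite E. ring.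
Qed.

(** Used with [qf d = d] for products of Dirichlet series and with [qf d = d^k] for k-free
    integers. *)
Lemma dirichlet_rearr (a F : nat -> C) (qf : nat -> nat) N M : (forall d, (1 <= qf (S d))%nat) ->
  csum (fun n => csum (fun d => if dv (qf (S d)) (S n) then a (S d) else 0) M * F (S n))%C N =
  csum (fun d => a (S d) * csum (fun m => F (qf (S d) * S m)%nat) (N / qf (S d)))%C M.
Proof.
  intros Hq.
  transitivity (csum (fun n => csum (fun d => a (S d) * (if dv (qf (S d)) (S n) then F (S n) else 0))%C M) N).
  - apply csum_ext. intros n _. rewrite Cmult_comm, <- csum_scal. apply csum_ext. intros d _. destruct (dv _ _); ring.
  - rewrite csum_exch. apply csum_ext. intros d _. rewrite csum_scal, csum_multiples; auto.
Qed.

Lemma rp_lim q e : 0 < q -> 0 < e -> exists N0, (1 <= N0)%nat /\ forall n, (N0 <= n)%nat -> rp (INR n) q < e.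
Proof.
  intros Hq He. set (T := exp ((Rabs (ln e) + 1) / q)).
  destruct (archimed T) as [A _]. exists (S (Z.to_nat (up T))). split; [lia|]. intros n Hn.
  assert (TP : 0 < T) by apply exp_pos.
  assert (L : T < INR n).
  { apply Rlt_le_trans with (IZR (up T)); auto. apply le_INR in Hn. rewrite S_INR, INR_IZR_INZ, Z2Nat.id in Hn; [lra|].
    apply le_IZR. lra. }
  unfold rp. rewrite <- (exp_ln e) by auto. apply exp_increasing.
  apply ln_increasing in L; auto. unfold T in L. rewrite ln_exp in L.
  apply Rlt_div_l in L; auto. pose proof (Rle_abs (- ln e)). rewrite Rabs_Ropp in H. lra.
Qed.

Definition zt (s : C) : C := (zf 0 s * / (s - 1))%C.

Lemma ex_series_rp' p : 1 < p -> ex_series (fun n => rp (INR (S n)) p).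
Proof. intros H. replace p with ((p - 1) + 1) by ring. apply ex_series_rp. lra. Qed.

Lemma INR_S_ge1 n : 1 <= INR (S n).
Proof. apply (le_INR 1). lia. Qed.

Lemma s_neq_1 s : Re s <> 1 -> (s - 1)%C <> 0%C.
Proof. intros H E. apply H. apply (f_equal Re) in E. destruct s; simpl in *. lra. Qed.

(** In [zf_partial] the endpoint terms tend to 0 for Re s > 1, which identifies the continuation
    with the Dirichlet series. *)
Lemma zsum_lim s : 1 < Re s -> csums (fun n => cp (INR (S n)) s) (zt s).
Proof.
  intros Hs.
  assert (Z : csums (fun n => cp (INR (S n)) s) (CSeries (fun n => cp (INR (S n)) s))).
  { apply csums_dom with (M := fun n => rp (INR (S n)) (Re s)); [|apply ex_series_rp'; auto].
    intros n. rewrite Cmod_cp. lra. }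
  set (L := CSeries _) in Z. replace (zt s) with L; auto.
  assert (N1 : (s - 1)%C <> 0%C) by (apply s_neq_1; lra).
  assert (E : ((s - 1) * L)%C = zf 0 s).
  { apply Ceq_minus, Cmod_eq_0. apply Rle_antisym; [|apply Cmod_ge_0]. apply le_epsilon. intros e He.
    pose proof (Cmod_ge_0 (s - 1)) as C0.
    set (k := e / (4 * (Cmod (s - 1) + 1))).
    assert (Hk : 0 < k) by (apply Rdiv_lt_0_compat; lra).
    destruct (Z k Hk) as [N1' H1]. destruct (gz_csums s ltac:(lra) k Hk) as [N2 H2].
    destruct (rp_lim (Re s - 1) k ltac:(lra) Hk) as [N3 [_ H3]].
    set (N := max N1' (max N2 N3)).
    specialize (H1 (S N) ltac:(lia)). specialize (H2 N ltac:(lia)). specialize (H3 (S N) ltac:(lia)).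
    fold (zsum (S N) s) in H1.
    pose proof (zf_partial N s) as Q.
    set (x := INR (S N)) in *. assert (Hx : 1 <= x) by apply INR_S_ge1.
    replace ((s - 1) * L - zf 0 s)%C with
      ((s - 1) * (L - zsum (S N) s) + (csum (fun n => gz n 0 s) N - CSeries (fun n => gz n 0 s))
       + (s - 1) * RtoC (/ 2) * cp x s - RtoC x * cp x s)%C.
    2:{ unfold zf. replace ((s - 1) * (L - zsum (S N) s))%C with ((s - 1) * L - (s - 1) * zsum (S N) s)%C by ring.
        replace ((s - 1) * zsum (S N) s)%C with (Pz 0 s + csum (fun n => gz n 0 s) N + (s - 1) * RtoC (/ 2) * cp x s - RtoC x * cp x s)%C by (rewrite Q; ring). ring. }
    eapply Rle_trans; [apply Cmod_minus_le|]. eapply Rle_trans; [apply Rplus_le_compat_r, Cmod_triangle|].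
    eapply Rle_trans; [apply Rplus_le_compat_r, Rplus_le_compat_r, Cmod_triangle|].
    rewrite !Cmod_mult, !Cmod_R, Cmod_cp, (Cmod_sub_comm L), (Rabs_pos_eq (/ 2)), (Rabs_pos_eq x) by lra.
    assert (R1 : rp x (Re s - 1) = x * rp x (Re s)).
    { replace (Re s - 1) with (-1 + Re s) by ring. rewrite rp_plus, rp_m1; lra. }
    pose proof (rp_pos x (Re s)).
    assert (R2 : rp x (Re s) < k) by nra.
    assert (Ke : k * (4 * (Cmod (s - 1) + 1)) = e) by (unfold k; field; lra).
    assert (Cmod (s - 1) * Cmod (zsum (S N) s - L) <= Cmod (s - 1) * k) by (apply Rmult_le_compat_l; lra).
    assert (Cmod (s - 1) * / 2 * rp x (Re s) <= Cmod (s - 1) * / 2 * k) by (apply Rmult_le_compat_l; lra).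
    rewrite Rplus_0_l. nra. }
  unfold zt. rewrite <- E. field. auto.
Qed.

Lemma csums_tail (a : nat -> C) l (N : nat) B : csums a l ->
  (forall n, Cmod (csum (fun m => a (N + m)%nat) n) <= B) -> Cmod (l - csum a N) <= B.
Proof.
  intros H HB.
  assert (E : forall n, csum a (N + n) = (csum a N + csum (fun m => a (N + m)%nat) n)%C).
  { induction n as [|n IH]; [rewrite Nat.add_0_r; simpl; ring|]. rewrite Nat.add_succ_r. simpl. rewrite IH. ring. }
  apply le_epsilon. intros e He. destruct (H e He) as [N0 HN]. specialize (HN (N + N0)%nat ltac:(lia)).
  rewrite E in HN. specialize (HB N0).
  replace (l - csum a N)%C with (csum (fun m => a (N + m)%nat) N0 - (csum a N + csum (fun m => a (N + m)%nat) N0 - l))%C by ring.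
  eapply Rle_trans; [apply Cmod_minus_le|]. lra.
Qed.

Lemma zsum_tail s N : 1 < Re s -> (1 <= N)%nat ->
  Cmod (zt s - zsum N s) <= / (Re s - 1) * rp (INR N) (Re s - 1).
Proof.
  intros Hs HN. apply csums_tail; [apply zsum_lim; auto|]. intros n.
  eapply Rle_trans; [apply (csum_le _ (fun m => rp (INR (S (N + m))) ((Re s - 1) + 1)))|].
  - intros m _. rewrite Cmod_cp. right. f_equal. ring.
  - eapply Rle_trans; [apply rp_sum_tail; auto; lra|].
    apply Rmult_le_compat_l; [left; apply Rinv_0_lt_compat; lra|]. pose proof (rp_pos (INR (N + n)) (Re s - 1)). lra.
Qed.

Lemma zt_near_1 s : 1 < Re s -> Cmod (zt s - 1) <= / (Re s - 1).
Proof.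
  intros Hs. pose proof (zsum_tail s 1 Hs ltac:(lia)) as H.
  unfold zsum in H. simpl csum in H. simpl INR in H. rewrite cp_1 in H.
  replace (0 + 1)%C with (RtoC 1) in H by ring.
  replace (rp 1 (Re s - 1)) with 1 in H by (unfold rp; rewrite ln_1, Rmult_0_r, exp_0; auto). lra.
Qed.

Lemma rsum_nonneg_le_scal N (f g : nat -> R) c : (forall n, (n < N)%nat -> f n <= c * g n) -> rsum f N <= c * rsum g N.
Proof. intros H. rewrite <- rsum_scal. apply rsum_le. auto. Qed.

(** A partial sum of the product is the sum over d of a(d) d^(-s) times a partial sum of zeta of
    length N/d. Half of the decay of that tail is traded for d^(-q), using d <= N; absolute
    convergence at the halfway exponent q + 1 then leaves an error of order N^(-q). *)
Lemma dirichlet_mul (a c : nat -> C) s B A : 1 < Re s ->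
  (forall N, rsum (fun d => Cmod (a (S d)) * rp (INR (S d)) ((Re s - 1) / 2 + 1)) N <= B) ->
  (forall n M, (1 <= n)%nat -> (n <= M)%nat -> csum (fun d => if dv (S d) n then a (S d) else 0%C) M = c n) ->
  csums (fun d => a (S d) * cp (INR (S d)) s)%C A ->
  csums (fun n => c (S n) * cp (INR (S n)) s)%C (A * zt s)%C.
Proof.
  intros Hs HB Hc HA.
  set (q := (Re s - 1) / 2) in *. assert (Hq : 0 < q) by (unfold q; lra).
  assert (B0 : 0 <= B) by (specialize (HB O); simpl in HB; lra).
  assert (Main : forall N, (1 <= N)%nat -> Cmod (csum (fun n => c (S n) * cp (INR (S n)) s)%C N - csum (fun d => a (S d) * cp (INR (S d)) s)%C N * zt s)
     <= / (Re s - 1) * rp (/ 2) (Re s - 1) * B * rp (INR N) q).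
  { intros N HN.
    rewrite (csum_ext _ (fun n => csum (fun d => if dv (S d) (S n) then a (S d) else 0) N * cp (INR (S n)) s)%C).
    2:{ intros n Hn. rewrite (Hc (S n) N); auto; lia. }
    rewrite (dirichlet_rearr a (fun n => cp (INR n) s) (fun d => d)) by (intros; lia).
    rewrite (csum_ext (fun d => a (S d) * csum (fun m => cp (INR (S d * S m)) s) (N / S d))%C
       (fun d => a (S d) * cp (INR (S d)) s * zsum (N / S d) s)%C).
    2:{ intros d Hd. unfold zsum. rewrite <- Cmult_assoc. f_equal. rewrite <- csum_scal. apply csum_ext. intros m _.
        rewrite mult_INR. apply cp_mult; apply lt_0_INR; lia. }
    replace (csum (fun d => a (S d) * cp (INR (S d)) s * zsum (N / S d) s)%C N - csum (fun d => a (S d) * cp (INR (S d)) s)%C N * zt s)%C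
      with (csum (fun d => a (S d) * cp (INR (S d)) s * (zsum (N / S d) s - zt s))%C N).
    2:{ rewrite (Cmult_comm _ (zt s)). 
        rewrite (csum_ext _ (fun d => a (S d) * cp (INR (S d)) s * zsum (N / S d) s + (- zt s) * (a (S d) * cp (INR (S d)) s))%C) by (intros; ring).
        rewrite csum_plus, csum_scal. ring. }
    eapply Rle_trans; [apply csum_le with (M := fun d => / (Re s - 1) * rp (/ 2) (Re s - 1) * rp (INR N) q * (Cmod (a (S d)) * rp (INR (S d)) (q + 1)))|].
    - intros d Hd. rewrite !Cmod_mult, Cmod_cp.
      assert (Hdiv : (1 <= N / S d)%nat) by (apply Nat.div_le_lower_bound; lia).
      rewrite Cmod_sub_comm. 
      set (x := INR (S d)). set (n := INR N). set (m := INR (N / S d)).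
      assert (Hx : 1 <= x) by apply INR_S_ge1. assert (Hm : 1 <= m) by (apply (le_INR 1); auto).
      assert (Hn : 1 <= n) by (apply (le_INR 1); auto).
      assert (Hxn : x <= n) by (apply le_INR; lia).
      (* Rounding N/d down loses at most a factor 2 because the quotient is at least 1. *)
      assert (Hmn : n * / x * / 2 <= m).
      { pose proof (Nat.div_mod_eq N (S d)). pose proof (Nat.mod_upper_bound N (S d) ltac:(lia)).
        assert (N <= S d * (2 * (N / S d)))%nat by nia. apply le_INR in H1. rewrite mult_INR, mult_INR in H1. fold x m n in H1.
        simpl (INR 2) in H1. apply (Rmult_le_reg_r x); [lra|]. replace (n * / x * / 2 * x) with (n * / 2) by (field; lra). lra. }
      assert (Hi : 0 < / x) by (apply Rinv_0_lt_compat; lra).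
      assert (T : Cmod (zt s - zsum (N / S d) s) <= / (Re s - 1) * (rp n (Re s - 1) * rp x (1 - Re s) * rp (/ 2) (Re s - 1))).
      { eapply Rle_trans; [apply zsum_tail; auto|]. apply Rmult_le_compat_l; [left; apply Rinv_0_lt_compat; lra|]. fold m.
        eapply Rle_trans; [apply (rp_le_base (n * / x * / 2) m); [apply Rmult_lt_0_compat; [apply Rmult_lt_0_compat|]; lra|auto|lra]|].
        rewrite !rp_mult by (try apply Rmult_lt_0_compat; lra).
        replace (rp (/ x) (Re s - 1)) with (rp x (1 - Re s)); [lra|]. unfold rp. rewrite ln_Rinv by lra. f_equal. ring. }
      assert (X1 : rp n (Re s - 1) = rp n q * rp n q) by (rewrite <- rp_plus; f_equal; unfold q; field).
      assert (X2 : rp n q <= rp x q) by (apply rp_le_base; lra).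
      assert (X3 : rp x (Re s) * rp x (1 - Re s) * rp x q = rp x (q + 1)).
      { rewrite <- !rp_plus. f_equal. ring. }
      assert (Hinv : 0 < / (Re s - 1)) by (apply Rinv_0_lt_compat; lra).
      pose proof (Cmod_ge_0 (a (S d))) as PA. pose proof (rp_pos x (Re s)) as P1. pose proof (rp_pos x (1 - Re s)) as P2.
      pose proof (rp_pos n q) as P3. pose proof (rp_pos (/ 2) (Re s - 1)) as P4.
      apply Rle_trans with (Cmod (a (S d)) * rp x (Re s) * (/ (Re s - 1) * (rp n q * rp x q * rp x (1 - Re s) * rp (/ 2) (Re s - 1)))).
      + apply Rmult_le_compat_l; [apply Rmult_le_pos; lra|]. eapply Rle_trans; [exact T|].
        apply Rmult_le_compat_l; [lra|]. rewrite X1. apply Rmult_le_compat_r; [lra|]. apply Rmult_le_compat_r; [lra|].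
        apply Rmult_le_compat_l; lra.
      + right. rewrite <- X3. ring.
    - rewrite rsum_scal. specialize (HB N).
      assert (0 <= / (Re s - 1) * rp (/ 2) (Re s - 1) * rp (INR N) q).
      { repeat apply Rmult_le_pos; try (apply Rlt_le, rp_pos). left; apply Rinv_0_lt_compat; lra. }
      replace (/ (Re s - 1) * rp (/ 2) (Re s - 1) * B * rp (INR N) q) with (/ (Re s - 1) * rp (/ 2) (Re s - 1) * rp (INR N) q * B) by ring.
      apply Rmult_le_compat_l; auto. }
  intros e He. set (K := / (Re s - 1) * rp (/ 2) (Re s - 1) * B) in *.
  assert (K0 : 0 <= K).
  { unfold K. repeat apply Rmult_le_pos; auto; try (apply Rlt_le, rp_pos). left; apply Rinv_0_lt_compat; lra. }
  destruct (rp_lim q (e / (2 * (K + 1))) Hq) as [N1 [N1p H1]]; [apply Rdiv_lt_0_compat; lra|].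
  pose proof (Cmod_ge_0 (zt s)) as Z0.
  destruct (HA (e / (2 * (Cmod (zt s) + 1)))) as [N2 H2]; [apply Rdiv_lt_0_compat; lra|].
  exists (max N1 N2). intros N HN. specialize (H1 N ltac:(lia)). specialize (H2 N ltac:(lia)). specialize (Main N ltac:(lia)).
  set (P := csum (fun d => a (S d) * cp (INR (S d)) s)%C N) in *. set (Q := csum (fun n => c (S n) * cp (INR (S n)) s)%C N) in *.
  replace (Q - A * zt s)%C with ((Q - P * zt s) + (P - A) * zt s)%C by ring.
  eapply Rle_lt_trans; [apply Cmod_triangle|]. rewrite (Cmod_mult (P - A)).
  apply Rlt_div_r in H1; [|lra]. apply Rlt_div_r in H2; [|lra].
  pose proof (Cmod_ge_0 (P - A)). pose proof (rp_pos (INR N) q). nra.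
Qed.

Lemma csums_indicator (z : C) (F : nat -> C) : csums (fun n => (if Nat.eqb (S n) 1 then z else 0) * F n)%C (z * F O)%C.
Proof.
  intros e He. exists 1%nat. intros N HN.
  assert (E : csum (fun n => (if Nat.eqb (S n) 1 then z else 0) * F n)%C N = (z * F O)%C).
  { destruct N as [|N]; [lia|]. clear HN. induction N as [|N IH]; [simpl; ring|].
    cbn [csum]. cbn [csum] in IH. rewrite IH. simpl. ring. }
  rewrite E. replace (z * F O - z * F O)%C with (RtoC 0) by ring. rewrite Cmod_0. auto.
Qed.

Lemma csum_RtoC f N : csum (fun n => RtoC (f n)) N = RtoC (rsum f N).
Proof. induction N; simpl; auto. rewrite IHN, RtoC_plus. reflexivity. Qed.

Lemma Cmod_mu n : Cmod (RtoC (mu n)) <= 1.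
Proof. rewrite Cmod_R. apply mu_le1. Qed.

Lemma mu_csums s : 1 < Re s -> csums (fun d => RtoC (mu (S d)) * cp (INR (S d)) s)%C (CSeries (fun d => RtoC (mu (S d)) * cp (INR (S d)) s)%C).
Proof.
  intros Hs. apply csums_dom with (M := fun n => rp (INR (S n)) (Re s)); [|apply ex_series_rp'; auto].
  intros n. rewrite Cmod_mult, Cmod_cp. pose proof (Cmod_mu (S n)). pose proof (rp_pos (INR (S n)) (Re s)). nra.
Qed.

(** The case k = 1 of [mobius_kfree]: the only 1-free integer is 1. *)
Theorem mu_zeta s : 1 < Re s -> (CSeries (fun d => RtoC (mu (S d)) * cp (INR (S d)) s) * zt s)%C = 1%C.
Proof.
  intros Hs.
  assert (H : csums (fun n => (if Nat.eqb (S n) 1 then 1 else 0) * cp (INR (S n)) s)%C (CSeries (fun d => RtoC (mu (S d)) * cp (INR (S d)) s) * zt s)%C).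
  { apply (dirichlet_mul (fun n => RtoC (mu n)) (fun n => if Nat.eqb n 1 then 1%C else 0%C) s (1 + / ((Re s - 1) / 2))); auto.
    - intros N. eapply Rle_trans; [|apply (rp_sum_le N ((Re s - 1) / 2)); lra]. apply rsum_le. intros n _.
      pose proof (Cmod_mu (S n)). pose proof (rp_pos (INR (S n)) ((Re s - 1) / 2 + 1)). nra.
    - intros n M Hn HM. pose proof (mobius_kfree 1 n M ltac:(lia) Hn HM) as Q. rewrite kfreeb_1 in Q by auto.
      rewrite <- (csum_ext (fun d => RtoC (if dv (S d) n then mu (S d) else 0))).
      + rewrite csum_RtoC. rewrite (rsum_ext _ (fun d => if dv (ssrnat.expn (S d) 1) n then mu (S d) else 0)).
        * rewrite Q. destruct (Nat.eqb n 1); reflexivity.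
        * intros d _. rewrite expn_pow, Nat.pow_1_r. reflexivity.
      + intros d _. destruct (dv _ _); reflexivity.
    - apply mu_csums; auto. }
  rewrite (csums_unique _ _ _ H (csums_indicator 1 (fun n => cp (INR (S n)) s))).
  simpl INR. rewrite cp_1. ring.
Qed.

Lemma zt_neq_0 s : 1 < Re s -> zt s <> 0%C.
Proof. intros Hs E. pose proof (mu_zeta s Hs) as H. rewrite E, Cmult_0_r in H. apply C1_nz. auto. Qed.

Lemma zf_neq_0_gt1 s : 1 < Re s -> zf 0 s <> 0%C.
Proof. intros Hs E. apply (zt_neq_0 s Hs). unfold zt. rewrite E. ring. Qed.

Lemma Cmod_dirichlet_le (b : nat -> C) s l : 1 < Re s -> (forall n, Cmod (b n) <= 1) ->
  csums (fun d => b (S d) * cp (INR (S d)) s)%C l -> Cmod l <= 1 + / (Re s - 1).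
Proof.
  intros Hs Hb Hl. apply (csums_le _ _ _ Hl). exists O. intros N _.
  eapply Rle_trans; [apply csum_le with (M := fun n => rp (INR (S n)) ((Re s - 1) + 1))|].
  - intros n _. rewrite Cmod_mult, Cmod_cp. replace (Re s - 1 + 1) with (Re s) by ring.
    pose proof (Hb (S n)). pose proof (rp_pos (INR (S n)) (Re s)). nra.
  - apply rp_sum_le. lra.
Qed.

Lemma Cmod_zt_le s : 1 < Re s -> Cmod (zt s) <= 1 + / (Re s - 1).
Proof.
  intros Hs. apply (Cmod_dirichlet_le (fun _ => 1%C) s); auto.
  - intros; rewrite Cmod_1; lra.
  - eapply csums_ext; [|apply zsum_lim; auto]. intros; simpl; ring.
Qed.

Lemma Cmod_zt_ge s : 1 < Re s -> 1 <= (1 + / (Re s - 1)) * Cmod (zt s).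
Proof.
  intros Hs. pose proof (mu_zeta s Hs) as H. apply (f_equal Cmod) in H. rewrite Cmod_mult, Cmod_1 in H.
  rewrite <- H at 1. apply Rmult_le_compat_r; [apply Cmod_ge_0|].
  apply (Cmod_dirichlet_le (fun n => RtoC (mu n)) s); auto; [intros; apply Cmod_mu|apply mu_csums; auto].
Qed.

Lemma ln_le_rp x q : 1 <= x -> 0 < q -> ln x <= / q * rp x (- q).
Proof.
  intros Hx Hq. unfold rp. replace (- - q * ln x) with (q * ln x) by ring.
  pose proof (exp_ineq1_le (q * ln x)). apply (Rmult_le_reg_l q); auto.
  rewrite <- Rmult_assoc, Rinv_r, Rmult_1_l; lra.
Qed.

Lemma ln_rp_sum N q : 0 < q -> rsum (fun d => ln (INR (S d)) * rp (INR (S d)) (q + 1)) N <= / (q / 2) * (1 + / (q / 2)).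
Proof.
  intros Hq. eapply Rle_trans; [apply rsum_nonneg_le_scal with (c := / (q / 2)) (g := fun d => rp (INR (S d)) (q / 2 + 1))|].
  - intros n _. pose proof (ln_le_rp (INR (S n)) (q / 2) (INR_S_ge1 n) ltac:(lra)) as L.
    replace (q + 1) with (q / 2 + (q / 2 + 1)) by field. rewrite (rp_plus _ (q / 2)).
    assert (E : rp (INR (S n)) (- (q / 2)) * rp (INR (S n)) (q / 2) = 1) by (rewrite <- rp_plus; replace (- (q/2) + q/2) with 0 by ring; apply rp_0).
    rewrite <- Rmult_assoc. apply Rmult_le_compat_r; [apply Rlt_le, rp_pos|].
    pose proof (rp_pos (INR (S n)) (q / 2)).
    apply Rle_trans with (/ (q / 2) * rp (INR (S n)) (- (q / 2)) * rp (INR (S n)) (q / 2)); [apply Rmult_le_compat_r; lra|].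
    rewrite Rmult_assoc, E. lra.
  - apply Rmult_le_compat_l; [left; apply Rinv_0_lt_compat; lra|]. apply rp_sum_le. lra.
Qed.

Lemma vm_abs n : Cmod (RtoC (vm (S n))) <= ln (INR (S n)).
Proof. rewrite Cmod_R. pose proof (vm_bounds (S n) ltac:(lia)). rewrite Rabs_pos_eq; lra. Qed.

Definition VS (s : C) : C := CSeries (fun d => RtoC (vm (S d)) * cp (INR (S d)) s)%C.

Lemma vm_csums s : 1 < Re s -> csums (fun d => RtoC (vm (S d)) * cp (INR (S d)) s)%C (VS s).
Proof.
  intros Hs. apply csums_dom with (M := fun n => ln (INR (S n)) * rp (INR (S n)) (Re s - 1 + 1)).
  - intros n. rewrite Cmod_mult, Cmod_cp. replace (Re s - 1 + 1) with (Re s) by ring.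
    apply Rmult_le_compat_r; [apply Rlt_le, rp_pos|apply vm_abs].
  - eapply ex_series_bounded.
    + intros n. apply Rmult_le_pos; [apply ln_nonneg, INR_S_ge1|apply Rlt_le, rp_pos].
    + intros N. apply ln_rp_sum. lra.
Qed.

Definition Dz (n j : nat) (s : C) : C := Tt 0 1 (ln (INR (S n))) j s.

Lemma Dz_0 n s : Dz n 0 s = cp (INR (S n)) s.
Proof. unfold Dz, Tt, cp. simpl. ring. Qed.

Lemma Dz_1 n s : Dz n 1 s = (- RtoC (ln (INR (S n))) * cp (INR (S n)) s)%C.
Proof. unfold Dz, Tt, cp. simpl. ring. Qed.

Lemma Dz_bound z0 : 1 < Re z0 -> forall n z, Cmod (z - z0) < (Re z0 - 1) / 2 -> Cmod (Dz n 0 z) <= rp (INR (S n)) ((Re z0 - 1) / 2 + 1).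
Proof.
  intros H n z Hz. rewrite Dz_0, Cmod_cp. apply rp_le_exp; [apply INR_S_ge1|].
  pose proof (Rabs_Re_le (z - z0)) as R1.
  replace (Re (z - z0)) with (Re z - Re z0) in R1 by (destruct z, z0; simpl; ring).
  apply Rabs_le_between in R1. lra.
Qed.

Lemma cder_ext_loc (F G : C -> C) z l d : 0 < d -> (forall w, Cmod (w - z) < d -> F w = G w) -> cder F z l -> cder G z l.
Proof.
  intros Hd E H e He. destruct (H e He) as [d1 [Hd1 Hw]]. exists (Rmin d d1). split; [apply Rmin_case; auto|].
  intros w Hlt. rewrite <- !E.
  - apply Hw. eapply Rlt_le_trans; [exact Hlt|apply Rmin_r].
  - replace (z - z)%C with (RtoC 0) by ring. rewrite Cmod_0; auto.
  - eapply Rlt_le_trans; [exact Hlt|apply Rmin_l].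
Qed.

Lemma Re_near z w d : Cmod (w - z) < d -> Re z - d < Re w < Re z + d.
Proof.
  intros H. pose proof (Rabs_Re_le (w - z)) as R1.
  replace (Re (w - z)) with (Re w - Re z) in R1 by (destruct z, w; simpl; ring).
  apply Rabs_le_between in R1. lra.
Qed.

(** Termwise differentiation gives the coefficients - ln n, and [vm_sum] recognises them as the
    Dirichlet product of von Mangoldt with 1. *)
Lemma zt_cder s : 1 < Re s -> cder zt s (- (VS s * zt s))%C.
Proof.
  intros Hs.
  assert (Hq : 0 < (Re s - 1) / 2) by lra.
  pose proof (series_cder Dz s ((Re s - 1) / 2) _ (fun n => Tt_tower _ _ _) Hq (Dz_bound s Hs) (ex_series_rp _ Hq) 0) as H.
  pose proof (series_conv Dz s ((Re s - 1) / 2) _ (fun n => Tt_tower _ _ _) Hq (Dz_bound s Hs) (ex_series_rp _ Hq) 1 s) as H1.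
  assert (Z0 : Cmod (s - s) < (Re s - 1) / 2 / 2) by (replace (s - s)%C with (RtoC 0) by ring; rewrite Cmod_0; lra).
  specialize (H1 Z0).
  assert (V : csums (fun n => RtoC (ln (INR (S n))) * cp (INR (S n)) s)%C (VS s * zt s)%C).
  { apply (dirichlet_mul (fun n => RtoC (vm n)) (fun n => RtoC (ln (INR n))) s (/ ((Re s - 1) / 2 / 2) * (1 + / ((Re s - 1) / 2 / 2)))); auto.
    - intros N. eapply Rle_trans; [|apply (ln_rp_sum N ((Re s - 1) / 2)); lra]. apply rsum_le. intros n _.
      apply Rmult_le_compat_r; [apply Rlt_le, rp_pos|apply vm_abs].
    - intros n M Hn HM. rewrite <- (vm_sum n M Hn HM), <- csum_RtoC. apply csum_ext. intros d _. destruct (dv _ _); reflexivity.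
    - apply vm_csums; auto. }
  assert (E : CSeries (fun n => Dz n 1 s) = (- (VS s * zt s))%C).
  { apply (csums_unique _ _ _ H1). replace (- (VS s * zt s))%C with (Copp 1 * (VS s * zt s))%C by ring.
    eapply csums_ext; [|apply csums_scal, V]. intros n. rewrite Dz_1. cbv beta. ring. }
  rewrite <- E.
  apply (cder_ext_loc (fun z => CSeries (fun n => Dz n 0 z)) zt s _ (Re s - 1)); [lra| |exact H].
  intros w Hw. pose proof (Re_near _ _ _ Hw).
  apply (csums_unique (fun n => cp (INR (S n)) w)); [|apply zsum_lim; lra].
  eapply csums_ext; [intros n; apply (Dz_0 n w)|].
  apply csums_dom with (M := fun n => rp (INR (S n)) (Re w)); [|apply ex_series_rp'; lra].
  intros n. rewrite Dz_0, Cmod_cp. lra.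
Qed.

Definition Ez (s : C) : C := (zf 1 s * / zf 0 s)%C.

Theorem Ez_dirichlet s : 1 < Re s -> Ez s = (/ (s - 1) - VS s)%C.
Proof.
  intros Hs.
  assert (N1 : (s - 1)%C <> 0%C) by (apply s_neq_1; lra).
  assert (H : cder (zf 0) s (zt s + (s - 1) * (- (VS s * zt s)))%C).
  { apply (cder_ext_loc (fun w => (w - 1) * zt w)%C (zf 0) s _ (Re s - 1)); [lra| |].
    - intros w Hw. pose proof (Re_near _ _ _ Hw). unfold zt. field. apply s_neq_1. lra.
    - eapply cder_ext; [intros; reflexivity| |apply cder_mult; [apply cder_minus; [apply cder_id|apply (cder_const 1)]|apply zt_cder; auto]].
      cbv beta. ring. }
  pose proof (cder_unique _ _ _ _ (zf_cder 0 s ltac:(lra)) H) as E.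
  unfold Ez. rewrite E.
  assert (Z : zf 0 s = ((s - 1) * zt s)%C) by (unfold zt; field; auto).
  rewrite Z. pose proof (zt_neq_0 s Hs). field. auto.
Qed.

(** ** Zero-free region *)

Lemma cgrad_comp (u : C -> R) (F : C -> C) z e l : cgrad u (F z) e -> cder F z l ->
  cgrad (fun w => u (F w)) z (l * e)%C.
Proof.
  intros Hu HF k Hk.
  set (A := Cmod e). set (B := Cmod l).
  assert (HA : 0 <= A) by apply Cmod_ge_0. assert (HB : 0 <= B) by apply Cmod_ge_0.
  set (q := k / (A + B + 1)).
  assert (Hq : 0 < q) by (apply Rdiv_lt_0_compat; lra).
  assert (Hqe : q * (A + B + 1) = k) by (unfold q; field; lra).
  destruct (Hu q Hq) as [d1 [Hd1 H1]].
  destruct (HF (Rmin q 1) ltac:(apply Rmin_case; lra)) as [d2 [Hd2 H2]].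
  destruct (cder_Cctn _ _ _ HF d1 Hd1) as [d3 [Hd3 H3]].
  exists (Rmin d2 d3). split; [apply Rmin_case; auto|]. intros w Hw.
  specialize (H2 w (Rlt_le_trans _ _ _ Hw (Rmin_l _ _))).
  specialize (H3 w (Rlt_le_trans _ _ _ Hw (Rmin_r _ _))).
  specialize (H1 (F w) H3).
  assert (Hk1 : Rmin q 1 <= q) by apply Rmin_l. assert (Hk2 : Rmin q 1 <= 1) by apply Rmin_r.
  pose proof (Cmod_ge_0 (w - z)) as Hz. set (m := Cmod (w - z)) in *.
  set (p := Cmod (F w - F z - (w - z) * l)) in *. assert (0 <= p) by apply Cmod_ge_0.
  assert (Q : Cmod (F w - F z) <= p + m * B).
  { replace (F w - F z)%C with ((F w - F z - (w - z) * l) + (w - z) * l)%C by ring.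
    eapply Rle_trans; [apply Cmod_triangle|]. rewrite Cmod_mult. fold p m B. lra. }
  assert (p <= q * m) by nra. assert (p <= m) by nra.
  replace (u (F w) - u (F z) - Re ((w - z) * (l * e))) with
   ((u (F w) - u (F z) - Re ((F w - F z) * e)) + Re ((F w - F z - (w - z) * l) * e))
   by (destruct (F w), (F z), w, z, l, e; simpl; ring).
  eapply Rle_trans; [apply Rabs_triang|].
  assert (Rabs (Re ((F w - F z - (w - z) * l) * e)) <= p * A).
  { eapply Rle_trans; [apply Rabs_Re_le|]. rewrite Cmod_mult. fold p A. lra. }
  rewrite <- Hqe. nra.
Qed.

Lemma cgrad_lnC (F : C -> C) z l : F z <> 0%C -> cder F z l -> cgrad (fun w => ln (Cmod (F w))) z (l * / F z)%C.
Proof. intros N H. apply (cgrad_comp (fun w => ln (Cmod w)) F); auto. apply cgrad_ln; auto. Qed.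

Lemma rder_horiz t x : rder (horiz t) x 1.
Proof. eapply rder_ext; [| |apply (horiz_rder t 0 x)]; [intros; simpl; ring|reflexivity]. Qed.

Lemma lnC_horiz (F : C -> C) (t x : R) l : F (x, t) <> 0%C -> cder F (x, t) l ->
  is_derive (fun s => ln (Cmod (F (s, t)))) x (Re (l * / F (x, t))).
Proof.
  intros N H. pose proof (cgrad_path _ (horiz t) x _ 1%C (cgrad_lnC F (x, t) l N H) (rder_horiz t x)) as K.
  rewrite Cmult_1_r in K. exact K.
Qed.

Lemma is_derive_mono (f df : R -> R) a b : a <= b -> (forall x, a <= x <= b -> is_derive f x (df x)) ->
  (forall x, a <= x <= b -> 0 <= df x) -> f a <= f b.
Proof.
  intros H Hd Hp. destruct (MVT_gen f a b df) as [c [Hc E]].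
  - rewrite Rmin_left, Rmax_right by auto. intros; apply Hd; lra.
  - rewrite Rmin_left, Rmax_right by auto. intros x Hx.
    apply continuity_pt_filterlim. apply (ex_derive_continuous (K := R_AbsRing) (V := R_NormedModule)). eexists; apply Hd; auto.
  - rewrite Rmin_left, Rmax_right in Hc by auto. specialize (Hp c Hc). nra.
Qed.

Lemma csums_Re_nonneg a l : csums a l -> (forall n, 0 <= Re (a n)) -> 0 <= Re l.
Proof.
  intros H Ha. apply Rnot_lt_le. intros L. destruct (H (- Re l) ltac:(lra)) as [N HN].
  specialize (HN N ltac:(lia)). pose proof (Rabs_Re_le (csum a N - l)) as R1.
  replace (Re (csum a N - l)) with (Re (csum a N) - Re l) in R1 by (destruct (csum a N), l; simpl; ring).
  rewrite csum_Re in R1. pose proof (rsum_nonneg (fun n => Re (a n)) N Ha). apply Rabs_le_between in R1. lra.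
Qed.

Lemma Re_cp x s t : Re (cp x (s, t)) = rp x s * cos (t * ln x).
Proof.
  unfold cp, rp, cexp. simpl. replace (- s * ln x - - t * 0) with (- s * ln x) by ring.
  replace (- s * 0 + - t * ln x) with (- (t * ln x)) by ring. rewrite cos_neg. reflexivity.
Qed.

(** Termwise from 3 + 4 cos v + cos 2v = 2 (1 + cos v)^2. *)
Lemma VS_341 s tau : 1 < s -> 0 <= Re (3 * VS (s, 0%R) + 4 * VS (s, tau) + VS (s, (2 * tau)%R))%C.
Proof.
  intros Hs. apply (csums_Re_nonneg _ _ (csums_plus _ _ _ _ (csums_plus _ _ _ _ (csums_scal 3 _ _ (vm_csums (s, 0) Hs)) (csums_scal 4 _ _ (vm_csums (s, tau) Hs))) (vm_csums (s, 2 * tau) Hs))).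
  intros n. set (x := INR (S n)). pose proof (vm_bounds (S n) ltac:(lia)) as [V _].
  assert (E : forall (c v : R) (w : C), Re (RtoC c * (RtoC v * w)) = c * v * Re w) by (intros c v w; destruct w; simpl; ring).
  assert (E1 : forall (v : R) (w : C), Re (RtoC v * w) = v * Re w) by (intros v w; destruct w; simpl; ring).
  assert (Ep : forall a b : C, Re (a + b) = Re a + Re b) by (intros [] []; reflexivity).
  rewrite !Ep, !E, E1, !Re_cp. rewrite Rmult_0_l, cos_0.
  replace (2 * tau * ln x) with (2 * (tau * ln x)) by ring. rewrite cos_2a_cos. set (c := cos (tau * ln x)).
  pose proof (rp_pos x s).
  replace (3 * vm (S n) * (rp x s * 1) + 4 * vm (S n) * (rp x s * c) + vm (S n) * (rp x s * (2 * c * c - 1))) with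
   (2 * (vm (S n) * rp x s) * ((1 + c) * (1 + c))) by ring.
  apply Rmult_le_pos; [|apply Rle_0_sqr]. apply Rmult_le_pos; [lra|]. apply Rmult_le_pos; lra.
Qed.

Definition h341 (tau s : R) : R :=
  3 * ln (Cmod (zt (s, 0))) + 4 * ln (Cmod (zt (s, tau))) + ln (Cmod (zt (s, 2 * tau))).

Lemma ln_zt_der s t : 1 < s -> is_derive (fun s => ln (Cmod (zt (s, t)))) s (- Re (VS (s, t))).
Proof.
  intros Hs. pose proof (zt_neq_0 (s, t) Hs) as N.
  pose proof (lnC_horiz zt t s _ N (zt_cder (s, t) Hs)) as H.
  replace (- Re (VS (s, t))) with (Re (- (VS (s, t) * zt (s, t)) * / zt (s, t))); auto.
  replace (- (VS (s, t) * zt (s, t)) * / zt (s, t))%C with (- VS (s, t))%C by (field; auto).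
  destruct (VS (s, t)); reflexivity.
Qed.

Lemma h341_decr tau s s' : 1 < s -> s <= s' -> h341 tau s' <= h341 tau s.
Proof.
  intros Hs H. apply Ropp_le_cancel.
  apply (is_derive_mono (fun x => - h341 tau x) (fun x => Re (3 * VS (x, 0%R) + 4 * VS (x, tau) + VS (x, (2 * tau)%R))%C)); auto.
  - intros x Hx. unfold h341.
    replace (Re (3 * VS (x, 0%R) + 4 * VS (x, tau) + VS (x, (2 * tau)%R))) with
     (- (3 * (- Re (VS (x, 0))) + 4 * (- Re (VS (x, tau))) + - Re (VS (x, 2 * tau)))).
    + apply (is_derive_opp (V := R_NormedModule)).
      apply (is_derive_plus (V := R_NormedModule)); [apply (is_derive_plus (V := R_NormedModule))|].
      * apply is_derive_scal. apply ln_zt_der; lra.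
      * apply is_derive_scal. apply ln_zt_der; lra.
      * apply ln_zt_der; lra.
    + destruct (VS (x, 0)), (VS (x, tau)), (VS (x, 2 * tau)); simpl; ring.
  - intros x Hx. apply VS_341. lra.
Qed.

(** [h341] decreases in s by [VS_341], and it tends to 0 at infinity because zeta tends to 1
    uniformly in t. *)
Lemma h341_nonneg tau s : 1 < s -> 0 <= h341 tau s.
Proof.
  intros Hs. apply le_epsilon. intros e He.
  set (eta := Rmin (1 / 4) (e / 16)). assert (He0 : 0 < eta) by (apply Rmin_case; lra).
  assert (He1 : eta <= 1 / 4) by apply Rmin_l. assert (He2 : eta <= e / 16) by apply Rmin_r.
  assert (Hi : 0 < / eta) by (apply Rinv_0_lt_compat; auto).
  set (M := s + / eta).
  assert (L : forall t, - (2 * eta) <= ln (Cmod (zt (M, t)))).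
  { intros t. pose proof (zt_near_1 (M, t) ltac:(simpl; unfold M; lra)) as Z. simpl in Z.
    assert (Z2 : / (M - 1) <= eta).
    { rewrite <- (Rinv_inv eta). apply Rinv_le_contravar; [auto|unfold M; lra]. }
    assert (1 - eta <= Cmod (zt (M, t))).
    { pose proof (Cmod_rev 1 (zt (M, t))) as R1. rewrite Cmod_1, Cmod_sub_comm in R1. lra. }
    assert (ln (1 - eta) <= ln (Cmod (zt (M, t)))) by (apply ln_le; lra).
    pose proof (ln_2nd (- eta) ltac:(rewrite Rabs_Ropp, Rabs_pos_eq; lra)) as Q. apply Rabs_le_between in Q.
    replace (1 + - eta) with (1 - eta) in Q by ring. nra. }
  pose proof (h341_decr tau s M Hs ltac:(unfold M; lra)) as D. unfold h341 in D at 1.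
  pose proof (L 0). pose proof (L tau). pose proof (L (2 * tau)). lra.
Qed.

Lemma zf_1 : zf 0 1 = 1%C.
Proof.
  assert (Z : forall N, csum (fun n => gz n 0 1) N = 0%C).
  { intros N. pose proof (zf_partial N 1) as Q.
    replace (RtoC (INR (S N)) * cp (INR (S N)) 1)%C with (RtoC 1) in Q.
    - simpl Pz in Q. replace (csum (fun n => gz n 0 1) N) with ((1 + (1 - 1) * RtoC (/ 2) + csum (fun n => gz n 0 1) N) - 1 - (1 - 1) * RtoC (/ 2))%C by ring.
      rewrite Q. ring.
    - rewrite cp_R, rp_1, <- RtoC_mult by (pose proof (INR_S_ge1 N); lra). f_equal. field. pose proof (INR_S_ge1 N); lra. }
  unfold zf. rewrite (csums_unique _ _ 0%C (gz_csums 1 ltac:(simpl; lra))); [simpl; ring|].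
  intros e He. exists O. intros N _. rewrite Z. replace (0 - 0)%C with (RtoC 0) by ring. rewrite Cmod_0; auto.
Qed.

Lemma cder_zero_bound (F : C -> C) (z l : C) : F z = 0%C -> cder F z l -> exists d, 0 < d /\ forall w, Cmod (w - z) < d -> Cmod (F w) <= (Cmod l + 1) * Cmod (w - z).
Proof.
  intros Z H. destruct (H 1 Rlt_0_1) as [d [Hd Hw]]. exists d. split; auto. intros w Hlt. specialize (Hw w Hlt).
  rewrite Z in Hw. replace (F w) with ((F w - 0 - (w - z) * l) + (w - z) * l)%C by ring.
  eapply Rle_trans; [apply Cmod_triangle|]. rewrite Cmod_mult. lra.
Qed.

(** At 1 + x the triple pole contributes (2/x)^3 and a zero at 1 + i tau would contribute (K1 x)^4,
    so the product in [h341] would be at most [KK * x] < 1, against [h341_nonneg]. The height tau =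
    0 is settled by f(1) = 1. *)
Lemma zf_neq_0_line1 tau : zf 0 (1, tau) <> 0%C.
Proof.
  intros Z. destruct (Req_dec tau 0) as [E|E].
  { rewrite E in Z. change (zf 0 (RtoC 1) = 0%C) in Z. rewrite zf_1 in Z. apply C1_nz; auto. }
  destruct (cder_zero_bound _ _ _ Z (zf_cder 0 (1, tau) ltac:(simpl; lra))) as [d [Hd B]].
  set (l := Cmod (zf 1 (1, tau)) + 1) in *. assert (Hl : 1 <= l) by (unfold l; pose proof (Cmod_ge_0 (zf 1 (1, tau))); lra).
  assert (Ht : 0 < Rabs tau) by (apply Rabs_pos_lt; auto).
  set (K1 := l / Rabs tau). assert (HK1 : 0 < K1) by (apply Rdiv_lt_0_compat; lra).
  set (K2 := 3 * (4 + 2 * Rabs tau) ^ 3 / (2 * Rabs tau)).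
  assert (HK2 : 0 < K2) by (apply Rdiv_lt_0_compat; [apply Rmult_lt_0_compat; [lra|apply pow_lt; lra]|lra]).
  set (KK := 8 * (K1 * K1 * K1 * K1) * K2).
  assert (HK4 : 0 < K1 * K1 * K1 * K1) by (repeat (apply Rmult_lt_0_compat; [|exact HK1]); exact HK1).
  assert (HKK : 0 < KK) by (unfold KK; apply Rmult_lt_0_compat; [lra|exact HK2]).
  set (x := Rmin (Rmin 1 (d / 2)) (/ (2 * KK))).
  assert (Hx : 0 < x) by (unfold x; repeat apply Rmin_case; try lra; apply Rinv_0_lt_compat; lra).
  assert (Hx1 : x <= 1) by (unfold x; eapply Rle_trans; [apply Rmin_l|apply Rmin_l]).
  assert (Hx2 : x < d) by (unfold x; eapply Rle_lt_trans; [eapply Rle_trans; [apply Rmin_l|apply Rmin_r]|lra]).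
  assert (Hx3 : KK * x <= 1 / 2).
  { apply Rle_trans with (KK * / (2 * KK)); [apply Rmult_le_compat_l; [lra|apply Rmin_r]|]. right; field; lra. }
  assert (S1 : 1 < 1 + x) by lra.
  assert (Fr : forall t, t <> 0 -> Cmod (zt (1 + x, t)) <= Cmod (zf 0 (1 + x, t)) / Rabs t).
  { intros t Hn. unfold zt.
    assert (N1 : (((1 + x)%R, t) - 1)%C <> 0%C) by (apply s_neq_1; simpl; lra).
    rewrite Cmod_mult, Cmod_inv by auto. unfold Rdiv. apply Rmult_le_compat_l; [apply Cmod_ge_0|].
    apply Rinv_le_contravar; [apply Rabs_pos_lt; auto|]. eapply Rle_trans; [|apply Rabs_Im_le]. simpl. right; f_equal; ring. }
  assert (A1 : Cmod (zt (1 + x, 0)) <= 2 / x).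
  { eapply Rle_trans; [apply Cmod_zt_le; simpl; lra|]. simpl. replace (1 + x - 1) with x by ring.
    assert (1 <= / x) by (rewrite <- Rinv_1; apply Rinv_le_contravar; lra). unfold Rdiv. lra. }
  assert (A2 : Cmod (zt (1 + x, tau)) <= K1 * x).
  { eapply Rle_trans; [apply Fr; auto|].
    assert (D : (((1 + x)%R, tau) - (1%R, tau))%C = RtoC x) by (apply C_eta; simpl; ring).
    assert (Q := B (1 + x, tau)). rewrite D, Cmod_R, Rabs_pos_eq in Q by lra. specialize (Q Hx2).
    unfold K1, Rdiv. apply Rle_trans with (l * x * / Rabs tau); [apply Rmult_le_compat_r; auto; left; apply Rinv_0_lt_compat; auto|right; ring]. }
  assert (A3 : Cmod (zt (1 + x, 2 * tau)) <= K2).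
  { eapply Rle_trans; [apply Fr; lra|]. rewrite Rabs_mult, (Rabs_pos_eq 2) by lra. unfold K2, Rdiv.
    apply Rmult_le_compat_r; [left; apply Rinv_0_lt_compat; lra|].
    eapply Rle_trans; [apply zf_growth; simpl; lra|]. apply Rmult_le_compat_l; [lra|]. apply pow_incr. split.
    - pose proof (Cmod_ge_0 (1 + x, 2 * tau)). lra.
    - pose proof (Cmod_le_abs (1 + x, 2 * tau)) as Q. simpl in Q. rewrite Rabs_mult, (Rabs_pos_eq 2), (Rabs_pos_eq (1 + x)) in Q by lra. lra. }
  assert (P : forall t, 0 < Cmod (zt (1 + x, t))) by (intros t; apply Cmod_gt_0, zt_neq_0; simpl; lra).
  pose proof (h341_nonneg tau (1 + x) S1) as H. unfold h341 in H.
  pose proof (ln_le _ _ (P 0) A1) as L1. pose proof (ln_le _ _ (P tau) A2) as L2. pose proof (ln_le _ _ (P (2 * tau)) A3) as L3.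
  assert (L : ln (KK * x) = 3 * ln (2 / x) + 4 * ln (K1 * x) + ln K2).
  { rewrite ln_div, ln_mult, ln_mult by lra. unfold KK.
    rewrite (ln_mult (8 * (K1 * K1 * K1 * K1))), (ln_mult 8) by lra.
    rewrite (ln_mult (K1 * K1 * K1) K1), (ln_mult (K1 * K1) K1), (ln_mult K1 K1) by (repeat (apply Rmult_lt_0_compat; [|exact HK1]); exact HK1).
    replace 8 with (2 * (2 * 2)) by ring. rewrite (ln_mult 2 (2 * 2)), (ln_mult 2 2) by lra. ring. }
  assert (L0 : ln (KK * x) < ln 1) by (apply ln_increasing; nra). rewrite ln_1 in L0. lra.
Qed.

(** * From zeros of (s - 1) zeta(s) to zeros of the alternating series *)

Lemma eta_term_cp s n : eta_term s n = (RtoC ((-1) ^ n) * cp (INR (S n)) s)%C.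
Proof.
  unfold eta_term, cpow, cp, cexp. f_equal. destruct s as [a b]. simpl.
  f_equal; f_equal; f_equal; ring.
Qed.

Lemma eta_partial N s : csum (eta_term s) (2 * N) = (zsum (2 * N) s - 2 * cp 2 s * zsum N s)%C.
Proof.
  induction N as [|N IH].
  - change (2 * 0)%nat with O. unfold zsum. cbn [csum]. ring.
  - replace (2 * S N)%nat with (S (S (2 * N))) by lia. unfold zsum in *. cbn [csum]. rewrite IH, !eta_term_cp.

    assert (E1 : (-1) ^ (2 * N) = 1) by (apply pow_1_even).
    assert (E2 : (-1) ^ (S (2 * N)) = -1) by (apply pow_1_odd).
    rewrite E1, E2.
    replace (INR (S (S (2 * N)))) with (2 * INR (S N)) by (rewrite !S_INR, mult_INR; simpl; ring).
    rewrite (cp_mult 2 (INR (S N))) by (pose proof (INR_S_ge1 N); lra).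
    ring.
Qed.

Lemma rp_lim_S q e : 0 < q -> 0 < e -> exists N0, forall n, (N0 <= n)%nat -> rp (INR (S n)) q < e.
Proof. intros Hq He. destruct (rp_lim q e Hq He) as [N0 [_ H]]. exists N0. intros n Hn. apply H. lia. Qed.

(* The factor [s - 1] clears the divergent term [N^(1-s)] of the partial sums, which
   cancels in the alternating series. *)
Lemma eta_of_zero s : 0 < Re s -> Re s < 1 -> zf 0 s = 0%C -> csums (eta_term s) 0%C.
Proof.
  intros H0 H1 Z.
  assert (N1 : (s - 1)%C <> 0%C) by (apply s_neq_1; lra).
  set (A := fun N => (Pz 0 s + csum (fun n => gz n 0 s) N)%C).
  assert (HA : forall e, 0 < e -> exists N0, forall N, (N0 <= N)%nat -> Cmod (A N) < e).
  { intros e He. destruct (gz_csums s ltac:(lra) e He) as [N0 HN]. exists N0. intros N Hn. specialize (HN N Hn).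
    unfold A. replace (Pz 0 s + csum (fun n => gz n 0 s) N)%C with (csum (fun n => gz n 0 s) N - CSeries (fun n => gz n 0 s) + zf 0 s)%C by (unfold zf; ring).
    rewrite Z, Cplus_0_r. auto. }
  assert (E : forall N, ((s - 1) * csum (eta_term s) (2 * S N))%C =
     (A (S (2 * N)) - 2 * cp 2 s * A N + (s - 1) * RtoC (/ 2) * (cp (INR (2 * S N)) s - 2 * cp (INR (2 * S N)) s))%C).
  { intros N. rewrite eta_partial.
    assert (Q1 : forall M, ((s - 1) * zsum (S M) s)%C = (A M + (s - 1) * RtoC (/ 2) * cp (INR (S M)) s - RtoC (INR (S M)) * cp (INR (S M)) s)%C).
    { intros M. unfold A. rewrite zf_partial. ring. }
    replace (2 * S N)%nat with (S (S (2 * N))) by lia.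
    replace ((s - 1) * (zsum (S (S (2 * N))) s - 2 * cp 2 s * zsum (S N) s))%C with ((s - 1) * zsum (S (S (2 * N))) s - 2 * cp 2 s * ((s - 1) * zsum (S N) s))%C by ring.
    rewrite !Q1. 
    replace (INR (S (S (2 * N)))) with (2 * INR (S N)) by (rewrite !S_INR, mult_INR; simpl; ring).
    rewrite (cp_mult 2 (INR (S N))) by (pose proof (INR_S_ge1 N); lra). rewrite RtoC_mult. ring. }
  assert (Ev : forall e, 0 < e -> exists N0, forall N, (N0 <= N)%nat -> Cmod (csum (eta_term s) (2 * S N)) < e).
  { intros e He. pose proof (proj1 (Cmod_gt_0 _) N1) as P1. pose proof (Cmod_ge_0 (cp 2 s)) as P2.
    set (D := Cmod (s - 1) / (4 + 2 * Cmod (cp 2 s) + Cmod (s - 1))).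
    assert (HD : 0 < D) by (apply Rdiv_lt_0_compat; lra).
    assert (ED : D * (4 + 2 * Cmod (cp 2 s) + Cmod (s - 1)) = Cmod (s - 1)) by (unfold D; field; lra).
    destruct (HA (D * e) ltac:(nra)) as [N0 HN]. destruct (rp_lim_S (Re s) (D * e) H0 ltac:(nra)) as [N2 HN2].
    exists (max N0 N2). intros N Hn.
    pose proof (HN N ltac:(lia)) as B1. pose proof (HN (S (2 * N)) ltac:(lia)) as B2. pose proof (HN2 (S (2 * N)) ltac:(lia)) as B3.
    replace (S (S (2 * N))) with (2 * S N)%nat in B3 by lia.
    apply (Rmult_lt_reg_l (Cmod (s - 1))); auto. rewrite <- Cmod_mult, E.
    eapply Rle_lt_trans; [apply Cmod_triangle|]. eapply Rle_lt_trans; [apply Rplus_le_compat_r, Cmod_minus_le|].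
    replace (cp (INR (2 * S N)) s - 2 * cp (INR (2 * S N)) s)%C with (- cp (INR (2 * S N)) s)%C by ring.
    rewrite !Cmod_mult, Cmod_opp, !Cmod_R, (Cmod_cp (INR (2 * S N))), (Rabs_pos_eq (/ 2)), (Rabs_pos_eq 2) by lra.
    pose proof (Cmod_ge_0 (A N)). pose proof (rp_pos (INR (2 * S N)) (Re s)). 
    set (c2 := Cmod (cp 2 s)) in *. set (c1 := Cmod (s - 1)) in *. set (r := rp (INR (2 * S N)) (Re s)) in *.
    assert (2 * c2 * Cmod (A N) <= 2 * c2 * (D * e)) by (apply Rmult_le_compat_l; lra).
    assert (c1 * / 2 * r <= c1 * / 2 * (D * e)) by (apply Rmult_le_compat_l; lra).
    apply Rlt_le_trans with (D * (4 + 2 * c2 + c1) * e); [|rewrite ED; lra]. assert (De : 0 < D * e) by (apply Rmult_lt_0_compat; lra).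
    assert (0 <= c1 * (D * e)) by (apply Rmult_le_pos; lra). assert (0 <= c2 * (D * e)) by (apply Rmult_le_pos; lra). lra. }
  intros e He. destruct (Ev (e / 2) ltac:(lra)) as [N0 HN]. destruct (rp_lim_S (Re s) (e / 2) H0 ltac:(lra)) as [N2 HN2].
  exists (2 * (N0 + N2) + 4)%nat. intros N Hn.
  replace (csum (eta_term s) N - 0)%C with (csum (eta_term s) N) by ring.
  destruct (Nat.Even_or_Odd N) as [[k Ek]|[k Ek]].
  - subst N. destruct k as [|k]; [lia|]. specialize (HN k ltac:(lia)). lra.
  - subst N. replace (2 * k + 1)%nat with (S (2 * k)) by lia. cbn [csum].
    destruct k as [|k]; [lia|]. specialize (HN k ltac:(lia)). specialize (HN2 (2 * S k)%nat ltac:(lia)).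
    eapply Rle_lt_trans; [apply Cmod_triangle|]. rewrite eta_term_cp, Cmod_mult, Cmod_R, Cmod_cp, pow_1_even, Rabs_R1. lra.
Qed.

Lemma is_series_csums a : csums a 0%C -> is_series a (RtoC 0).
Proof.
  intros H. apply filterlim_locally. intros e.
  destruct (H e (cond_pos e)) as [N0 HN]. exists N0. intros n Hn.
  match goal with |- context [@sum_n ?G a n] => assert (E : @sum_n G a n = csum a (S n)) end.
  { clear Hn. induction n as [|n IH]; [rewrite sum_O; simpl; ring|]. rewrite sum_Sn, IH. reflexivity. }
  rewrite E. specialize (HN (S n) ltac:(lia)).
  first [ exact HN | split;
   [ change (Rabs (fst (csum a (S n)) - fst (RtoC 0)) < e); eapply Rle_lt_trans; [|exact HN]; eapply Rle_trans; [|apply (Rabs_Re_le (csum a (S n) - RtoC 0)%C)]; right; f_equal; destruct (csum a (S n)); simpl; ring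
   | change (Rabs (snd (csum a (S n)) - snd (RtoC 0)) < e); eapply Rle_lt_trans; [|exact HN]; eapply Rle_trans; [|apply (Rabs_Im_le (csum a (S n) - RtoC 0)%C)]; right; f_equal; destruct (csum a (S n)); simpl; ring ] ].
Qed.

(** The hypothesis speaks only about the open critical strip; the half plane Re s > 1 comes from the
    Möbius series and the line Re s = 1 from the 3-4-1 inequality. *)
Theorem zf_neq_0 s : RiemannHypothesis -> 1 / 2 < Re s -> zf 0 s <> 0%C.
Proof.
  intros RH Hs Z. destruct (Rlt_le_dec 1 (Re s)) as [L|L].
  - exact (zf_neq_0_gt1 s L Z).
  - destruct (Req_dec (Re s) 1) as [E|E].
    + destruct s as [a b]. simpl in E. subst a. exact (zf_neq_0_line1 b Z).
    + assert (Q : Re s = 1 / 2).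
      (* The alternating series sums to 0 by [eta_of_zero], and 0 divided by anything is 0, even
         where 1 - 2^(1 - s) vanishes. *)
      { apply RH; [lra|]. exists (RtoC 0). split; [|unfold Cdiv; ring].
        apply is_series_csums, eta_of_zero; auto; lra. }
      lra.
Qed.

Lemma Tt_conj (a b : R) c s : Tt (RtoC a) (RtoC b) c 0 (Cconj s) = Cconj (Tt (RtoC a) (RtoC b) c 0 s).
Proof.
  unfold Tt. simpl INR. simpl Cpow.
  replace (- Cconj s * RtoC c)%C with (Cconj (- s * RtoC c)%C) by (destruct s; apply C_eta; simpl; ring).
  rewrite cexp_conj. destruct s, (cexp (- (r, r0) * RtoC c)); apply C_eta; simpl; ring.
Qed.

Lemma zf_conj s : - 3 / 4 < Re s -> zf 0 (Cconj s) = Cconj (zf 0 s).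
Proof.
  intros Hs. unfold zf.
  assert (Hs' : - 3 / 4 < Re (Cconj s)) by (destruct s; exact Hs).
  assert (G : forall n, gz n 0 (Cconj s) = Cconj (gz n 0 s)).
  { intros n. unfold gz. rewrite <- !RtoC_opp. change (RtoC 0) with (RtoC 0). rewrite !Tt_conj.
    repeat match goal with |- context [Tt ?a ?b ?c ?d s] => destruct (Tt a b c d s) end. apply C_eta; simpl; ring. }
  assert (E : CSeries (fun n => gz n 0 (Cconj s)) = Cconj (CSeries (fun n => gz n 0 s))).
  { apply (csums_unique _ _ _ (gz_csums _ Hs')). intros e He. destruct (gz_csums s Hs e He) as [N0 HN].
    exists N0. intros N Hn. specialize (HN N Hn). rewrite <- Cmod_conj in HN.
    replace (csum (fun n => gz n 0 (Cconj s)) N) with (Cconj (csum (fun n => gz n 0 s) N)).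
    - eapply Rle_lt_trans; [|exact HN]. right. f_equal.
      destruct (csum (fun n => gz n 0 s) N), (CSeries (fun n => gz n 0 s)); apply C_eta; simpl; ring.
    - clear Hn HN. induction N as [|N IH]; [apply C_eta; simpl; ring|]. cbn [csum]. rewrite <- IH, G.
      destruct (csum (fun n => gz n 0 s) N), (gz N 0 s); apply C_eta; simpl; ring. }
  rewrite E. simpl Pz. destruct (CSeries (fun n => gz n 0 s)), s; apply C_eta; simpl; ring.
Qed.

Lemma Cmod_zf_conj s : - 3 / 4 < Re s -> Cmod (zf 0 (Cconj s)) = Cmod (zf 0 s).
Proof. intros H. rewrite zf_conj by auto. apply Cmod_conj. Qed.

(** ** The logarithmic derivative to the right of the critical line *)

Definition Ez1 (s : C) : C := (zf 2 s * / zf 0 s + zf 1 s * (- (/ zf 0 s * / zf 0 s) * zf 1 s))%C.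

Lemma hol_zf j : hol (fun z => - 3 / 4 < Re z) (zf j) (zf (S j)).
Proof. intros z Hz. split; [apply zf_cder; auto|]. eapply cder_Cctn. apply zf_cder; auto. Qed.


Section RHsec.
Hypothesis RH : RiemannHypothesis.

Let RHP : C -> Prop := fun z => 1 / 2 < Re z.

Lemma hol_zf_inv : hol RHP (fun z => / zf 0 z)%C (fun z => - (/ zf 0 z * / zf 0 z) * zf 1 z)%C.
Proof.
  apply (hol_inv RHP (zf 0) (zf 1)).
  - apply (hol_sub _ (fun z => - 3 / 4 < Re z)); [unfold RHP; intros; lra|apply hol_zf].
  - intros z Hz. apply zf_neq_0; auto.
Qed.

Lemma hol_zf_R j : hol RHP (zf j) (zf (S j)).
Proof. apply (hol_sub _ (fun z => - 3 / 4 < Re z)); [unfold RHP; intros; lra|apply hol_zf]. Qed.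

Lemma hol_Ez : hol RHP Ez Ez1.
Proof. exact (hol_mult RHP _ _ _ _ (hol_zf_R 1) hol_zf_inv). Qed.

Lemma hol_Ez1 : exists E2, hol RHP Ez1 E2.
Proof.
  eexists. unfold Ez1. apply hol_plus; [apply hol_mult; [apply hol_zf_R|apply hol_zf_inv]|].
  apply hol_mult; [apply hol_zf_R|]. apply hol_mult; [|apply hol_zf_R].
  apply (hol_ext _ (fun z => Copp 1 * (/ zf 0 z * / zf 0 z))%C _ (fun z => - (/ zf 0 z * / zf 0 z))%C); [intros; ring|].
  apply hol_mult; [apply hol_const|apply hol_mult; apply hol_zf_inv].
Qed.

Lemma disc_RHP a t rho z : rho <= a -> Cmod (z - (1 / 2 + a, t)) < rho -> RHP z.
Proof.
  intros H Hz. pose proof (Re_near _ _ _ Hz) as Q. simpl in Q. unfold RHP. lra.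
Qed.

(** [borel_caratheodory] wants a radius strictly smaller than that of the disc of holomorphy. The
    discs used below touch the critical line, and the full radius a is reached in the limit. *)
Lemma le_radius (X V a : R) : 0 < a -> 0 <= X -> (forall r, 0 < r < a -> X <= 2 / r * V) -> X <= 2 / a * V.
Proof.
  intros Ha HX H. 
  assert (K : X * a <= 2 * V).
  { apply le_epsilon. intros e He.
    set (k := Rmin (a / 2) (e / (X + 1))).
    assert (0 < k) by (apply Rmin_case; [lra|apply Rdiv_lt_0_compat; lra]).
    assert (K1 : k <= a / 2) by apply Rmin_l. assert (K2 : k <= e / (X + 1)) by apply Rmin_r.
    apply Rle_div_r in K2; [|lra].
    specialize (H (a - k) ltac:(lra)). apply (Rmult_le_compat_r (a - k)) in H; [|lra].
    replace (2 / (a - k) * V * (a - k)) with (2 * V) in H by (field; lra). nra. }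
  apply (Rmult_le_reg_r a); auto. replace (2 / a * V * a) with (2 * V) by (field; lra). auto.
Qed.

(** Logarithm of an upper bound for |f| on discs of radius at most 1 at height t: a fourth factor
    |t| + 5 absorbs the constant 3 of the cubic bound. *)
Definition Bd (t : R) : R := 4 * ln (Rabs t + 5).

Lemma ln5_ge1 t : 1 <= ln (Rabs t + 5).
Proof.
  rewrite <- (ln_exp 1). apply ln_le; [apply exp_pos|]. pose proof exp_le_3. pose proof (Rabs_pos t). lra.
Qed.

Lemma zf_le_Bd a t z : 0 < a <= 1 -> Cmod (z - (1 / 2 + a, t)) <= a -> 1 / 2 < Re z -> ln (Cmod (zf 0 z)) <= Bd t.
Proof.
  intros Ha Hz Hr. unfold Bd. pose proof (Rabs_pos t).
  replace (4 * ln (Rabs t + 5)) with (ln (Rabs t + 5) + 3 * ln (Rabs t + 5)) by ring.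
  assert (G : Cmod (zf 0 z) <= (Rabs t + 5) * (Rabs t + 5) ^ 3).
  { eapply Rle_trans; [apply zf_growth; lra|]. apply Rmult_le_compat; try lra.
    - apply pow_le. pose proof (Cmod_ge_0 z). lra.
    - apply pow_incr. split; [pose proof (Cmod_ge_0 z); lra|].
      replace z with ((z - cc (1 / 2 + a) t) + cc (1 / 2 + a) t)%C by ring.
      pose proof (Cmod_triangle (z - (1 / 2 + a, t)) (1 / 2 + a, t)).
      pose proof (Cmod_le_abs (1 / 2 + a, t)) as Q. simpl in Q. rewrite (Rabs_pos_eq (1 / 2 + a)) in Q by lra. lra. }
  assert (L : ln (Cmod (zf 0 z)) <= ln ((Rabs t + 5) * (Rabs t + 5) ^ 3)).
  { apply ln_le; auto. apply Cmod_gt_0, zf_neq_0; auto. }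
  rewrite ln_mult in L by (try apply pow_lt; lra). rewrite ln_pow in L by lra. simpl INR in L. lra.
Qed.

(** Borel-Caratheodory for ln |f| in the disc of radius a, the largest about 1/2 + a + i t on which
    the hypothesis excludes zeros. *)
Lemma Ez_le_V a t : 0 < a <= 1 -> Cmod (Ez (1 / 2 + a, t)) <= 2 / a * (Bd t - ln (Cmod (zf 0 (1 / 2 + a, t)))).
Proof.
  intros Ha. apply le_radius; [lra|apply Cmod_ge_0|]. intros r Hr.
  apply (borel_caratheodory (fun w => ln (Cmod (zf 0 w))) Ez Ez1 (1 / 2 + a, t) a); auto.
  - apply (hol_sub _ RHP); [|apply hol_Ez]. intros z Hz. apply (disc_RHP a t a z); auto; lra.
  - intros z Hz. apply (cgrad_lnC (zf 0) z (zf 1 z)).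
    + apply zf_neq_0; auto. apply (disc_RHP a t a z); auto; lra.
    + apply zf_cder. pose proof (disc_RHP a t a z ltac:(lra) Hz) as Q. unfold RHP in Q. lra.
  - intros z Hz. apply (zf_le_Bd a t z); auto; [lra|]. apply (disc_RHP a t a z); lra.
Qed.

Lemma ln_zf_der a t : 0 < a -> is_derive (fun a => ln (Cmod (zf 0 (1 / 2 + a, t)))) a (Re (Ez (1 / 2 + a, t))).
Proof.
  intros Ha.
  assert (N : zf 0 (1 / 2 + a, t) <> 0%C) by (apply zf_neq_0; simpl; auto; lra).
  pose proof (lnC_horiz (zf 0) t (1 / 2 + a) (zf 1 (1 / 2 + a, t)) N (zf_cder 0 (1 / 2 + a, t) ltac:(simpl; lra))) as H.
  pose proof (is_derive_comp (fun s => ln (Cmod (zf 0 (s, t)))) (fun a => 1 / 2 + a) a _ 1 H) as K.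
  unfold Ez. replace (Re (zf 1 (1 / 2 + a, t) * / zf 0 (1 / 2 + a, t))) with (scal 1 (Re (zf 1 (1 / 2 + a, t) * / zf 0 (1 / 2 + a, t)))).
  - apply K. auto_derive; auto; ring.
  - unfold scal; simpl; unfold mult; simpl. ring.
Qed.

Lemma zf_low_32 z : 3 / 2 <= Re z -> Cmod (z - 1) <= 3 * Cmod (zf 0 z).
Proof.
  intros H. pose proof (Cmod_zt_ge z ltac:(lra)) as Q. unfold zt in Q.
  assert (N1 : (z - 1)%C <> 0%C) by (apply s_neq_1; lra).
  rewrite Cmod_mult, Cmod_inv in Q by auto. pose proof (proj1 (Cmod_gt_0 _) N1) as P.
  assert (I : / (Re z - 1) <= 2) by (replace 2 with (/ (1 / 2)) by field; apply Rinv_le_contravar; lra).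
  pose proof (Cmod_ge_0 (zf 0 z)) as G. assert (Hi : 0 < / Cmod (z - 1)) by (apply Rinv_0_lt_compat; auto).
  assert (0 <= Cmod (zf 0 z) * / Cmod (z - 1)) by (apply Rmult_le_pos; lra).
  assert (Q2 : 1 <= 3 * (Cmod (zf 0 z) * / Cmod (z - 1))) by nra.
  apply (Rmult_le_compat_r (Cmod (z - 1))) in Q2; [|lra].
  replace (3 * (Cmod (zf 0 z) * / Cmod (z - 1)) * Cmod (z - 1)) with (3 * Cmod (zf 0 z)) in Q2 by (field; lra). lra.
Qed.

Lemma ln_inv_zf_low z : 3 / 2 <= Re z -> - ln (Cmod (zf 0 z)) <= 2.
Proof.
  intros H. pose proof (zf_low_32 z H) as Q.
  assert (1 / 2 <= Cmod (z - 1)).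
  { eapply Rle_trans; [|apply Rabs_Re_le]. rewrite Rabs_pos_eq; destruct z; simpl in *; lra. }
  assert (1 / 6 <= Cmod (zf 0 z)) by lra.
  assert (L : ln (1 / 6) <= ln (Cmod (zf 0 z))) by (apply ln_le; lra).
  assert (L6 : ln 6 <= 2).
  { rewrite <- (ln_exp 2). apply ln_le; [lra|]. replace 2 with (1 + 1) by ring. rewrite exp_plus.
    assert (E : 2.5 <= exp 1).
    { pose proof (exp_ineq1_le (1/2)). replace 1 with (1/2+1/2) by field. rewrite exp_plus. 
      pose proof (exp_ineq1_le (1/4)). assert (exp (1/2) = exp (1/4) * exp (1/4)) by (rewrite <- exp_plus; f_equal; field). 
      pose proof (exp_ineq1_le (1/8)). assert (exp (1/4) = exp (1/8) * exp (1/8)) by (rewrite <- exp_plus; f_equal; field).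
      assert (81/64 <= exp (1/4)) by nra. assert (1.6 <= exp (1/2)) by nra. nra. }
    nra. }
  replace (ln (1 / 6)) with (- ln 6) in L; [lra|]. rewrite <- ln_Rinv by lra. f_equal. field.
Qed.

(** [Ez_le_V] is the differential inequality V' >= - 2 V / a for the left side V(a), so a^2 V(a)
    increases. At a = 1 the abscissa is 3/2, where the Möbius series bounds 1/|f|. *)
Lemma ln_inv_zf a t : 0 < a <= 1 -> Bd t - ln (Cmod (zf 0 (1 / 2 + a, t))) <= 6 * ln (Rabs t + 5) / a ^ 2.
Proof.
  intros Ha. set (V := fun a => Bd t - ln (Cmod (zf 0 (1 / 2 + a, t)))).
  change (V a <= 6 * ln (Rabs t + 5) / a ^ 2).
  assert (M : a ^ 2 * V a <= 1 ^ 2 * V 1).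
  { apply (is_derive_mono (fun a => a ^ 2 * V a) (fun a => 2 * a * V a + a ^ 2 * (- Re (Ez (1 / 2 + a, t))))); [lra| |].
    - intros x Hx. apply (is_derive_mult (K := R_AbsRing) (fun a => a ^ 2) V).
      + auto_derive; auto. ring.
      + unfold V. pose proof (is_derive_minus (V := R_NormedModule) (fun _ => Bd t) _ x _ _ (is_derive_const (K := R_AbsRing) (V := R_NormedModule) (Bd t) x) (ln_zf_der x t ltac:(lra))) as K.
        eapply is_derive_ext; [|replace (- Re (Ez (1 / 2 + x, t))) with (minus zero (Re (Ez (1 / 2 + x, t))))]; [intros; reflexivity|exact K|].
        unfold minus, plus, opp, zero; simpl. ring.
      + intros; apply Rmult_comm.
    - intros x Hx. pose proof (Ez_le_V x t ltac:(lra)) as Q. fold (V x) in Q.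
      pose proof (Re_le_Cmod (Ez (1 / 2 + x, t))).
      assert (x ^ 2 * Re (Ez (1 / 2 + x, t)) <= x ^ 2 * (2 / x * V x)) by (apply Rmult_le_compat_l; [nra|lra]).
      replace (x ^ 2 * (2 / x * V x)) with (2 * x * V x) in H0 by (field; lra). lra. }
  apply Rle_div_r; [apply pow_lt; lra|]. rewrite Rmult_comm. eapply Rle_trans; [exact M|].
  unfold V. pose proof (ln_inv_zf_low (1 / 2 + 1, t) ltac:(simpl; lra)). unfold Bd. pose proof (ln5_ge1 t). lra.
Qed.

Lemma VS_bound s : 3 / 2 <= Re s -> Cmod (VS s) <= 20.
Proof.
  intros H. apply (csums_le _ _ _ (vm_csums s ltac:(lra))). exists O. intros N _.
  eapply Rle_trans; [apply csum_le with (M := fun n => ln (INR (S n)) * rp (INR (S n)) (1 / 2 + 1))|].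
  - intros n _. rewrite Cmod_mult, Cmod_cp. apply Rmult_le_compat; [apply Cmod_ge_0|apply Rlt_le, rp_pos|apply vm_abs|].
    apply rp_le_exp; [apply INR_S_ge1|lra].
  - eapply Rle_trans; [apply ln_rp_sum; lra|]. right. field.
Qed.

(** A bound logarithmic in the height but with a bad power of a. It starts the iteration, provides
    the growth condition of the maximum principle, and settles small heights. *)
Lemma Ez_crude a z : 0 < a <= 1 -> 1 / 2 + a <= Re z -> Cmod (Ez z) <= 22 * ln (Rabs (Im z) + 5) / a ^ 3.
Proof.
  intros Ha Hz. pose proof (ln5_ge1 (Im z)) as L. assert (A3 : 0 < a ^ 3) by (apply pow_lt; lra).
  destruct (Rle_lt_dec (Re z) (3 / 2)) as [H|H].
  - set (a' := Re z - 1 / 2). destruct z as [x y]; simpl in *.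
    replace x with (1 / 2 + a') by (unfold a'; ring).
    eapply Rle_trans; [apply Ez_le_V; unfold a'; lra|].
    assert (Ha' : 0 < a') by (unfold a'; lra).
    apply Rle_trans with (2 / a' * (6 * ln (Rabs y + 5) / a' ^ 2)).
    + apply Rmult_le_compat_l; [apply Rlt_le, Rdiv_lt_0_compat; lra|]. apply ln_inv_zf. unfold a'; lra.
    + replace (2 / a' * (6 * ln (Rabs y + 5) / a' ^ 2)) with (12 * ln (Rabs y + 5) / a' ^ 3) by (field; lra).
      apply Rle_trans with (12 * ln (Rabs y + 5) / a ^ 3).
      * unfold Rdiv. apply Rmult_le_compat_l; [lra|]. apply Rinv_le_contravar; auto. apply pow_incr. unfold a'; lra.
      * unfold Rdiv. apply Rmult_le_compat_r; [left; apply Rinv_0_lt_compat; auto|]. lra.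
  - rewrite Ez_dirichlet by lra. eapply Rle_trans; [apply Cmod_minus_le|].
    assert (N1 : (z - 1)%C <> 0%C) by (apply s_neq_1; lra).
    rewrite Cmod_inv by auto. pose proof (VS_bound z ltac:(lra)).
    assert (Q : 1 / 2 <= Cmod (z - 1)).
    { eapply Rle_trans; [|apply Rabs_Re_le]. rewrite Rabs_pos_eq; destruct z; simpl in *; lra. }
    assert (/ Cmod (z - 1) <= 2) by (replace 2 with (/ (1 / 2)) by field; apply Rinv_le_contravar; lra).
    apply Rle_trans with (22 * ln (Rabs (Im z) + 5)); [lra|].
    apply (proj1 (Rle_div_r _ _ _ A3)). assert (a ^ 3 <= 1) by (rewrite <- (pow1 3); apply pow_incr; lra). 
    assert (0 <= 22 * ln (Rabs (Im z) + 5)) by lra. nra.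
Qed.

Lemma inv_zf_crude a z : 0 < a <= 1 -> 1 / 2 + a <= Re z -> - ln (Cmod (zf 0 z)) <= 6 * ln (Rabs (Im z) + 5) / a ^ 2.
Proof.
  intros Ha Hz. pose proof (ln5_ge1 (Im z)) as L. assert (A2 : 0 < a ^ 2) by (apply pow_lt; lra).
  destruct (Rle_lt_dec (Re z) (3 / 2)) as [H|H].
  - set (a' := Re z - 1 / 2). destruct z as [x y]; simpl Re in *; simpl Im in *.
    replace x with (1 / 2 + a') by (unfold a'; ring).
    pose proof (ln_inv_zf a' y ltac:(unfold a'; lra)) as Q. unfold Bd in Q.
    apply Rle_trans with (6 * ln (Rabs y + 5) / a' ^ 2); [lra|].
    unfold Rdiv. apply Rmult_le_compat_l; [lra|]. apply Rinv_le_contravar; auto. apply pow_incr. unfold a'; lra.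
  - pose proof (ln_inv_zf_low z ltac:(lra)). apply Rle_trans with (6 * ln (Rabs (Im z) + 5)); [lra|].
    apply (proj1 (Rle_div_r _ _ _ A2)). assert (a ^ 2 <= 1) by (rewrite <- (pow1 2); apply pow_incr; lra). nra.
Qed.

(** ** Positivity of [Re (zeta'/zeta)] up to a logarithm *)

Lemma deriv_sign (phi : R -> R) l d : 0 < d -> phi 0 = 0 -> (forall a, 0 < a < d -> 0 <= phi a) ->
  is_derive phi 0 l -> 0 <= l.
Proof.
  intros Hd H0 Hp HD. apply Rnot_lt_le. intros L.
  apply is_derive_Reals in HD. destruct (HD (- l / 2) ltac:(lra)) as [d1 H1].
  set (h := Rmin (d / 2) (d1 / 2)).
  assert (Hh : 0 < h) by (apply Rmin_case; [lra|pose proof (cond_pos d1); lra]).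
  assert (Hh1 : h <= d / 2) by apply Rmin_l. assert (Hh2 : h <= d1 / 2) by apply Rmin_r.
  pose proof (cond_pos d1).
  specialize (H1 h ltac:(lra) ltac:(rewrite Rabs_pos_eq; lra)). rewrite Rplus_0_l, H0, Rminus_0_r in H1.
  specialize (Hp h ltac:(lra)). apply Rabs_lt_between in H1.
  assert (0 <= phi h / h) by (apply Rdiv_le_0_compat; auto). lra.
Qed.

(* The zeros are handled by reflecting in the line [Re s = be], on which zeta has no
   zero: there |zeta (2 be - s) / zeta s| = 1 by complex conjugation, and the maximum
   principle bounds the quotient inside a strip.  No functional equation is used. *)
Lemma reflection be t0 a : 1 / 2 < be <= 5 / 2 -> 0 < a < 1 ->
  Cmod (zf 0 (be - a, t0)) <= exp ((2 * ln (Rabs t0 + 5) + 7) * a) * Cmod (zf 0 (be + a, t0)).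
Proof.
  intros Hb Ha. pose proof (Rabs_pos t0) as T0.
  set (A := 2 * ln (Rabs t0 + 5) + 7).
  set (ep := Rmin (1 / 8) ((be - 1 / 2) / 2)).
  assert (Hep : 0 < ep) by (apply Rmin_case; lra).
  assert (Hep1 : ep <= 1 / 8) by apply Rmin_l. assert (Hep2 : ep <= (be - 1 / 2) / 2) by apply Rmin_r.
  set (Dm := fun z : C => 0 - ep < Re z < 1 + ep).
  (* At z = a the quotient compares the abscissae be - a and be + a up to conjugation. The Gaussian
     exp (z^2) kills the growth in vertical direction, and exp (- A z) lowers the right edge below
     1. *)
  set (F := fun z => (zf 0 (cc be (- t0) + Copp 1 * z) * / zf 0 (cc be t0 + 1 * z) * cexp (- RtoC A * z + z * z))%C).
  assert (HF : exists F', hol Dm F F').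
  { eexists. unfold F. apply hol_mult; [apply hol_mult|].
    - apply (hol_comp_affine Dm (fun z => - 3 / 4 < Re z) (zf 0) (zf 1)); [apply hol_zf|].
      intros z Hz. unfold Dm in Hz. destruct z; simpl in *. lra.
    - apply (hol_comp_affine Dm RHP (fun z => / zf 0 z)%C (fun z => - (/ zf 0 z * / zf 0 z) * zf 1 z)%C); [apply hol_zf_inv|].
      intros z Hz. unfold Dm, RHP in *. destruct z; simpl in *. lra.
    - apply hol_cexp. apply hol_plus; [apply hol_mult; [apply hol_const|apply hol_id]|apply hol_mult; apply hol_id]. }
  destruct HF as [F' HF].
  assert (CF : forall z, Cmod (F z) = Cmod (zf 0 (cc be (- t0) + Copp 1 * z)) * Cmod (/ zf 0 (cc be t0 + 1 * z)) * exp (- A * Re z + (Re z * Re z - Im z * Im z))).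
  { intros z. unfold F. rewrite !Cmod_mult, Cmod_cexp. do 2 f_equal. destruct z; simpl; ring. }
  set (eta := Rmin 1 (be - 1 / 2)).
  assert (He : 0 < eta <= 1) by (split; [apply Rmin_case; lra|apply Rmin_l]).
  assert (He2 : eta <= be - 1 / 2) by apply Rmin_r.
  (* The numerator grows with exponent 3, the inverse of the denominator with exponent 6 / eta^2.
     The height V of the box is chosen so that V^2 exceeds K (|t0| + V + 5) + 3. *)
  set (K := 3 + 6 / eta ^ 2). 
  assert (HK0 : 0 < 6 / eta ^ 2) by (apply Rdiv_lt_0_compat; [lra|apply pow_lt; lra]).
  set (V := K + (Rabs t0 + 5) + 3).
  assert (HV : 3 < V) by (unfold V, K; lra).
  assert (Low : forall z, 0 <= Re z <= 1 -> zf 0 (cc be t0 + 1 * z) <> 0%C).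
  { intros z Hz. apply zf_neq_0; auto. destruct z; simpl in *. lra. }
  assert (Top : forall z, 0 <= Re z <= 1 -> Rabs (Im z) = V -> Cmod (F z) <= 1).
  { intros z Hz Iz. rewrite CF, Cmod_inv by (apply Low; auto).
    set (X := Rabs t0 + V + 5). assert (HX : 8 < X) by (unfold X; lra).
    assert (B1 : Cmod (zf 0 (cc be (- t0) + Copp 1 * z)) <= exp 2 * exp (3 * ln X)).
    { eapply Rle_trans; [apply zf_growth; destruct z; simpl in *; lra|]. apply Rmult_le_compat; try lra.
      - apply pow_le. pose proof (Cmod_ge_0 (cc be (- t0) + Copp 1 * z)). lra.
      - pose proof (exp_ineq1_le 2). lra.
      - replace (exp (3 * ln X)) with (X ^ 3).
        + apply pow_incr. split; [pose proof (Cmod_ge_0 (cc be (- t0) + Copp 1 * z)); lra|].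
          eapply Rle_trans; [apply Rplus_le_compat_r, Cmod_le_abs|].
          destruct z as [x y]; simpl in *. unfold X. rewrite <- Iz.
          replace (be + (- (1) * x - - 0 * y)) with (be - x) by ring.
          replace (- t0 + (- (1) * y + - 0 * x)) with (- (t0 + y)) by ring. rewrite Rabs_Ropp.
          pose proof (Rabs_triang t0 y). assert (Rabs (be - x) <= 5 / 2) by (apply Rabs_le; lra). lra.
        + replace 3 with (INR 3) by (simpl; ring). rewrite <- ln_pow by lra. rewrite exp_ln; auto. apply pow_lt; lra. }
    assert (B2 : / Cmod (zf 0 (cc be t0 + 1 * z)) <= exp (6 / eta ^ 2 * ln X)).
    { pose proof (proj1 (Cmod_gt_0 _) (Low z Hz)) as P. rewrite <- (exp_ln (/ _)) by (apply Rinv_0_lt_compat; auto).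
      apply exp_le. rewrite ln_Rinv by auto.
      eapply Rle_trans; [apply (inv_zf_crude eta); [lra|destruct z; simpl in *; lra]|].
      unfold Rdiv. rewrite (Rmult_assoc 6 _ (/ _)), (Rmult_comm (ln _) (/ _)), <- Rmult_assoc.
      apply Rmult_le_compat_l; [unfold Rdiv in HK0; lra|]. apply ln_le; [pose proof (Rabs_pos (Im (cc be t0 + 1 * z))); lra|].
      unfold X. rewrite <- Iz. destruct z as [x y]; simpl. replace (t0 + (1 * y + 0 * x)) with (t0 + y) by ring. pose proof (Rabs_triang t0 y). lra. }
    assert (LX : ln X <= X).
    { pose proof (exp_ineq1_le (ln X)) as Q. rewrite exp_ln in Q by lra. lra. }
    assert (I2 : Im z * Im z = V * V) by (rewrite <- Iz; pose proof (Rsqr_abs (Im z)) as Q; unfold Rsqr in Q; auto).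
    rewrite I2.
    assert (AP : 0 <= A) by (unfold A; pose proof (ln5_ge1 t0); lra).
    apply Rle_trans with (exp 2 * exp (3 * ln X) * exp (6 / eta ^ 2 * ln X) * exp (1 - V * V)).
    - apply Rmult_le_compat; [apply Rmult_le_pos; [apply Cmod_ge_0|left; apply Rinv_0_lt_compat, Cmod_gt_0, Low; auto]|apply Rlt_le, exp_pos| |apply exp_le; nra].
      apply Rmult_le_compat; auto; [apply Cmod_ge_0|left; apply Rinv_0_lt_compat, Cmod_gt_0, Low; auto].
    - rewrite <- !exp_plus. apply Rle_trans with (exp 0); [apply exp_le|rewrite exp_0; lra].
      assert (K * ln X <= K * X) by (apply Rmult_le_compat_l; [unfold K; lra|auto]).
      assert (3 * ln X + 6 / eta ^ 2 * ln X = K * ln X) by (unfold K; ring).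
      assert (K * X + 3 <= V * V).
      { unfold X. assert (3 <= K) by (unfold K; lra). 
        replace (V * V) with (V * K + V * (Rabs t0 + 5) + V * 3) by (unfold V at 4; ring).
        assert (K * (Rabs t0 + 5) <= V * (Rabs t0 + 5)) by (apply Rmult_le_compat_r; unfold V; lra). lra. }
      lra. }
  assert (Lft : forall y, Cmod (F (0, y)) <= 1).
  { intros y. rewrite CF, Cmod_inv by (apply Low; simpl; lra). simpl Re; simpl Im.
    replace (cc be (- t0) + Copp 1 * (0, y))%C with (Cconj (cc be t0 + 1 * (0, y)))%C by (apply C_eta; simpl; ring).
    rewrite Cmod_zf_conj by (simpl; lra).
    pose proof (proj1 (Cmod_gt_0 _) (Low (0, y) ltac:(simpl; lra))) as P.
    rewrite Rinv_r by lra. rewrite Rmult_1_l. apply Rle_trans with (exp 0); [apply exp_le; nra|rewrite exp_0; lra]. }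
  (* Here the denominator is taken at abscissa be + 1 > 3/2, where |f| is at least linear in the
     height. A cubic over a linear term leaves the square 54 (u + 5/2)^2, which [A] is designed to
     absorb. *)
  assert (Rgt : forall y, Cmod (F (1, y)) <= 1).
  { intros y. rewrite CF, Cmod_inv by (apply Low; simpl; lra). simpl Re; simpl Im.
    set (u := Rabs (t0 + y)). assert (Hu : 0 <= u) by apply Rabs_pos.
    assert (B1 : Cmod (zf 0 (cc be (- t0) + Copp 1 * (1, y))) <= 3 * (u + 5 / 2) ^ 3).
    { eapply Rle_trans; [apply zf_growth; simpl; lra|]. apply Rmult_le_compat_l; [lra|]. apply pow_incr.
      split; [pose proof (Cmod_ge_0 (cc be (- t0) + Copp 1 * (1, y))); lra|].
      eapply Rle_trans; [apply Rplus_le_compat_r, Cmod_le_abs|]. simpl.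
      replace (be + (- (1) * 1 - - 0 * y)) with (be - 1) by ring.
      replace (- t0 + (- (1) * y + - 0 * 1)) with (- (t0 + y)) by ring. rewrite Rabs_Ropp. fold u.
      assert (Rabs (be - 1) <= 3 / 2) by (apply Rabs_le; lra). lra. }
    assert (B2 : (u + 5 / 2) / 18 <= Cmod (zf 0 (cc be t0 + 1 * (1, y)))).
    { pose proof (zf_low_32 (cc be t0 + 1 * (1, y)) ltac:(simpl; lra)) as Q.
      assert (Q1 : u <= Cmod (cc be t0 + 1 * (1, y) - 1)).
      { eapply Rle_trans; [|apply Rabs_Im_le]. simpl. right. unfold u. f_equal. ring. }
      assert (Q2 : 1 / 2 <= Cmod (cc be t0 + 1 * (1, y) - 1)).
      { eapply Rle_trans; [|apply Rabs_Re_le]. simpl. rewrite Rabs_pos_eq; lra. }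
      lra. }
    assert (B3 : u + 5 / 2 <= (Rabs t0 + 5) * (1 + Rabs y)).
    { unfold u. pose proof (Rabs_triang t0 y). pose proof (Rabs_pos y). nra. }
    assert (P : 0 < Cmod (zf 0 (cc be t0 + 1 * (1, y)))) by (apply Cmod_gt_0, Low; simpl; lra).
    apply Rle_trans with (54 * (u + 5 / 2) ^ 2 * exp (- A * 1 + (1 * 1 - y * y))).
    - apply Rmult_le_compat_r; [apply Rlt_le, exp_pos|].
      apply (Rmult_le_reg_r (Cmod (zf 0 (cc be t0 + 1 * (1, y))))); auto. rewrite Rmult_assoc, Rinv_l, Rmult_1_r by lra.
      eapply Rle_trans; [exact B1|]. 
      apply Rle_trans with (54 * (u + 5 / 2) ^ 2 * ((u + 5 / 2) / 18)); [right; field|].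
      apply Rmult_le_compat_l; auto. apply Rmult_le_pos; [lra|apply pow_le; lra].
    - assert (E1 : 54 * (u + 5 / 2) ^ 2 <= exp 5 * exp (2 * (ln (Rabs t0 + 5) + Rabs y))).
      { apply Rmult_le_compat; [lra|apply pow_le; lra| |].
        - replace 5 with (1 + 1 + 1 + 1 + 1) by ring. rewrite !exp_plus.
          assert (E : 2.3 <= exp 1).
          { pose proof (exp_ineq1_le (1/4)). assert (exp (1/2) = exp (1/4) * exp (1/4)) by (rewrite <- exp_plus; f_equal; field).
            replace 1 with (1/2+1/2) by field. rewrite exp_plus. assert (1.56 <= exp (1/2)) by nra. nra. }
          assert (5.29 <= exp 1 * exp 1) by nra. assert (27.9 <= exp 1 * exp 1 * (exp 1 * exp 1)) by nra. nra.
        - replace (2 * (ln (Rabs t0 + 5) + Rabs y)) with ((ln (Rabs t0 + 5) + Rabs y) + (ln (Rabs t0 + 5) + Rabs y)) by ring.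
          rewrite exp_plus. assert (u + 5 / 2 <= exp (ln (Rabs t0 + 5) + Rabs y)).
          { rewrite exp_plus, exp_ln by lra. eapply Rle_trans; [exact B3|]. apply Rmult_le_compat_l; [lra|]. apply exp_ineq1_le. }
          simpl. nra. }
      eapply Rle_trans; [apply Rmult_le_compat_r; [apply Rlt_le, exp_pos|exact E1]|].
      rewrite <- !exp_plus. apply Rle_trans with (exp 0); [apply exp_le|rewrite exp_0; lra]. unfold A.
      pose proof (Rsqr_abs y) as Q; unfold Rsqr in Q. rewrite Q. pose proof (Rle_0_sqr (Rabs y - 1)). unfold Rsqr in H. nra. }
  pose proof (maxmod F F' (a, 0) 0 1 (- V) V ep 1 Hep ltac:(simpl; lra) ltac:(simpl; lra) HF Rlt_0_1
    ltac:(intros; apply Top; simpl; [lra|rewrite Rabs_left; lra]) ltac:(intros; apply Top; simpl; [lra|rewrite Rabs_right; lra])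
    ltac:(intros; apply Lft) ltac:(intros; apply Rgt)) as Q.
  rewrite CF in Q.
  pose proof (Low (a, 0) ltac:(simpl; lra)) as N. rewrite Cmod_inv in Q by auto.
  replace (cc be (- t0) + Copp 1 * (a, 0))%C with (Cconj (cc (be - a) t0)) in Q by (apply C_eta; simpl; ring).
  rewrite Cmod_zf_conj in Q by (simpl; lra).
  replace (cc be t0 + 1 * (a, 0))%C with ((be + a)%R, t0) in * by (apply C_eta; simpl; ring).
  pose proof (proj1 (Cmod_gt_0 _) N) as P. simpl Re in Q; simpl Im in Q.
  apply (Rmult_le_compat_r (Cmod (zf 0 (be + a, t0)))) in Q; [|lra].
  replace (Cmod (zf 0 (be - a, t0)) * / Cmod (zf 0 (be + a, t0)) * exp (- A * a + (a * a - 0 * 0)) * Cmod (zf 0 (be + a, t0)))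
   with (Cmod (zf 0 (be - a, t0)) * exp (- A * a + (a * a - 0 * 0))) in Q by (field; lra).
  apply (Rmult_le_compat_l (exp (A * a))) in Q; [|apply Rlt_le, exp_pos].
  rewrite Rmult_1_l in Q.
  replace (exp (A * a) * (Cmod (zf 0 (be - a, t0)) * exp (- A * a + (a * a - 0 * 0)))) with (Cmod (zf 0 (be - a, t0)) * exp (a * a)) in Q.
  - pose proof (Cmod_ge_0 (zf 0 (be - a, t0))). pose proof (exp_ineq1_le (a * a)). nra.
  - rewrite (Rmult_comm (Cmod _) (exp (- A * a + _))), <- Rmult_assoc, <- exp_plus. rewrite Rmult_comm. do 2 f_equal. ring.
Qed.

(** [reflection] becomes an equality as a tends to 0; comparing the derivatives of the logarithms of
    its sides there gives 2 Re E + A >= 0. *)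
Theorem Ez_positive be t0 : 1 / 2 < be <= 5 / 2 -> - (ln (Rabs t0 + 5) + 7 / 2) <= Re (Ez (be, t0)).
Proof.
  intros Hb. set (A := 2 * ln (Rabs t0 + 5) + 7).
  set (b := be - 1 / 2).
  assert (H : 0 <= Re (Ez (be, t0)) + Re (Ez (be, t0)) + A).
  { apply (deriv_sign (fun a => ln (Cmod (zf 0 (1 / 2 + (b + a), t0))) - ln (Cmod (zf 0 (1 / 2 + (b - a), t0))) + A * a) _ (Rmin 1 b)).
    - apply Rmin_case; unfold b; lra.
    - rewrite Rplus_0_r, Rminus_0_r. ring.
    - intros a Ha. assert (Ha1 : a < 1) by (eapply Rlt_le_trans; [apply Ha|apply Rmin_l]).
      assert (Ha2 : a < b) by (eapply Rlt_le_trans; [apply Ha|apply Rmin_r]).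
      pose proof (reflection be t0 a Hb ltac:(lra)) as Q. fold A in Q.
      replace (1 / 2 + (b + a)) with (be + a) by (unfold b; ring). replace (1 / 2 + (b - a)) with (be - a) by (unfold b; ring).
      assert (P1 : 0 < Cmod (zf 0 (be - a, t0))) by (apply Cmod_gt_0, zf_neq_0; simpl; auto; unfold b in *; lra).
      assert (P2 : 0 < Cmod (zf 0 (be + a, t0))) by (apply Cmod_gt_0, zf_neq_0; simpl; auto; unfold b in *; lra).
      apply ln_le in Q; auto. rewrite ln_mult, ln_exp in Q; auto; [lra|apply exp_pos].
    - replace (be, t0) with (1 / 2 + b, t0) by (f_equal; unfold b; ring).
      assert (D1 : is_derive (fun a => ln (Cmod (zf 0 (1 / 2 + (b + a), t0)))) 0 (Re (Ez (1 / 2 + b, t0)))).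
      { pose proof (ln_zf_der (b + 0) t0 ltac:(unfold b; lra)) as D. 
        pose proof (is_derive_comp (fun s => ln (Cmod (zf 0 (1 / 2 + s, t0)))) (fun a => b + a) 0 _ 1 D) as K.
        rewrite Rplus_0_r in K. 
        replace (Re (Ez (1 / 2 + b, t0))) with (scal 1 (Re (Ez (1 / 2 + b, t0)))) by (unfold scal; simpl; unfold mult; simpl; ring).
        apply K. auto_derive; auto; ring. }
      assert (D2 : is_derive (fun a => ln (Cmod (zf 0 (1 / 2 + (b - a), t0)))) 0 (- Re (Ez (1 / 2 + b, t0)))).
      { pose proof (ln_zf_der (b - 0) t0 ltac:(unfold b; lra)) as D. 
        pose proof (is_derive_comp (fun s => ln (Cmod (zf 0 (1 / 2 + s, t0)))) (fun a => b - a) 0 _ (-1) D) as K.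
        rewrite Rminus_0_r in K. 
        replace (- Re (Ez (1 / 2 + b, t0))) with (scal (-1) (Re (Ez (1 / 2 + b, t0)))) by (unfold scal; simpl; unfold mult; simpl; ring).
        apply K. auto_derive; auto; ring. }
      replace (Re (Ez (1 / 2 + b, t0)) + Re (Ez (1 / 2 + b, t0)) + A) with (Re (Ez (1 / 2 + b, t0)) - - Re (Ez (1 / 2 + b, t0)) + A) by ring.
      apply (is_derive_plus (V := R_NormedModule)); [apply (is_derive_minus (V := R_NormedModule)); auto|].
      auto_derive; auto; ring. }
  unfold A in H. lra.
Qed.

(** An upper bound for - Re E valid on a whole disc of radius at most 1 at height t, hence 6 in
    place of 5. *)
Definition Nz (t : R) : R := ln (Rabs t + 6) + 7 / 2.

(** Borel-Caratheodory for -E: the one-sided bound [Ez_positive] is all that is known of its real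
    part, and it is all that is required. *)
Lemma Ez1_le a t : 0 < a <= 1 -> Cmod (Ez1 (1 / 2 + a, t)) <= 2 / a * (Nz t + Re (Ez (1 / 2 + a, t))).
Proof.
  intros Ha. apply le_radius; [lra|apply Cmod_ge_0|]. intros r Hr.
  destruct hol_Ez1 as [E2 H2].
  pose proof (borel_caratheodory (fun w => Re (Copp 1 * Ez w)) (fun w => Copp 1 * Ez1 w)%C (fun w => 0 * Ez1 w + Copp 1 * E2 w)%C (1 / 2 + a, t) a) as Q.
  assert (Sub : forall z, Cmod (z - (1 / 2 + a, t)) < a -> RHP z) by (intros z Hz; apply (disc_RHP a t a z); auto; lra).
  assert (R1 : forall w : C, Re (Copp 1 * w) = - Re w) by (intros w; destruct w; simpl; ring).
  assert (Q1 := Q ltac:(apply (hol_sub _ RHP); [exact Sub|apply hol_mult; [apply hol_const|exact H2]])). clear Q.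
  assert (Q2 := fun X => Q1 X r (Nz t) Hr). clear Q1. cbv beta in Q2.
  rewrite Cmod_mult, Cmod_opp, Cmod_1, Rmult_1_l, R1 in Q2.
  replace (Nz t + Re (Ez (1 / 2 + a, t))) with (Nz t - - Re (Ez (1 / 2 + a, t))) by ring. apply Q2; clear Q2.
  - intros z Hz. apply (cgrad_Re (fun w => Copp 1 * Ez w)%C).
    eapply cder_ext; [intros; reflexivity| |apply cder_mult; [apply (cder_const (Copp 1))|apply (proj1 (hol_Ez z (Sub z Hz)))]]. cbv beta. ring.
  - intros z Hz. rewrite R1. pose proof (Re_near z (1 / 2 + a, t)) as _.
    assert (Hza : Cmod (z - (1 / 2 + a, t)) < a) by lra.
    pose proof (Re_near _ _ _ Hza) as B. simpl in B. destruct z as [x y]. simpl in B.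
    pose proof (Ez_positive x y ltac:(lra)) as P. unfold Nz.
    assert (ln (Rabs y + 5) <= ln (Rabs t + 6)).
    { pose proof (Rabs_pos y). apply ln_le; [lra|]. pose proof (Rabs_Im_le ((x, y) - cc (1 / 2 + a) t)) as I. simpl in I.
      pose proof (Rabs_triang_inv y t). unfold Rminus in *. lra. }
    lra.
Qed.

(* By [Ez1_le], a^2 |zeta'/zeta + Nz| at abscissa 1/2 + a is nondecreasing in a. *)
Theorem Ez_half a t : 0 < a <= 1 ->
  Cmod (Ez (1 / 2 + a / 2, t) + RtoC (Nz t)) <= 4 * Cmod (Ez (1 / 2 + a, t) + RtoC (Nz t)).
Proof.
  intros Ha. set (G := fun a => (Ez (cc (1 / 2 + a) t) + RtoC (Nz t))%C).
  change (Cmod (G (a / 2)) <= 4 * Cmod (G a)).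
  (* Squared, because the modulus is not differentiable at a zero of [G]. *)
  set (W := fun a => a ^ 4 * (Re (G a) * Re (G a) + Im (G a) * Im (G a))).
  assert (M : W (a / 2) <= W a).
  { apply (is_derive_mono W (fun x => 4 * x ^ 3 * (Re (G x) * Re (G x) + Im (G x) * Im (G x)) +
        x ^ 4 * ((Re (Ez1 (1 / 2 + x, t)) * Re (G x) + Re (G x) * Re (Ez1 (1 / 2 + x, t))) + (Im (Ez1 (1 / 2 + x, t)) * Im (G x) + Im (G x) * Im (Ez1 (1 / 2 + x, t)))))); [lra| |].
    - intros x Hx. unfold W.
      assert (DG : rder G x (Ez1 (1 / 2 + x, t))).
      { unfold G. eapply rder_ext; [| |apply rder_plus; [|apply (rder_const (RtoC (Nz t)))]]; [intros; reflexivity| |].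
        2:{ pose proof (rder_comp Ez (fun u => (1 / 2 + u, t)) x (Ez1 (1 / 2 + x, t)) 1) as K. cbv beta in K. apply K; clear K.
            - eapply rder_ext; [| |apply (rder_affine (1 / 2, t) 1 x)]; [intros u; apply C_eta; simpl; ring|reflexivity].
            - apply hol_Ez. unfold RHP; simpl; lra. }
        ring. }
      pose proof (rder_Re _ _ _ DG) as D1. pose proof (rder_Im _ _ _ DG) as D2.
      apply (is_derive_mult (K := R_AbsRing) (fun a => a ^ 4) (fun a => Re (G a) * Re (G a) + Im (G a) * Im (G a))).
      + auto_derive; auto. ring.
      + apply (is_derive_plus (V := R_NormedModule)); apply (is_derive_mult (K := R_AbsRing)); auto; intros; apply Rmult_comm.
      + intros; apply Rmult_comm.
    - intros x Hx. pose proof (Ez1_le x t ltac:(lra)) as Q.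
      assert (RG : Nz t + Re (Ez (1 / 2 + x, t)) <= Cmod (G x)).
      { eapply Rle_trans; [|apply Re_le_Cmod]. unfold G. destruct (Ez (1 / 2 + x, t)); simpl. lra. }
      rewrite <- Cmod_sqr. set (e := Ez1 (1 / 2 + x, t)) in *. set (g := G x) in *.
      assert (CS : Rabs (Re e * Re g + Im e * Im g) <= Cmod e * Cmod g).
      { replace (Re e * Re g + Im e * Im g) with (Re (e * Cconj g)) by (destruct e, g; simpl; ring).
        eapply Rle_trans; [apply Rabs_Re_le|]. rewrite Cmod_mult, Cmod_conj. lra. }
      apply Rabs_le_between in CS. pose proof (Cmod_ge_0 g) as G0.
      assert (Q2 : x * Cmod e <= 2 * Cmod g).
      { apply Rle_trans with (x * (2 / x * (Nz t + Re (Ez (1 / 2 + x, t))))); [apply Rmult_le_compat_l; lra|].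
        replace (x * (2 / x * (Nz t + Re (Ez (1 / 2 + x, t))))) with (2 * (Nz t + Re (Ez (1 / 2 + x, t)))) by (field; lra). lra. }
      assert (X3 : 0 < x ^ 3) by (apply pow_lt; lra).
      assert (x * (Cmod e * Cmod g) <= 2 * (Cmod g * Cmod g)) by nra.
      replace (4 * x ^ 3 * (Cmod g * Cmod g) + x ^ 4 * (Re e * Re g + Re g * Re e + (Im e * Im g + Im g * Im e)))
       with (2 * x ^ 3 * (2 * (Cmod g * Cmod g) + x * (Re e * Re g + Im e * Im g))) by ring.
      apply Rmult_le_pos; [lra|]. nra. }
  unfold W in M. rewrite <- !Cmod_sqr in M.
  set (p := Cmod (G (a / 2))) in *. set (q := Cmod (G a)) in *.
  assert (0 <= p) by apply Cmod_ge_0. assert (0 <= q) by apply Cmod_ge_0.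
  assert (A4 : 0 < a ^ 4) by (apply pow_lt; lra).
  assert (p * p <= 16 * (q * q)).
  { apply (Rmult_le_reg_l (a ^ 4 / 16)); [lra|]. replace (a ^ 4 / 16 * (p * p)) with ((a / 2) ^ 4 * (p * p)) by field.
    replace (a ^ 4 / 16 * (16 * (q * q))) with (a ^ 4 * (q * q)) by field. auto. }
  nra.
Qed.
End RHsec.

(** * Comparison with a Dirichlet polynomial in a half plane *)

Definition SV (N : nat) (s : C) : C := csum (fun n => RtoC (vm (S n)) * cp (INR (S n)) s)%C N.
(** A majorant of [SV] with ln n for the von Mangoldt function, so that no estimate on primes
    enters; the lost logarithm is affordable. *)
Definition Sabs (N : nat) (q : R) : R := rsum (fun n => ln (INR (S n)) * rp (INR (S n)) q) N.
(** This is (s - 1) (zeta'/zeta + SV) with the pole at 1 cleared. To the right of 1 it equals - (s -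
    1) times the tail of the von Mangoldt series. *)
Definition Rz (N : nat) (s : C) : C := ((s - 1) * (Ez s + SV N s) - 1)%C.
(** The scale of all bounds on E: of logarithmic size at large heights, and at least l everywhere,
    which absorbs constants and powers of u. *)
Definition om (l t : R) : R := ln (exp l + Rabs t).

Lemma ln_INR_S_nonneg n : 0 <= ln (INR (S n)).
Proof. apply ln_nonneg, INR_S_ge1. Qed.

Lemma SV_abs N s q : q <= Re s -> Cmod (SV N s) <= Sabs N q.
Proof.
  intros H. apply csum_le. intros n _. rewrite Cmod_mult, Cmod_cp.
  apply Rmult_le_compat; [apply Cmod_ge_0|apply Rlt_le, rp_pos|apply vm_abs|].
  apply rp_le_exp; [apply INR_S_ge1|auto].
Qed.

Lemma hol_cp D x : exists G, hol D (cp x) G.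
Proof.
  eexists. unfold cp. apply (hol_ext D (fun z => cexp (RtoC (- ln x) * z))).
  - intros z. f_equal. apply C_eta; simpl; ring.
  - apply hol_cexp. apply hol_mult; [apply hol_const|apply hol_id].
Qed.

Lemma hol_csum D (c : nat -> C) (N : nat) : exists G, hol D (fun s => csum (fun n => c n * cp (INR (S n)) s)%C N) G.
Proof.
  induction N as [|N [G IH]].
  - exists (fun _ => 0%C). exact (hol_const D 0%C).
  - destruct (hol_cp D (INR (S N))) as [G1 H1]. eexists. cbn [csum]. apply hol_plus; [exact IH|].
    apply hol_mult; [apply hol_const|exact H1].
Qed.

Lemma rsum_shift_le (f : nat -> R) N n : (forall k, 0 <= f k) -> rsum (fun m => f (N + m)%nat) n <= rsum f (N + n).
Proof.
  intros H. induction n; cbn [rsum]; [apply rsum_nonneg; auto|]. rewrite Nat.add_succ_r. cbn [rsum]. lra.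
Qed.

(** All n in the tail exceed exp lam, so everything beyond n^(-2) can be replaced by exp (- lam (Re
    s - 2)). The bound is uniform in Re s, as the far right edge of the maximum principle
    demands. *)
Lemma VS_tail lam N s : exp lam < INR (S N) -> 2 <= Re s ->
  exp (lam * Re s) * Cmod (VS s - SV N s) <= 6 * exp (2 * lam).
Proof.
  intros HN Hs.
  assert (T : Cmod (VS s - SV N s) <= 6 * exp (- lam * (Re s - 2))).
  { apply (csums_tail _ _ _ _ (vm_csums s ltac:(lra))). intros n.
    eapply Rle_trans; [apply csum_le with (M := fun m => exp (- lam * (Re s - 2)) * (ln (INR (S (N + m))) * rp (INR (S (N + m))) (1 + 1)))|].
    - intros m _. rewrite Cmod_mult, Cmod_cp.
      replace (exp (- lam * (Re s - 2)) * (ln (INR (S (N + m))) * rp (INR (S (N + m))) (1 + 1)))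
        with (ln (INR (S (N + m))) * (rp (INR (S (N + m))) (1 + 1) * exp (- lam * (Re s - 2)))) by ring.
      apply Rmult_le_compat; [apply Cmod_ge_0|apply Rlt_le, rp_pos|apply vm_abs|].
      replace (Re s) with (1 + 1 + (Re s - 2)) at 1 by ring. rewrite rp_plus.
      apply Rmult_le_compat_l; [apply Rlt_le, rp_pos|]. unfold rp. apply exp_le.
      assert (lam <= ln (INR (S (N + m)))).
      { rewrite <- (ln_exp lam). apply ln_le; [apply exp_pos|]. apply Rle_trans with (INR (S N)); [lra|]. apply le_INR. lia. }
      nra.
    - rewrite rsum_scal. rewrite Rmult_comm. apply Rmult_le_compat_r; [apply Rlt_le, exp_pos|].
      eapply Rle_trans; [apply (rsum_shift_le (fun k => ln (INR (S k)) * rp (INR (S k)) (1 + 1)))|].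
      + intros k. apply Rmult_le_pos; [apply ln_INR_S_nonneg|apply Rlt_le, rp_pos].
      + eapply Rle_trans; [apply ln_rp_sum; lra|]. right. field. }
  apply Rle_trans with (exp (lam * Re s) * (6 * exp (- lam * (Re s - 2)))).
  - apply Rmult_le_compat_l; auto. apply Rlt_le, exp_pos.
  - right. rewrite (Rmult_comm 6), <- Rmult_assoc, <- exp_plus. rewrite Rmult_comm. f_equal. f_equal. ring.
Qed.

Lemma om_shift l t v : 0 <= l -> om l (t + v) <= om l t + ln (1 + Rabs v).
Proof.
  intros Hl. unfold om. pose proof (Rabs_pos t). pose proof (Rabs_pos v).
  assert (1 <= exp l) by (pose proof (exp_ineq1_le l); lra).
  rewrite <- ln_mult by lra. apply ln_le; [pose proof (Rabs_pos (t + v)); lra|].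
  pose proof (Rabs_triang t v). nra.
Qed.

Lemma om_ge l t : l <= om l t.
Proof.
  unfold om. rewrite <- (ln_exp l) at 1. apply ln_le; [apply exp_pos|]. pose proof (Rabs_pos t). lra.
Qed.

Section RHsec.
Hypothesis RH : RiemannHypothesis.

Lemma Rz_div N s : 0 < Re s -> Cmod (Rz N s) <= Cmod (s + 1) * (Cmod (Ez s) + Cmod (SV N s) + 1).
Proof.
  intros Hs. unfold Rz.
  assert (H1 : Cmod (s - 1) <= Cmod (s + 1)).
  { apply Rsqr_incr_0; [|apply Cmod_ge_0..]. unfold Rsqr. rewrite !Cmod_sqr. destruct s; simpl in *. nra. }
  assert (H2 : 1 <= Cmod (s + 1)).
  { eapply Rle_trans; [|apply Re_le_Cmod]. destruct s; simpl in *. lra. }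
  eapply Rle_trans; [apply Cmod_minus_le|]. rewrite Cmod_mult, Cmod_1.
  pose proof (Cmod_triangle (Ez s) (SV N s)). pose proof (Cmod_ge_0 (Ez s + SV N s)).
  pose proof (Cmod_ge_0 (s - 1)).
  assert (Cmod (s - 1) * Cmod (Ez s + SV N s) <= Cmod (s + 1) * (Cmod (Ez s) + Cmod (SV N s))) by (apply Rmult_le_compat; lra).
  lra.
Qed.

Lemma Rz_right N s : 1 < Re s -> Rz N s = (- (s - 1) * (VS s - SV N s))%C.
Proof.
  intros Hs. unfold Rz. rewrite Ez_dirichlet by auto. field. apply s_neq_1. lra.
Qed.

(* Phragmen-Lindelof for the half plane [1/2 + b <= Re z]: the factor [1 + (z - ..) / l]
   kills the growth at infinity at the cost of a factor close to 1. *)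
Lemma half_plane (lam b l K1 P : R) (N : nat) (t a : R) :
  0 < b <= 1 / 2 -> 2 <= l -> 0 <= lam -> exp lam < INR (S N) -> 0 <= K1 -> 
  (forall y, Cmod (Ez (1 / 2 + b, y)) <= K1 * om l y) -> Sabs N (1 / 2 + b) <= P -> b < a ->
  Cmod (Rz N (1 / 2 + a, t)) <= Cmod (cc (1 / 2 + a) t + 1) * (1 + (a - b) / l) * exp (- lam * (a - b)) *
    ((1 + ln (1 + l) / l) * (K1 * om l t + P + 1)).
Proof.
  intros Hb Hl Hlam HN HK HE HS Hab.
  set (w := om l t). assert (Hw : l <= w) by apply om_ge.
  assert (HP : 0 <= P).
  { eapply Rle_trans; [|exact HS]. apply rsum_nonneg. intros k. apply Rmult_le_pos; [apply ln_INR_S_nonneg|apply Rlt_le, rp_pos]. }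
  set (xL := 1 / 2 + b). set (Q := (1 + ln (1 + l) / l) * (K1 * w + P + 1)).
  assert (L1 : 0 <= ln (1 + l)) by (apply ln_nonneg; lra).
  assert (L2 : 0 <= ln (1 + l) / l) by (apply Rdiv_le_0_compat; lra).
  assert (HQ : 1 <= Q).
  { unfold Q. assert (0 <= K1 * w) by (apply Rmult_le_pos; lra). nra. }
  set (M := exp (lam * xL) * Q).
  assert (HM : 0 < M) by (apply Rmult_lt_0_compat; [apply exp_pos|lra]).
  (* This is 1 + (z - xL - i t) / l: of modulus at least 1 on the left edge, real at height t, and
     large enough away from t to absorb the growth of [om]. *)
  set (Den := fun z : C => (RtoC (/ l) * z + (cc (1 - xL / l) (- t / l)))%C).
  assert (DRe : forall z, Re (Den z) = 1 + (Re z - xL) / l) by (intros z; unfold Den; destruct z; simpl; field; lra).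
  assert (DIm : forall z, Im (Den z) = (Im z - t) / l) by (intros z; unfold Den; destruct z; simpl; field; lra).
  (* Division by z + 1 compensates the factor s - 1 in [Rz]; exp (lam z) is what yields the gain exp
     (- lam (a - b)) at the end. *)
  set (F := fun z => (cexp (RtoC lam * z) * Rz N z * (/ (z + 1) * / Den z))%C).
  set (ep := b / 2). assert (Hep : 0 < ep < 1 / 2) by (unfold ep; lra).
  assert (DP : forall z, xL - ep < Re z -> 1 / 2 < Re (Den z)).
  { intros z Hz. rewrite DRe. assert (- (1 / 2) < (Re z - xL) / l); [|lra].
    apply (Rmult_lt_reg_r l); [lra|]. replace ((Re z - xL) / l * l) with (Re z - xL) by (field; lra). nra. }
  assert (DN : forall z, xL - ep < Re z -> Den z <> 0%C).
  { intros z Hz E. pose proof (DP z Hz) as D. rewrite E in D. simpl in D. lra. }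
  assert (ZN : forall z, xL - ep < Re z -> (z + 1)%C <> 0%C).
  { intros z Hz E. apply (f_equal Re) in E. unfold xL in Hz. destruct z; simpl in *. lra. }
  assert (HF : forall X, exists F', hol (fun z => xL - ep < Re z < X + ep) F F').
  { intros X. set (D := fun z => xL - ep < Re z < X + ep). 
    destruct (hol_csum D (fun n => RtoC (vm (S n))) N) as [G1 H1].
    eexists. unfold F. apply hol_mult; [apply hol_mult|apply hol_mult].
    - apply hol_cexp. apply hol_mult; [apply hol_const|apply hol_id].
    - unfold Rz. apply hol_minus; [|apply hol_const]. apply hol_mult; [apply hol_minus; [apply hol_id|apply hol_const]|].
      apply hol_plus; [|exact H1]. apply (hol_sub _ (fun z => 1 / 2 < Re z)); [|apply hol_Ez; auto].
      intros z [Hz _]. unfold xL, ep in Hz. lra.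
    - apply hol_inv; [apply hol_plus; [apply hol_id|apply hol_const]|]. intros z [Hz _]. apply ZN; auto.
    - apply hol_inv; [unfold Den; apply hol_plus; [apply hol_mult; [apply hol_const|apply hol_id]|apply hol_const]|].
      intros z [Hz _]. apply DN; auto. }
  assert (CF : forall z, xL - ep < Re z -> Cmod (F z) = exp (lam * Re z) * Cmod (Rz N z) * (/ Cmod (z + 1) * / Cmod (Den z))).
  { intros z Hz. unfold F. rewrite !Cmod_mult, Cmod_cexp, !Cmod_inv; [|apply DN; auto|apply ZN; auto].
    do 3 f_equal. destruct z; simpl; ring. }
  assert (PZ : forall z, xL - ep < Re z -> 0 < Cmod (z + 1)) by (intros z Hz; apply Cmod_gt_0, ZN; auto).
  assert (PD : forall z, xL - ep < Re z -> 0 < Cmod (Den z)) by (intros z Hz; apply Cmod_gt_0, DN; auto).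
  assert (FB : forall z B, xL - ep < Re z -> exp (lam * Re z) * Cmod (Rz N z) <= B * (Cmod (z + 1) * Cmod (Den z)) -> Cmod (F z) <= B).
  { intros z B Hz HB. rewrite CF by auto. pose proof (PZ z Hz). pose proof (PD z Hz).
    apply (Rmult_le_reg_r (Cmod (z + 1) * Cmod (Den z))); [apply Rmult_lt_0_compat; auto|].
    replace (exp (lam * Re z) * Cmod (Rz N z) * (/ Cmod (z + 1) * / Cmod (Den z)) * (Cmod (z + 1) * Cmod (Den z)))
      with (exp (lam * Re z) * Cmod (Rz N z)) by (field; lra). auto. }
  assert (Lft : forall y, Cmod (F (xL, y)) <= M).
  { intros y. apply FB; [simpl; lra|]. simpl Re. unfold M. rewrite Rmult_assoc. apply Rmult_le_compat_l; [apply Rlt_le, exp_pos|].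
    eapply Rle_trans; [apply Rz_div; unfold xL; simpl; lra|]. rewrite <- Rmult_assoc, (Rmult_comm Q), Rmult_assoc.
    apply Rmult_le_compat_l; [apply Cmod_ge_0|].
    pose proof (HE y) as E1. pose proof (SV_abs N (xL, y) (1 / 2 + b) ltac:(unfold xL; simpl; lra)) as E2. fold xL in E1.
    set (v := Rabs (y - t)). assert (Hv : 0 <= v) by apply Rabs_pos.
    pose proof (om_shift l t (y - t) ltac:(lra)) as E3. replace (t + (y - t)) with y in E3 by ring. fold v w in E3.
    set (q := (v / l) ^ 2) in *. assert (Hq : 0 <= q) by apply pow2_ge_0.
    assert (D1 : 1 <= Cmod (Den (xL, y))).
    { eapply Rle_trans; [|apply Re_le_Cmod]. rewrite DRe. simpl. right. field. lra. }
    assert (D2 : Cmod (Den (xL, y)) * Cmod (Den (xL, y)) = 1 + q).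
    { rewrite Cmod_sqr, DRe, DIm. simpl Re. simpl Im. unfold q, v. replace ((Rabs (y - t) / l) ^ 2) with (Rabs (y - t) * Rabs (y - t) / l ^ 2) by (field; lra).
      replace (Rabs (y - t) * Rabs (y - t)) with ((y - t) * (y - t)) by (pose proof (Rsqr_abs (y - t)) as Q0; unfold Rsqr in Q0; auto). field. lra. }
    assert (V4 : ln (1 + v) <= ln (1 + l) * Cmod (Den (xL, y))).
    { destruct (Rle_lt_dec v l) as [H|H].
      - apply Rle_trans with (ln (1 + l)); [apply ln_le; lra|nra].
      - pose proof (Rabs_Im_le (Den (xL, y))) as I. rewrite DIm in I. simpl in I.
        unfold Rdiv in I. rewrite Rabs_mult, (Rabs_pos_eq (/ l)) in I by (apply Rlt_le, Rinv_0_lt_compat; lra). fold v in I.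
        assert (ln (1 + v) <= ln (1 + l) * (v * / l)); [|nra].
        assert (1 < v * / l) by (apply (Rmult_lt_reg_r l); [lra|]; replace (v * / l * l) with v by (field; lra); lra).
        assert (1 <= ln (1 + l)).
        { apply Rle_trans with (ln (exp 1)); [rewrite ln_exp; lra|]. apply ln_le; [apply exp_pos|]. pose proof exp_le_3. lra. }
        assert (ln (1 + v) <= ln (1 + l) + (v * / l - 1)); [|nra].
        replace (1 + v) with ((1 + l) * ((1 + v) / (1 + l))) by (field; lra).
        assert (0 < (1 + v) / (1 + l)) by (apply Rdiv_lt_0_compat; lra).
        rewrite ln_mult by lra. apply Rplus_le_compat_l.
        pose proof (exp_ineq1_le (ln ((1 + v) / (1 + l)))) as Q0. rewrite exp_ln in Q0 by auto.
        assert ((1 + v) / (1 + l) <= v * / l); [|lra].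
        apply (Rmult_le_reg_r (l * (1 + l))); [nra|]. 
        replace ((1 + v) / (1 + l) * (l * (1 + l))) with ((1 + v) * l) by (field; lra).
        replace (v * / l * (l * (1 + l))) with (v * (1 + l)) by (field; lra). nra. }
    set (d := Cmod (Den (xL, y))) in *.
    assert (Cmod (Ez (xL, y)) + Cmod (SV N (xL, y)) + 1 <= (K1 * w + P + 1) + K1 * (ln (1 + l) * d)).
    { assert (K1 * om l y <= K1 * (w + ln (1 + l) * d)) by (apply Rmult_le_compat_l; lra). lra. }
    assert (K1 * (ln (1 + l) * d) <= ln (1 + l) / l * (K1 * w + P + 1) * d).
    { assert (K1 * (ln (1 + l) * d) = ln (1 + l) / l * (K1 * l) * d) by (field; lra). rewrite H0.
      apply Rmult_le_compat_r; [lra|]. apply Rmult_le_compat_l; auto.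
      assert (K1 * l <= K1 * w) by (apply Rmult_le_compat_l; lra). lra. }
    unfold Q. assert (0 <= K1 * w) by (apply Rmult_le_pos; lra). nra. }
  (* The right edge lies so far out that M Re [Den] exceeds the constant 6 exp (2 lam) of
     [VS_tail]. *)
  set (A := xL + 6 * exp (2 * lam) * l / M + (a + 2)).
  assert (G0 : 0 < 6 * exp (2 * lam) * l / M).
  { apply Rdiv_lt_0_compat; auto. apply Rmult_lt_0_compat; [apply Rmult_lt_0_compat; [lra|apply exp_pos]|lra]. }
  assert (Rgt : forall y, Cmod (F (A, y)) <= M).
  { intros y. apply FB; [unfold A; simpl; lra|]. rewrite Rz_right by (simpl; unfold A, xL; lra). 
    rewrite Cmod_mult, Cmod_opp.
    pose proof (VS_tail lam N (A, y) HN ltac:(simpl; unfold A, xL; lra)) as T.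
    assert (H1 : Cmod ((A, y) - 1) <= Cmod ((A, y) + 1)).
    { apply Rsqr_incr_0; [|apply Cmod_ge_0..]. unfold Rsqr. rewrite !Cmod_sqr. simpl. assert (0 < A) by (unfold A, xL; lra). nra. }
    assert (H2 : 6 * exp (2 * lam) <= M * Cmod (Den (A, y))).
    { apply Rle_trans with (M * Re (Den (A, y))); [|apply Rmult_le_compat_l; [lra|apply Re_le_Cmod]].
      rewrite DRe. simpl. unfold A. apply Rle_trans with (M * ((6 * exp (2 * lam) * l / M) / l)); [right; field; lra|].
      apply Rmult_le_compat_l; [lra|]. set (g := 6 * exp (2 * lam) * l / M) in *.
      replace (1 + (xL + g + (a + 2) - xL) / l) with (g / l + (1 + (a + 2) / l)) by (field; lra).
      assert (0 < (a + 2) / l) by (apply Rdiv_lt_0_compat; lra). lra. }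
    set (c1 := Cmod ((A, y) - 1)) in *. set (c2 := Cmod ((A, y) + 1)) in *. set (c3 := Cmod (VS (A, y) - SV N (A, y))) in *.
    assert (0 <= c1) by apply Cmod_ge_0. assert (0 <= exp (lam * Re (A, y)) * c3) by (apply Rmult_le_pos; [apply Rlt_le, exp_pos|apply Cmod_ge_0]).
    replace (exp (lam * Re (A, y)) * (c1 * c3)) with (c1 * (exp (lam * Re (A, y)) * c3)) by ring.
    replace (M * (c2 * Cmod (Den (A, y)))) with (c2 * (M * Cmod (Den (A, y)))) by ring.
    apply Rmult_le_compat; lra. }
  set (Cb := 22 / b ^ 3). assert (HCb : 0 < Cb) by (apply Rdiv_lt_0_compat; [lra|apply pow_lt; lra]).
  set (G := exp (lam * A) * l / M).
  assert (HG : 0 < G) by (apply Rdiv_lt_0_compat; auto; apply Rmult_lt_0_compat; [apply exp_pos|lra]).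
  (* With height V = W^2 - 5 the logarithm in the crude bound is ln (W^2) <= 2 W, so the horizontal
     edges reduce to a polynomial inequality in W. *)
  set (W := G * (2 * Cb + P + 1) + 6 + Rabs t).
  assert (HGp : 0 < G * (2 * Cb + P + 1)) by (apply Rmult_lt_0_compat; lra).
  assert (HW : 6 + Rabs t <= W) by (unfold W; lra). pose proof (Rabs_pos t) as T0.
  set (V := W * W - 5).
  assert (HV : Rabs t < V) by (unfold V; nra).
  assert (Top : forall z, xL <= Re z <= A -> Rabs (Im z) = V -> Cmod (F z) <= M).
  { intros z Hz Iz. apply FB; [lra|].
    assert (E1 : Cmod (Ez z) <= Cb * (2 * W)).
    { eapply Rle_trans; [apply (Ez_crude RH b z); [lra|unfold xL in Hz; lra]|]. rewrite Iz. unfold V.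
      replace (W * W - 5 + 5) with (W * W) by ring. rewrite ln_mult by lra.
      pose proof (exp_ineq1_le (ln W)) as Q0. rewrite exp_ln in Q0 by lra.
      unfold Cb. replace (22 * (ln W + ln W) / b ^ 3) with (22 / b ^ 3 * (2 * ln W)) by (field; lra).
      apply Rmult_le_compat_l; [unfold Cb in HCb; lra|lra]. }
    pose proof (SV_abs N z (1 / 2 + b) ltac:(unfold xL in Hz; lra)) as E2.
    assert (E3 : exp (lam * Re z) <= exp (lam * A)) by (apply exp_le, Rmult_le_compat_l; lra).
    assert (E4 : (V - Rabs t) / l <= Cmod (Den z)).
    { eapply Rle_trans; [|apply Rabs_Im_le]. rewrite DIm. unfold Rdiv. rewrite Rabs_mult, (Rabs_pos_eq (/ l)) by (apply Rlt_le, Rinv_0_lt_compat; lra).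
      apply Rmult_le_compat_r; [apply Rlt_le, Rinv_0_lt_compat; lra|]. rewrite <- Iz. pose proof (Rabs_triang_inv (Im z) t). lra. }
    pose proof (Rz_div N z ltac:(unfold xL in Hz; lra)) as E5.
    set (c2 := Cmod (z + 1)) in *. assert (Hc2 : 0 < c2) by (apply PZ; lra).
    apply Rle_trans with (exp (lam * A) * (c2 * (Cb * (2 * W) + P + 1))).
    { apply Rmult_le_compat; [apply Rlt_le, exp_pos|apply Cmod_ge_0|auto|]. eapply Rle_trans; [exact E5|]. apply Rmult_le_compat_l; lra. }
    apply Rle_trans with (M * (c2 * ((V - Rabs t) / l))); [|apply Rmult_le_compat_l; [lra|apply Rmult_le_compat_l; lra]].
    replace (exp (lam * A)) with (G * M / l) by (unfold G; field; lra).
    replace (G * M / l * (c2 * (Cb * (2 * W) + P + 1))) with (M * c2 / l * (G * (Cb * (2 * W) + P + 1))) by (field; lra).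
    replace (M * (c2 * ((V - Rabs t) / l))) with (M * c2 / l * (V - Rabs t)) by (field; lra).
    apply Rmult_le_compat_l; [apply Rlt_le, Rdiv_lt_0_compat; [apply Rmult_lt_0_compat; lra|lra]|].
    unfold V. assert (W * W = W * (G * (2 * Cb + P + 1)) + W * (6 + Rabs t)) by (unfold W at 2; ring).
    assert (G * (Cb * (2 * W) + P + 1) <= W * (G * (2 * Cb + P + 1))).
    { replace (W * (G * (2 * Cb + P + 1))) with (G * (Cb * (2 * W) + W * (P + 1))) by ring. apply Rmult_le_compat_l; [lra|]. nra. }
    nra. }
  destruct (HF A) as [F' HF']. 
  assert (Rp : xL < Re (1 / 2 + a, t) < A) by (simpl; unfold A, xL; lra).
  assert (Ip : - V < Im (1 / 2 + a, t) < V) by (simpl; pose proof (Rle_abs t); pose proof (Rle_abs (- t)); rewrite Rabs_Ropp in *; lra).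
  pose proof (maxmod F F' (1 / 2 + a, t) xL A (- V) V ep M (proj1 Hep) Rp Ip HF' HM
    ltac:(intros; apply Top; simpl; [lra|rewrite Rabs_left; lra]) ltac:(intros; apply Top; simpl; [lra|rewrite Rabs_right; lra])
    ltac:(intros; apply Lft) ltac:(intros; apply Rgt)) as R.
  set (p := cc (1 / 2 + a) t) in *.
  assert (Hp : xL - ep < Re p) by lra.
  rewrite CF in R by auto. pose proof (PZ p Hp) as P1. pose proof (PD p Hp) as P2.
  assert (DE : Den p = RtoC (1 + (a - b) / l)).
  { apply C_eta; [rewrite DRe|rewrite DIm]; unfold p, xL; simpl; field; lra. }
  assert (DM : Cmod (Den p) = 1 + (a - b) / l).
  { rewrite DE, Cmod_R, Rabs_pos_eq; auto. assert (0 < (a - b) / l) by (apply Rdiv_lt_0_compat; lra). lra. }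
  rewrite <- DM.
  apply (Rmult_le_compat_l (exp (- (lam * Re p)) * (Cmod (p + 1) * Cmod (Den p)))) in R; [|apply Rmult_le_pos; [apply Rlt_le, exp_pos|apply Rmult_le_pos; lra]].
  replace (exp (- (lam * Re p)) * (Cmod (p + 1) * Cmod (Den p)) * (exp (lam * Re p) * Cmod (Rz N p) * (/ Cmod (p + 1) * / Cmod (Den p))))
    with ((exp (- (lam * Re p)) * exp (lam * Re p)) * Cmod (Rz N p)) in R by (field; lra).
  rewrite <- exp_plus in R. replace (- (lam * Re p) + lam * Re p) with 0 in R by ring. rewrite exp_0, Rmult_1_l in R.
  eapply Rle_trans; [exact R|]. right. unfold M.
  replace (exp (- lam * (a - b))) with (exp (- (lam * Re p)) * exp (lam * xL)); [ring|].
  rewrite <- exp_plus. f_equal. unfold p, xL. simpl. ring.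
Qed.

End RHsec.

(** ** Numerical bounds *)

Lemma exp_taylor_2 y : 0 <= y -> 1 + y + y ^ 2 / 2 <= exp y.
Proof.
  intros Hy. pose proof (is_derive_mono (fun y => exp y - (1 + y + y ^ 2 / 2)) (fun y => exp y - (1 + y)) 0 y Hy) as H.
  cbv beta in H. rewrite exp_0 in H. assert (1 - (1 + 0 + 0 ^ 2 / 2) <= exp y - (1 + y + y ^ 2 / 2)); [|lra].
  apply H; intros x Hx; [auto_derive; auto; field|pose proof (exp_ineq1_le x); lra].
Qed.

Lemma exp_taylor_3 y : 0 <= y -> 1 + y + y ^ 2 / 2 + y ^ 3 / 6 <= exp y.
Proof.
  intros Hy. pose proof (is_derive_mono (fun y => exp y - (1 + y + y ^ 2 / 2 + y ^ 3 / 6)) (fun y => exp y - (1 + y + y ^ 2 / 2)) 0 y Hy) as H.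
  cbv beta in H. rewrite exp_0 in H. assert (1 - (1 + 0 + 0 ^ 2 / 2 + 0 ^ 3 / 6) <= exp y - (1 + y + y ^ 2 / 2 + y ^ 3 / 6)); [|lra].
  apply H; intros x Hx; [auto_derive; auto; field|pose proof (exp_taylor_2 x); lra].
Qed.

Lemma exp_half_lb : 1.648671 <= exp (1 / 2).
Proof.
  assert (H4 : 1.064493 <= exp (1 / 16)) by (pose proof (exp_taylor_3 (1 / 16)); lra).
  assert (H3 : 1.13314 <= exp (1 / 8)) by (replace (1 / 8) with (1 / 16 + 1 / 16) by field; rewrite exp_plus; nra).
  assert (H2 : 1.284006 <= exp (1 / 4)) by (replace (1 / 4) with (1 / 8 + 1 / 8) by field; rewrite exp_plus; nra).
  replace (1 / 2) with (1 / 4 + 1 / 4) by field; rewrite exp_plus; nra.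
Qed.

Lemma exp_1_lb : 2.718116 <= exp 1.
Proof.
  pose proof exp_half_lb. replace 1 with (1 / 2 + 1 / 2) by field. rewrite exp_plus. nra.
Qed.

Lemma exp_3_lb : 20.0812 <= exp 3.
Proof.
  pose proof exp_1_lb as E. replace 3 with (1 + 1 + 1) by ring. rewrite !exp_plus.
  assert (E2 : 7.38815 <= exp 1 * exp 1) by nra. nra.
Qed.

Lemma exp_m3 : exp (- (3)) <= 0.0498.
Proof.
  rewrite exp_Ropp. pose proof exp_3_lb. apply Rle_trans with (/ 20.0812); [apply Rinv_le_contravar; lra|lra].
Qed.

(** 10.46 lies just below 2.302 * 4.487 + 0.14, the lower bound for u = ln (ln x / 2) in the least
    range of the theorem. The value 13.6 is a lower bound for exp (10.46 / 4). *)
Lemma exp_quarter u : 10.46 <= u -> 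
  13.6 * (1 + (u - 10.46) / 4 + ((u - 10.46) / 4) ^ 2 / 2) <= exp (u / 4).
Proof.
  intros H. set (w := (u - 10.46) / 4). assert (Hw : 0 <= w) by (unfold w; lra).
  replace (u / 4) with (2.615 + w) by (unfold w; lra). rewrite exp_plus.
  pose proof (exp_taylor_2 w Hw). apply Rmult_le_compat; try lra; [nra|].
  replace 2.615 with (1 + 1 + 1 / 2 + 0.115) by lra. rewrite !exp_plus.
  pose proof exp_1_lb as E. pose proof exp_half_lb as E1. pose proof (exp_taylor_2 0.115).
  assert (E2 : 7.38815 <= exp 1 * exp 1) by nra.
  assert (E3 : 12.18 <= exp 1 * exp 1 * exp (1 / 2)) by nra.
  assert (E4 : 1.1216 <= exp 0.115) by lra. nra.
Qed.

Lemma exp_4 u : exp u = exp (u / 4) ^ 4.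
Proof. simpl. rewrite Rmult_1_r, <- !exp_plus. f_equal. field. Qed.

(* The exponents come from [lam = 3 u / 2] and the abscissa [1 / 2 + b], [b = 2 / u], so that [lam * b = 3]. *)
Lemma num_P0 u : 10.46 <= u -> 3 / 2 * u * (exp (3 / 4 * u - 6) / (1 / 2 - 4 / u)) <= 0.026 * exp u.
Proof.
  intros H. pose proof (exp_quarter u H) as Q. set (w := (u - 10.46) / 4) in *. assert (Hw : 0 <= w) by (unfold w; lra).
  assert (Eu : u = 10.46 + 4 * w) by (unfold w; lra).
  replace (exp u) with (exp (3 / 4 * u - 6) * exp (u / 4) * exp 6) by (rewrite <- !exp_plus; f_equal; field).
  assert (E6 : 403.2 <= exp 6).
  { replace 6 with (3 + 3) by ring. rewrite exp_plus. pose proof exp_3_lb.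
    nra. }
  assert (D : 0 < u / 2 - 4) by lra.
  replace (3 / 2 * u * (exp (3 / 4 * u - 6) / (1 / 2 - 4 / u))) with (exp (3 / 4 * u - 6) * (3 / 2 * u * u / (u / 2 - 4))) by (field; lra).
  replace (0.026 * (exp (3 / 4 * u - 6) * exp (u / 4) * exp 6)) with (exp (3 / 4 * u - 6) * (0.026 * (exp (u / 4) * exp 6))) by ring. apply Rmult_le_compat_l; [apply Rlt_le, exp_pos|].
  apply (Rmult_le_reg_r (u / 2 - 4)); auto. replace (3 / 2 * u * u / (u / 2 - 4) * (u / 2 - 4)) with (3 / 2 * u * u) by (field; lra).
  assert (5483 * (1 + w + w ^ 2 / 2) <= exp (u / 4) * exp 6) by nra.
  apply Rle_trans with (0.026 * (5483 * (1 + w + w ^ 2 / 2)) * (u / 2 - 4)); [|apply Rmult_le_compat_r; lra].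
  rewrite Eu. nra.
Qed.

Lemma num_P u : 10.46 <= u -> 3 / 2 * u * (exp (3 / 4 * u - 3) / (1 / 2 - 2 / u)) <= 0.2 * exp u.
Proof.
  intros H. pose proof (exp_quarter u H) as Q. set (w := (u - 10.46) / 4) in *. assert (Hw : 0 <= w) by (unfold w; lra).
  assert (Eu : u = 10.46 + 4 * w) by (unfold w; lra).
  replace (exp u) with (exp (3 / 4 * u - 3) * exp (u / 4) * exp 3) by (rewrite <- !exp_plus; f_equal; field).
  assert (E6 : 20.08 <= exp 3).
  { pose proof exp_3_lb. lra. }
  assert (D : 0 < u / 2 - 2) by lra.
  replace (3 / 2 * u * (exp (3 / 4 * u - 3) / (1 / 2 - 2 / u))) with (exp (3 / 4 * u - 3) * (3 / 2 * u * u / (u / 2 - 2))) by (field; lra).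
  replace (0.2 * (exp (3 / 4 * u - 3) * exp (u / 4) * exp 3)) with (exp (3 / 4 * u - 3) * (0.2 * (exp (u / 4) * exp 3))) by ring. apply Rmult_le_compat_l; [apply Rlt_le, exp_pos|].
  apply (Rmult_le_reg_r (u / 2 - 2)); auto. replace (3 / 2 * u * u / (u / 2 - 2) * (u / 2 - 2)) with (3 / 2 * u * u) by (field; lra).
  assert (273 * (1 + w + w ^ 2 / 2) <= exp (u / 4) * exp 3) by nra.
  apply Rle_trans with (0.2 * (273 * (1 + w + w ^ 2 / 2)) * (u / 2 - 2)); [|apply Rmult_le_compat_r; lra].
  rewrite Eu. nra.
Qed.

Lemma num_cube u : 10.46 <= u -> u ^ 3 <= 0.036 * exp u.
Proof.
  intros H. pose proof (exp_quarter u H) as Q. set (w := (u - 10.46) / 4) in *. assert (Hw : 0 <= w) by (unfold w; lra).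
  assert (Eu : u = 10.46 + 4 * w) by (unfold w; lra). rewrite exp_4.
  assert (Q1 : 13.6 * (1 + w) <= exp (u / 4)) by nra.
  apply Rle_trans with (0.036 * (13.6 * (1 + w)) ^ 4); [|apply Rmult_le_compat_l; [lra|apply pow_incr; nra]].
  rewrite Eu. assert (Z : 0 <= w * w) by nra. assert (Z3 : 0 <= w * w * w) by nra. assert (Z4 : 0 <= w * w * w * w) by nra. ring_simplify. nra.
Qed.

Lemma num_big u : 10.46 <= u -> 34000 <= exp u.
Proof. intros H. pose proof (num_cube u H). 
  pose proof (exp_quarter u H) as Q. rewrite exp_4. 
  assert (Q1 : 13.6 <= exp (u / 4)) by (assert (0 <= ((u - 10.46) / 4) ^ 2) by apply pow2_ge_0; lra).
  apply Rle_trans with (13.6 ^ 4); [lra|apply pow_incr; lra].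
Qed.

(** * Power sums up to exp lam *)

Lemma is_derive_rp t q : 0 < t -> is_derive (fun t => rp t q) t (- q * rp t (q + 1)).
Proof.
  intros H. replace (rp t (q + 1)) with (rp t q * / t) by (rewrite rp_plus, rp_1; auto). unfold rp. auto_derive; auto. field. lra.
Qed.

Lemma rp_sum_power N q : 0 < q < 1 -> (1 - q) * rsum (fun n => rp (INR (S n)) q) (S N) <= rp (INR (S N)) (q - 1).
Proof.
  intros Hq. induction N as [|N IH].
  - cbn [rsum]. change (INR 1) with 1. unfold rp. rewrite ln_1, !Rmult_0_r, exp_0. lra.
  - cbn [rsum] in *. pose proof (INR_S_ge1 N) as H1. rewrite (S_INR (S N)) in *. set (y := INR (S N)) in *.
    pose proof (is_derive_mono (fun t => rp t (q - 1) - (1 - q) * rp (y + 1) q * t) (fun t => - (q - 1) * rp t (q - 1 + 1) - (1 - q) * rp (y + 1) q) y (y + 1) ltac:(lra)) as M.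
    cbv beta in M. assert (rp y (q - 1) - (1 - q) * rp (y + 1) q * y <= rp (y + 1) (q - 1) - (1 - q) * rp (y + 1) q * (y + 1)); [|lra].
    apply M.
    + intros t Ht. apply (is_derive_minus (V := R_NormedModule)); [apply is_derive_rp; lra|auto_derive; auto; ring].
    + intros t Ht. replace (q - 1 + 1) with q by ring. pose proof (rp_le_base t (y + 1) q ltac:(lra) ltac:(lra) ltac:(lra)). nra.
Qed.

Lemma rp_sum_exp N lam q : INR N <= exp lam -> 0 < q < 1 ->
  rsum (fun n => rp (INR (S n)) q) N <= exp (lam * (1 - q)) / (1 - q).
Proof.
  intros HN Hq. destruct N as [|N]; [cbn [rsum]; apply Rlt_le, Rdiv_lt_0_compat; [apply exp_pos|lra]|].
  apply (Rmult_le_reg_l (1 - q)); [lra|]. eapply Rle_trans; [apply rp_sum_power; auto|].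
  replace ((1 - q) * (exp (lam * (1 - q)) / (1 - q))) with (exp (lam * (1 - q))) by (field; lra).
  unfold rp. apply exp_le. replace (- (q - 1)) with (1 - q) by ring. rewrite Rmult_comm. apply Rmult_le_compat_r; [lra|].
  rewrite <- (ln_exp lam). apply ln_le; auto. apply lt_0_INR. lia.
Qed.

Lemma Sabs_exp N lam q : INR N <= exp lam -> 0 < q < 1 -> 0 <= lam ->
  Sabs N q <= lam * (exp (lam * (1 - q)) / (1 - q)).
Proof.
  intros HN Hq Hl. eapply Rle_trans; [|apply Rmult_le_compat_l; [auto|apply (rp_sum_exp N lam q HN Hq)]].
  apply rsum_nonneg_le_scal. intros n Hn. apply Rmult_le_compat_r; [apply Rlt_le, rp_pos|].
  rewrite <- (ln_exp lam). apply ln_le; [apply lt_0_INR; lia|]. eapply Rle_trans; [|exact HN]. apply le_INR. lia.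
Qed.

Lemma exp_nfloor lam : exists N, INR N <= exp lam < INR (S N).
Proof. destruct (nfloor_ex (exp lam) ltac:(apply Rlt_le, exp_pos)) as [N HN]. exists N. rewrite S_INR. auto. Qed.

(** ** The logarithm of zeta near the critical line *)

Lemma Nz_om u t : 10.46 <= u -> 0 <= Nz t <= 1.01 * om (exp u) t.
Proof.
  intros Hu. pose proof (num_big u Hu) as B. pose proof (om_ge (exp u) t) as O. pose proof (Rabs_pos t).
  assert (ln (Rabs t + 6) <= om (exp u) t).
  { apply ln_le; [lra|]. pose proof (exp_ineq1_le (exp u)). lra. }
  assert (0 <= ln (Rabs t + 6)) by (apply ln_nonneg; lra). unfold Nz. lra.
Qed.

Lemma num_u u : 10.46 <= u -> u <= 0.00034 * exp u.
Proof. intros H. pose proof (num_cube u H). pose proof (exp_pos u). nra. Qed.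

Lemma ln_105 : ln 105 <= 4.8.
Proof.
  rewrite <- (ln_exp 4.8). apply ln_le; [lra|]. pose proof exp_3_lb. pose proof exp_1_lb. pose proof (exp_taylor_2 0.8).
  replace 4.8 with (3 + 1 + 0.8) by lra. rewrite !exp_plus. assert (2.12 <= exp 0.8) by lra.
  assert (54 <= exp 3 * exp 1) by nra. nra.
Qed.

Section RHsec.
Hypothesis RH : RiemannHypothesis.
Variable u : R.
Hypothesis Hu : 10.46 <= u.

Let l := exp u.
Let lam := 3 / 2 * u.
Let b := 2 / u.

Lemma b_range : 0 < b <= 0.1913.
Proof.
  unfold b. split; [apply Rdiv_lt_0_compat; lra|]. apply (Rmult_le_reg_r u); [lra|]. replace (2 / u * u) with 2 by (field; lra). lra.
Qed.

Section N.
Variable N : nat.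
Hypothesis HN : INR N <= exp lam < INR (S N).

Lemma Sabs_half : Sabs N (1 / 2 + b) <= 0.2 * l.
Proof.
  pose proof b_range as Hb. eapply Rle_trans; [apply (Sabs_exp N lam); [apply HN|lra|unfold lam; lra]|].
  eapply Rle_trans; [|apply (num_P u Hu)]. right. unfold lam, b. 
  replace (1 - (1 / 2 + 2 / u)) with (1 / 2 - 2 / u) by (field; lra). do 3 f_equal; field; lra.
Qed.

Lemma Sabs_a0 : Sabs N (1 / 2 + 2 * b) <= 0.026 * l.
Proof.
  pose proof b_range as Hb. eapply Rle_trans; [apply (Sabs_exp N lam); [apply HN|lra|unfold lam; lra]|].
  eapply Rle_trans; [|apply (num_P0 u Hu)]. right. unfold lam, b. 
  replace (1 - (1 / 2 + 2 * (2 / u))) with (1 / 2 - 4 / u) by (field; lra). do 3 f_equal; field; lra.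
Qed.

(** [half_plane] divided by |s - 1|. For |t| >= 100 the quotient |s + 1| / |s - 1| is at most 1.02,
    and the term -1 of [Rz] costs 0.01; the corrections of relative size ln l / l turn 1.02 into
    1.022. *)
Lemma fine_bound K1 t a : 0 <= K1 -> (forall y, Cmod (Ez (cc (1 / 2 + b) y)) <= K1 * om l y) -> 100 <= Rabs t -> b < a <= 1 ->
  Cmod (Ez (cc (1 / 2 + a) t) + SV N (cc (1 / 2 + a) t)) <= 1.022 * exp (- lam * (a - b)) * (K1 * om l t + 0.2 * l + 1) + 0.01.
Proof.
  intros HK HE Ht Ha. pose proof b_range as Hb. pose proof (num_big u Hu) as Bl. fold l in Bl.
  pose proof (half_plane RH lam b l K1 (0.2 * l) N t a ltac:(lra) ltac:(lra) ltac:(unfold lam; lra) (proj2 HN) HK HE Sabs_half (proj1 Ha)) as Q.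
  set (p := cc (1 / 2 + a) t) in *. set (X := (Ez p + SV N p)%C).
  assert (Hd : 100 <= Cmod (p - 1)).
  { eapply Rle_trans; [exact Ht|]. eapply Rle_trans; [|apply Rabs_Im_le]. unfold p; simpl. right. f_equal. ring. }
  assert (HD : Cmod (p + 1) <= Cmod (p - 1) + 2).
  { replace (p + 1)%C with ((p - 1) + 2)%C by (apply C_eta; simpl; ring). eapply Rle_trans; [apply Cmod_triangle|]. rewrite Cmod_R, Rabs_pos_eq; lra. }
  set (d := Cmod (p - 1)) in *.
  assert (R1 : d * Cmod X <= 1 + Cmod (Rz N p)).
  { unfold d. rewrite <- Cmod_mult. replace ((p - 1) * X)%C with (1 + Rz N p)%C by (unfold Rz, X; ring).
    eapply Rle_trans; [apply Cmod_triangle|]. rewrite Cmod_1. lra. }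
  assert (L1 : 0 <= ln (1 + l) / l <= 0.0004).
  { split; [apply Rdiv_le_0_compat; [apply ln_nonneg; lra|lra]|]. apply (Rmult_le_reg_r l); [lra|].
    replace (ln (1 + l) / l * l) with (ln (1 + l)) by (field; lra).
    assert (ln (1 + l) <= u + 1).
    { apply Rle_trans with (ln (exp (u + 1))); [|rewrite ln_exp; lra]. apply ln_le; [lra|]. rewrite exp_plus. fold l. pose proof exp_1_lb. nra. }
    pose proof (num_u u Hu) as Z. fold l in Z. lra. }
  assert (L2 : 0 <= (a - b) / l <= 0.0001).
  { split; [apply Rdiv_le_0_compat; lra|]. apply (Rmult_le_reg_r l); [lra|].
    replace ((a - b) / l * l) with (a - b) by (field; lra). lra. }
  set (q1 := ln (1 + l) / l) in *. set (q2 := (a - b) / l) in *.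
  set (e := exp (- lam * (a - b))) in *. assert (He : 0 < e) by apply exp_pos.
  assert (HQ : 0 <= K1 * om l t + 0.2 * l + 1).
  { pose proof (om_ge l t). assert (0 <= K1 * om l t) by (apply Rmult_le_pos; lra). lra. }
  set (Y := K1 * om l t + 0.2 * l + 1) in *.
  assert (HeY : 0 <= e * Y) by (apply Rmult_le_pos; lra).
  assert (R2 : Cmod (Rz N p) <= d * (1.022 * (e * Y))).
  { eapply Rle_trans; [exact Q|]. replace (Cmod (p + 1) * (1 + q2) * e * ((1 + q1) * Y)) with (Cmod (p + 1) * ((1 + q2) * (1 + q1) * (e * Y))) by ring.
    assert (Hq : 0 <= (1 + q2) * (1 + q1) <= 1.001) by nra.
    apply Rle_trans with (1.02 * d * (1.001 * (e * Y))).
    - apply Rmult_le_compat; [apply Cmod_ge_0|apply Rmult_le_pos; lra|lra|apply Rmult_le_compat_r; lra].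
    - replace (1.02 * d * (1.001 * (e * Y))) with (d * ((1.02 * 1.001) * (e * Y))) by ring. apply Rmult_le_compat_l; [lra|]. apply Rmult_le_compat_r; lra. }
  apply (Rmult_le_reg_l d); [lra|]. nra.
Qed.

(* [Ez_half] moves a bound from abscissa 1/2 + 2b to 1/2 + b at the cost of a factor 4, while
   [half_plane] moves it back and gains exp (- 3): the composition is a contraction. *)
Lemma closure_step K : 0 <= K -> (forall y, Cmod (Ez (cc (1 / 2 + b) y) + RtoC (Nz y)) <= K * om l y) ->
  forall y, Cmod (Ez (cc (1 / 2 + b) y) + RtoC (Nz y)) <= (5 + 0.21 * K) * om l y.
Proof.
  intros HK HE y. pose proof b_range as Hb. pose proof (num_big u Hu) as Bl. pose proof (om_ge l y) as O. fold l in Bl.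
  pose proof (Nz_om u y Hu) as NO. fold l in NO.
  destruct (Rle_lt_dec 100 (Rabs y)) as [H|H].
  - pose proof (Ez_half RH (2 * b) y ltac:(lra)) as E. replace (2 * b / 2) with b in E by field.
    assert (HE1 : forall y, Cmod (Ez (cc (1 / 2 + b) y)) <= (K + 1.01) * om l y).
    { intros z. replace (Ez (cc (1 / 2 + b) z)) with ((Ez (cc (1 / 2 + b) z) + RtoC (Nz z)) - RtoC (Nz z))%C by ring.
      eapply Rle_trans; [apply Cmod_minus_le|]. specialize (HE z). pose proof (Nz_om u z Hu) as NZ. fold l in NZ.
      rewrite Cmod_R, Rabs_pos_eq by lra. lra. }
    pose proof (fine_bound (K + 1.01) y (2 * b) ltac:(lra) HE1 H ltac:(lra)) as F.
    replace (- lam * (2 * b - b)) with (- (3)) in F by (unfold lam, b; field; lra). pose proof exp_m3 as E3.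
    pose proof (exp_pos (- (3))) as E0.
    pose proof (SV_abs N (1 / 2 + 2 * b, y) (1 / 2 + 2 * b) ltac:(simpl; lra)) as S1. pose proof Sabs_a0 as S2.
    set (p := cc (1 / 2 + 2 * b) y) in *.
    assert (G : Cmod (Ez p + RtoC (Nz y)) <= Cmod (Ez p + SV N p) + Cmod (SV N p) + Nz y).
    { replace (Ez p + RtoC (Nz y))%C with ((Ez p + SV N p) - SV N p + RtoC (Nz y))%C by ring.
      eapply Rle_trans; [apply Cmod_triangle|]. rewrite Cmod_R, (Rabs_pos_eq (Nz y)) by lra.
      apply Rplus_le_compat_r. apply Cmod_minus_le. }
    assert (N1 : Nz y <= om l y + 3.5).
    { unfold Nz. pose proof (Rabs_pos y). assert (ln (Rabs y + 6) <= om l y); [|lra].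
      apply ln_le; [lra|]. pose proof (exp_ineq1_le l). lra. }
    assert (KO : 0 <= K * om l y) by (apply Rmult_le_pos; lra).
    (* The contraction factor is 4 * 1.022 * 0.0498 < 0.21. *)
    assert (1.022 * exp (- (3)) * ((K + 1.01) * om l y + 0.2 * l + 1) <= 1.022 * 0.0498 * ((K + 1.01) * om l y + 0.2 * l + 1)).
    { apply Rmult_le_compat_r; [lra|]. apply Rmult_le_compat_l; lra. }
    lra.
  - assert (LK : 0 <= K * om l y) by (apply Rmult_le_pos; lra).
    eapply Rle_trans; [apply Cmod_triangle|]. rewrite Cmod_R, (Rabs_pos_eq (Nz y)) by lra.
    pose proof (Ez_crude RH b (1 / 2 + b, y) ltac:(lra) ltac:(simpl; lra)) as C. simpl in C.
    assert (B3 : 22 * ln (Rabs y + 5) / b ^ 3 <= 22 / 8 * 4.8 * u ^ 3).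
    { pose proof ln_105. assert (ln (Rabs y + 5) <= ln 105) by (apply ln_le; [pose proof (Rabs_pos y); lra|lra]).
      replace (22 * ln (Rabs y + 5) / b ^ 3) with (22 / 8 * u ^ 3 * ln (Rabs y + 5)) by (unfold b; field; lra).
      assert (0 <= u ^ 3) by (apply pow_le; lra). nra. }
    pose proof (num_cube u Hu) as U. fold l in U. 
    replace (b * (b * (b * 1))) with (b ^ 3) in C by ring. lra.
Qed.

End N.

(** The map K -> 5 + 0.21 K sends 6.5 below itself, so iterating from the crude constant [K0] gives
    6.5 + K0 * 0.21^n. Once the second term is at most 0.4, removing [Nz] <= 1.01 om leaves less
    than 8. *)
Lemma Ez_left y : Cmod (Ez (cc (1 / 2 + b) y)) <= 8 * om l y.
Proof.
  pose proof b_range as Hb. destruct (exp_nfloor lam) as [N HN]. pose proof (num_big u Hu) as Bl. fold l in Bl.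
  set (K0 := 22 / b ^ 3 + 1.01).
  assert (P3 : 0 < 22 / b ^ 3) by (apply Rdiv_lt_0_compat; [lra|apply pow_lt; lra]).
  assert (I : forall n : nat, forall y, Cmod (Ez (cc (1 / 2 + b) y) + RtoC (Nz y)) <= (6.5 + K0 * 0.21 ^ n) * om l y).
  { induction n as [|n IH].
    - intros z. pose proof (om_ge l z). pose proof (Nz_om u z Hu) as NZ. fold l in NZ.
      eapply Rle_trans; [apply Cmod_triangle|]. rewrite Cmod_R, (Rabs_pos_eq (Nz z)) by lra.
      pose proof (Ez_crude RH b (1 / 2 + b, z) ltac:(lra) ltac:(simpl; lra)) as C. simpl Im in C.
      assert (22 * ln (Rabs z + 5) / b ^ 3 <= 22 / b ^ 3 * om l z).
      { replace (22 * ln (Rabs z + 5) / b ^ 3) with (22 / b ^ 3 * ln (Rabs z + 5)) by (field; lra).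
        apply Rmult_le_compat_l; [lra|]. pose proof (Rabs_pos z). apply ln_le; [lra|]. pose proof (exp_ineq1_le l). lra. }
      change (0.21 ^ 0) with 1. unfold K0. lra.
    - intros z. assert (P : 0 <= K0 * 0.21 ^ n) by (apply Rmult_le_pos; [unfold K0; lra|apply pow_le; lra]).
      eapply Rle_trans; [apply (closure_step N HN (6.5 + K0 * 0.21 ^ n)); [lra|exact IH]|]. pose proof (om_ge l z).
      apply Rmult_le_compat_r; [lra|]. simpl pow. lra. }
  assert (K0p : 0 < K0) by (unfold K0; lra).
  destruct (pow_lt_1_zero 0.21 ltac:(rewrite Rabs_pos_eq; lra) (0.4 / K0) ltac:(apply Rdiv_lt_0_compat; lra)) as [n Hn].
  specialize (Hn n (Nat.le_refl _)). rewrite Rabs_pos_eq in Hn by (apply pow_le; lra).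
  specialize (I n y). pose proof (Nz_om u y Hu) as NZ. fold l in NZ. pose proof (om_ge l y) as O.
  assert (K0 * 0.21 ^ n <= 0.4).
  { apply Rlt_le in Hn. apply (Rmult_le_compat_l K0) in Hn; [|lra]. replace (K0 * (0.4 / K0)) with 0.4 in Hn by (field; lra). auto. }
  replace (Ez (cc (1 / 2 + b) y)) with ((Ez (cc (1 / 2 + b) y) + RtoC (Nz y)) - RtoC (Nz y))%C by ring.
  eapply Rle_trans; [apply Cmod_minus_le|]. rewrite Cmod_R, (Rabs_pos_eq (Nz y)) by lra. nra.
Qed.

Lemma Re_Ez_bound N : INR N <= exp lam < INR (S N) -> forall t a, 100 <= Rabs t -> b < a <= 1 ->
  Rabs (Re (Ez (cc (1 / 2 + a) t))) <= Sabs N (1 / 2 + a) + 8.5 * om l t * exp (- lam * (a - b)) + 0.01.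
Proof.
  intros HN t a Ht Ha. pose proof (num_big u Hu) as Bl. fold l in Bl. pose proof (om_ge l t) as O.
  pose proof (fine_bound N HN 8 t a ltac:(lra) Ez_left Ht Ha) as F.
  pose proof (SV_abs N (cc (1 / 2 + a) t) (1 / 2 + a) ltac:(simpl; lra)) as S1.
  eapply Rle_trans; [apply Rabs_Re_le|]. set (p := cc (1 / 2 + a) t) in *.
  replace (Ez p) with ((Ez p + SV N p) - SV N p)%C by ring. eapply Rle_trans; [apply Cmod_minus_le|].
  pose proof (exp_pos (- lam * (a - b))). assert (1.022 * (8 * om l t + 0.2 * l + 1) <= 8.5 * om l t) by lra. nra.
Qed.

Lemma is_derive_Hsum N t : is_derive (fun a => rsum (fun n => rp (INR (S n)) (1 / 2 + a)) N) t (- Sabs N (1 / 2 + t)).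
Proof.
  induction N as [|N IH]; unfold Sabs in *; cbn [rsum].
  - rewrite Ropp_0. apply (is_derive_const (V := R_NormedModule)).
  - replace (- (rsum (fun n => ln (INR (S n)) * rp (INR (S n)) (1 / 2 + t)) N + ln (INR (S N)) * rp (INR (S N)) (1 / 2 + t)))
      with (- rsum (fun n => ln (INR (S n)) * rp (INR (S n)) (1 / 2 + t)) N + - (ln (INR (S N)) * rp (INR (S N)) (1 / 2 + t))) by ring.
    apply (is_derive_plus (V := R_NormedModule)); auto. unfold rp. set (c := ln (INR (S N))). auto_derive; auto. ring.
Qed.

(** [Re_Ez_bound] is integrated from a to 1 through monotonicity of an explicit primitive: [Sabs]
    integrates to the power sum [Hs], and the exponential term gains 1 / lam. The constant is (0.026
    + 8.5 * 0.0498) * 2/3 < 0.3, and the two signs serve zeta and 1/zeta. *)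
Lemma ln_zf_var t a sg : sg = 1 \/ sg = -1 -> 100 <= Rabs t -> 2 * b <= a <= 1 ->
  sg * (ln (Cmod (zf 0 (cc (1 / 2 + a) t))) - ln (Cmod (zf 0 (cc (1 / 2 + 1) t)))) <= 0.3 / u * om l t + 0.01.
Proof.
  intros Hsg Ht Ha. destruct (exp_nfloor lam) as [N HN]. pose proof b_range as Hb. pose proof (num_big u Hu) as Bl. fold l in Bl.
  pose proof (om_ge l t) as O. assert (Hlam : 15 <= lam) by (unfold lam; lra).
  set (phi := fun a => ln (Cmod (zf 0 (cc (1 / 2 + a) t)))).
  set (Hs := fun a => rsum (fun n => rp (INR (S n)) (1 / 2 + a)) N).
  set (c := 8.5 * om l t).
  pose proof (is_derive_mono (fun a => sg * phi a - Hs a - c / lam * exp (- lam * (a - b)) + 0.01 * a)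
    (fun a => sg * Re (Ez (cc (1 / 2 + a) t)) - - Sabs N (1 / 2 + a) + c * exp (- lam * (a - b)) + 0.01) a 1 ltac:(lra)) as M.
  cbv beta in M.
  assert (K : sg * phi a - Hs a - c / lam * exp (- lam * (a - b)) + 0.01 * a <= sg * phi 1 - Hs 1 - c / lam * exp (- lam * (1 - b)) + 0.01 * 1).
  { apply M; clear M; intros x Hx.
    - apply (is_derive_plus (V := R_NormedModule)); [|auto_derive; auto; ring].
      unfold Rminus at 2. unfold Rminus at 3.
      replace (c * exp (- lam * (x - b))) with (- (- (c * exp (- lam * (x - b))))) by ring.
      apply (is_derive_minus (V := R_NormedModule) (fun x => sg * phi x - Hs x) (fun x => c / lam * exp (- lam * (x + - b)))).
      + apply (is_derive_minus (V := R_NormedModule)); [|apply is_derive_Hsum].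
        apply (is_derive_scal phi x sg). apply ln_zf_der; auto; lra.
      + auto_derive; auto. unfold Rminus. field. lra.
    - pose proof (Re_Ez_bound N HN t x Ht ltac:(lra)) as Q. fold c in Q. apply Rabs_le_between in Q.
      destruct Hsg; subst sg; lra. }
  clear M.
  assert (H1 : 0 <= Hs 1) by (apply rsum_nonneg; intros; apply Rlt_le, rp_pos).
  assert (H2 : Hs a <= 0.026 * l / lam).
  { apply Rle_trans with (Hs (2 * b)).
    - apply rsum_le. intros n _. apply rp_le_exp; [apply INR_S_ge1|lra].
    - eapply Rle_trans; [apply (rp_sum_exp N lam); [apply HN|lra]|].
      apply (Rmult_le_reg_l lam); [lra|]. replace (lam * (0.026 * l / lam)) with (0.026 * exp u) by (unfold l; field; lra).
      eapply Rle_trans; [|apply (num_P0 u Hu)]. right. unfold lam, b. 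
      replace (1 - (1 / 2 + 2 * (2 / u))) with (1 / 2 - 4 / u) by (field; lra). do 3 f_equal; field; lra. }
  assert (Hc : 0 < c / lam) by (apply Rdiv_lt_0_compat; unfold c; lra).
  assert (H3 : exp (- lam * (a - b)) <= 0.0498).
  { eapply Rle_trans; [|apply exp_m3]. apply exp_le. replace 3 with (lam * b) by (unfold lam, b; field; lra). nra. }
  pose proof (exp_pos (- lam * (1 - b))) as H4.
  assert (c / lam * exp (- lam * (a - b)) <= c / lam * 0.0498) by (apply Rmult_le_compat_l; lra).
  assert (0 < c / lam * exp (- lam * (1 - b))) by (apply Rmult_lt_0_compat; lra).
  assert (0.026 * l / lam + c / lam * 0.0498 <= 0.3 / u * om l t).
  { replace (0.026 * l / lam + c / lam * 0.0498) with ((0.026 * l + 8.5 * 0.0498 * om l t) * (2 / 3) / u) by (unfold lam, c; field; lra).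
    replace (0.3 / u * om l t) with (0.3 * om l t / u) by (field; lra).
    apply Rmult_le_compat_r; [apply Rlt_le, Rinv_0_lt_compat; lra|]. lra. }
  fold (phi a). fold (phi 1). lra.
Qed.

(** Since om >= exp u, there is ample room for bounded factors beside the variation 0.3 / u * om of
    [ln_zf_var]. *)
Lemma thom t : 1400 <= 0.5 / u * om l t.
Proof.
  pose proof (om_ge l t). pose proof (num_u u Hu) as Z. fold l in Z.
  replace (0.5 / u * om l t) with (0.5 * om l t / u) by (field; lra). apply (proj1 (Rle_div_r _ _ u ltac:(lra))). lra.
Qed.

(** A bound for 1/zeta = (s - 1) / f, with no exception at s = 1. Right of 3/2 it comes from the
    Möbius series, for |t| >= 100 from the variation up to abscissa 3/2, and for smaller heights
    from the crude bound, of order u^2, far below exp u / u. *)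
Lemma inv_zeta_bound s : 1 / 2 + 2 * b <= Re s -> Cmod (s - 1) <= exp (0.5 / u * om l (Im s)) * Cmod (zf 0 s).
Proof.
  intros Hs. pose proof b_range as Hb. pose proof (thom (Im s)) as T. pose proof (Cmod_ge_0 (zf 0 s)) as Z0.
  destruct (Rle_lt_dec (3 / 2) (Re s)) as [H|H].
  - eapply Rle_trans; [apply zf_low_32; auto|]. apply Rmult_le_compat_r; auto. pose proof (exp_ineq1_le (0.5 / u * om l (Im s))). lra.
  - assert (P : 0 < Cmod (zf 0 s)) by (apply Cmod_gt_0, zf_neq_0; auto; lra).
    rewrite <- (exp_ln (Cmod (zf 0 s))) by auto. rewrite <- exp_plus.
    destruct s as [x t]. set (a := x - 1 / 2). simpl Re in *. simpl Im in *.
    replace x with (1 / 2 + a) in * by (unfold a; ring).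
    destruct (Rle_lt_dec 100 (Rabs t)) as [Ht|Ht].
    + pose proof (ln_zf_var t a (-1) (or_intror eq_refl) Ht ltac:(lra)) as V.
      assert (S1 : Cmod (cc (1 / 2 + a) t - 1) <= Cmod (cc (1 / 2 + 1) t - 1)).
      { apply Rsqr_incr_0; [|apply Cmod_ge_0..]. unfold Rsqr. rewrite !Cmod_sqr. simpl. nra. }
      assert (S2 : Cmod (cc (1 / 2 + 1) t - 1) <= 3 * Cmod (zf 0 (cc (1 / 2 + 1) t))) by (apply zf_low_32; simpl; lra).
      assert (P1 : 0 < Cmod (zf 0 (cc (1 / 2 + 1) t))) by (apply Cmod_gt_0, zf_neq_0; auto; simpl; lra).
      apply Rle_trans with (exp 2 * exp (ln (Cmod (zf 0 (cc (1 / 2 + 1) t))))).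
      { rewrite exp_ln by auto. eapply Rle_trans; [exact S1|]. eapply Rle_trans; [exact S2|]. apply Rmult_le_compat_r; [lra|].
        pose proof (exp_ineq1_le 2). lra. }
      rewrite <- exp_plus. apply exp_le. lra.
    + pose proof (inv_zf_crude RH (2 * b) (cc (1 / 2 + a) t) ltac:(lra) ltac:(simpl; lra)) as C. simpl Im in C.
      assert (B3 : 6 * ln (Rabs t + 5) / (2 * b) ^ 2 <= 1.8 * u ^ 2).
      { pose proof ln_105. assert (ln (Rabs t + 5) <= ln 105) by (apply ln_le; [pose proof (Rabs_pos t); lra|lra]).
        replace (6 * ln (Rabs t + 5) / (2 * b) ^ 2) with (3 / 8 * u ^ 2 * ln (Rabs t + 5)) by (unfold b; field; lra).
        assert (0 <= u ^ 2) by (apply pow_le; lra). nra. }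
      apply Rle_trans with (exp 101).
      { eapply Rle_trans; [apply Cmod_le_abs|]. simpl. pose proof (exp_ineq1_le 101).
        replace (t - 0) with t by ring. assert (Rabs (1 / 2 + a - 1) <= 1) by (apply Rabs_le; lra). unfold Rminus in *. rewrite ?Ropp_0, ?Rplus_0_r. lra. }
      apply exp_le. pose proof (num_cube u Hu) as U. fold l in U. pose proof (om_ge l t) as O.
      assert (1.8 * u ^ 2 + 101 <= 0.5 / u * om l t); [|lra].
      replace (0.5 / u * om l t) with (0.5 * om l t / u) by (field; lra). apply (proj1 (Rle_div_r _ _ u ltac:(lra))).
      pose proof (num_u u Hu) as Z. fold l in Z. lra.
Qed.

(** The summand 1 accounts for the pole of zeta: at s = 1 the factor s - 1 vanishes while f(1) =
    1. *)
Lemma zeta_bound s : 1 / 2 + 2 * b <= Re s -> Cmod (zf 0 s) <= exp (0.5 / u * om l (Im s)) * (Cmod (s - 1) + 1).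
Proof.
  intros Hs. pose proof b_range as Hb. pose proof (thom (Im s)) as T. pose proof (Cmod_ge_0 (s - 1)) as Z0.
  pose proof (exp_taylor_3 (0.5 / u * om l (Im s)) ltac:(lra)) as ET.
  destruct (Rle_lt_dec (3 / 2) (Re s)) as [H|H].
  - pose proof (Cmod_zt_le s ltac:(lra)) as Q. unfold zt in Q. 
    assert (N1 : (s - 1)%C <> 0%C) by (apply s_neq_1; lra). pose proof (proj1 (Cmod_gt_0 _) N1) as P.
    rewrite Cmod_mult, Cmod_inv in Q by auto.
    assert (I : / (Re s - 1) <= 2) by (replace 2 with (/ (1 / 2)) by field; apply Rinv_le_contravar; lra).
    assert (Q1 : Cmod (zf 0 s) <= 3 * Cmod (s - 1)).
    { apply (Rmult_le_reg_r (/ Cmod (s - 1))); [apply Rinv_0_lt_compat; auto|]. rewrite Rmult_assoc, Rinv_r by lra. lra. }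
    apply Rle_trans with (3 * (Cmod (s - 1) + 1)); [lra|]. apply Rmult_le_compat_r; [lra|].
    pose proof (exp_ineq1_le (0.5 / u * om l (Im s))). lra.
  - destruct s as [x t]. set (a := x - 1 / 2). simpl Re in *. simpl Im in *.
    replace x with (1 / 2 + a) in * by (unfold a; ring).
    destruct (Rle_lt_dec 100 (Rabs t)) as [Ht|Ht].
    + pose proof (ln_zf_var t a 1 (or_introl eq_refl) Ht ltac:(lra)) as V.
      assert (P : 0 < Cmod (zf 0 (cc (1 / 2 + a) t))) by (apply Cmod_gt_0, zf_neq_0; auto; simpl; lra).
      assert (P1 : 0 < Cmod (zf 0 (cc (1 / 2 + 1) t))) by (apply Cmod_gt_0, zf_neq_0; auto; simpl; lra).
      assert (S1 : Cmod (cc (1 / 2 + 1) t - 1) <= Cmod (cc (1 / 2 + a) t - 1) + 1).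
      { replace (cc (1 / 2 + 1) t - 1)%C with ((cc (1 / 2 + a) t - 1) + RtoC (1 - a))%C by (apply C_eta; simpl; ring).
        eapply Rle_trans; [apply Cmod_triangle|]. rewrite Cmod_R, Rabs_pos_eq; lra. }
      assert (S2 : Cmod (zf 0 (cc (1 / 2 + 1) t)) <= 3 * Cmod (cc (1 / 2 + 1) t - 1)).
      { pose proof (Cmod_zt_le (cc (1 / 2 + 1) t) ltac:(simpl; lra)) as Q. unfold zt in Q. 
        assert (N1 : (cc (1 / 2 + 1) t - 1)%C <> 0%C) by (apply s_neq_1; simpl; lra). pose proof (proj1 (Cmod_gt_0 _) N1) as P2.
        rewrite Cmod_mult, Cmod_inv in Q by auto. simpl Re in Q. replace (1 + / (1 / 2 + 1 - 1)) with 3 in Q by field.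
        apply (Rmult_le_reg_r (/ Cmod (cc (1 / 2 + 1) t - 1))); [apply Rinv_0_lt_compat; auto|]. rewrite Rmult_assoc, Rinv_r by lra. lra. }
      rewrite <- (exp_ln (Cmod (zf 0 (cc (1 / 2 + a) t)))) by auto.
      apply Rle_trans with (exp (0.5 / u * om l t - 2 + ln (Cmod (zf 0 (cc (1 / 2 + 1) t))))); [apply exp_le; lra|].
      rewrite exp_plus, exp_ln by auto.
      apply Rle_trans with (exp (0.5 / u * om l t - 2) * (3 * (Cmod (cc (1 / 2 + a) t - 1) + 1))).
      { apply Rmult_le_compat_l; [apply Rlt_le, exp_pos|lra]. }
      rewrite <- Rmult_assoc. apply Rmult_le_compat_r; [lra|].
      apply Rle_trans with (exp (0.5 / u * om l t - 2) * exp 2); [apply Rmult_le_compat_l; [apply Rlt_le, exp_pos|pose proof (exp_ineq1_le 2); lra]|].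
      rewrite <- exp_plus. apply exp_le. lra.
    + eapply Rle_trans; [apply zf_growth; simpl; lra|].
      assert (Cmod (cc (1 / 2 + a) t) <= 102).
      { eapply Rle_trans; [apply Cmod_le_abs|]. simpl. rewrite Rabs_pos_eq; lra. }
      apply Rle_trans with (3 * 103 ^ 3).
      { apply Rmult_le_compat_l; [lra|]. apply pow_incr. pose proof (Cmod_ge_0 (cc (1 / 2 + a) t)). lra. }
      set (T0 := 0.5 / u * om l t) in *.
      assert (1400 ^ 3 <= T0 ^ 3) by (apply pow_incr; lra). assert (0 <= T0 ^ 2) by apply pow2_ge_0.
      pose proof (exp_pos T0). assert (3 * 103 ^ 3 <= exp T0) by lra. nra.
Qed.

End RHsec.

(** ** Perron's formula *)

(** Cauchy's formula read as moving a vertical line across one simple pole; the horizontal sides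
    form the error. Parametrising by t removes the i from 2 pi i. *)
Lemma rect_shift (F F' : C -> C) (p : C) (x0 x1 V ep Mh : R) : 0 < ep -> x0 < Re p < x1 -> - V < Im p < V ->
  hol (fun z => x0 - ep < Re z < x1 + ep) F F' ->
  (forall z, x0 <= Re z <= x1 -> Rabs (Im z) = V -> Cmod (F z * / (z - p)) <= Mh) ->
  Cmod (CI (fun t => F (cc x1 t) * / (cc x1 t - p))%C (- V) V - CI (fun t => F (cc x0 t) * / (cc x0 t - p))%C (- V) V
    - RtoC (2 * PI) * F p) <= 2 * Mh * (x1 - x0).
Proof.
  intros Hep Hx Hy HF HM. assert (HV : 0 < V) by lra.
  pose proof (cauchy_rect F F' p x0 x1 (- V) V ep Hep Hx Hy HF) as E. unfold vert in E.
  assert (Hc : forall y, y = - V \/ y = V -> Cmod (CI (fun t => F (horiz y t) * / (horiz y t - p))%C x0 x1) <= Mh * (x1 - x0)).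
  { intros y Hyy. apply Cmod_CI_const; [lra| |].
    - intros t Ht. apply ctn_mult; [apply (con_horiz _ _ _ y x0 x1 HF); auto; intros; simpl; lra|].
      apply (ctn_comp Cinv (fun t => (horiz y t - p)%C)); [|eapply rder_ctn, horiz_rder].
      apply Cinv_Cctn. intros Z. apply (f_equal Im) in Z. destruct p; simpl in *. destruct Hyy; lra.
    - intros t Ht. apply HM; [exact Ht|]. simpl. destruct Hyy; subst; [rewrite Rabs_left|rewrite Rabs_right]; lra. }
  pose proof (Hc (- V) (or_introl eq_refl)) as H1. pose proof (Hc V (or_intror eq_refl)) as H2.
  set (I1 := CI _ x0 x1) in E, H1. set (I2 := CI _ x0 x1) in E, H2.
  set (L := CI (fun t => F (cc x0 t) * / (cc x0 t - p))%C (- V) V) in *.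
  set (Rr := CI (fun t => F (cc x1 t) * / (cc x1 t - p))%C (- V) V) in *.
  assert (K : (Rr - L - RtoC (2 * PI) * F p)%C = (Ci * (I1 - I2))%C).
  { replace (Ci * (I1 - I2))%C with (Ci * (I1 + Ci * Rr - I2 - Ci * L) - Ci * Ci * (Rr - L))%C by ring.
    rewrite E. replace (Ci * Ci)%C with (- (1))%C by (apply C_eta; simpl; ring).
    replace (Ci * (RtoC (2 * PI) * Ci * F p))%C with ((Ci * Ci) * (RtoC (2 * PI) * F p))%C by ring.
    replace (Ci * Ci)%C with (- (1))%C by (apply C_eta; simpl; ring). ring. }
  rewrite K, Cmod_mult, Cmod_Ci, Rmult_1_l. eapply Rle_trans; [apply Cmod_minus_le|]. lra.
Qed.

Definition ux (u : R) (s : C) : C := cexp (s * RtoC (ln u)).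
(** The Mellin kernel of the weight (1 - 1/u)^+. Its quadratic decay makes the Perron integrals
    absolutely convergent, at the price of smoothed sums. *)
Definition kern (s : C) : C := (/ s * / (s + 1))%C.
Definition pp (y : R) : R := Rmax 0 y.

Lemma Cmod_ux u s : Cmod (ux u s) = exp (Re s * ln u).
Proof. unfold ux. rewrite Cmod_cexp. f_equal. destruct s; simpl; ring. Qed.

Lemma ux_0 u : ux u 0 = 1%C.
Proof. unfold ux. rewrite Cmult_0_l. apply cexp_0. Qed.

Lemma ux_plus u s t : ux u (s + t) = (ux u s * ux u t)%C.
Proof. unfold ux. rewrite <- cexp_plus. f_equal. ring. Qed.

Lemma ux_1 u : 0 < u -> ux u 1 = RtoC u.
Proof. intros H. unfold ux. rewrite Cmult_1_l, cexp_R, exp_ln; auto. Qed.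

Lemma ux_cp u s : ux u s = cp u (- s).
Proof. unfold ux, cp. f_equal. ring. Qed.

Lemma hol_ux D u : hol D (ux u) (fun s => ux u s * (1 * RtoC (ln u) + s * 0))%C.
Proof. apply hol_cexp. apply hol_mult; [apply hol_id|apply hol_const]. Qed.

Lemma hol_inv_shift (D : C -> Prop) (c : C) : (forall z, D z -> (z + c)%C <> 0%C) -> exists G, hol D (fun z => / (z + c))%C G.
Proof.
  intros H. eexists. apply (hol_inv D (fun z => z + c)%C); [apply hol_plus; [apply hol_id|apply hol_const]|auto].
Qed.

Lemma Re_neq_0 z : Re z <> 0 -> z <> 0%C.
Proof. intros H E. apply H. rewrite E. reflexivity. Qed.
Lemma Im_neq_0 z : Im z <> 0 -> z <> 0%C.
Proof. intros H E. apply H. rewrite E. reflexivity. Qed.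

Lemma Cinv_le (z : C) r : 0 < r -> r <= Cmod z -> Cmod (/ z) <= / r.
Proof.
  intros Hr H. rewrite Cmod_inv by (apply Cmod_gt_0; lra). apply Rinv_le_contravar; auto.
Qed.

Lemma kern_le z r1 r2 : 0 < r1 -> 0 < r2 -> r1 <= Cmod z -> r2 <= Cmod (z + 1) -> Cmod (kern z) <= / r1 * / r2.
Proof.
  intros. unfold kern. rewrite Cmod_mult. apply Rmult_le_compat; try apply Cmod_ge_0; apply Cinv_le; auto.
Qed.

Lemma kern_Im z V : 0 < V -> V <= Rabs (Im z) -> Cmod (kern z) <= / V ^ 2.
Proof.
  intros HV H. replace (/ V ^ 2) with (/ V * / V) by (field; lra). apply kern_le; auto.
  - eapply Rle_trans; [exact H|apply Rabs_Im_le].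
  - eapply Rle_trans; [|apply Rabs_Im_le]. replace (Im (z + 1)) with (Im z) by (destruct z; simpl; ring). auto.
Qed.

Lemma con_kern q a b (F : R -> C) : q <> 0 -> q <> -1 -> con F a b -> con (fun t => F t * kern (cc q t))%C a b.
Proof.
  intros H1 H2 HF t Ht. apply ctn_mult; [apply HF; auto|]. unfold kern.
  assert (V : ctn (fun t => cc q t) t).
  { eapply ctn_ext; [|eapply rder_ctn, (vert_rder q 0)]. intros y; unfold vert; simpl. apply C_eta; simpl; ring. }
  apply ctn_mult; [apply (ctn_comp Cinv); auto|apply (ctn_comp Cinv (fun t => cc q t + 1)%C)].
  - apply Cinv_Cctn, Re_neq_0; auto.
  - apply Cinv_Cctn, Re_neq_0. simpl. lra.
  - apply ctn_plus; auto. apply ctn_const.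
Qed.

Lemma con_ux u q a b : con (fun t => ux u (cc q t)) a b.
Proof. eapply (con_vert (ux u) _ (fun _ => True) q); [apply hol_ux|auto]. Qed.

Definition Jk (q u V : R) : C := CI (fun t => ux u (cc q t) * kern (cc q t))%C (- V) V.

Lemma Jk_edge q u V M : 0 < V -> 0 < M -> M <= Rabs q -> M <= Rabs (q + 1) -> Cmod (Jk q u V) <= exp (q * ln u) * / M ^ 2 * (2 * V).
Proof.
  intros HV HM H1 H2. unfold Jk. replace (2 * V) with (V - - V) by ring. apply Cmod_CI_const; [lra| |].
  - apply con_kern; [| |apply con_ux]; intros ->; [rewrite Rabs_R0 in H1; lra|].
    replace (-1 + 1) with 0 in H2 by ring. rewrite Rabs_R0 in H2. lra.
  - intros t _. rewrite Cmod_mult, Cmod_ux. simpl. apply Rmult_le_compat_l; [apply Rlt_le, exp_pos|].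
    replace (/ (M * (M * 1))) with (/ M * / M) by (field; lra). apply kern_le; auto.
    + eapply Rle_trans; [exact H1|]. apply (Rabs_Re_le (cc q t)).
    + eapply Rle_trans; [exact H2|]. apply (Rabs_Re_le (cc q t + 1)).
Qed.

(** For u >= 1 the line moves left across the poles 0 and -1, whose residues add up to 1 - 1/u; for
    u < 1 it moves right, where there is no pole. *)
Lemma kernel_bound u V : 0 < u -> 4 <= V -> Cmod (Jk 2 u V - RtoC (2 * PI * pp (1 - / u))) <= 8 * u ^ 2 / V.
Proof.
  intros Hu HV. assert (U2 : exp (2 * ln u) = u ^ 2) by (rewrite <- (exp_ln u) at 2 by auto; simpl; rewrite Rmult_1_r, <- exp_plus; f_equal; ring).
  assert (U0 : 0 < u ^ 2) by (apply pow_lt; lra).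
  destruct (Rle_lt_dec 1 u) as [H|H].
  - assert (L : 0 <= ln u) by (apply ln_nonneg; auto).
    assert (U1 : 1 <= u ^ 2) by nra.
    unfold pp. rewrite Rmax_right by (assert (/ u <= 1) by (rewrite <- Rinv_1; apply Rinv_le_contravar; lra); lra).
    (* Two moves, from 2 to -1/2 and from there to -V, because [rect_shift] crosses one pole at a
       time. *)
    destruct (hol_inv_shift (fun z => - 1 / 2 - 1 / 4 < Re z < 2 + 1 / 4) 1) as [G1 HG1].
    { intros z Hz. apply Re_neq_0. destruct z; simpl in *; lra. }
    pose proof (rect_shift (fun z => ux u z * / (z + 1))%C _ 0 (- 1 / 2) 2 V (1 / 4) (u ^ 2 * / V ^ 2) ltac:(lra) ltac:(simpl; lra) ltac:(simpl; lra)
      (hol_mult _ _ _ _ _ (hol_ux _ u) HG1)) as S1.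
    assert (S1' := S1 ltac:(intros z Hz Iz; cbv beta; replace (ux u z * / (z + 1) * / (z - 0))%C with (ux u z * kern z)%C by (unfold kern; replace (z - 0)%C with z by ring; ring);
      rewrite Cmod_mult, Cmod_ux, <- U2; apply Rmult_le_compat; [apply Rlt_le, exp_pos|apply Cmod_ge_0|apply exp_le; nra|apply kern_Im; lra])). clear S1; cbv beta in S1'.
    destruct (hol_inv_shift (fun z => - V - 1 / 4 < Re z < - 1 / 2 + 1 / 4) 0) as [G2 HG2].
    { intros z Hz. apply Re_neq_0. destruct z; simpl in *; lra. }
    pose proof (rect_shift (fun z => ux u z * / (z + 0))%C _ (-1) (- V) (- 1 / 2) V (1 / 4) (1 * / V ^ 2) ltac:(lra) ltac:(simpl; lra) ltac:(simpl; lra)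
      (hol_mult _ _ _ _ _ (hol_ux _ u) HG2)) as S2.
    assert (S2' := S2 ltac:(intros z Hz Iz; cbv beta; replace (ux u z * / (z + 0) * / (z - -1))%C with (ux u z * kern z)%C by (unfold kern; replace (z - -1)%C with (z + 1)%C by (apply C_eta; simpl; ring); replace (z + 0)%C with z by ring; ring);
      rewrite Cmod_mult, Cmod_ux; apply Rmult_le_compat; [apply Rlt_le, exp_pos|apply Cmod_ge_0|apply Rle_trans with (exp 0); [apply exp_le; nra|rewrite exp_0; lra]|apply kern_Im; lra])). clear S2; cbv beta in S2'.
    assert (E1 : forall q, CI (fun t => ux u (cc q t) * / (cc q t + 1) * / (cc q t - 0))%C (- V) V = Jk q u V).
    { intros q. apply CI_ext; [lra|]. intros t _. unfold kern. replace (cc q t - 0)%C with (cc q t) by (apply C_eta; simpl; ring). ring. }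
    assert (E2 : forall q, CI (fun t => ux u (cc q t) * / (cc q t + 0) * / (cc q t - -1))%C (- V) V = Jk q u V).
    { intros q. apply CI_ext; [lra|]. intros t _. unfold kern. replace (cc q t - -1)%C with (cc q t + 1)%C by (apply C_eta; simpl; ring).
      replace (cc q t + 0)%C with (cc q t) by (apply C_eta; simpl; ring). ring. }
    rewrite !E1 in S1'. rewrite !E2 in S2'.
    pose proof (Jk_edge (- V) u V (V - 1) ltac:(lra) ltac:(lra) ltac:(rewrite Rabs_left; lra) ltac:(rewrite Rabs_left; lra)) as S3.
    assert (X3 : exp (- V * ln u) <= 1) by (apply Rle_trans with (exp 0); [apply exp_le; nra|rewrite exp_0; lra]).
    assert (P1 : (ux u 0 * / (0 + 1))%C = 1%C) by (rewrite ux_0; apply C_eta; simpl; field).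
    assert (P2 : (ux u (-1) * / (-1 + 0))%C = RtoC (- / u)).
    { rewrite ux_cp. replace (- -1)%C with (RtoC 1) by (apply C_eta; simpl; ring). rewrite cp_R, rp_1 by auto.
      replace (-1 + 0)%C with (RtoC (-1)) by (apply C_eta; simpl; ring). rewrite <- RtoC_inv, <- RtoC_mult by lra. f_equal. field; lra. }
    rewrite P1 in S1'. rewrite P2 in S2'.
    replace (Jk 2 u V - RtoC (2 * PI * (1 - / u)))%C with ((Jk 2 u V - Jk (- 1 / 2) u V - RtoC (2 * PI) * 1) + ((Jk (- 1 / 2) u V - Jk (- V) u V - RtoC (2 * PI) * RtoC (- / u)) + Jk (- V) u V))%C
      by (apply C_eta; simpl; ring).
    eapply Rle_trans; [apply Cmod_triangle|]. eapply Rle_trans; [apply Rplus_le_compat_l, Cmod_triangle|].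
    assert (Y3 : exp (- V * ln u) * / (V - 1) ^ 2 * (2 * V) <= 4 / V).
    { apply Rle_trans with (1 * / (V - 1) ^ 2 * (2 * V)).
      - apply Rmult_le_compat_r; [lra|]. apply Rmult_le_compat_r; [left; apply Rinv_0_lt_compat, pow_lt; lra|auto].
      - apply (Rmult_le_reg_r ((V - 1) ^ 2 * V)); [apply Rmult_lt_0_compat; [apply pow_lt; lra|lra]|].
        replace (1 * / (V - 1) ^ 2 * (2 * V) * ((V - 1) ^ 2 * V)) with (2 * V ^ 2) by (field; lra).
        replace (4 / V * ((V - 1) ^ 2 * V)) with (4 * (V - 1) ^ 2) by (field; lra). nra. }
    assert (Y1 : 2 * (u ^ 2 * / V ^ 2) * (2 - - 1 / 2) <= 5 / 4 * u ^ 2 / V).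
    { apply (Rmult_le_reg_r (V ^ 2)); [apply pow_lt; lra|]. replace (2 * (u ^ 2 * / V ^ 2) * (2 - - 1 / 2) * V ^ 2) with (5 * u ^ 2) by (field; lra).
      replace (5 / 4 * u ^ 2 / V * V ^ 2) with (5 / 4 * u ^ 2 * V) by (field; lra). nra. }
    assert (Y2 : 2 * (1 * / V ^ 2) * (- 1 / 2 - - V) <= 2 / V).
    { apply (Rmult_le_reg_r (V ^ 2)); [apply pow_lt; lra|]. replace (2 * (1 * / V ^ 2) * (- 1 / 2 - - V) * V ^ 2) with (2 * V - 1) by (field; lra).
      replace (2 / V * V ^ 2) with (2 * V) by (field; lra). lra. }
    assert (Y4 : 5 / 4 * u ^ 2 / V + (2 / V + 4 / V) <= 8 * u ^ 2 / V).
    { apply (Rmult_le_reg_r V); [lra|]. replace ((5 / 4 * u ^ 2 / V + (2 / V + 4 / V)) * V) with (5 / 4 * u ^ 2 + 2 + 4) by (field; lra).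
      replace (8 * u ^ 2 / V * V) with (8 * u ^ 2) by (field; lra). nra. }
    eapply Rle_trans; [|exact Y4]. apply Rplus_le_compat; [eapply Rle_trans; [exact S1'|exact Y1]|].
    apply Rplus_le_compat; [eapply Rle_trans; [exact S2'|exact Y2]|]. eapply Rle_trans; [exact S3|exact Y3].
  - assert (L : ln u <= 0) by (rewrite <- ln_1; apply ln_le; lra).
    unfold pp. rewrite Rmax_left by (assert (1 <= / u) by (rewrite <- Rinv_1; apply Rinv_le_contravar; lra); lra).
    replace (Jk 2 u V - RtoC (2 * PI * 0))%C with (Jk 2 u V) by (rewrite Rmult_0_r; ring).
    set (A := V + 2).
    destruct (hol_inv_shift (fun z => 2 - 1 / 4 < Re z < A + 1 / 4) 0) as [G1 HG1].
    { intros z Hz. apply Re_neq_0. destruct z; simpl in *; lra. }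
    destruct (hol_inv_shift (fun z => 2 - 1 / 4 < Re z < A + 1 / 4) 1) as [G2 HG2].
    { intros z Hz. apply Re_neq_0. destruct z; simpl in *; lra. }
    (* [rect_shift] wants a pole; the artificial one at 3 has residue zero thanks to the factor z -
       3. *)
    pose proof (rect_shift (fun z => (z - 3) * (ux u z * (/ (z + 0) * / (z + 1))))%C _ 3 2 A V (1 / 4) (u ^ 2 * / V ^ 2) ltac:(lra) ltac:(unfold A; simpl; lra) ltac:(simpl; lra)
      (hol_mult _ _ _ _ _ (hol_minus _ _ _ _ _ (hol_id _) (hol_const _ 3)) (hol_mult _ _ _ _ _ (hol_ux _ u) (hol_mult _ _ _ _ _ HG1 HG2)))) as S1.
    assert (E0 : forall z, (z - 3)%C <> 0%C -> ((z - 3) * (ux u z * (/ (z + 0) * / (z + 1))) * / (z - 3))%C = (ux u z * kern z)%C).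
    { intros z Hz. unfold kern. replace (z + 0)%C with z by ring. 
      replace ((z - 3) * (ux u z * (/ z * / (z + 1))) * / (z - 3))%C with (((z - 3) * / (z - 3)) * (ux u z * (/ z * / (z + 1))))%C by ring.
      rewrite Cinv_r by auto. ring. }
    assert (S1' := S1 ltac:(intros z Hz Iz; cbv beta; rewrite E0 by (apply Im_neq_0; replace (Im (z - 3)) with (Im z) by (destruct z; simpl; ring); intros Z; rewrite Z, Rabs_R0 in Iz; lra);
      rewrite Cmod_mult, Cmod_ux, <- U2; apply Rmult_le_compat; [apply Rlt_le, exp_pos|apply Cmod_ge_0|apply exp_le; nra|apply kern_Im; lra])). clear S1; cbv beta in S1'.
    assert (E1 : forall q, q <> 3 -> CI (fun t => (cc q t - 3) * (ux u (cc q t) * (/ (cc q t + 0) * / (cc q t + 1))) * / (cc q t - 3))%C (- V) V = Jk q u V).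
    { intros q Hq. apply CI_ext; [lra|]. intros t _. apply E0. apply Re_neq_0. simpl. lra. }
    rewrite !E1 in S1' by (unfold A; lra).
    pose proof (Jk_edge A u V V ltac:(lra) ltac:(lra) ltac:(unfold A; rewrite Rabs_right; lra) ltac:(unfold A; rewrite Rabs_right; lra)) as S3.
    assert (X3 : exp (A * ln u) <= u ^ 2) by (rewrite <- U2; apply exp_le; unfold A; nra).
    replace (RtoC (2 * PI) * ((3 - 3) * (ux u 3 * (/ (3 + 0) * / (3 + 1)))))%C with (RtoC 0) in S1' by ring.
    replace (Jk 2 u V) with (Jk A u V - (Jk A u V - Jk 2 u V - RtoC 0))%C by ring.
    eapply Rle_trans; [apply Cmod_minus_le|].
    assert (Y1 : 2 * (u ^ 2 * / V ^ 2) * (A - 2) = 2 * u ^ 2 / V) by (unfold A; field; lra).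
    assert (Y3 : exp (A * ln u) * / V ^ 2 * (2 * V) <= 2 * u ^ 2 / V).
    { replace (exp (A * ln u) * / V ^ 2 * (2 * V)) with (2 * exp (A * ln u) / V) by (field; lra).
      apply Rmult_le_compat_r; [left; apply Rinv_0_lt_compat; lra|lra]. }
    assert (0 < u ^ 2 / V) by (apply Rdiv_lt_0_compat; lra). unfold Rdiv in *. lra.
Qed.

Definition pk (X : R) (s : C) : C := (ux X (s + 1) * kern s)%C.

(** The Perron integral of A along Re s = q is S, with an unspecified O(1/V) rate for symmetric
    truncation. If A has coefficients c(n), then S is the sum of c(n) (X - n)^+, corrected by the
    residues between q and the region of absolute convergence. *)
Definition Plim (A : C -> C) (q X : R) (S : C) : Prop := exists E, forall V, 4 <= V ->
  Cmod (CI (fun t => A (cc q t) * pk X (cc q t))%C (- V) V - RtoC (2 * PI) * S) <= E / V.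

Lemma ctn_pk q X t : 0 < q -> ctn (fun t => pk X (cc q t)) t.
Proof.
  intros Hq. unfold pk. apply (con_kern q t t (fun t => ux X (cc q t + 1))%C); [lra|lra| |lra].
  assert (E : forall y : R, ux X (cc (q + 1) y) = ux X (cc q y + 1)) by (intros y; f_equal; apply C_eta; simpl; ring).
  intros t' _. apply (ctn_ext (fun t => ux X (cc (q + 1) t))); [exact E|].
  apply (con_ux X (q + 1) t' t'). lra.
Qed.

Lemma ctn_apk A q X : 0 < q -> (forall t, ctn (fun t => A (cc q t)) t) -> forall a b, con (fun t => A (cc q t) * pk X (cc q t))%C a b.
Proof. intros Hq HA a b t _. apply ctn_mult; auto. apply ctn_pk; auto. Qed.

Lemma Plim_plus A A' q X S S' : 0 < q -> (forall t, ctn (fun t => A (cc q t)) t) -> (forall t, ctn (fun t => A' (cc q t)) t) ->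
  Plim A q X S -> Plim A' q X S' -> Plim (fun s => A s + A' s)%C q X (S + S')%C.
Proof.
  intros Hq C1 C2 [E HE] [E' HE']. exists (E + E'). intros V HV.
  rewrite (CI_ext _ (fun t => A (cc q t) * pk X (cc q t) + A' (cc q t) * pk X (cc q t))%C) by (try lra; intros; ring).
  rewrite CI_plus by (try lra; apply ctn_apk; auto).
  set (I := CI _ _ _). set (I' := CI (fun t => A' _ * _)%C _ _).
  replace (I + I' - RtoC (2 * PI) * (S + S'))%C with ((I - RtoC (2 * PI) * S) + (I' - RtoC (2 * PI) * S'))%C by ring.
  eapply Rle_trans; [apply Cmod_triangle|]. specialize (HE V HV). specialize (HE' V HV). fold I in HE. fold I' in HE'.
  unfold Rdiv in *. lra.
Qed.

Lemma Plim_scal c A q X S : 0 < q -> (forall t, ctn (fun t => A (cc q t)) t) ->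
  Plim A q X S -> Plim (fun s => c * A s)%C q X (c * S)%C.
Proof.
  intros Hq C1 [E HE]. exists (Cmod c * E). intros V HV.
  rewrite (CI_ext _ (fun t => c * (A (cc q t) * pk X (cc q t)))%C) by (try lra; intros; ring).
  rewrite CI_scal by (try lra; apply ctn_apk; auto).
  set (I := CI _ _ _). replace (c * I - RtoC (2 * PI) * (c * S))%C with (c * (I - RtoC (2 * PI) * S))%C by ring.
  rewrite Cmod_mult. specialize (HE V HV). fold I in HE. unfold Rdiv. rewrite Rmult_assoc. apply Rmult_le_compat_l; [apply Cmod_ge_0|auto].
Qed.

Lemma ctn_cp d q t : ctn (fun t => cp d (cc q t)) t.
Proof. destruct (hol_cp (fun _ => True) d) as [G HG]. apply (con_vert (cp d) G (fun _ => True) q t t HG); auto; lra. Qed.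

(** The factor d^(-s) replaces n by d n, and (X - d n)^+ = d (X/d - n)^+. *)
Lemma Plim_dilate d A q X S : 0 < q -> 0 < d -> 0 < X -> (forall t, ctn (fun t => A (cc q t)) t) ->
  Plim A q (X / d) S -> Plim (fun s => cp d s * A s)%C q X (RtoC d * S)%C.
Proof.
  intros Hq Hd HX C1 H. apply (Plim_scal (RtoC d)) in H; auto. destruct H as [E HE]. exists E. intros V HV.
  rewrite (CI_ext _ (fun t => RtoC d * A (cc q t) * pk (X / d) (cc q t))%C); [auto|lra|].
  intros t _. unfold pk. replace (ux X (cc q t + 1)) with (ux (X / d) (cc q t + 1) * ux d (cc q t + 1))%C.
  - rewrite (ux_plus d), ux_1 by auto. 
    replace (cp d (cc q t) * A (cc q t) * (ux (X / d) (cc q t + 1) * (ux d (cc q t) * RtoC d) * kern (cc q t)))%C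
      with ((cp d (cc q t) * ux d (cc q t)) * (RtoC d * A (cc q t) * (ux (X / d) (cc q t + 1) * kern (cc q t))))%C by ring.
    rewrite ux_cp, <- cp_plus. replace (cc q t + - cc q t)%C with (RtoC 0) by ring. rewrite cp_R, rp_0. ring.
  - unfold ux. rewrite <- cexp_plus. f_equal. rewrite ln_div by auto. rewrite RtoC_minus. ring.
Qed.

Lemma Plim_csum (A : nat -> C -> C) q X (S : nat -> C) N : 0 < q -> (forall n t, ctn (fun t => A n (cc q t)) t) ->
  (forall n, (n < N)%nat -> Plim (A n) q X (S n)) -> Plim (fun s => csum (fun n => A n s) N) q X (csum S N).
Proof.
  intros Hq HC H. induction N as [|N IH].
  - exists 0. intros V HV. cbn [csum]. rewrite (CI_ext _ (fun _ => RtoC 0)) by (try lra; intros; ring).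
    rewrite CI_const. replace (RtoC (V - - V) * 0 - RtoC (2 * PI) * 0)%C with (RtoC 0) by ring. rewrite Cmod_0. unfold Rdiv. lra.
  - cbn [csum]. apply Plim_plus; auto.
    clear IH H. intros t. induction N; cbn [csum]; [apply ctn_const|]. apply ctn_plus; auto.
Qed.

Lemma CI_csum (f : nat -> R -> C) N a b : a <= b -> (forall n, con (f n) a b) ->
  con (fun t => csum (fun n => f n t) N) a b /\ CI (fun t => csum (fun n => f n t) N) a b = csum (fun n => CI (f n) a b) N.
Proof.
  intros Hab Hc. induction N as [|N [IH1 IH2]]; cbn [csum].
  - split; [intros t _; apply ctn_const|]. rewrite CI_const. ring.
  - split; [apply con_plus; auto|]. rewrite CI_plus by auto. rewrite IH2. reflexivity.
Qed.

Lemma pk_abs q X t : 0 < q -> Cmod (pk X (cc q t)) <= exp ((q + 1) * ln X) * (/ q * / (q + 1)).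
Proof.
  intros Hq. unfold pk. rewrite Cmod_mult, Cmod_ux. simpl Re. apply Rmult_le_compat_l; [apply Rlt_le, exp_pos|].
  apply kern_le; try lra; (eapply Rle_trans; [|apply Rabs_Re_le]); simpl; rewrite Rabs_right; lra.
Qed.

Lemma pp_0 y : y <= 0 -> pp y = 0.
Proof. intros; apply Rmax_left; auto. Qed.

Lemma csum_pp_stable (c : nat -> C) X M N : X <= INR (S M) -> (M <= N)%nat ->
  csum (fun n => c n * RtoC (pp (X - INR (S n))))%C N = csum (fun n => c n * RtoC (pp (X - INR (S n))))%C M.
Proof.
  intros HX H. induction H as [|N H IH]; auto. cbn [csum]. rewrite IH.
  rewrite (pp_0 (X - INR (S N))); [ring|]. assert (INR (S M) <= INR (S N)) by (apply le_INR; lia). lra.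
Qed.

(** For a truncated series, [kernel_bound] at X/n gives errors of order X^3 n^(-2) / V, whose sum
    over n costs a factor 2. The truncation then tends to infinity with V fixed. *)
Lemma perron_right (c : nat -> C) (A0 : R) (Af : C -> C) X M V : (forall n, Cmod (c n) <= A0) ->
  (forall t, ctn (fun t => Af (cc 2 t)) t) ->
  (forall t, csums (fun n => c n * cp (INR (S n)) (cc 2 t))%C (Af (cc 2 t))) -> 0 < X <= INR (S M) -> 4 <= V ->
  Cmod (CI (fun t => Af (cc 2 t) * pk X (cc 2 t))%C (- V) V - RtoC (2 * PI) * csum (fun n => c n * RtoC (pp (X - INR (S n))))%C M)
    <= 16 * A0 * X ^ 3 / V.
Proof.
  intros Hc HA HS HX HV. assert (A0p : 0 <= A0) by (eapply Rle_trans; [apply Cmod_ge_0|apply (Hc O)]).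
  assert (X3 : exp ((2 + 1) * ln X) = X ^ 3).
  { rewrite <- (exp_ln X) at 2 by lra. simpl. rewrite Rmult_1_r, <- !exp_plus. f_equal. ring. }
  assert (X3p : 0 < X ^ 3) by (apply pow_lt; lra).
  assert (Tr : forall N, (M <= N)%nat -> Cmod (CI (fun t => csum (fun n => c n * cp (INR (S n)) (cc 2 t))%C N * pk X (cc 2 t))%C (- V) V
     - RtoC (2 * PI) * csum (fun n => c n * RtoC (pp (X - INR (S n))))%C M) <= 16 * A0 * X ^ 3 / V).
  { intros N HN. rewrite <- (csum_pp_stable c X M N) by (auto; lra).
    assert (Cn : forall n, con (fun t => cp (INR (S n)) (cc 2 t) * pk X (cc 2 t))%C (- V) V).
    { intros n. apply (ctn_apk (cp (INR (S n))) 2 X); [lra|intros; apply ctn_cp]. }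
    rewrite (CI_ext _ (fun t => csum (fun n => c n * (cp (INR (S n)) (cc 2 t) * pk X (cc 2 t)))%C N)); [|lra|].
    2:{ intros t _. rewrite Cmult_comm, <- csum_scal. apply csum_ext. intros; ring. }
    destruct (CI_csum (fun n t => c n * (cp (INR (S n)) (cc 2 t) * pk X (cc 2 t)))%C N (- V) V ltac:(lra)) as [_ ->].
    { intros n. apply con_scal, Cn. }
    rewrite <- csum_scal.
    replace (csum (fun n => CI _ _ _) N - csum (fun n => RtoC (2 * PI) * _)%C N)%C with
      (csum (fun n => c n * (RtoC X * (Jk 2 (X / INR (S n)) V - RtoC (2 * PI * pp (1 - / (X / INR (S n)))))))%C N).
    - eapply Rle_trans; [apply csum_le with (M := fun n => 8 * A0 * X ^ 3 / V * rp (INR (S n)) (1 + 1))|].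
      + intros n _. pose proof (INR_S_ge1 n) as Hn. set (y := INR (S n)) in *.
        pose proof (kernel_bound (X / y) V ltac:(apply Rdiv_lt_0_compat; lra) HV) as K.
        rewrite !Cmod_mult, Cmod_R, (Rabs_pos_eq X) by lra.
        rewrite rp_plus, !rp_1 by lra.
        apply Rle_trans with (A0 * (X * (8 * (X / y) ^ 2 / V))); [|right; field; lra].
        apply Rmult_le_compat; auto; [apply Cmod_ge_0|apply Rmult_le_pos; [lra|apply Cmod_ge_0]|apply Rmult_le_compat_l; lra].
      + rewrite rsum_scal. pose proof (rp_sum_le N 1 ltac:(lra)) as Q. rewrite Rinv_1 in Q.
        assert (0 <= 8 * A0 * X ^ 3 / V) by (apply Rdiv_le_0_compat; [apply Rmult_le_pos; lra|lra]).
        replace (16 * A0 * X ^ 3 / V) with (8 * A0 * X ^ 3 / V * 2) by (field; lra). apply Rmult_le_compat_l; lra.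
    - symmetry. replace (csum _ N - csum _ N)%C with (csum (fun n => CI (fun t => c n * (cp (INR (S n)) (cc 2 t) * pk X (cc 2 t)))%C (- V) V) N + Copp 1 * csum (fun n => RtoC (2 * PI) * (c n * RtoC (pp (X - INR (S n)))))%C N)%C by ring.
      rewrite <- csum_scal, <- csum_plus. apply csum_ext. intros n _. pose proof (INR_S_ge1 n) as Hn. set (y := INR (S n)) in *.
      rewrite CI_scal by (try lra; apply Cn).
      rewrite (CI_ext _ (fun t => RtoC X * (ux (X / y) (cc 2 t) * kern (cc 2 t)))%C); [|lra|].
      2:{ intros t _. unfold pk. rewrite ux_plus, ux_1 by lra. 
          replace (ux (X / y) (cc 2 t)) with (cp y (cc 2 t) * ux X (cc 2 t))%C; [ring|].
          unfold cp, ux. rewrite <- cexp_plus. f_equal. rewrite ln_div by lra. rewrite RtoC_minus. ring. }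
      rewrite CI_scal; [|lra|apply con_kern; [lra|lra|apply con_ux]]. fold (Jk 2 (X / y) V).
      assert (E : pp (X - y) = X * pp (1 - / (X / y))).
      { unfold pp. rewrite <- RmaxRmult by lra. f_equal; field; lra. }
      rewrite E. rewrite !RtoC_mult. ring. }
  apply le_epsilon. intros e He.
  set (D := A0 * X ^ 3 * (2 * V)). assert (HD : 0 <= D) by (apply Rmult_le_pos; [apply Rmult_le_pos; lra|lra]).
  destruct (rp_lim 1 (e / (D + 1)) ltac:(lra) ltac:(apply Rdiv_lt_0_compat; lra)) as [N1 [HN1 Hlim]].
  set (N := Nat.max N1 M). specialize (Hlim N ltac:(unfold N; lia)). specialize (Tr N ltac:(unfold N; lia)).
  assert (Ctr : forall t, ctn (fun t => csum (fun n => c n * cp (INR (S n)) (cc 2 t))%C N) t).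
  { intros t. destruct (hol_csum (fun _ => True) c N) as [G HG]. apply (con_vert _ G (fun _ => True) 2 t t HG); auto; lra. }
  assert (Df : Cmod (CI (fun t => Af (cc 2 t) * pk X (cc 2 t))%C (- V) V - CI (fun t => csum (fun n => c n * cp (INR (S n)) (cc 2 t))%C N * pk X (cc 2 t))%C (- V) V) <= e).
  { rewrite <- CI_minus; [|lra| |].
    2:{ apply ctn_apk; auto; lra. }
    2:{ apply (ctn_apk (fun s => csum (fun n => c n * cp (INR (S n)) s)%C N)); auto; lra. }
    apply Rle_trans with (A0 * rp (INR N) 1 * X ^ 3 * (V - - V)).
    - apply Cmod_CI_const; [lra| |].
      + intros t _. apply (ctn_ext (fun t => (Af (cc 2 t) + Copp 1 * csum (fun n => c n * cp (INR (S n)) (cc 2 t))%C N) * pk X (cc 2 t))%C); [intros; ring|].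
        apply ctn_mult; [|apply ctn_pk; lra]. apply ctn_plus; auto. apply ctn_mult; [apply ctn_const|auto].
      + intros t _. replace (Af (cc 2 t) * pk X (cc 2 t) - csum (fun n => c n * cp (INR (S n)) (cc 2 t)) N * pk X (cc 2 t))%C
          with ((Af (cc 2 t) - csum (fun n => c n * cp (INR (S n)) (cc 2 t))%C N) * pk X (cc 2 t))%C by ring.
        rewrite Cmod_mult. apply Rmult_le_compat; try apply Cmod_ge_0.
        * apply (csums_tail _ _ _ _ (HS t)). intros n.
          eapply Rle_trans; [apply csum_le with (M := fun m => A0 * rp (INR (S (N + m))) (1 + 1))|].
          -- intros m _. rewrite Cmod_mult, Cmod_cp. apply Rmult_le_compat; [apply Cmod_ge_0|apply Rlt_le, rp_pos|apply Hc|].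
             apply rp_le_exp; [apply INR_S_ge1|simpl; lra].
          -- rewrite rsum_scal. apply Rmult_le_compat_l; auto. eapply Rle_trans; [apply rp_sum_tail; [unfold N; lia|lra]|].
             rewrite Rinv_1. pose proof (rp_pos (INR (N + n)) 1). lra.
        * eapply Rle_trans; [apply pk_abs; lra|]. rewrite X3. lra.
    - replace (A0 * rp (INR N) 1 * X ^ 3 * (V - - V)) with (D * rp (INR N) 1) by (unfold D; ring).
      apply Rle_trans with (D * (e / (D + 1))); [apply Rmult_le_compat_l; lra|].
      apply (Rmult_le_reg_r (D + 1)); [lra|]. replace (D * (e / (D + 1)) * (D + 1)) with (D * e) by (field; lra). nra. }
  set (I1 := CI (fun t => Af (cc 2 t) * _)%C _ _) in *. set (I2 := CI _ _ _) in *. set (S0 := csum _ M) in *.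
  replace (I1 - RtoC (2 * PI) * S0)%C with ((I2 - RtoC (2 * PI) * S0) + (I1 - I2))%C by ring.
  eapply Rle_trans; [apply Cmod_triangle|]. lra.
Qed.

(** The line moves from 2 to s0 across the only pole, that of B / (s - 1) at 1, where the kernel is
    X^2 / 2. [Cg] affects only the rate of convergence, so a crude growth bound suffices. *)
Theorem perron_lim (c : nat -> C) (A0 : R) (B B' : C -> C) (s0 ep Cg X : R) M :
  (forall n, Cmod (c n) <= A0) -> 0 < s0 < 1 -> 0 < ep < s0 ->
  hol (fun z => s0 - ep < Re z < 2 + ep) B B' ->
  (forall t, csums (fun n => c n * cp (INR (S n)) (cc 2 t))%C (B (cc 2 t) * / (cc 2 t - 1))%C) ->
  (forall z, s0 <= Re z <= 2 -> 1 <= Rabs (Im z) -> Cmod (B z) <= Cg * (1 + Rabs (Im z)) * Cmod (z - 1)) ->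
  0 < X <= INR (S M) ->
  Plim (fun s => B s * / (s - 1))%C s0 X (csum (fun n => c n * RtoC (pp (X - INR (S n))))%C M - B (RtoC 1) * RtoC (X ^ 2 / 2))%C.
Proof.
  intros Hc Hs Hep HB HS HG HX. set (X3 := exp (3 * Rabs (ln X))).
  assert (X3p : 0 < X3) by apply exp_pos.
  exists (8 * Rabs Cg * X3 + 16 * A0 * X ^ 3). intros V HV.
  set (D := fun z => s0 - ep < Re z < 2 + ep) in *.
  destruct (hol_inv_shift D 0) as [G1 HG1].
  { intros z Hz. apply Re_neq_0. unfold D in Hz. destruct z; simpl in *; lra. }
  destruct (hol_inv_shift D 1) as [G2 HG2].
  { intros z Hz. apply Re_neq_0. unfold D in Hz. destruct z; simpl in *; lra. }
  pose proof (rect_shift (fun z => B z * (RtoC X * ux X z * (/ (z + 0) * / (z + 1))))%C _ 1 s0 2 V ep (2 * Rabs Cg * X3 / V) ltac:(lra) ltac:(simpl; lra) ltac:(simpl; lra)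
    (hol_mult _ _ _ _ _ HB (hol_mult _ _ _ _ _ (hol_mult _ _ _ _ _ (hol_const _ (RtoC X)) (hol_ux _ X)) (hol_mult _ _ _ _ _ HG1 HG2)))) as Sh.
  assert (EP : forall z, (RtoC X * ux X z * (/ (z + 0) * / (z + 1)))%C = pk X z).
  { intros z. unfold pk, kern. rewrite ux_plus, ux_1 by lra. replace (z + 0)%C with z by ring. ring. }
  assert (Z1 : forall z, Re z <> 1 \/ Im z <> 0 -> (z - 1)%C <> 0%C).
  { intros z Hz E. apply (f_equal (fun w => (w + 1)%C)) in E. replace (z - 1 + 1)%C with z in E by ring. subst z. simpl in Hz. destruct Hz; lra. }
  assert (Hor : forall z, s0 <= Re z <= 2 -> Rabs (Im z) = V -> Cmod (B z * (RtoC X * ux X z * (/ (z + 0) * / (z + 1))) * / (z - 1)) <= 2 * Rabs Cg * X3 / V).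
  { intros z Hz Iz. rewrite EP. pose proof (HG z Hz ltac:(lra)) as Q. rewrite Iz in Q.
    assert (N1 : (z - 1)%C <> 0%C) by (apply Z1; right; intros E; rewrite E, Rabs_R0 in Iz; lra).
    pose proof (proj1 (Cmod_gt_0 _) N1) as P1.
    rewrite !Cmod_mult, Cmod_inv by auto.
    assert (K : Cmod (pk X z) <= X3 * / V ^ 2).
    { unfold pk. rewrite Cmod_mult, Cmod_ux. apply Rmult_le_compat; [apply Rlt_le, exp_pos|apply Cmod_ge_0| |apply kern_Im; lra].
      apply exp_le. replace (Re (z + 1)) with (Re z + 1) by (destruct z; reflexivity). pose proof (Rle_abs (ln X)). pose proof (Rabs_pos (ln X)). nra. }
    assert (Q2 : Cmod (B z) * / Cmod (z - 1) <= Rabs Cg * (1 + V)).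
    { apply (Rmult_le_reg_r (Cmod (z - 1))); auto. rewrite Rmult_assoc, Rinv_l, Rmult_1_r by lra.
      eapply Rle_trans; [exact Q|]. apply Rmult_le_compat_r; [lra|]. apply Rmult_le_compat_r; [lra|apply Rle_abs]. }
    replace (Cmod (B z) * Cmod (pk X z) * / Cmod (z - 1)) with ((Cmod (B z) * / Cmod (z - 1)) * Cmod (pk X z)) by ring.
    apply Rle_trans with (Rabs Cg * (1 + V) * (X3 * / V ^ 2)).
    - apply Rmult_le_compat; auto; [apply Rmult_le_pos; [apply Cmod_ge_0|left; apply Rinv_0_lt_compat; auto]|apply Cmod_ge_0].
    - pose proof (Rabs_pos Cg). assert (0 <= Rabs Cg * X3) by (apply Rmult_le_pos; lra).
      apply (Rmult_le_reg_r (V ^ 2)); [apply pow_lt; lra|].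
      replace (Rabs Cg * (1 + V) * (X3 * / V ^ 2) * V ^ 2) with (Rabs Cg * X3 * (1 + V)) by (field; lra).
      replace (2 * Rabs Cg * X3 / V * V ^ 2) with (Rabs Cg * X3 * (2 * V)) by (field; lra). apply Rmult_le_compat_l; lra. }
  specialize (Sh Hor). cbv beta in Sh.
  assert (EI : forall q, q <> 1 -> CI (fun t => B (cc q t) * (RtoC X * ux X (cc q t) * (/ (cc q t + 0) * / (cc q t + 1))) * / (cc q t - 1))%C (- V) V
     = CI (fun t => B (cc q t) * / (cc q t - 1) * pk X (cc q t))%C (- V) V).
  { intros q Hq. apply CI_ext; [lra|]. intros t _. rewrite EP. ring. }
  rewrite !EI in Sh by lra. rewrite EP in Sh.
  assert (P1 : pk X 1 = RtoC (X ^ 2 / 2)).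
  { unfold pk, kern. rewrite ux_plus, ux_1 by lra. apply C_eta; simpl; field. }
  rewrite P1 in Sh.
  assert (Ct : forall q, s0 <= q <= 2 -> q <> 1 -> forall t, ctn (fun t => B (cc q t) * / (cc q t - 1))%C t).
  { intros q Hq Hq1 t. apply ctn_mult.
    - apply (con_vert B B' D q t t HB); [intros; unfold D; simpl; lra|lra].
    - apply (ctn_comp Cinv (fun t => (cc q t - 1)%C)).
      + apply Cinv_Cctn, Z1. left; simpl; auto.
      + eapply rder_ctn, (vert_rder q 1). }
  pose proof (perron_right c A0 (fun s => B s * / (s - 1))%C X M V Hc (Ct 2 ltac:(lra) ltac:(lra)) HS HX HV) as PR. cbv beta in PR.
  set (I2 := CI (fun t => B (cc 2 t) * / (cc 2 t - 1) * pk X (cc 2 t))%C (- V) V) in *.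
  set (I0 := CI (fun t => B (cc s0 t) * / (cc s0 t - 1) * pk X (cc s0 t))%C (- V) V) in *.
  set (S0 := csum _ M) in *.
  replace (I0 - RtoC (2 * PI) * (S0 - B 1 * RtoC (X ^ 2 / 2)))%C with
    ((I2 - RtoC (2 * PI) * S0) - (I2 - I0 - RtoC (2 * PI) * (B 1 * RtoC (X ^ 2 / 2))))%C by ring.
  eapply Rle_trans; [apply Cmod_minus_le|].
  assert (2 * (2 * Rabs Cg * X3 / V) * (2 - s0) <= 8 * Rabs Cg * X3 / V).
  { assert (0 <= Rabs Cg * X3 / V) by (apply Rdiv_le_0_compat; [apply Rmult_le_pos; [apply Rabs_pos|lra]|lra]).
    replace (2 * (2 * Rabs Cg * X3 / V) * (2 - s0)) with (Rabs Cg * X3 / V * (4 * (2 - s0))) by (field; lra).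
    replace (8 * Rabs Cg * X3 / V) with (Rabs Cg * X3 / V * 8) by (field; lra). apply Rmult_le_compat_l; lra. }
  unfold Rdiv in *. lra.
Qed.

(** ** Smoothed sums *)

Lemma CI_Chasles f a b c : a <= b -> b <= c -> con f a c -> CI f a c = (CI f a b + CI f b c)%C.
Proof.
  intros H1 H2 Hf. assert (C1 : con f a b) by (intros t Ht; apply Hf; lra). assert (C2 : con f b c) by (intros t Ht; apply Hf; lra).
  pose proof (con_Re f a b H1 C1) as R1. pose proof (con_Re f b c H2 C2) as R2.
  pose proof (con_Im f a b H1 C1) as I1. pose proof (con_Im f b c H2 C2) as I2.
  unfold CI. rewrite <- (RInt_Chasles (V := R_CompleteNormedModule) (fun t => Re (f t)) a b c R1 R2),
    <- (RInt_Chasles (V := R_CompleteNormedModule) (fun t => Im (f t)) a b c I1 I2).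
  reflexivity.
Qed.

Lemma CI_dom f (G g : R -> R) a b : a <= b -> con f a b -> (forall t, a <= t <= b -> is_derive G t (g t)) ->
  (forall t, a <= t <= b -> continuous g t) -> (forall t, a <= t <= b -> Cmod (f t) <= g t) ->
  Cmod (CI f a b) <= G b - G a.
Proof.
  intros Hab Hf HG Hg Hle.
  assert (I : is_RInt g a b (G b - G a)).
  { apply (is_RInt_derive G g); rewrite Rmin_left, Rmax_right by auto; auto. }
  rewrite <- (is_RInt_unique _ _ _ _ I). apply Cmod_CI_le; auto. eexists; exact I.
Qed.

Lemma ux_diff s x h : 0 <= Re s -> 0 < x -> 0 <= h ->
  Cmod (ux (x + h) (s + 1) - ux x (s + 1)) <= Cmod (s + 1) * exp (Re s * ln (x + h)) * h.
Proof.
  intros Hs Hx Hh.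
  assert (D : forall v, 0 < v -> rder (fun v => ux v (s + 1)) v ((s + 1) * ux v s)%C).
  { intros v Hv. unfold ux at 1. eapply rder_ext; [intros; reflexivity| |apply (rder_comp cexp (fun v => (s + 1) * RtoC (ln v))%C v (cexp ((s + 1) * RtoC (ln v))) ((s + 1) * RtoC (/ v))%C)].
    - fold (ux v (s + 1)). rewrite ux_plus, ux_1 by auto. rewrite RtoC_inv by lra. field. intros E. apply RtoC_inj in E. lra.
    - apply rder_scal. unfold RtoC. apply rder_of_is_derive; [apply is_derive_ln; auto|apply (is_derive_const (V := R_NormedModule))].
    - apply cexp_cder. }
  assert (Cn : con (fun v => (s + 1) * ux v s)%C x (x + h)).
  { intros v Hv. apply ctn_mult; [apply ctn_const|]. unfold ux. apply (ctn_comp cexp (fun v => s * RtoC (ln v))%C).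
    - apply (cder_Cctn _ _ _ (cexp_cder _)).
    - apply ctn_mult; [apply ctn_const|]. apply ctn_RtoC. apply (ex_derive_continuous (K := R_AbsRing) (V := R_NormedModule)). exists (/ v). apply is_derive_ln. lra. }
  rewrite <- (CI_FTC (fun v => ux v (s + 1)) (fun v => (s + 1) * ux v s)%C x (x + h)); [|lra|intros; apply D; lra|auto].
  replace h with ((x + h) - x) at 3 by ring. apply Cmod_CI_const; [lra|auto|].
  intros v Hv. rewrite Cmod_mult, Cmod_ux. apply Rmult_le_compat_l; [apply Cmod_ge_0|]. apply exp_le. apply Rmult_le_compat_l; auto. apply ln_le; lra.
Qed.

Lemma Cmod_ge_13 q t : 1 / 2 <= q -> (1 + Rabs t) / 3 <= Cmod (cc q t).
Proof.
  intros Hq. destruct (Rle_lt_dec (Rabs t) (1 / 2)).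
  - eapply Rle_trans; [|apply Rabs_Re_le]. simpl. rewrite (Rabs_right q); lra.
  - eapply Rle_trans; [|apply Rabs_Im_le]. simpl. lra.
Qed.

(** The first bound differentiates in the upper limit and gains h; the second is the triangle
    inequality and gains a second power of the height, better once |t| exceeds about (x + h) / h. *)
Lemma pk_diff q x h t : 1 / 2 <= q -> 0 < x -> 0 < h ->
  Cmod (pk (x + h) (cc q t) - pk x (cc q t)) <= h * exp (q * ln (x + h)) * (3 / (1 + Rabs t)) /\
  Cmod (pk (x + h) (cc q t) - pk x (cc q t)) <= h * exp (q * ln (x + h)) * (12 * ((x + h) / h) / (1 + Rabs t) ^ 2).
Proof.
  intros Hq Hx Hh. set (s := cc q t). set (y := 1 + Rabs t). assert (Hy : 1 <= y) by (unfold y; pose proof (Rabs_pos t); lra).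
  set (P := exp (q * ln (x + h))). assert (HP : 0 < P) by apply exp_pos.
  assert (B1 : y / 3 <= Cmod s) by (apply Cmod_ge_13; auto).
  assert (B2 : y / 2 <= Cmod (s + 1)).
  { destruct (Rle_lt_dec (Rabs t) 1).
    - eapply Rle_trans; [|apply Rabs_Re_le]. unfold s, y; simpl. rewrite (Rabs_right (q + 1)); lra.
    - eapply Rle_trans; [|apply Rabs_Im_le]. unfold s, y; simpl. rewrite Rplus_0_r. lra. }
  replace (pk (x + h) s - pk x s)%C with ((ux (x + h) (s + 1) - ux x (s + 1)) * kern s)%C by (unfold pk; ring).
  assert (S1 : (s + 1)%C <> 0%C) by (apply Cmod_gt_0; lra). assert (S0 : s <> RtoC 0) by (apply Cmod_gt_0; lra).
  rewrite Cmod_mult. unfold kern. rewrite Cmod_mult, !Cmod_inv by auto.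
  set (c1 := Cmod s) in *. set (c2 := Cmod (s + 1)) in *.
  assert (I1 : / c1 <= 3 / y) by (replace (3 / y) with (/ (y / 3)) by (field; lra); apply Rinv_le_contravar; lra).
  assert (I2 : / c2 <= 2 / y) by (replace (2 / y) with (/ (y / 2)) by (field; lra); apply Rinv_le_contravar; lra).
  assert (J1 : 0 < / c1) by (apply Rinv_0_lt_compat; lra). assert (J2 : 0 < / c2) by (apply Rinv_0_lt_compat; lra).
  split.
  - pose proof (ux_diff s x h ltac:(simpl; lra) Hx ltac:(lra)) as Q. simpl Re in Q. fold P c2 in Q.
    apply Rle_trans with (c2 * P * h * (/ c1 * / c2)); [apply Rmult_le_compat_r; [apply Rmult_le_pos; lra|auto]|].
    replace (c2 * P * h * (/ c1 * / c2)) with (h * P * / c1) by (field; lra). apply Rmult_le_compat_l; [apply Rmult_le_pos; lra|auto].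
  - assert (Q : Cmod (ux (x + h) (s + 1) - ux x (s + 1)) <= 2 * (P * (x + h))).
    { eapply Rle_trans; [apply Cmod_minus_le|]. rewrite !Cmod_ux. simpl Re.
      assert (E : exp ((q + 1) * ln (x + h)) = P * (x + h)).
      { unfold P. rewrite <- (exp_ln (x + h)) at 3 by lra. rewrite <- exp_plus. f_equal. ring. }
      assert (exp ((q + 1) * ln x) <= exp ((q + 1) * ln (x + h))) by (apply exp_le, Rmult_le_compat_l; [lra|apply ln_le; lra]). lra. }
    apply Rle_trans with (2 * (P * (x + h)) * (3 / y * (2 / y))); [|right; field; lra].
    apply Rmult_le_compat; [apply Cmod_ge_0|apply Rmult_le_pos; lra|auto|apply Rmult_le_compat; lra].
Qed.

(** A majorant with the elementary primitive [Gdom]. For 1 + t <= T the first part covers 3 / (1 +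
    t), beyond it the second covers 12 r / (1 + t)^2, each with the growth ((T + t) / T)^(1/2)
    included. *)
Definition gdom (T r t : R) : R := 9 * (/ (1 + t) - / (1 + t + T)) + 48 * r * rp T (1 / 2) * rp (1 + t + T) (3 / 2).
Definition Gdom (T r t : R) : R := 9 * (ln (1 + t) - ln (1 + t + T)) - 96 * r * rp T (1 / 2) * rp (1 + t + T) (1 / 2).

Lemma Gdom_der T r t : 1 <= T -> 0 <= t -> is_derive (Gdom T r) t (gdom T r t).
Proof.
  intros HT Ht. unfold Gdom, gdom, rp. 
  replace (exp (- (3 / 2) * ln (1 + t + T))) with (exp (- (1 / 2) * ln (1 + t + T)) * / (1 + t + T)).
  - auto_derive; [repeat split; lra|]. field. lra.
  - replace (/ (1 + t + T)) with (exp (- ln (1 + t + T))) by (rewrite exp_Ropp, exp_ln; lra). rewrite <- exp_plus. f_equal. field.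
Qed.

Lemma Gdom_total T r V : 1 <= T -> 0 <= r -> 0 <= V -> Gdom T r V - Gdom T r 0 <= 9 * ln (1 + T) + 96 * r / T.
Proof.
  intros HT Hr HV. unfold Gdom.
  assert (ln (1 + V) <= ln (1 + V + T)) by (apply ln_le; lra).
  replace (1 + 0) with 1 by ring. rewrite ln_1.
  assert (0 <= r * rp T (1 / 2)) by (apply Rmult_le_pos; [lra|apply Rlt_le, rp_pos]).
  assert (0 <= r * rp T (1 / 2) * rp (1 + V + T) (1 / 2)) by (apply Rmult_le_pos; [lra|apply Rlt_le, rp_pos]).
  assert (r * rp T (1 / 2) * rp (1 + T) (1 / 2) <= r / T).
  { apply Rle_trans with (r * rp T (1 / 2) * rp T (1 / 2)); [apply Rmult_le_compat_l; [lra|apply rp_le_base; lra]|].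
    rewrite Rmult_assoc, <- rp_plus. replace (1 / 2 + 1 / 2) with 1 by field. rewrite rp_1; [right; field|]; lra. }
  unfold Rdiv in *. lra.
Qed.

Lemma gdom_dom T r th y P : 1 <= T -> 0 <= th <= 1 / 2 -> 0 <= r -> 0 <= P -> 1 <= y -> forall d, d <= P * (3 / y) -> d <= P * (12 * r / y ^ 2) ->
  0 <= d -> exp (th * ln (T + (y - 1))) * d <= P * exp (th * ln T) * gdom T r (y - 1).
Proof.
  intros HT Hth Hr HP Hy d D1 D2 D0. unfold gdom. replace (1 + (y - 1)) with y by ring.
  assert (R0 : 0 < rp T (1 / 2)) by apply rp_pos. assert (R1 : 0 < rp (y + T) (3 / 2)) by apply rp_pos.
  assert (Et : 0 < exp (th * ln T)) by apply exp_pos.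
  assert (Nn : 0 <= 48 * r * rp T (1 / 2) * rp (y + T) (3 / 2)) by (apply Rmult_le_pos; [apply Rmult_le_pos; lra|lra]).
  assert (Nn2 : 0 <= / y - / (y + T)) by (assert (/ (y + T) <= / y) by (apply Rinv_le_contravar; lra); lra).
  assert (Ex : exp (th * ln (T + (y - 1))) <= exp (th * ln T) * exp (th * ln ((y + T) / T))).
  { rewrite <- exp_plus. apply exp_le. rewrite <- Rmult_plus_distr_l, <- ln_mult by (try apply Rdiv_lt_0_compat; lra).
    apply Rmult_le_compat_l; [lra|]. apply ln_le; [lra|]. replace (T * ((y + T) / T)) with (y + T) by (field; lra). lra. }
  assert (HyT : 1 <= (y + T) / T).
  { apply (proj1 (Rle_div_r _ _ T ltac:(lra))). lra. }
  assert (Ex2 : exp (th * ln ((y + T) / T)) <= exp (1 / 2 * ln ((y + T) / T))).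
  { apply exp_le. apply Rmult_le_compat_r; [apply ln_nonneg; auto|lra]. }
  replace (P * exp (th * ln T) * (9 * (/ y - / (y + T)) + 48 * r * rp T (1 / 2) * rp (y + T) (3 / 2)))
    with (exp (th * ln T) * (P * (9 * (/ y - / (y + T)) + 48 * r * rp T (1 / 2) * rp (y + T) (3 / 2)))) by ring.
  apply Rle_trans with (exp (th * ln T) * exp (1 / 2 * ln ((y + T) / T)) * d).
  { apply Rmult_le_compat_r; auto. eapply Rle_trans; [exact Ex|]. apply Rmult_le_compat_l; lra. }
  rewrite Rmult_assoc. apply Rmult_le_compat_l; [lra|].
  destruct (Rle_lt_dec y T) as [H|H].
  - assert (E2 : exp (1 / 2 * ln ((y + T) / T)) <= 3 / 2).
    { apply Rle_trans with (exp (1 / 2 * ln ((3 / 2) * (3 / 2)))).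
      - apply exp_le, Rmult_le_compat_l; [lra|]. apply ln_le; [lra|]. apply (proj2 (Rle_div_l _ _ T ltac:(lra))). lra.
      - rewrite ln_mult by lra. replace (1 / 2 * (ln (3 / 2) + ln (3 / 2))) with (ln (3 / 2)) by field. rewrite exp_ln; lra. }
    apply Rle_trans with (3 / 2 * (P * (3 / y))); [apply Rmult_le_compat; auto; apply Rlt_le, exp_pos|].
    assert (/ y <= 2 * (/ y - / (y + T))).
    { assert (/ (y + T) <= / (2 * y)) by (apply Rinv_le_contravar; lra). rewrite Rinv_mult in H0. lra. }
    replace (3 / 2 * (P * (3 / y))) with (P * (9 / 2 * / y)) by (field; lra). apply Rmult_le_compat_l; lra.
  - apply Rle_trans with (exp (1 / 2 * ln ((y + T) / T)) * (P * (12 * r / y ^ 2))); [apply Rmult_le_compat_l; [apply Rlt_le, exp_pos|auto]|].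
    assert (E3 : exp (1 / 2 * ln ((y + T) / T)) = rp T (1 / 2) * (rp (y + T) (3 / 2) * (y + T) ^ 2)).
    { replace ((y + T) ^ 2) with (exp (2 * ln (y + T))).
      - unfold rp. rewrite <- !exp_plus. f_equal. rewrite ln_div by lra. field.
      - rewrite <- (exp_ln (y + T)) at 2 by lra. simpl. rewrite Rmult_1_r, <- exp_plus. f_equal. ring. }
    rewrite E3.
    replace (rp T (1 / 2) * (rp (y + T) (3 / 2) * (y + T) ^ 2) * (P * (12 * r / y ^ 2))) with
      (P * ((r * rp T (1 / 2) * rp (y + T) (3 / 2)) * (12 * ((y + T) ^ 2 / y ^ 2)))) by (field; lra).
    apply Rmult_le_compat_l; auto.
    assert (0 <= r * rp T (1 / 2) * rp (y + T) (3 / 2)) by (apply Rmult_le_pos; [apply Rmult_le_pos; lra|lra]).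
    assert ((y + T) ^ 2 / y ^ 2 <= 4).
    { apply (proj2 (Rle_div_l _ _ (y ^ 2) ltac:(apply pow_lt; lra))). nra. }
    assert (0 <= 9 * (/ y - / (y + T))) by lra.
    apply Rle_trans with ((r * rp T (1 / 2) * rp (y + T) (3 / 2)) * (12 * 4)); [apply Rmult_le_compat_l; lra|lra].
Qed.

(** The first part of [gdom] integrates to the logarithm, the second to the term in 1/T. Both
    half-lines together give 2 * 9 and 2 * 96, and division by 2 pi > 6 leaves 3 and 32. *)
Theorem smooth_bound (A : C -> C) (q x h E T th : R) (S1 S2 : C) : 1 / 2 <= q -> 0 < x -> 0 < h -> 0 <= E -> 1 <= T -> 0 <= th <= 1 / 2 ->
  (forall t, ctn (fun t => A (cc q t)) t) -> (forall t, Cmod (A (cc q t)) <= E * exp (th * ln (T + Rabs t))) ->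
  Plim A q x S1 -> Plim A q (x + h) S2 ->
  Cmod (S2 - S1) <= h * E * exp (q * ln (x + h)) * exp (th * ln T) * (3 * ln (1 + T) + 32 * ((x + h) / h) / T).
Proof.
  intros Hq Hx Hh HE HT Hth CA HA [E1 H1] [E2 H2]. set (r := (x + h) / h).
  assert (Hr : 0 <= r) by (apply Rdiv_le_0_compat; lra).
  set (P := h * exp (q * ln (x + h))). assert (HP : 0 < P) by (apply Rmult_lt_0_compat; [lra|apply exp_pos]).
  set (c := E * (P * exp (th * ln T))). assert (Hc : 0 <= c) by (apply Rmult_le_pos; [lra|apply Rmult_le_pos; [lra|apply Rlt_le, exp_pos]]).
  set (f := fun t => (A (cc q t) * pk (x + h) (cc q t) - A (cc q t) * pk x (cc q t))%C).
  assert (Cf : forall a b, con f a b).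
  { intros a b t Ht. unfold f. apply (ctn_ext (fun t => A (cc q t) * (pk (x + h) (cc q t) + Copp 1 * pk x (cc q t)))%C); [intros; ring|].
    apply ctn_mult; auto. apply ctn_plus; [apply ctn_pk; lra|apply ctn_mult; [apply ctn_const|apply ctn_pk; lra]]. }
  assert (Fb : forall t, Cmod (f t) <= c * gdom T r (Rabs t)).
  { intros t. unfold f. replace (A (cc q t) * pk (x + h) (cc q t) - A (cc q t) * pk x (cc q t))%C with (A (cc q t) * (pk (x + h) (cc q t) - pk x (cc q t)))%C by ring.
    rewrite Cmod_mult. destruct (pk_diff q x h t Hq Hx Hh) as [K1 K2]. fold P r in K1, K2.
    set (d := Cmod (pk (x + h) (cc q t) - pk x (cc q t))) in *. assert (D0 : 0 <= d) by apply Cmod_ge_0.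
    pose proof (gdom_dom T r th (1 + Rabs t) P HT Hth Hr ltac:(lra) ltac:(pose proof (Rabs_pos t); lra) d K1 K2 D0) as G.
    replace (1 + Rabs t - 1) with (Rabs t) in G by ring.
    apply Rle_trans with (E * exp (th * ln (T + Rabs t)) * d); [apply Rmult_le_compat_r; auto|].
    rewrite Rmult_assoc. unfold c. rewrite (Rmult_assoc E). apply Rmult_le_compat_l; auto. }
  assert (Cg : forall t, 0 <= t -> continuous (gdom T r) t).
  { intros t Ht. apply (ex_derive_continuous (K := R_AbsRing) (V := R_NormedModule)). unfold gdom, rp. auto_derive. repeat split; lra. }
  assert (Half : forall V, 0 <= V -> Cmod (CI f (- V) V) <= 2 * (c * (9 * ln (1 + T) + 96 * r / T))).
  { intros V HV. pose proof (Gdom_total T r V HT Hr HV) as GT. 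
    apply Rle_trans with (2 * (c * (Gdom T r V - Gdom T r 0))); [|apply Rmult_le_compat_l; [lra|apply Rmult_le_compat_l; lra]].
    rewrite (CI_Chasles f (- V) 0 V) by (try lra; apply Cf). eapply Rle_trans; [apply Cmod_triangle|].
    pose proof (CI_dom f (fun t => c * Gdom T r t) (fun t => c * gdom T r t) 0 V HV (Cf _ _)) as Q1.
    pose proof (CI_dom f (fun t => - (c * Gdom T r (- t))) (fun t => c * gdom T r (- t)) (- V) 0 ltac:(lra) (Cf _ _)) as Q2.
    cbv beta in Q1, Q2. rewrite Ropp_0, Ropp_involutive in Q2.
    assert (Q1' : Cmod (CI f 0 V) <= c * Gdom T r V - c * Gdom T r 0).
    { apply Q1; intros t Ht.
      - apply (is_derive_scal (Gdom T r) t c). apply Gdom_der; lra.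
      - apply (continuous_mult (K := R_AbsRing) (fun _ => c) (gdom T r)); [apply continuous_const|apply Cg; lra].
      - pose proof (Fb t) as Z. rewrite (Rabs_pos_eq t) in Z by lra. auto. }
    assert (Q2' : Cmod (CI f (- V) 0) <= - (c * Gdom T r 0) - - (c * Gdom T r V)).
    { apply Q2; intros t Ht.
      - assert (D : is_derive (fun t => Gdom T r (- t)) t (- gdom T r (- t))).
        { replace (- gdom T r (- t)) with (scal (-1) (gdom T r (- t))) by (unfold scal; simpl; unfold mult; simpl; ring).
          apply (is_derive_comp (Gdom T r) Ropp); [apply Gdom_der; lra|]. auto_derive; auto. }
        replace (c * gdom T r (- t)) with (- (c * - gdom T r (- t))) by ring.
        apply (is_derive_opp (V := R_NormedModule)). apply (is_derive_scal (fun t => Gdom T r (- t)) t c). auto.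
      - apply (continuous_mult (K := R_AbsRing) (fun _ => c) (fun t => gdom T r (- t))); [apply continuous_const|].
        apply (continuous_comp Ropp (gdom T r)); [apply (continuous_opp (V := R_NormedModule) (fun x => x)), continuous_id|apply Cg; lra].
      - pose proof (Fb t) as Z. rewrite (Rabs_left1 t) in Z by lra. auto. }
    lra. }
  assert (PI3 : 3 < PI) by (pose proof PI2_3_2; lra).
  assert (Main : 2 * PI * Cmod (S2 - S1) <= 2 * (c * (9 * ln (1 + T) + 96 * r / T))).
  { apply le_epsilon. intros e He.
    set (V := 4 + (Rabs E1 + Rabs E2) / e). pose proof (Rabs_pos E1) as A1. pose proof (Rabs_pos E2) as A2.
    assert (V4 : 4 <= V) by (unfold V; assert (0 <= (Rabs E1 + Rabs E2) / e) by (apply Rdiv_le_0_compat; lra); lra).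
    specialize (H1 V V4). specialize (H2 V V4). specialize (Half V ltac:(lra)).
    assert (EV : E1 / V + E2 / V <= e).
    { replace (E1 / V + E2 / V) with ((E1 + E2) / V) by (field; lra). apply (proj2 (Rle_div_l _ _ V ltac:(lra))).
      pose proof (Rle_abs E1). pose proof (Rle_abs E2). unfold V. replace (e * (4 + (Rabs E1 + Rabs E2) / e)) with (4 * e + (Rabs E1 + Rabs E2)) by (field; lra). lra. }
    rewrite <- (Rabs_pos_eq (2 * PI)) by lra. rewrite <- Cmod_R, <- Cmod_mult.
    unfold f in Half. rewrite CI_minus in Half by (try lra; apply ctn_apk; auto; lra).
    set (I1 := CI (fun t => A (cc q t) * pk x (cc q t))%C (- V) V) in *. set (I2 := CI (fun t => A (cc q t) * pk (x + h) (cc q t))%C (- V) V) in *.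
    replace (RtoC (2 * PI) * (S2 - S1))%C with ((I2 - I1) + ((I1 - RtoC (2 * PI) * S1) - (I2 - RtoC (2 * PI) * S2)))%C by ring.
    eapply Rle_trans; [apply Cmod_triangle|]. apply Rplus_le_compat; auto. eapply Rle_trans; [apply Cmod_minus_le|]. lra. }
  pose proof (Cmod_ge_0 (S2 - S1)) as S0.
  assert (Cmod (S2 - S1) <= c * (3 * ln (1 + T) + 32 * r / T)).
  { assert (6 * Cmod (S2 - S1) <= 2 * PI * Cmod (S2 - S1)) by (apply Rmult_le_compat_r; lra). unfold Rdiv in *. lra. }
  eapply Rle_trans; [exact H|]. right. unfold c, P. ring.
Qed.

Lemma csum_split a N K : csum a (N + K) = (csum a N + csum (fun n => a (N + n)%nat) K)%C.
Proof.
  induction K; cbn [csum]; [rewrite Nat.add_0_r; ring|]. rewrite Nat.add_succ_r. cbn [csum]. rewrite IHK. ring.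
Qed.

Lemma pp_sum h K : rsum (fun j => pp (h - INR (S j))) K <= pp h ^ 2 / 2.
Proof.
  assert (G : rsum (fun j => pp (h - INR (S j))) K <= pp h ^ 2 / 2 - pp (h - INR K) ^ 2 / 2).
  { induction K as [|K IH]; cbn [rsum]; [simpl; rewrite Rminus_0_r; lra|].
    eapply Rle_trans; [apply Rplus_le_compat_r, IH|]. rewrite S_INR. unfold pp in *.
    assert (Rmax 0 (h - (INR K + 1)) <= Rmax 0 (h - INR K) ^ 2 / 2 - Rmax 0 (h - (INR K + 1)) ^ 2 / 2); [|lra].
    destruct (Rle_lt_dec (h - (INR K + 1)) 0).
    - rewrite (Rmax_left 0 (h - (INR K + 1))) by lra. pose proof (pow2_ge_0 (Rmax 0 (h - INR K))). lra.
    - rewrite !Rmax_right by lra. nra. }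
  pose proof (pow2_ge_0 (pp (h - INR K))). lra.
Qed.

(* The smoothed weight equals [h] up to [N]; the terms in (N, N + h) are bounded trivially. *)
Lemma unsmooth (c : nat -> C) N K h : (forall n, Cmod (c n) <= 1) -> 0 < h ->
  Cmod (csum (fun n => c n * RtoC (pp (INR N + h - INR (S n))))%C (N + K)
    - csum (fun n => c n * RtoC (pp (INR N - INR (S n))))%C (N + K) - RtoC h * csum c N) <= h ^ 2 / 2.
Proof.
  intros Hc Hh. rewrite !csum_split.
  assert (E1 : csum (fun n => c n * RtoC (pp (INR N + h - INR (S n))))%C N = (csum (fun n => c n * RtoC (pp (INR N - INR (S n))))%C N + RtoC h * csum c N)%C).
  { rewrite <- csum_scal, <- csum_plus. apply csum_ext. intros n Hn. assert (INR (S n) <= INR N) by (apply le_INR; lia).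
    unfold pp. rewrite !Rmax_right by lra. replace (INR N + h - INR (S n)) with (INR N - INR (S n) + h) by ring. rewrite RtoC_plus. ring. }
  rewrite E1.
  assert (E2 : csum (fun n => c (N + n)%nat * RtoC (pp (INR N - INR (S (N + n)))))%C K = 0%C).
  { rewrite (csum_ext _ (fun _ => 0%C)); [apply csum_zero|]. intros n _. rewrite pp_0; [ring|].
    assert (INR N <= INR (S (N + n))) by (apply le_INR; lia). lra. }
  rewrite E2.
  set (X := csum (fun n => c (N + n)%nat * _)%C K). set (Y := csum (fun n => c n * _)%C N).
  assert (HX : Cmod X <= h ^ 2 / 2).
  { eapply Rle_trans; [apply csum_le with (M := fun j => pp (h - INR (S j)))|].
    - intros n _. rewrite Cmod_mult, Cmod_R. replace (INR N + h - INR (S (N + n))) with (h - INR (S n)) by (rewrite !S_INR, plus_INR; ring).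
      assert (0 <= pp (h - INR (S n))) by apply Rmax_l. rewrite Rabs_pos_eq by auto.
      rewrite <- (Rmult_1_l (pp (h - INR (S n)))) at 2. apply Rmult_le_compat_r; auto.
    - eapply Rle_trans; [apply pp_sum|]. unfold pp. rewrite Rmax_right by lra. lra. }
  replace (Y + RtoC h * csum c N + X - (Y + 0) - RtoC h * csum c N)%C with X by ring. auto.
Qed.

Lemma exp_ln_sum th T t : 1 <= T -> 0 <= th <= 1 -> exp (th * ln (T + Rabs t)) <= T * (1 + Rabs t).
Proof.
  intros HT Hth. pose proof (Rabs_pos t). 
  apply Rle_trans with (exp (ln (T + Rabs t))).
  - apply exp_le. assert (0 <= ln (T + Rabs t)) by (apply ln_nonneg; lra). nra.
  - rewrite exp_ln by lra. nra.
Qed.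

Section RHsec.
Hypothesis RH : RiemannHypothesis.
Variable u : R.
Hypothesis Hu : 10.46 <= u.

Let l := exp u.
Let b := 2 / u.
Let th := 0.5 / u.
Let q := 1 / 2 + 2 * b.

Lemma th_range : 0 <= th <= 1 / 2.
Proof. unfold th. split; [apply Rdiv_le_0_compat; lra|]. apply (proj2 (Rle_div_l _ _ u ltac:(lra))). lra. Qed.

Lemma om_tau t tau : om l (t + tau) <= ln (exp l + Rabs tau + Rabs t).
Proof.
  unfold om. apply ln_le; [pose proof (exp_pos l); pose proof (Rabs_pos (t + tau)); lra|]. pose proof (Rabs_triang t tau). lra.
Qed.

(** Perron's formula for 1 / zeta (s + i tau) between x and x + h. With h = sqrt x the terms lost in
    unsmoothing cost h / 2 <= x^q, and N <= exp (2 l) gives h <= exp l <= T, so the 1/T term of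
    [smooth_bound] stays bounded. *)
Theorem mobius_twist_sum tau N : (1 <= N)%nat -> INR N <= exp (2 * l) ->
  Cmod (csum (fun n => RtoC (mu (S n)) * cp (INR (S n)) (cc 0 tau))%C N) <=
    7 * ln (1 + (exp l + Rabs tau)) * exp (th * ln (exp l + Rabs tau)) * exp (q * ln (INR N)).
Proof.
  intros HN1 HN. pose proof (b_range u Hu) as Hb. fold b in Hb. pose proof th_range as Hth. pose proof (num_big u Hu) as Bl. fold l in Bl.
  set (T := exp l + Rabs tau). set (x := INR N). assert (Hx : 1 <= x) by (apply (le_INR 1); auto).
  assert (HT0 : exp l <= T) by (unfold T; pose proof (Rabs_pos tau); lra).
  assert (HT : 34000 <= T) by (pose proof (exp_ineq1_le l); lra).
  set (h := sqrt x). assert (Hh : 1 <= h) by (unfold h; rewrite <- sqrt_1; apply sqrt_le_1_alt; lra).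
  assert (Hhh : h * h = x) by (apply sqrt_def; lra).
  set (c := fun n => (RtoC (mu (S n)) * cp (INR (S n)) (cc 0 tau))%C).
  assert (Hc : forall n, Cmod (c n) <= 1).
  { intros n. unfold c. rewrite Cmod_mult, Cmod_cp. simpl Re. rewrite rp_0, Rmult_1_r. apply Cmod_mu. }
  set (sh := fun z : C => (cc 0 tau + 1 * z)%C).
  assert (shR : forall z, Re (sh z) = Re z) by (intros z; unfold sh; destruct z; simpl; ring).
  assert (shI : forall z, Im (sh z) = Im z + tau) by (intros z; unfold sh; destruct z; simpl; ring).
  (* The factor z - 1 cancels the 1 / (s - 1) built into [perron_lim] and makes its residue zero;
     the other factor is 1 / zeta (z + i tau). *)
  set (B := fun z => ((z - 1) * ((sh z - 1) * / zf 0 (sh z)))%C).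
  set (D := fun z : C => q - b < Re z < 2 + b).
  assert (Hz : exists G, hol D (fun z => / zf 0 (sh z))%C G).
  { eexists. apply (hol_comp_affine D (fun z => 1 / 2 < Re z) (fun z => / zf 0 z)%C _ (cc 0 tau) 1 (hol_zf_inv RH)).
    intros z Hz. fold (sh z). rewrite shR. unfold D, q in Hz. lra. }
  destruct Hz as [G HG].
  assert (Hs : exists G, hol D sh G) by (eexists; apply hol_plus; [apply hol_const|apply hol_mult; [apply hol_const|apply hol_id]]).
  destruct Hs as [G1 HG1].
  pose proof (hol_mult D _ _ _ _ (hol_minus D _ _ _ _ (hol_id D) (hol_const D 1)) (hol_mult D _ _ _ _ (hol_minus D _ _ _ _ HG1 (hol_const D 1)) HG)) as HB.
  fold B in HB.
  assert (ZN : forall z, 1 / 2 < Re z -> zf 0 (sh z) <> 0%C) by (intros z Hz; apply zf_neq_0; auto; rewrite shR; auto).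
  assert (AB : forall z, q <= Re z -> Cmod ((sh z - 1) * / zf 0 (sh z)) <= exp (th * ln (T + Rabs (Im z)))).
  { intros z Hz. assert (N0 := ZN z ltac:(unfold q in Hz; lra)). pose proof (proj1 (Cmod_gt_0 _) N0) as P.
    rewrite Cmod_mult, Cmod_inv by auto. apply (Rmult_le_reg_r (Cmod (zf 0 (sh z)))); auto.
    rewrite Rmult_assoc, Rinv_l, Rmult_1_r by lra.
    pose proof (inv_zeta_bound RH u Hu (sh z) ltac:(rewrite shR; unfold q, b in Hz; lra)) as I. 
    eapply Rle_trans; [exact I|]. apply Rmult_le_compat_r; [lra|]. apply exp_le, Rmult_le_compat_l; [lra|].
    rewrite shI. apply om_tau. }
  assert (HS : forall t, csums (fun n => c n * cp (INR (S n)) (cc 2 t))%C (B (cc 2 t) * / (cc 2 t - 1))%C).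
  { intros t. set (s := cc 2 t). pose proof (mu_csums (sh s) ltac:(rewrite shR; unfold s; simpl; lra)) as M.
    pose proof (mu_zeta (sh s) ltac:(rewrite shR; unfold s; simpl; lra)) as Z.
    assert (N1 : (s - 1)%C <> 0%C) by (apply s_neq_1; unfold s; simpl; lra).
    assert (N2 : (sh s - 1)%C <> 0%C) by (apply s_neq_1; rewrite shR; unfold s; simpl; lra).
    assert (N3 := ZN s ltac:(unfold s; simpl; lra)).
    replace (B s * / (s - 1))%C with (CSeries (fun d => RtoC (mu (S d)) * cp (INR (S d)) (sh s))%C).
    - eapply csums_ext; [|exact M]. intros n. unfold c. cbv beta. unfold sh. rewrite cp_plus, Cmult_1_l. ring.
    - set (m := CSeries _) in *. unfold zt in Z. unfold B. 
      replace m with (m * (zf 0 (sh s) * / (sh s - 1)) * ((sh s - 1) * / zf 0 (sh s)))%C by (field; auto). rewrite Z. field; auto. }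
  assert (HGr : forall z, q <= Re z <= 2 -> 1 <= Rabs (Im z) -> Cmod (B z) <= T * (1 + Rabs (Im z)) * Cmod (z - 1)).
  { intros z Hz _. unfold B. rewrite Cmod_mult, Rmult_comm. apply Rmult_le_compat_r; [apply Cmod_ge_0|].
    eapply Rle_trans; [apply AB; lra|]. apply exp_ln_sum; lra. }
  set (M := (N + N)%nat).
  assert (HM : x + h <= INR (S M)) by (unfold M; rewrite S_INR, plus_INR; fold x; nra).
  assert (Hq : 0 < q < 1) by (unfold q; lra).
  pose proof (perron_lim c 1 B _ q b T x M Hc Hq ltac:(unfold q; lra) HB HS HGr ltac:(lra)) as L1.
  pose proof (perron_lim c 1 B _ q b T (x + h) M Hc Hq ltac:(unfold q; lra) HB HS HGr ltac:(lra)) as L2.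
  assert (B1 : B (RtoC 1) = 0%C) by (unfold B; ring). rewrite B1 in L1, L2.
  assert (LN1 : forall t, (cc q t - 1)%C <> 0%C) by (intros t; apply s_neq_1; simpl; lra).
  assert (EA : forall t : R, ((sh (cc q t) - 1) * / zf 0 (sh (cc q t)) = B (cc q t) * / (cc q t - 1))%C).
  { intros t. unfold B. set (w := ((sh (cc q t) - 1) * / zf 0 (sh (cc q t)))%C).
    replace ((cc q t - 1) * w * / (cc q t - 1))%C with (((cc q t - 1) * / (cc q t - 1)) * w)%C by ring.
    rewrite Cinv_r by apply LN1. ring. }
  pose proof (smooth_bound (fun s => B s * / (s - 1))%C q x h 1 T th _ _ ltac:(unfold q; lra) ltac:(lra) ltac:(lra) ltac:(lra) ltac:(lra) Hth
    ltac:(intros t; apply (ctn_ext (fun t => (sh (cc q t) - 1) * / zf 0 (sh (cc q t)))%C); [exact EA|];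
      apply (con_vert _ _ D q t t (hol_mult D _ _ _ _ (hol_minus D _ _ _ _ HG1 (hol_const D 1)) HG)); [intros; unfold D; simpl; lra|lra])
    ltac:(intros t; cbv beta; rewrite <- EA, Rmult_1_l; apply (AB (cc q t)); simpl; lra) L1 L2) as SB.
  pose proof (unsmooth c N N h Hc ltac:(lra)) as US0. fold M x in US0.
  set (Sa := csum _ M) in US0. set (Sb := csum _ M) in US0. fold Sa Sb in SB.
  assert (US : h * Cmod (csum c N) <= Cmod (Sa - Sb) + h ^ 2 / 2).
  { rewrite <- (Rabs_pos_eq h) at 1 by lra. rewrite <- Cmod_R, <- Cmod_mult.
    replace (RtoC h * csum c N)%C with ((Sa - Sb) - (Sa - Sb - RtoC h * csum c N))%C by ring.
    eapply Rle_trans; [apply Cmod_minus_le|]. lra. }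
  replace (Sa - 0 * RtoC ((x + h) ^ 2 / 2) - (Sb - 0 * RtoC (x ^ 2 / 2)))%C with (Sa - Sb)%C in SB by ring.
  set (Z := exp (th * ln T)) in *. assert (HZ : 1 <= Z).
  { apply Rle_trans with (exp 0); [rewrite exp_0; lra|]. apply exp_le. apply Rmult_le_pos; [lra|apply ln_nonneg; lra]. }
  set (Xq := exp (q * ln x)). 
  assert (HXq : h <= Xq).
  { unfold Xq. apply Rle_trans with (exp (ln h)); [rewrite exp_ln; lra|]. apply exp_le. rewrite <- Hhh, ln_mult by lra.
    assert (0 <= ln h) by (apply ln_nonneg; auto). unfold q. nra. }
  assert (HXq2 : exp (q * ln (x + h)) <= 2 * Xq).
  { apply Rle_trans with (exp (q * ln (2 * x))); [apply exp_le, Rmult_le_compat_l; [lra|apply ln_le; nra]|].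
    rewrite ln_mult by lra. rewrite Rmult_plus_distr_l, exp_plus. apply Rmult_le_compat_r; [apply Rlt_le, exp_pos|].
    rewrite <- (exp_ln 2) at 2 by lra. apply exp_le. assert (0 <= ln 2) by (apply ln_nonneg; lra). nra. }
  assert (Hr : 32 * ((x + h) / h) / T <= 64).
  { apply (proj2 (Rle_div_l _ _ T ltac:(lra))). assert ((x + h) / h = h + 1) by (rewrite <- Hhh; field; lra).
    rewrite H. assert (h <= exp l); [|lra]. unfold h. replace (exp l) with (sqrt (exp (2 * l))).
    - apply sqrt_le_1_alt. auto.
    - replace (2 * l) with (l + l) by ring. rewrite exp_plus. apply sqrt_square. apply Rlt_le, exp_pos. }
  assert (HL : 34000 <= ln (1 + T)).
  { apply Rle_trans with (ln (exp l)); [rewrite ln_exp; lra|]. apply ln_le; [apply exp_pos|lra]. }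
  set (LT := ln (1 + T)) in *.
  apply (Rmult_le_reg_l h); [lra|]. eapply Rle_trans; [exact US|]. 
  assert (HP : 0 <= Xq) by lra.
  apply Rle_trans with (h * (2 * Xq * Z * (3 * LT + 64)) + h * (Xq / 2)).
  - apply Rplus_le_compat.
    + eapply Rle_trans; [exact SB|]. rewrite Rmult_1_r, !Rmult_assoc. apply Rmult_le_compat_l; [lra|].
      rewrite <- !Rmult_assoc. apply Rmult_le_compat; [apply Rmult_le_pos; [apply Rlt_le, exp_pos|lra]| | |lra].
      * assert (0 <= 32 * ((x + h) / h) / T) by (apply Rdiv_le_0_compat; [apply Rmult_le_pos; [lra|apply Rdiv_le_0_compat; lra]|lra]). lra.
      * apply Rmult_le_compat_r; lra.
    + nra.
  - rewrite <- Rmult_plus_distr_l. apply Rmult_le_compat_l; [lra|].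
    assert (Xq / 2 <= Xq * Z * (1 / 2)) by nra.
    assert (0 <= Xq * Z) by nra. nra.
Qed.

End RHsec.

(** ** The Mertens function *)

Lemma exp_neg_2 y : 0 <= y -> exp (- y) <= 1 - y + y ^ 2 / 2.
Proof.
  intros Hy. pose proof (is_derive_mono (fun y => (1 - y + y ^ 2 / 2) - exp (- y)) (fun y => exp (- y) - (1 - y)) 0 y Hy) as H.
  cbv beta in H. rewrite Ropp_0, exp_0 in H. assert (1 - 0 + 0 ^ 2 / 2 - 1 <= 1 - y + y ^ 2 / 2 - exp (- y)); [|lra].
  apply H; intros x Hx; [auto_derive; auto; field|pose proof (exp_ineq1_le (- x)); lra].
Qed.

Lemma exp_neg_3 y : 0 <= y -> 1 - y + y ^ 2 / 2 - y ^ 3 / 6 <= exp (- y).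
Proof.
  intros Hy. pose proof (is_derive_mono (fun y => exp (- y) - (1 - y + y ^ 2 / 2 - y ^ 3 / 6)) (fun y => (1 - y + y ^ 2 / 2) - exp (- y)) 0 y Hy) as H.
  cbv beta in H. rewrite Ropp_0, exp_0 in H. assert (1 - (1 - 0 + 0 ^ 2 / 2 - 0 ^ 3 / 6) <= exp (- y) - (1 - y + y ^ 2 / 2 - y ^ 3 / 6)); [|lra].
  apply H; intros x Hx; [auto_derive; auto; field|pose proof (exp_neg_2 x); lra].
Qed.

Lemma exp_ub y c : 0 <= y -> 0 < c -> 1 <= c * (1 - y + y ^ 2 / 2 - y ^ 3 / 6) -> exp y <= c.
Proof.
  intros Hy Hc H. pose proof (exp_neg_3 y Hy) as Q. rewrite exp_Ropp in Q. pose proof (exp_pos y) as P.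
  assert (1 <= c * / exp y) by nra. apply (Rmult_le_compat_r (exp y)) in H0; [|lra]. rewrite Rmult_assoc, Rinv_l in H0 by lra. lra.
Qed.

Lemma ln_10 : 2.302 <= ln 10.
Proof.
  rewrite <- (ln_exp 2.302). apply ln_le; [apply exp_pos|].
  assert (E3 : exp (1 / 8) <= 1.13317) by (apply exp_ub; lra). pose proof (exp_pos (1 / 8)).
  assert (E2 : exp (1 / 4) <= 1.284075) by (replace (1 / 4) with (1 / 8 + 1 / 8) by field; rewrite exp_plus; nra). pose proof (exp_pos (1 / 4)).
  assert (E1 : exp (1 / 2) <= 1.64885) by (replace (1 / 2) with (1 / 4 + 1 / 4) by field; rewrite exp_plus; nra). pose proof (exp_pos (1 / 2)).
  assert (E0 : exp 1 <= 2.71871) by (replace 1 with (1 / 2 + 1 / 2) by field; rewrite exp_plus; nra). pose proof (exp_pos 1).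
  assert (Es : exp 0.052 <= 1.0534) by (apply exp_ub; lra). pose proof (exp_pos 0.052).
  replace 2.302 with (1 + 1 + 1 / 4 + 0.052) by lra. rewrite !exp_plus.
  assert (F1 : exp 1 * exp 1 <= 7.3914) by nra. assert (F2 : exp 1 * exp 1 * exp (1 / 4) <= 9.4912) by nra. nra.
Qed.

(** 1.151 is half of 2.302, the lower bound for ln 10; it enters through u = ln (ln x / 2). *)
Lemma ln_1151 : 0.14 <= ln 1.151.
Proof. rewrite <- (ln_exp 0.14). apply ln_le; [apply exp_pos|]. apply exp_ub; lra. Qed.

Lemma threshold x c X : 0 < c -> 0 <= X -> Rpower 10 (c * Rpower 10 X) <= x ->
  0 < x /\ 2.302 * c * exp (2.302 * X) <= ln x.
Proof.
  intros Hc HX H. pose proof ln_10 as L. assert (P : 0 < Rpower 10 (c * Rpower 10 X)) by apply exp_pos. split; [lra|].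
  apply ln_le in H; auto. rewrite ln_Rpower in H. eapply Rle_trans; [|exact H].
  assert (exp (2.302 * X) <= Rpower 10 X) by (unfold Rpower; apply exp_le; nra).
  pose proof (exp_pos (2.302 * X)). set (p := exp (2.302 * X)) in *. set (r := Rpower 10 X) in *.
  apply Rle_trans with (c * p * ln 10); [|apply Rmult_le_compat_r; [lra|apply Rmult_le_compat_l; lra]].
  assert (0 < c * p) by (apply Rmult_lt_0_compat; lra). nra.
Qed.

Lemma floor_nat_spec x : 1 <= x -> (1 <= floor_nat x)%nat /\ INR (floor_nat x) <= x < INR (floor_nat x) + 1.
Proof.
  intros Hx. unfold floor_nat. destruct (base_Int_part x) as [B1 B2].
  assert (Hz : (1 <= Int_part x)%Z).
  { assert (0 < Int_part x)%Z; [|lia]. apply lt_IZR. simpl. lra. }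
  split; [lia|]. rewrite INR_IZR_INZ, Z2Nat.id by lia. lra.
Qed.

Lemma mertens_rsum N : IZR (mertens_nat N) = rsum (fun n => mu (S n)) N.
Proof. induction N; [reflexivity|]. cbn [mertens_nat rsum]. rewrite plus_IZR, IHN. reflexivity. Qed.

(** The twist tau = 0. The line at 1/2 + 4/u contributes ln x / 2 + 4 ln x / u, and the size of
    1/zeta contributes 0.5 / u * l = ln x / (4 u). *)
Lemma mertens_bound (RH : RiemannHypothesis) x u : 10.46 <= u -> 0 < x -> ln x = 2 * exp u ->
  Rabs (Mertens x) <= 7 * (exp u + 1) * exp (ln x / 2 + 17 / 4 * ln x / u).
Proof.
  intros Hu Hx Lx. pose proof (num_big u Hu) as Bl. set (l := exp u) in *.
  assert (X1 : 1 <= x).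
  { rewrite <- (exp_ln x) by auto. pose proof (exp_ineq1_le (ln x)). lra. }
  destruct (floor_nat_spec x X1) as [N1 [N2 _]]. set (N := floor_nat x) in *.
  pose proof (mobius_twist_sum RH u Hu 0 N N1) as T. fold l in T.
  assert (NE : INR N <= exp (2 * l)) by (rewrite <- Lx, exp_ln; auto).
  specialize (T NE). rewrite Rabs_R0, Rplus_0_r, ln_exp in T.
  unfold Mertens. fold N. rewrite mertens_rsum, <- Cmod_R, <- csum_RtoC.
  rewrite (csum_ext _ (fun n => RtoC (mu (S n)) * cp (INR (S n)) (cc 0 0))%C).
  2:{ intros n _. replace (cc 0 0) with (RtoC 0) by reflexivity. rewrite cp_R, rp_0. ring. }
  eapply Rle_trans; [exact T|]. rewrite Rmult_assoc, <- exp_plus.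
  assert (L1 : ln (1 + exp l) <= l + 1).
  { rewrite <- (ln_exp (l + 1)). apply ln_le; [pose proof (exp_pos l); lra|]. rewrite exp_plus. pose proof exp_1_lb. pose proof (exp_ineq1_le l). nra. }
  assert (L0 : 0 <= ln (1 + exp l)) by (apply ln_nonneg; pose proof (exp_pos l); lra).
  apply Rmult_le_compat; [lra|apply Rlt_le, exp_pos|lra|]. apply exp_le.
  assert (LN : ln (INR N) <= ln x) by (apply ln_le; auto; apply lt_0_INR; lia).
  assert (P : 0 < 2 / u) by (apply Rdiv_lt_0_compat; lra).
  apply Rle_trans with (0.5 / u * l + (1 / 2 + 2 * (2 / u)) * ln x); [apply Rplus_le_compat_l, Rmult_le_compat_l; lra|].
  rewrite Lx. fold l. replace 0.5 with (1 / 2) by lra. right. field. lra.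
Qed.

Theorem mertens_explicit (RH : RiemannHypothesis) x : Rpower 10 (Rpower 10 (4487/1000)) <= x ->
  Rabs (Mertens x) <= 6/10 * sqrt x * exp (52251/10000 * ln x / ln (ln (3 * exp 1 / 2 * sqrt x)) + ln (ln x)).
Proof.
  intros H. destruct (threshold x 1 (4487 / 1000) ltac:(lra) ltac:(lra) ltac:(rewrite Rmult_1_l; auto)) as [X0 HL].
  set (u := ln (ln x / 2)).
  assert (Hu : 10.46 <= u).
  { unfold u. apply Rle_trans with (ln (1.151 * exp (2.302 * (4487 / 1000)))).
    - rewrite ln_mult, ln_exp by (try apply exp_pos; lra). pose proof ln_1151. lra.
    - apply ln_le; [apply Rmult_lt_0_compat; [lra|apply exp_pos]|]. lra. }
  assert (L0 : 0 < ln x) by (pose proof (exp_pos (2.302 * (4487 / 1000))); lra).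
  assert (EU : ln x = 2 * exp u) by (unfold u; rewrite exp_ln; lra).
  pose proof (mertens_bound RH x u Hu X0 EU) as B. eapply Rle_trans; [exact B|].
  pose proof (num_big u Hu) as Bl. pose proof (num_u u Hu) as Nu. set (l := exp u) in *.
  assert (SX : sqrt x = exp l).
  { rewrite <- (exp_ln x) by auto. rewrite EU. replace (2 * l) with (l + l) by ring. rewrite exp_plus. apply sqrt_square, Rlt_le, exp_pos. }
  rewrite SX, (exp_plus _ (ln (ln x))), (exp_ln (ln x)) by auto.
  assert (LL : ln (3 * exp 1 / 2 * exp l) <= 1.001 * l).
  { rewrite <- (ln_exp (1.001 * l)). apply ln_le; [apply Rmult_lt_0_compat; [pose proof (exp_pos 1); lra|apply exp_pos]|].
    replace (1.001 * l) with (0.001 * l + l) by lra. rewrite exp_plus. apply Rmult_le_compat_r; [apply Rlt_le, exp_pos|].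
    pose proof (exp_ineq1_le (0.001 * l)). pose proof exp_le_3. lra. }
  assert (LL0 : l <= ln (3 * exp 1 / 2 * exp l)).
  { rewrite <- (ln_exp l) at 1. apply ln_le; [apply exp_pos|]. pose proof exp_1_lb. pose proof (exp_pos l). nra. }
  set (w := ln (ln (3 * exp 1 / 2 * exp l))).
  assert (W1 : u <= w) by (unfold w; rewrite <- (ln_exp u); apply ln_le; [apply exp_pos|auto]).
  assert (W2 : w <= u + 0.001).
  { unfold w. apply Rle_trans with (ln (1.001 * l)); [apply ln_le; lra|]. rewrite ln_mult by lra. unfold l. rewrite ln_exp.
    assert (ln 1.001 <= 0.001); [|lra]. rewrite <- (ln_exp 0.001). apply ln_le; [lra|]. pose proof (exp_ineq1_le 0.001). lra. }
  rewrite EU. replace (2 * l / 2 + 17 / 4 * (2 * l) / u) with (l + 17 / 2 * l / u) by (field; lra). rewrite exp_plus.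
  (* The iterated logarithm [w] of the statement exceeds u by at most 0.001. The extra 2 in the
     exponent pays for 7 (l + 1) against 1.2 l. *)
  assert (G : 17 / 2 * l / u + 2 <= 52251 / 10000 * (2 * l) / w).
  { apply Rle_trans with (10 * l / w).
    - apply (Rmult_le_reg_r (u * w)); [nra|]. replace ((17 / 2 * l / u + 2) * (u * w)) with (17 / 2 * l * w + 2 * (u * w)) by (field; lra).
      replace (10 * l / w * (u * w)) with (10 * l * u) by (field; lra).
      assert (17 / 2 * l * w <= 17 / 2 * l * (u + 0.001)) by (apply Rmult_le_compat_l; lra).
      assert (u * w <= 0.00034 * l * (u + 0.001)) by (apply Rmult_le_compat; lra). nra.
    - apply Rmult_le_compat_r; [left; apply Rinv_0_lt_compat; lra|lra]. }
  apply exp_le in G. rewrite exp_plus in G.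
  assert (E2 : 7.38 <= exp 2) by (replace 2 with (1 + 1) by ring; rewrite exp_plus; pose proof exp_1_lb; nra).
  pose proof (exp_pos (17 / 2 * l / u)) as P1. set (e1 := exp (17 / 2 * l / u)) in *. set (e2 := exp (52251 / 10000 * (2 * l) / w)) in *.
  pose proof (exp_pos l) as P2. set (e3 := exp l) in *.
  replace (7 * (l + 1) * (e3 * e1)) with (e3 * (7 * (l + 1) * e1)) by ring.
  replace (6 / 10 * e3 * (e2 * (2 * l))) with (e3 * (1.2 * l * e2)) by lra.
  apply Rmult_le_compat_l; [lra|]. assert (7.38 * e1 <= e2) by nra.
  apply Rle_trans with (1.2 * l * (7.38 * e1)); [|apply Rmult_le_compat_l; lra]. nra.
Qed.

(** Needed is 17/4 <= (al - 1/2) u up to a little room: 4.2509 exceeds 17/4 by enough to gain a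
    factor exp 3.1, which covers 7 / 0.179 halved. The value 0.179 is the least A in the list. *)
Lemma mertens_table (RH : RiemannHypothesis) al X A x : 4.487 <= X -> 0.179 <= A -> 
  4.2509 <= (al - 1 / 2) * (2.302 * X + 0.14) -> 0 <= al - 1 / 2 -> Rpower 10 (Rpower 10 X) <= x ->
  Rabs (Mertens x) <= A * Rpower x al * ln x.
Proof.
  intros HX HA Hal Hal0 H. destruct (threshold x 1 X ltac:(lra) ltac:(lra) ltac:(rewrite Rmult_1_l; auto)) as [X0 HL].
  set (u := ln (ln x / 2)).
  assert (Hu0 : 2.302 * X + 0.14 <= u).
  { unfold u. apply Rle_trans with (ln (1.151 * exp (2.302 * X))).
    - rewrite ln_mult, ln_exp by (try apply exp_pos; lra). pose proof ln_1151. lra.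
    - apply ln_le; [apply Rmult_lt_0_compat; [lra|apply exp_pos]|]. lra. }
  assert (Hu : 10.46 <= u) by lra.
  assert (L0 : 0 < ln x) by (pose proof (exp_pos (2.302 * X)); nra).
  assert (EU : ln x = 2 * exp u) by (unfold u; rewrite exp_ln; lra).
  pose proof (mertens_bound RH x u Hu X0 EU) as B. eapply Rle_trans; [exact B|].
  pose proof (num_big u Hu) as Bl. pose proof (num_u u Hu) as Nu. pose proof (num_cube u Hu) as Nc. unfold Rpower. rewrite EU. set (l := exp u) in *.
  replace (2 * l / 2 + 17 / 4 * (2 * l) / u) with (l + 17 / 2 * l / u) by (field; lra).
  assert (G : l + 17 / 2 * l / u + 3.1 <= al * (2 * l)).
  { assert (4.2509 / u <= al - 1 / 2).
    { apply (proj2 (Rle_div_l _ _ u ltac:(lra))). eapply Rle_trans; [exact Hal|]. apply Rmult_le_compat_l; lra. }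
    assert (8.5018 * l / u <= (al - 1 / 2) * (2 * l)).
    { replace (8.5018 * l / u) with (4.2509 / u * (2 * l)) by (unfold Rdiv; lra). apply Rmult_le_compat_r; lra. }
    assert (3.1 <= 0.0018 * l / u).
    { apply (proj1 (Rle_div_r _ _ u ltac:(lra))). nra. }
    replace (8.5018 * l / u) with (17 / 2 * l / u + 0.0018 * l / u) in H1 by (unfold Rdiv; lra). lra. }
  apply exp_le in G. rewrite exp_plus in G.
  assert (E2 : 21 <= exp 3.1) by (replace 3.1 with (3 + 0.1) by lra; rewrite exp_plus; pose proof exp_3_lb; pose proof (exp_ineq1_le 0.1); nra).
  pose proof (exp_pos (l + 17 / 2 * l / u)) as P1. set (e1 := exp (l + 17 / 2 * l / u)) in *. set (e2 := exp (al * (2 * l))) in *.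
  assert (21 * e1 <= e2) by nra.
  apply Rle_trans with (0.179 * (21 * e1) * (2 * l)); [nra|]. apply Rmult_le_compat_r; [lra|]. apply Rmult_le_compat; lra.
Qed.

Theorem mertens_table_all (RH : RiemannHypothesis) al X A : In (al, X, A) M_table ->
  forall x, Rpower 10 (Rpower 10 X) <= x -> Rabs (Mertens x) <= A * Rpower x al * ln x.
Proof.
  intros Hin x. cbn [M_table In] in Hin.
  repeat (destruct Hin as [E|Hin]; [inversion E; subst; apply mertens_table; auto; lra|]). destruct Hin.
Qed.

(** ** k-free integers *)

Definition kf (k n : nat) : R := if kfreeb k n then 1 else 0.
(** The smoothed count of multiples of q up to X. The cut-off M is invisible once M >= X, and is
    shared by all q. *)
Definition psi (q : nat) (X : R) (M : nat) : R := rsum (fun m => pp (X - INR (q * S m))) (M / q).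

Lemma count_rsum k N : INR (count_kfree k N) = rsum (fun n => kf k (S n)) N.
Proof.
  induction N; [reflexivity|]. cbn [count_kfree rsum]. rewrite plus_INR, IHN. unfold kf. destruct (kfreeb k (S N)); reflexivity.
Qed.

Lemma kf_mobius k n M : (1 <= k)%nat -> (1 <= n)%nat -> (n <= M)%nat ->
  rsum (fun d => if dv (S d ^ k) n then mu (S d) else 0) M = kf k n.
Proof.
  intros Hk Hn HM. unfold kf. rewrite <- (mobius_kfree k n M Hk Hn HM). apply rsum_ext. intros d _. rewrite expn_pow. reflexivity.
Qed.

Lemma kf_weighted k M X : (1 <= k)%nat ->
  csum (fun n => RtoC (kf k (S n)) * RtoC (pp (X - INR (S n))))%C M = csum (fun d => RtoC (mu (S d)) * RtoC (psi (S d ^ k) X M))%C M.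
Proof.
  intros Hk.
  transitivity (csum (fun n => csum (fun d => if dv (S d ^ k) (S n) then RtoC (mu (S d)) else 0) M * RtoC (pp (X - INR (S n))))%C M).
  - apply csum_ext. intros n Hn. f_equal. rewrite <- (kf_mobius k (S n) M) by lia. rewrite <- csum_RtoC. apply csum_ext.
    intros d _. destruct (dv (S d ^ k) (S n)); reflexivity.
  - rewrite (dirichlet_rearr (fun n => RtoC (mu n)) (fun n => RtoC (pp (X - INR n))) (fun d => d ^ k)%nat M M).
    + apply csum_ext. intros d _. rewrite csum_RtoC. reflexivity.
    + intros d. pose proof (Nat.pow_nonzero (S d) k). lia.
Qed.

Lemma pp_step X1 X2 y : X1 <= X2 ->
  (if Rle_dec y X1 then 1 else 0) * (X2 - X1) <= pp (X2 - y) - pp (X1 - y) <= (if Rle_dec y X2 then 1 else 0) * (X2 - X1).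
Proof.
  intros H. unfold pp. destruct (Rle_dec y X1); destruct (Rle_dec y X2);
    repeat match goal with |- context [Rmax 0 ?z] => destruct (Rle_lt_dec z 0); [rewrite (Rmax_left 0 z) by lra|rewrite (Rmax_right 0 z) by lra] end; lra.
Qed.

Lemma count_multiples (q : nat) X K : (1 <= q)%nat -> 0 <= X -> X <= INR q * (INR K + 1) ->
  X / INR q - 1 <= rsum (fun m => if Rle_dec (INR (q * S m)) X then 1 else 0) K <= X / INR q.
Proof.
  intros Hq HX HK. assert (Q : 1 <= INR q) by (apply (le_INR 1); auto).
  set (Y := X / INR q). assert (EX : X = INR q * Y) by (unfold Y; field; lra).
  assert (HY : 0 <= Y) by (apply Rdiv_le_0_compat; lra).
  assert (HKY : Y <= INR K + 1) by (apply (Rmult_le_reg_l (INR q)); lra).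
  assert (G : forall K, (rsum (fun m => if Rle_dec (INR (q * S m)) X then 1 else 0) K <= INR K /\ rsum (fun m => if Rle_dec (INR (q * S m)) X then 1 else 0) K <= Y)
     /\ (rsum (fun m => if Rle_dec (INR (q * S m)) X then 1 else 0) K = INR K \/ Y - 1 <= rsum (fun m => if Rle_dec (INR (q * S m)) X then 1 else 0) K)).
  { clear K HK HKY. induction K as [|K [[I1 I2] I3]]; [cbn [rsum]; simpl; split; [split; lra|left; lra]|].
    cbn [rsum]. rewrite (S_INR K). set (r := rsum _ K) in *.
    destruct (Rle_dec (INR (q * S K)) X) as [H|H]; rewrite mult_INR, S_INR, EX in H.
    - apply Rmult_le_reg_l in H; [|lra]. split; [lra|]. destruct I3; [left; lra|right; lra].
    - assert (Y < INR K + 1) by (apply Rnot_le_lt; intros Z; apply H; apply Rmult_le_compat_l; lra).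
      split; [lra|]. right. destruct I3; lra. }
  destruct (G K) as [[G1 G2] G3]. destruct G3; lra.
Qed.

(** The difference lies between h times the number of multiples up to X and h times that up to X +
    h; rounding in these counts gives the error h. *)
Lemma psi_diff q X h M : (1 <= q)%nat -> 0 <= X -> 0 <= h -> X + h <= INR M ->
  Rabs (psi q (X + h) M - psi q X M - (X * h + h ^ 2 / 2) / INR q) <= h + h ^ 2 / 2 * / INR q.
Proof.
  intros Hq HX Hh HM. assert (Q : 1 <= INR q) by (apply (le_INR 1); auto).
  set (K := (M / q)%nat).
  assert (HK : INR M <= INR q * (INR K + 1)).
  { rewrite <- S_INR, <- mult_INR. apply le_INR. pose proof (Nat.mul_succ_div_gt M q). unfold K. lia. }
  pose proof (count_multiples q X K Hq HX ltac:(lra)) as [C1 _].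
  pose proof (count_multiples q (X + h) K Hq ltac:(lra) ltac:(lra)) as [_ C2].
  assert (E : psi q (X + h) M - psi q X M = rsum (fun m => pp (X + h - INR (q * S m)) - pp (X - INR (q * S m))) K).
  { unfold psi. fold K. clear. induction K; cbn [rsum]; lra. }
  assert (L : rsum (fun m => if Rle_dec (INR (q * S m)) X then 1 else 0) K * h <= psi q (X + h) M - psi q X M).
  { rewrite E, Rmult_comm, <- rsum_scal. apply rsum_le. intros m _. rewrite Rmult_comm. pose proof (pp_step X (X + h) (INR (q * S m)) ltac:(lra)) as [P _].
    replace (X + h - X) with h in P by ring. exact P. }
  assert (U : psi q (X + h) M - psi q X M <= rsum (fun m => if Rle_dec (INR (q * S m)) (X + h) then 1 else 0) K * h).
  { rewrite E, Rmult_comm, <- rsum_scal. apply rsum_le. intros m _. rewrite Rmult_comm. pose proof (pp_step X (X + h) (INR (q * S m)) ltac:(lra)) as [_ P].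
    replace (X + h - X) with h in P by ring. exact P. }
  apply (Rmult_le_compat_r h) in C1; [|lra]. apply (Rmult_le_compat_r h) in C2; [|lra].
  assert (0 <= h ^ 2 / 2 * / INR q) by (apply Rmult_le_pos; [pose proof (pow2_ge_0 h); lra|left; apply Rinv_0_lt_compat; lra]).
  replace ((X * h + h ^ 2 / 2) / INR q) with (X / INR q * h + h ^ 2 / 2 * / INR q) by (field; lra).
  replace ((X / INR q - 1) * h) with (X / INR q * h - h) in C1 by ring.
  replace ((X + h) / INR q * h) with (X / INR q * h + 2 * (h ^ 2 / 2 * / INR q)) in C2 by (field; lra).
  apply Rabs_le. lra.
Qed.

(** * The constant 1 / zeta(k) and the small divisors *)

Lemma rp_pow n k : 0 < n -> rp n (INR k) = / n ^ k.
Proof.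
  intros H. unfold rp. replace (- INR k * ln n) with (- (INR k * ln n)) by ring. rewrite exp_Ropp, <- ln_pow, exp_ln; auto. apply pow_lt; auto.
Qed.

Lemma zeta_real_zt k : (2 <= k)%nat -> zt (RtoC (INR k)) = RtoC (zeta_real k).
Proof.
  intros Hk. assert (HK : 2 <= INR k) by (apply (le_INR 2); auto).
  assert (E1 : forall n, cp (INR (S n)) (RtoC (INR k)) = RtoC (/ INR (S n) ^ k)).
  { intros n. rewrite cp_R, rp_pow; auto. pose proof (INR_S_ge1 n). lra. }
  apply (csums_unique _ _ _ (zsum_lim (RtoC (INR k)) ltac:(simpl; lra))).
  eapply csums_ext; [intros n; symmetry; apply E1|].
  assert (Ex : ex_series (fun n => / INR (S n) ^ k)).
  { eapply ex_series_ext; [|apply (ex_series_rp' (INR k)); lra]. intros n. apply rp_pow, lt_0_INR; lia. }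
  intros e He. destruct (is_series_rsum _ _ (Series_correct _ Ex) e He) as [N0 H]. exists N0. intros N HN.
  rewrite csum_RtoC, <- RtoC_minus, Cmod_R. apply H; auto.
Qed.

Lemma zeta_real_ge1 k : (2 <= k)%nat -> 1 <= zeta_real k.
Proof.
  intros Hk. assert (HK : 2 <= INR k) by (apply (le_INR 2); auto).
  assert (Ex : ex_series (fun n => / INR (S n) ^ k)).
  { eapply ex_series_ext; [|apply (ex_series_rp' (INR k)); lra]. intros n. apply rp_pow, lt_0_INR; lia. }
  eapply Rle_trans; [|apply (rsum_le_Series _ 1)]; auto.
  - cbn [rsum]. simpl INR. rewrite pow1. lra.
  - intros n. left. apply Rinv_0_lt_compat, pow_lt. pose proof (INR_S_ge1 n). lra.
Qed.

Lemma mu_zeta_tail k M : (2 <= k)%nat -> (1 <= M)%nat ->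
  Rabs (/ zeta_real k - rsum (fun d => mu (S d) * / INR (S d) ^ k) M) <= / INR M.
Proof.
  intros Hk HM. assert (HK : 2 <= INR k) by (apply (le_INR 2); auto). pose proof (zeta_real_ge1 k Hk) as Z1.
  set (s := RtoC (INR k)). assert (Hs : 1 < Re s) by (unfold s; simpl; lra).
  pose proof (mu_zeta s Hs) as Z. pose proof (mu_csums s Hs) as Cs. set (m := CSeries _) in *.
  unfold s in Z. rewrite zeta_real_zt in Z by auto.
  assert (Em : m = RtoC (/ zeta_real k)).
  { rewrite RtoC_inv by lra. apply (f_equal (fun z => (z * / RtoC (zeta_real k))%C)) in Z. rewrite <- Cmult_assoc, Cinv_r in Z.
    - rewrite Cmult_1_r, Cmult_1_l in Z. exact Z.
    - intros E. apply RtoC_inj in E. lra. }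
  rewrite <- Cmod_R, RtoC_minus, <- Em, <- csum_RtoC.
  rewrite (csum_ext _ (fun d => RtoC (mu (S d)) * cp (INR (S d)) s)%C).
  2:{ intros d _. unfold s. rewrite cp_R, rp_pow, RtoC_mult; auto. pose proof (INR_S_ge1 d). lra. }
  apply (csums_tail _ _ _ _ Cs). intros n.
  eapply Rle_trans; [apply csum_le with (M := fun j => rp (INR (S (M + j))) (1 + 1))|].
  - intros j _. rewrite Cmod_mult, Cmod_cp. rewrite <- (Rmult_1_l (rp _ (1 + 1))).
    apply Rmult_le_compat; [apply Cmod_ge_0|apply Rlt_le, rp_pos|apply Cmod_mu|]. apply rp_le_exp; [apply INR_S_ge1|unfold s; simpl; lra].
  - eapply Rle_trans; [apply rp_sum_tail; [auto|lra]|]. rewrite Rinv_1, Rmult_1_l. 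
    pose proof (rp_pos (INR (M + n)) 1). rewrite (rp_1 (INR M)) by (apply lt_0_INR; lia). lra.
Qed.

Lemma small_divisors k D0 X h M : (2 <= k)%nat -> 0 <= X -> 0 <= h -> X + h <= INR M ->
  Cmod (csum (fun d => RtoC (mu (S d)) * (RtoC (psi (S d ^ k) (X + h) M) - RtoC (psi (S d ^ k) X M) - RtoC ((X * h + h ^ 2 / 2) * / INR (S d) ^ k)))%C D0)
    <= INR D0 * h + h ^ 2.
Proof.
  intros Hk HX Hh HM. 
  eapply Rle_trans; [apply csum_le with (M := fun d => h + h ^ 2 / 2 * rp (INR (S d)) (1 + 1))|].
  - intros d _. rewrite <- !RtoC_minus, <- RtoC_mult, Cmod_R, Rabs_mult. rewrite <- (Rmult_1_l (h + _)).
    assert (Hq : (1 <= S d ^ k)%nat) by (pose proof (Nat.pow_nonzero (S d) k); lia).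
    pose proof (psi_diff (S d ^ k) X h M Hq HX Hh HM) as P. rewrite pow_INR in P. unfold Rdiv at 1 in P.
    apply Rmult_le_compat; [apply Rabs_pos|apply Rabs_pos|apply mu_le1|]. eapply Rle_trans; [exact P|].
    apply Rplus_le_compat_l. apply Rmult_le_compat_l; [pose proof (pow2_ge_0 h); lra|].
    pose proof (INR_S_ge1 d). rewrite <- rp_pow by lra. apply rp_le_exp; auto. pose proof (le_INR 2 k Hk) as Z. simpl in Z. lra.
  - rewrite rsum_plus, rsum_scal. pose proof (rp_sum_le D0 1 ltac:(lra)) as Q. rewrite Rinv_1 in Q.
    assert (E : rsum (fun _ => h) D0 = INR D0 * h) by (clear; induction D0; cbn [rsum]; [simpl; ring|rewrite S_INR, IHD0; ring]).
    rewrite E. pose proof (pow2_ge_0 h). nra.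
Qed.

(** * Partial summation and the large divisors *)

Lemma rsum_telescope (f : nat -> R) K : rsum (fun j => f j - f (S j)) K = f O - f K.
Proof. induction K; cbn [rsum]; lra. Qed.

Lemma abel_identity (c : nat -> C) (v : nat -> R) K :
  csum (fun j => c j * RtoC (v j))%C K = (csum c K * RtoC (v K) + csum (fun j => csum c (S j) * RtoC (v j - v (S j))) K)%C.
Proof.
  induction K as [|K IH]; cbn [csum] in *; [ring|]. rewrite IH, RtoC_minus. ring.
Qed.

(** Partial sums of size n^q against weights n^(-q-p). Each Abel term is compared with n^(-p) -
    (n+1)^(-p), so that the sum telescopes to N0^(-p). *)
Lemma abel_bound (a : nat -> C) (C0 q p : R) N0 K : 0 <= C0 -> 0 < q < 1 -> 1 / 2 <= p -> (1 <= N0)%nat ->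
  (forall n, (1 <= n)%nat -> (n <= N0 + K)%nat -> Cmod (csum a n) <= C0 * rp (INR n) (- q)) ->
  Cmod (csum (fun j => a (N0 + j)%nat * RtoC (rp (INR (S (N0 + j))) (q + p)))%C K) <= 8 * C0 * rp (INR N0) p.
Proof.
  intros HC Hq Hp HN Ha. pose proof (le_INR 1 N0 HN) as N1. simpl INR in N1.
  assert (up : forall n m, (1 <= n)%nat -> (n <= m)%nat -> rp (INR n) (- q) <= rp (INR m) (- q)).
  { intros n m Hn Hm. unfold rp. apply exp_le. rewrite Ropp_involutive. apply Rmult_le_compat_l; [lra|]. apply ln_le; [apply lt_0_INR; lia|apply le_INR; auto]. }
  assert (R : forall j, (j <= K)%nat -> Cmod (csum (fun n => a (N0 + n)%nat) j) <= 2 * C0 * rp (INR (N0 + j)) (- q)).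
  { intros j Hj. replace (csum (fun n => a (N0 + n)%nat) j) with (csum a (N0 + j) - csum a N0)%C by (rewrite csum_split; ring).
    eapply Rle_trans; [apply Cmod_minus_le|]. pose proof (Ha (N0 + j)%nat ltac:(lia) ltac:(lia)). pose proof (Ha N0 ltac:(lia) ltac:(lia)).
    pose proof (up N0 (N0 + j)%nat HN ltac:(lia)). assert (C0 * rp (INR N0) (- q) <= C0 * rp (INR (N0 + j)) (- q)) by (apply Rmult_le_compat_l; auto). lra. }
  assert (dn : forall n m r, (1 <= n)%nat -> (n <= m)%nat -> 0 <= r -> rp (INR m) r <= rp (INR n) r).
  { intros n m r Hn Hm Hr. apply rp_le_base; auto; [apply lt_0_INR; lia|apply le_INR; auto]. }
  rewrite (abel_identity (fun n => a (N0 + n)%nat) (fun j => rp (INR (S (N0 + j))) (q + p))).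
  eapply Rle_trans; [apply Cmod_triangle|].
  assert (T1 : Cmod (csum (fun n => a (N0 + n)%nat) K * RtoC (rp (INR (S (N0 + K))) (q + p))) <= 2 * C0 * rp (INR N0) p).
  { rewrite Cmod_mult, Cmod_R, Rabs_pos_eq by (apply Rlt_le, rp_pos).
    apply Rle_trans with (2 * C0 * rp (INR (N0 + K)) (- q) * rp (INR (N0 + K)) (q + p)).
    - apply Rmult_le_compat; [apply Cmod_ge_0|apply Rlt_le, rp_pos|apply R; auto|apply dn; [lia|lia|lra]].
    - rewrite Rmult_assoc, <- rp_plus. replace (- q + (q + p)) with p by ring. apply Rmult_le_compat_l; [lra|]. apply dn; [lia|lia|lra]. }
  assert (T2 : Cmod (csum (fun j => csum (fun n => a (N0 + n)%nat) (S j) * RtoC (rp (INR (S (N0 + j))) (q + p) - rp (INR (S (N0 + S j))) (q + p)))%C K)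
    <= 6 * C0 * rp (INR N0) p).
  { eapply Rle_trans; [apply csum_le with (M := fun j => 6 * C0 * (rp (INR (S (N0 + j))) p - rp (INR (S (N0 + S j))) p))|].
    - intros j Hj. rewrite Nat.add_succ_r. set (n := S (N0 + j)).
      assert (D : 0 <= rp (INR n) (q + p) - rp (INR (S n)) (q + p)) by (pose proof (dn n (S n) (q + p) ltac:(unfold n; lia) ltac:(lia) ltac:(lra)); lra).
      rewrite Cmod_mult, Cmod_R, Rabs_pos_eq by auto.
      pose proof (R (S j) ltac:(lia)) as Rj. rewrite Nat.add_succ_r in Rj. fold n in Rj.
      apply Rle_trans with (2 * C0 * rp (INR n) (- q) * (rp (INR n) (q + p) - rp (INR (S n)) (q + p))); [apply Rmult_le_compat_r; auto|].
      replace (6 * C0 * (rp (INR n) p - rp (INR (S n)) p)) with (2 * C0 * (3 * (rp (INR n) p - rp (INR (S n)) p))) by ring.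
      rewrite Rmult_assoc. apply Rmult_le_compat_l; [lra|].
      rewrite Rmult_minus_distr_l, <- rp_plus. replace (- q + (q + p)) with p by ring.
      pose proof (rp_telescope n p ltac:(unfold n; lia) ltac:(lra)) as Tl.
      pose proof (INR_S_ge1 n) as HS. assert (Hn : 1 <= INR n) by (apply (le_INR 1); unfold n; lia).
      (* The mismatch between n^q and (n+1)^q costs a term (n+1)^(-p-1), which for p >= 1/2 is at
         most twice the telescoping difference by [rp_telescope]; hence the factor 3. *)
      assert (LB : rp (INR (S n)) (- q) * (1 - / INR (S n)) <= rp (INR n) (- q)).
      { replace (- q) with ((1 - q) + - (1)) by ring. rewrite !rp_plus, !rp_m1 by lra.
        replace (rp (INR (S n)) (1 - q) * INR (S n) * (1 - / INR (S n))) with (rp (INR (S n)) (1 - q) * (INR (S n) - 1)) by (field; lra).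
        replace (INR (S n) - 1) with (INR n) by (rewrite S_INR; ring). apply Rmult_le_compat_r; [lra|]. apply dn; [unfold n; lia|lia|lra]. }
      apply (Rmult_le_compat_r (rp (INR (S n)) (q + p))) in LB; [|apply Rlt_le, rp_pos].
      replace (rp (INR (S n)) (- q) * (1 - / INR (S n)) * rp (INR (S n)) (q + p)) with (rp (INR (S n)) p - rp (INR (S n)) (p + 1)) in LB.
      2:{ rewrite (rp_plus _ p 1), rp_1 by lra. replace p with (- q + (q + p)) at 1 2 by ring. rewrite (rp_plus _ (- q)). ring. }
      assert (rp (INR (S n)) (p + 1) <= 2 * (p * rp (INR (S n)) (p + 1))) by (pose proof (rp_pos (INR (S n)) (p + 1)); nra). lra.
    - rewrite rsum_scal, (rsum_telescope (fun j => rp (INR (S (N0 + j))) p)). 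
      apply Rmult_le_compat_l; [lra|]. pose proof (rp_pos (INR (S (N0 + K))) p). rewrite Nat.add_0_r.
      pose proof (dn N0 (S N0) p HN ltac:(lia) ltac:(lra)). lra. }
  lra.
Qed.

Section RHsec.
Hypothesis RH : RiemannHypothesis.
Variable u : R.
Hypothesis Hu : 24 <= u.

Let l := exp u.
Let b := 2 / u.
Let th := 0.5 / u.
Let q := 1 / 2 + 2 * b.
Let T := exp l.

Lemma Hu' : 10.46 <= u. Proof. lra. Qed.

Lemma b_range' : 0 < b <= 1 / 12.
Proof.
  unfold b. split; [apply Rdiv_lt_0_compat; lra|]. apply (proj2 (Rle_div_l _ _ u ltac:(lra))). lra.
Qed.

Lemma zf_growth_line z : q <= Re z <= 2 -> 1 <= Rabs (Im z) -> Cmod (zf 0 z) <= 2 * T * (1 + Rabs (Im z)) * Cmod (z - 1).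
Proof.
  intros Hz Iz. pose proof b_range' as Hb. pose proof (zeta_bound RH u Hu' z ltac:(unfold q, b in Hz; lra)) as Q.
  pose proof (th_range u Hu') as Hth. fold th in Hth, Q. fold l in Q.
  assert (D : 1 <= Cmod (z - 1)).
  { eapply Rle_trans; [exact Iz|]. eapply Rle_trans; [|apply Rabs_Im_le]. right. f_equal. destruct z; simpl; ring. }
  assert (T1 : 1 <= T) by (unfold T; pose proof (exp_ineq1_le l); pose proof (exp_pos u); unfold l in *; lra).
  pose proof (exp_ln_sum th T (Im z) T1 ltac:(lra)) as E. unfold om in Q. fold T in Q.
  pose proof (exp_pos (th * ln (T + Rabs (Im z)))).
  apply Rle_trans with (T * (1 + Rabs (Im z)) * (2 * Cmod (z - 1))); [|right; ring].
  eapply Rle_trans; [exact Q|]. apply Rmult_le_compat; lra.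
Qed.

Lemma hol_zf_strip : hol (fun z => q - b < Re z < 2 + b) (zf 0) (zf 1).
Proof.
  pose proof b_range' as Hb. apply (hol_sub _ (fun z => - 3 / 4 < Re z)); [|apply hol_zf]. intros z Hz. unfold q in Hz. lra.
Qed.

Lemma ctn_zt t : ctn (fun t => zf 0 (cc q t) * / (cc q t - 1))%C t.
Proof.
  pose proof b_range' as Hb. apply ctn_mult.
  - apply (con_vert (zf 0) _ _ q t t hol_zf_strip); [intros; simpl; unfold q; lra|lra].
  - apply (ctn_comp Cinv (fun t => (cc q t - 1)%C)); [apply Cinv_Cctn, s_neq_1; simpl; unfold q; lra|eapply rder_ctn, (vert_rder q 1)].
Qed.

Lemma Plim_zeta X M : 0 < X <= INR (S M) ->
  Plim (fun s => zf 0 s * / (s - 1))%C q X (RtoC (rsum (fun m => pp (X - INR (S m))) M - X ^ 2 / 2)).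
Proof.
  intros HX. pose proof b_range' as Hb.
  pose proof (perron_lim (fun _ => RtoC 1) 1 (zf 0) _ q b (2 * T) X M ltac:(intros; cbv beta; rewrite Cmod_1; lra) ltac:(unfold q; lra) ltac:(unfold q; lra) hol_zf_strip) as P.
  specialize (P ltac:(intros t; eapply csums_ext; [|apply (zsum_lim (cc 2 t)); simpl; lra]; intros; cbv beta; ring) zf_growth_line HX).
  rewrite zf_1 in P. rewrite RtoC_minus, <- csum_RtoC. 
  rewrite (csum_ext _ (fun n => 1 * RtoC (pp (X - INR (S n))))%C) by (intros; ring).
  replace (1 * RtoC (X ^ 2 / 2))%C with (RtoC (X ^ 2 / 2)) in P by ring. exact P.
Qed.

Lemma Plim_psi Q X M : (1 <= Q)%nat -> 0 < X <= INR M ->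
  Plim (fun s => cp (INR Q) s * (zf 0 s * / (s - 1)))%C q X (RtoC (psi Q X M - X ^ 2 / 2 * / INR Q)).
Proof.
  intros HQ HX. pose proof (le_INR 1 Q HQ) as Q1. simpl in Q1. pose proof b_range' as Hb.
  assert (HK : INR M <= INR Q * INR (S (M / Q))).
  { rewrite <- mult_INR. apply le_INR. pose proof (Nat.mul_succ_div_gt M Q). lia. }
  assert (HX2 : 0 < X / INR Q <= INR (S (M / Q))).
  { split; [apply Rdiv_lt_0_compat; lra|]. apply (proj2 (Rle_div_l _ _ (INR Q) ltac:(lra))). lra. }
  pose proof (Plim_dilate (INR Q) _ q X _ ltac:(unfold q; lra) ltac:(lra) (proj1 HX) ctn_zt (Plim_zeta (X / INR Q) (M / Q) HX2)) as P.
  rewrite <- RtoC_mult in P.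
  replace (psi Q X M - X ^ 2 / 2 * / INR Q) with (INR Q * (rsum (fun m => pp (X / INR Q - INR (S m))) (M / Q) - (X / INR Q) ^ 2 / 2)); [exact P|].
  rewrite Rmult_minus_distr_l, <- rsum_scal. unfold psi. f_equal; [|field; lra]. apply rsum_ext. intros m _.
  unfold pp. rewrite <- RmaxRmult by lra. rewrite mult_INR. f_equal; field; lra.
Qed.

Variable k : nat.
Hypothesis Hk : (2 <= k)%nat.
Variables D0 K : nat.
Hypothesis HD0 : (1 <= D0)%nat.
Hypothesis HM : INR (D0 + K) <= exp (2 * l).

Let A (s : C) : C := csum (fun j => RtoC (mu (S (D0 + j))) * (cp (INR (S (D0 + j) ^ k)) s * (zf 0 s * / (s - 1))))%C K.

(** 448 = 4 * 8 * 14: the factors from zeta, from [abel_bound], and from the twisted Möbius sums. *)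
Definition large_E : R := 448 * u * INR k * rp (INR D0) ((INR k - 1) * q).

(** At s = q + i t the power d^(-k s) splits into d^(-q-p), with p = (k - 1) q, and the twist d^(- i
    k t). Hence the twisted sums are needed at tau = k t, and partial summation removes the real
    power. *)
Lemma A_bound t : Cmod (A (cc q t)) <= large_E * exp (3 * th * ln (T + Rabs t)).
Proof.
  pose proof b_range' as Hb. pose proof (th_range u Hu') as Hth. fold th in Hth. pose proof (num_big u Hu') as Bl. fold l in Bl.
  pose proof (le_INR 2 k Hk) as K2. simpl in K2.
  set (s := cc q t). set (p := (INR k - 1) * q). set (tau := INR k * t).
  assert (Hq : 0 < q < 1) by (unfold q; lra).
  set (a := fun n => (RtoC (mu (S n)) * cp (INR (S n)) (cc 0 tau))%C).
  assert (EA : A s = (zf 0 s * / (s - 1) * csum (fun j => a (D0 + j)%nat * RtoC (rp (INR (S (D0 + j))) (q + p))) K)%C).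
  { unfold A. rewrite <- csum_scal. apply csum_ext. intros j _. unfold a. set (n := S (D0 + j)).
    replace (cp (INR (n ^ k)) s) with (RtoC (rp (INR n) (q + p)) * cp (INR n) (cc 0 tau))%C; [ring|].
    rewrite <- cp_R, <- cp_plus. unfold cp. f_equal. rewrite pow_INR, ln_pow by (apply lt_0_INR; unfold n; lia).
    apply C_eta; unfold s, p, tau; simpl; ring. }
  rewrite EA, Cmod_mult.
  set (Tt := T + Rabs tau). set (W := ln (T + Rabs t)).
  assert (T1 : 34000 <= T) by (unfold T; pose proof (exp_ineq1_le l); lra).
  pose proof (Rabs_pos t) as Rt. pose proof (Rabs_pos tau) as Rta.
  set (C0 := 7 * ln (1 + Tt) * exp (th * ln Tt)).
  assert (LT : 0 <= ln (1 + Tt)) by (apply ln_nonneg; unfold Tt; lra).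
  assert (HC0 : 0 <= C0) by (apply Rmult_le_pos; [lra|apply Rlt_le, exp_pos]).
  assert (F : Cmod (csum (fun j => a (D0 + j)%nat * RtoC (rp (INR (S (D0 + j))) (q + p)))%C K) <= 8 * C0 * rp (INR D0) p).
  { apply abel_bound; auto; [unfold p, q; nra|]. intros n Hn1 Hn2.
    pose proof (mobius_twist_sum RH u Hu' tau n Hn1 ltac:(fold l; eapply Rle_trans; [apply le_INR; exact Hn2|exact HM])) as TM.
    fold l T Tt b th q in TM. unfold rp. rewrite Ropp_involutive. exact TM. }
  assert (Z : Cmod (zf 0 s * / (s - 1)) <= 4 * exp (th * W)).
  { pose proof (zeta_bound RH u Hu' s ltac:(fold b; unfold s, q; simpl; lra)) as Q. fold l th in Q. unfold om in Q. simpl Im in Q. fold T W in Q.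
    assert (N1 : (s - 1)%C <> 0%C) by (apply s_neq_1; unfold s; simpl; lra). pose proof (proj1 (Cmod_gt_0 _) N1) as P1.
    assert (P2 : 1 / 3 <= Cmod (s - 1)).
    { eapply Rle_trans; [|apply Rabs_Re_le]. unfold s; simpl. rewrite Rabs_left; unfold q; lra. }
    rewrite Cmod_mult, Cmod_inv by auto. apply (Rmult_le_reg_r (Cmod (s - 1))); auto. rewrite Rmult_assoc, Rinv_l, Rmult_1_r by lra.
    eapply Rle_trans; [exact Q|]. pose proof (exp_pos (th * W)). nra. }
  assert (C1 : C0 <= 14 * u * INR k * exp (2 * th * W)).
  { assert (L1 : ln (1 + Tt) <= ln (INR k) + W).
    { unfold W. rewrite <- ln_mult by lra. apply ln_le; [unfold Tt; lra|]. unfold Tt, tau. rewrite Rabs_mult, (Rabs_pos_eq (INR k)) by lra. nra. }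
    assert (thp : 0 < th) by (unfold th; apply Rdiv_lt_0_compat; lra).
    (* The logarithm is traded for one more power with exponent [th] = 1 / (2 u), so that the bound
       keeps the form required by [smooth_bound]. In total there are three such powers: one from
       zeta, two from the twisted sums. *)
    assert (L2 : ln (1 + Tt) <= 2 * u * exp (th * ln (1 + Tt))).
    { pose proof (exp_ineq1_le (th * ln (1 + Tt))) as Q. apply Rle_trans with (2 * u * (th * ln (1 + Tt))).
      - right. unfold th. replace 0.5 with (1 / 2) by lra. field. lra.
      - apply Rmult_le_compat_l; lra. }
    assert (L3 : exp (th * ln Tt) <= exp (th * ln (1 + Tt))).
    { apply exp_le, Rmult_le_compat_l; [lra|]. apply ln_le; unfold Tt; lra. }
    assert (L4 : exp (th * ln (1 + Tt)) * exp (th * ln (1 + Tt)) <= INR k * exp (2 * th * W)).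
    { rewrite <- exp_plus. apply Rle_trans with (exp (ln (INR k) + 2 * th * W)); [|rewrite exp_plus, exp_ln by lra; lra].
      apply exp_le. assert (0 <= ln (INR k)) by (apply ln_nonneg; lra). nra. }
    pose proof (exp_pos (th * ln (1 + Tt))) as P1. set (e := exp (th * ln (1 + Tt))) in *. pose proof (exp_pos (th * ln Tt)) as P2.
    unfold C0. apply Rle_trans with (7 * (2 * u * e) * e); [apply Rmult_le_compat; lra|]. nra. }
  pose proof (rp_pos (INR D0) p) as RP. pose proof (exp_pos (th * W)) as E1. pose proof (exp_pos (2 * th * W)) as E2.
  apply Rle_trans with (4 * exp (th * W) * (8 * (14 * u * INR k * exp (2 * th * W)) * rp (INR D0) p)).
  - apply Rmult_le_compat; [apply Cmod_ge_0|apply Cmod_ge_0|auto|]. eapply Rle_trans; [exact F|]. apply Rmult_le_compat_r; lra.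
  - right. unfold large_E. fold p. fold W. replace (3 * th * W) with (th * W + 2 * th * W) by ring. rewrite exp_plus. ring.
Qed.

Theorem large_divisors X h : 0 < X -> 0 < h -> X + h <= INR (D0 + K) ->
  Cmod (csum (fun j => RtoC (mu (S (D0 + j))) * (RtoC (psi (S (D0 + j) ^ k) (X + h) (D0 + K)) - RtoC (psi (S (D0 + j) ^ k) X (D0 + K))
     - RtoC ((X * h + h ^ 2 / 2) * / INR (S (D0 + j)) ^ k)))%C K)
  <= h * large_E * exp (q * ln (X + h)) * exp (3 * th * l) * (3 * ln (1 + T) + 32 * ((X + h) / h) / T).
Proof.
  intros HX Hh HXM. pose proof b_range' as Hb. pose proof (th_range u Hu') as Hth. fold th in Hth.
  set (Sx := fun X => csum (fun j => RtoC (mu (S (D0 + j))) * RtoC (psi (S (D0 + j) ^ k) X (D0 + K) - X ^ 2 / 2 * / INR (S (D0 + j) ^ k)))%C K).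
  assert (CT : forall j t, ctn (fun t => RtoC (mu (S (D0 + j))) * (cp (INR (S (D0 + j) ^ k)) (cc q t) * (zf 0 (cc q t) * / (cc q t - 1))))%C t).
  { intros j t. apply ctn_mult; [apply ctn_const|]. apply ctn_mult; [apply ctn_cp|apply ctn_zt]. }
  assert (PL : forall X, 0 < X <= INR (D0 + K) -> Plim A q X (Sx X)).
  { intros X0 HX0. apply (Plim_csum (fun j s => RtoC (mu (S (D0 + j))) * (cp (INR (S (D0 + j) ^ k)) s * (zf 0 s * / (s - 1))))%C); [unfold q; lra|exact CT|].
    intros j _. apply (Plim_scal _ (fun s => cp (INR (S (D0 + j) ^ k)) s * (zf 0 s * / (s - 1)))%C); [unfold q; lra| |].
    - intros t. apply ctn_mult; [apply ctn_cp|apply ctn_zt].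
    - apply Plim_psi; auto. pose proof (Nat.pow_nonzero (S (D0 + j)) k). lia. }
  assert (CA : forall t, ctn (fun t => A (cc q t)) t).
  { intros t. unfold A. clear - CT. induction K; cbn [csum]; [apply ctn_const|]. apply ctn_plus; auto. }
  assert (HE : 0 <= large_E).
  { unfold large_E. pose proof (pos_INR k). pose proof (rp_pos (INR D0) ((INR k - 1) * q)). repeat apply Rmult_le_pos; lra. }
  assert (T1 : 1 <= T) by (unfold T; pose proof (exp_ineq1_le l); pose proof (exp_pos u); unfold l in *; lra).
  assert (Th3 : 0 <= 3 * th <= 1 / 2).
  { split; [lra|]. unfold th. replace (3 * (0.5 / u)) with (1.5 / u) by (unfold Rdiv; lra). apply (proj2 (Rle_div_l _ _ u ltac:(lra))). lra. }
  pose proof (smooth_bound A q X h large_E T (3 * th) (Sx X) (Sx (X + h)) ltac:(unfold q; lra) HX Hh HE T1 Th3 CA A_bound (PL X ltac:(lra)) (PL (X + h) ltac:(lra))) as SB.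
  assert (LT : ln T = l) by apply ln_exp. rewrite LT in SB.
  replace (Sx (X + h)%R - Sx X)%C with (csum (fun j => RtoC (mu (S (D0 + j))) * (RtoC (psi (S (D0 + j) ^ k) (X + h) (D0 + K)) - RtoC (psi (S (D0 + j) ^ k) X (D0 + K))
     - RtoC ((X * h + h ^ 2 / 2) * / INR (S (D0 + j)) ^ k)))%C K) in SB; [exact SB|].
  unfold Sx. replace (csum _ K - csum _ K)%C with (csum (fun j => RtoC (mu (S (D0 + j))) * RtoC (psi (S (D0 + j) ^ k) (X + h) (D0 + K) - (X + h) ^ 2 / 2 * / INR (S (D0 + j) ^ k)))%C K
    + Copp 1 * csum (fun j => RtoC (mu (S (D0 + j))) * RtoC (psi (S (D0 + j) ^ k) X (D0 + K) - X ^ 2 / 2 * / INR (S (D0 + j) ^ k)))%C K)%C by ring.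
  rewrite <- csum_scal, <- csum_plus. apply csum_ext. intros j _. rewrite pow_INR, !RtoC_minus.
  replace ((X + h) ^ 2 / 2 * / INR (S (D0 + j)) ^ k) with (X ^ 2 / 2 * / INR (S (D0 + j)) ^ k + (X * h + h ^ 2 / 2) * / INR (S (D0 + j)) ^ k) by (field; apply pow_nonzero, not_0_INR; lia).
  rewrite !RtoC_plus. ring.
Qed.

End RHsec.

(** * Assembling the bounds for k-free integers *)

(** Four errors add up to 3 h^2: unsmoothing h^2 / 2, small divisors h^2 beside h D0, truncation of
    the series for 1 / zeta(k) h^2, and the second-order main term h^2 / 2. Summing d up to 2 N
    covers everything below N + h. *)
Lemma kfree_smoothed (k N D0 K : nat) h Lg : (2 <= k)%nat -> (D0 + K = N + N)%nat -> 1 <= h -> h <= INR N ->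
  Cmod (csum (fun j => RtoC (mu (S (D0 + j))) * (RtoC (psi (S (D0 + j) ^ k) (INR N + h) (D0 + K)) - RtoC (psi (S (D0 + j) ^ k) (INR N) (D0 + K))
     - RtoC ((INR N * h + h ^ 2 / 2) * / INR (S (D0 + j)) ^ k)))%C K) <= Lg ->
  h * Rabs (INR (count_kfree k N) - INR N / zeta_real k) <= h * INR D0 + 3 * h ^ 2 + Lg.
Proof.
  intros Hk HM Hh HhN HL. set (X := INR N) in *. set (M := (D0 + K)%nat) in *.
  assert (EM : INR M = 2 * X) by (rewrite HM, plus_INR; unfold X; ring).
  set (G := X * h + h ^ 2 / 2) in *.
  pose proof (small_divisors k D0 X h M Hk ltac:(lra) ltac:(lra) ltac:(lra)) as SD. fold G in SD.
  set (T := fun d => (RtoC (mu (S d)) * (RtoC (psi (S d ^ k) (X + h) M) - RtoC (psi (S d ^ k) X M) - RtoC (G * / INR (S d) ^ k)))%C) in *.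
  change (Cmod (csum (fun j => T (D0 + j)%nat) K) <= Lg) in HL.
  assert (TT : Cmod (csum T M) <= INR D0 * h + h ^ 2 + Lg).
  { unfold M at 1. rewrite csum_split. eapply Rle_trans; [apply Cmod_triangle|]. lra. }
  pose proof (unsmooth (fun n => RtoC (kf k (S n))) N N h ltac:(intros n; cbv beta; rewrite Cmod_R; unfold kf; destruct (kfreeb k (S n)); [rewrite Rabs_R1|rewrite Rabs_R0]; lra) ltac:(lra)) as US.
  rewrite <- HM in US. fold X M in US. rewrite !kf_weighted in US by lia.
  assert (EC : csum (fun n => RtoC (kf k (S n))) N = RtoC (INR (count_kfree k N))) by (rewrite csum_RtoC, count_rsum; reflexivity).
  rewrite EC in US.
  set (m := rsum (fun d => mu (S d) * / INR (S d) ^ k) M).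
  assert (ET : csum T M = (csum (fun d => RtoC (mu (S d)) * RtoC (psi (S d ^ k) (X + h) M)) M - csum (fun d => RtoC (mu (S d)) * RtoC (psi (S d ^ k) X M)) M - RtoC (G * m))%C).
  { replace (csum (fun d => RtoC (mu (S d)) * RtoC (psi (S d ^ k) (X + h) M)) M - csum (fun d => RtoC (mu (S d)) * RtoC (psi (S d ^ k) X M)) M - RtoC (G * m))%C
      with (csum (fun d => RtoC (mu (S d)) * RtoC (psi (S d ^ k) (X + h) M)) M + Copp 1 * csum (fun d => RtoC (mu (S d)) * RtoC (psi (S d ^ k) X M)) M + RtoC (- G) * RtoC m)%C
      by (rewrite RtoC_mult, RtoC_opp; ring).
    unfold m. rewrite <- csum_RtoC, <- !csum_scal, <- !csum_plus. apply csum_ext. intros d _. unfold T. rewrite !RtoC_mult, RtoC_opp. ring. }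
  set (Sa := csum (fun d => RtoC (mu (S d)) * RtoC (psi (S d ^ k) (X + h) M))%C M) in *.
  set (Sb := csum (fun d => RtoC (mu (S d)) * RtoC (psi (S d ^ k) X M))%C M) in *.
  set (Qn := INR (count_kfree k N)) in *. set (z := zeta_real k).
  pose proof (zeta_real_ge1 k Hk) as Z1. fold z in Z1.
  assert (HX : 1 <= X) by lra.
  assert (HM1 : (1 <= M)%nat) by (apply INR_le; simpl; lra).
  pose proof (mu_zeta_tail k M Hk HM1) as MT. fold z m in MT. rewrite EM in MT.
  assert (D1 : Rabs (h * Qn - G * m) <= h ^ 2 / 2 + (INR D0 * h + h ^ 2 + Lg)).
  { rewrite <- Cmod_R. replace (RtoC (h * Qn - G * m)) with (csum T M - (Sa - Sb - RtoC h * RtoC Qn))%C by (rewrite ET, RtoC_minus, (RtoC_mult h); ring).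
    eapply Rle_trans; [apply Cmod_minus_le|]. lra. }
  assert (D2 : Rabs (G * m - G / z) <= h ^ 2).
  { replace (G * m - G / z) with (- G * (/ z - m)) by (unfold Rdiv; ring). rewrite Rabs_mult, Rabs_Ropp, (Rabs_pos_eq G) by (unfold G; nra).
    apply Rle_trans with (G * / (2 * X)); [apply Rmult_le_compat_l; [unfold G; nra|auto]|].
    apply (Rmult_le_reg_r (2 * X)); [lra|]. rewrite Rmult_assoc, Rinv_l, Rmult_1_r by lra. unfold G.
    assert (X * h <= X * (h * h)) by (apply Rmult_le_compat_l; nra). assert (h * h <= X * (h * h)) by nra.
    assert (0 <= h * h) by nra. replace (h ^ 2) with (h * h) by ring. lra. }
  assert (D3 : Rabs (G / z - X * h / z) <= h ^ 2 / 2).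
  { replace (G / z - X * h / z) with (h ^ 2 / 2 * / z) by (unfold G, Rdiv; ring).
    assert (0 < / z <= 1) by (split; [apply Rinv_0_lt_compat; lra|rewrite <- Rinv_1; apply Rinv_le_contravar; lra]).
    rewrite Rabs_pos_eq by nra. nra. }
  rewrite <- (Rabs_pos_eq h) at 1 by lra. rewrite <- Rabs_mult.
  replace (h * (Qn - X / z)) with ((h * Qn - G * m) + ((G * m - G / z) + (G / z - X * h / z))) by (unfold Rdiv; ring).
  eapply Rle_trans; [apply Rabs_triang|]. eapply Rle_trans; [apply Rplus_le_compat_l, Rabs_triang|]. lra.
Qed.

(** 11/6 = 6 - 25/6 is the part of the exponent reserved for polynomial factors and for exp (k + 1).
    It is enough because exp w >= 27 w^3. *)
Lemma num_final (u w ka kk : R) : 53 <= w -> 3 <= ka -> 0 <= kk <= ka -> u <= ka * exp w -> 0 <= u ->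
  5 + 3584 * u * kk * (ka * exp w) * exp ka <= exp (11 / 6 * (ka * exp w) / w).
Proof.
  intros Hw Hka Hkk Hu Hu0. pose proof (num_cube w ltac:(lra)) as Cu. pose proof (exp_pos w) as P.
  set (l := ka * exp w) in *. assert (Hl : 3 <= l) by (unfold l; pose proof (exp_ineq1_le w); nra).
  assert (K1 : ka <= exp ka) by (pose proof (exp_ineq1_le ka); lra).
  assert (E9 : 3600 <= exp 9).
  { replace 9 with (3 + 3 + 3) by ring. rewrite !exp_plus. pose proof exp_3_lb. assert (400 <= exp 3 * exp 3) by nra. nra. }
  apply Rle_trans with (exp (9 + 4 * ka + 2 * w)).
  - apply Rle_trans with (3600 * (ka * (l * l)) * exp ka).
    + assert (Hll : 0 <= u * kk <= l * ka) by (split; [apply Rmult_le_pos; lra|apply Rmult_le_compat; lra]).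
      assert (u * kk * l <= l * ka * l) by (apply Rmult_le_compat_r; lra).
      assert (1 <= exp ka) by lra. assert (27 <= ka * (l * l)) by nra.
      assert (3584 * u * kk * l * exp ka <= 3584 * (ka * (l * l)) * exp ka) by nra. nra.
    + replace (exp (9 + 4 * ka + 2 * w)) with (exp 9 * (exp ka * exp ka * exp ka * (exp w * exp w)) * exp ka) by (rewrite <- !exp_plus; f_equal; ring).
      apply Rmult_le_compat_r; [lra|]. apply Rmult_le_compat; [lra|nra|lra|].
      replace (ka * (l * l)) with (ka * ka * ka * (exp w * exp w)) by (unfold l; ring). apply Rmult_le_compat_r; [nra|].
      assert (ka * ka <= exp ka * exp ka) by nra. apply Rmult_le_compat; nra.
  - apply exp_le. apply (proj1 (Rle_div_r _ _ w ltac:(lra))). unfold l.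
    assert (Cw : 27 * (w * w * w) <= exp w) by nra.
    assert (Cz : 27 * 53 * (w * w) <= exp w) by nra.
    assert (9 + 4 * ka + 2 * w <= 2 * (ka * w)) by nra.
    apply Rle_trans with (2 * (ka * w) * w); [apply Rmult_le_compat_r; lra|]. nra.
Qed.

(** The number y = exp ly = x^(1/(k+1)) is both the smoothing length and the cut between small and
    large d, so the trivial errors are all O(y). The zeta bounds are used with u = ln ln x, which is
    at least ln ln y. *)
Theorem kfree_bound (RH : RiemannHypothesis) (k : nat) x ly : (2 <= k)%nat -> 0 < x -> ln x = (INR k + 1) * ly -> 0 < ly -> 53 <= ln ly ->
  Rabs (Qk k x - x / zeta_real k) <= exp (ly + 6 * ln x / ln ly).
Proof.
  intros Hk Hx Lx Hly Hw. set (w := ln ly) in *. assert (Ely : ly = exp w) by (unfold w; rewrite exp_ln; auto).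
  pose proof (le_INR 2 k Hk) as K2. simpl in K2. set (ka := INR k + 1) in *.
  pose proof (num_big w ltac:(lra)) as Bly. rewrite <- Ely in Bly.
  set (l := ln x) in *. set (u := ln l).
  assert (Hl : 3 * ly <= l) by (rewrite Lx; unfold ka; nra).
  assert (El : l = exp u) by (unfold u; rewrite exp_ln; lra).
  assert (Huw : w <= u) by (unfold u, w; apply ln_le; lra).
  assert (Hul : u <= l) by (pose proof (exp_ineq1_le u); lra).
  assert (Ex : x = exp l) by (unfold l; rewrite exp_ln; auto).
  set (y := exp ly). assert (Hy : 34000 <= y) by (unfold y; pose proof (exp_ineq1_le ly); lra).
  assert (Hyx : y * y <= x) by (rewrite Ex; unfold y; rewrite <- exp_plus; apply exp_le; lra).
  destruct (floor_nat_spec x ltac:(nra)) as [N1 [N2 N3]]. unfold Qk. set (N := floor_nat x) in *.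
  destruct (floor_nat_spec y ltac:(lra)) as [D1 [D2 D3]]. set (D0 := floor_nat y) in *.
  assert (HyN : y <= INR N) by nra.
  assert (HDN : (D0 <= N)%nat) by (apply INR_le; lra).
  set (K := (N + N - D0)%nat). assert (HK : (D0 + K = N + N)%nat) by (unfold K; lia).
  assert (HM : INR (D0 + K) = 2 * INR N) by (rewrite HK, plus_INR; ring).
  set (b := 2 / u). set (q := 1 / 2 + 2 * b). set (th := 0.5 / u).
  assert (Hb : 0 < b <= 1 / 12) by (unfold b; split; [apply Rdiv_lt_0_compat; lra|apply (proj2 (Rle_div_l _ _ u ltac:(lra))); lra]).
  pose proof (large_divisors RH u ltac:(lra) k Hk D0 K D1) as LD. rewrite <- El in LD. fold b q th in LD.
  assert (HM2 : INR (D0 + K) <= exp (2 * l)).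
  { rewrite HM. replace (2 * l) with (l + l) by ring. rewrite exp_plus, <- Ex. nra. }
  specialize (LD HM2 (INR N) y ltac:(lra) ltac:(lra) ltac:(lra)).
  pose proof (kfree_smoothed k N D0 K y _ Hk HK ltac:(lra) HyN LD) as KS. rewrite <- Ex in KS.
  set (X := INR N) in *. set (z := zeta_real k) in *. pose proof (zeta_real_ge1 k Hk) as Z1. fold z in Z1.
  set (Ef := large_E u k D0) in *.
  (* The integer part of y is at least y / e, and the exponent is at most k + 1. *)
  assert (RPD : rp (INR D0) ((INR k - 1) * q) <= exp (- ((INR k - 1) * q * ly) + ka)).
  { unfold rp. apply exp_le.
    assert (LD0 : ly - 1 <= ln (INR D0)).
    { replace (ly - 1) with (ln (exp (ly - 1))) by apply ln_exp. apply ln_le; [apply exp_pos|].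
      replace (ly - 1) with (- (1) + ly) by ring. rewrite exp_plus. fold y. rewrite exp_Ropp. pose proof exp_1_lb as E1.
      assert (/ exp 1 <= / 2) by (apply Rinv_le_contravar; lra). nra. }
    assert (0 <= (INR k - 1) * q <= ka) by (unfold q, ka; split; nra).
    set (p := (INR k - 1) * q) in *. nra. }
  assert (Ef0 : 0 <= Ef <= 448 * u * INR k * exp (- ((INR k - 1) * q * ly) + ka)).
  { unfold Ef, large_E. fold b q. pose proof (rp_pos (INR D0) ((INR k - 1) * q)).
    assert (0 <= 448 * u * INR k) by (apply Rmult_le_pos; lra). split; [apply Rmult_le_pos; lra|apply Rmult_le_compat_l; auto]. }
  assert (F1 : exp (q * ln (X + y)) <= 2 * exp (q * l)).
  { apply Rle_trans with (exp (q * ln (2 * x))); [apply exp_le, Rmult_le_compat_l; [unfold q; lra|apply ln_le; lra]|].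
    rewrite ln_mult by lra. fold l. rewrite Rmult_plus_distr_l, exp_plus. apply Rmult_le_compat_r; [apply Rlt_le, exp_pos|].
    apply Rle_trans with (exp (ln 2)); [|rewrite exp_ln; lra]. apply exp_le. assert (0 <= ln 2) by (apply ln_nonneg; lra). unfold q; nra. }
  assert (F2 : 0 <= 3 * ln (1 + x) + 32 * ((X + y) / y) / x <= 4 * l).
  { assert (L0 : 0 <= ln (1 + x)) by (apply ln_nonneg; lra).
    assert (L1 : ln (1 + x) <= l + 1).
    { rewrite <- (ln_exp (l + 1)). apply ln_le; [lra|]. rewrite exp_plus, <- Ex. pose proof exp_1_lb. nra. }
    assert (R0 : 0 <= (X + y) / y) by (apply Rdiv_le_0_compat; lra).
    assert (R1 : (X + y) / y <= 2 * x) by (apply (proj2 (Rle_div_l _ _ y ltac:(lra))); nra).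
    assert (R2 : 0 <= 32 * ((X + y) / y) / x <= 64).
    { split; [apply Rdiv_le_0_compat; lra|apply (proj2 (Rle_div_l _ _ x ltac:(lra))); lra]. }
    lra. }
  set (Br := 3 * ln (1 + x) + 32 * ((X + y) / y) / x) in *.
  set (P2 := exp (3 * th * l)) in *. assert (HP2 : 0 < P2) by apply exp_pos.
  set (Ex1 := exp (- ((INR k - 1) * q * ly) + ka)) in *. assert (HEx1 : 0 < Ex1) by apply exp_pos.
  set (Ex2 := exp (q * l)) in *. assert (HEx2 : 0 < Ex2) by apply exp_pos.
  assert (LL : Ef * exp (q * ln (X + y)) * P2 * Br <= (448 * u * INR k * Ex1) * (2 * Ex2) * P2 * (4 * l)).
  { apply Rmult_le_compat; [apply Rmult_le_pos; [apply Rmult_le_pos; [lra|apply Rlt_le, exp_pos]|lra]|lra| |lra].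
    apply Rmult_le_compat_r; [lra|]. apply Rmult_le_compat; [lra|apply Rlt_le, exp_pos|lra|auto]. }
  assert (EE : Ex1 * Ex2 * P2 <= y * exp (25 / 6 * l / w) * exp ka).
  { unfold Ex1, Ex2, P2, y. rewrite <- !exp_plus. apply exp_le.
    (* With ln x = (k + 1) ly the two powers combine to 2 q ly, and q = 1/2 + 4/u. *)
    assert (E1 : - ((INR k - 1) * q * ly) + q * l = ly + 8 * ly / u).
    { rewrite Lx. unfold ka, q, b. field. lra. }
    assert (E2 : 3 * th * l = 3 / 2 * l / u) by (unfold th; replace 0.5 with (1 / 2) by lra; field; lra).
    (* From ly <= l / 3, as k >= 2: 8/3 + 3/2 = 25/6. *)
    assert (E3 : 8 * ly / u + 3 / 2 * l / u <= 25 / 6 * l / w).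
    { apply Rle_trans with (25 / 6 * l / u).
      - replace (8 * ly / u + 3 / 2 * l / u) with ((8 * ly + 3 / 2 * l) / u) by (field; lra). apply Rmult_le_compat_r; [left; apply Rinv_0_lt_compat; lra|lra].
      - apply Rmult_le_compat_l; [lra|]. apply Rinv_le_contravar; lra. }
    lra. }
  set (E4 := exp (25 / 6 * l / w)) in *. assert (HE4 : 1 <= E4).
  { apply Rle_trans with (exp 0); [rewrite exp_0; lra|]. apply exp_le. apply Rdiv_le_0_compat; lra. }
  assert (NF : 5 + 3584 * u * INR k * l * exp ka <= exp (11 / 6 * l / w)).
  { replace l with (ka * exp w) by (rewrite Lx, Ely; auto). apply num_final; try (unfold ka; lra); try lra. rewrite <- Ely, <- Lx. lra. }
  assert (Fin : 5 * y + 448 * u * INR k * Ex1 * (2 * Ex2) * P2 * (4 * l) <= exp (ly + 6 * l / w)).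
  { apply Rle_trans with (y * E4 * (5 + 3584 * u * INR k * l * exp ka)).
    - assert (U0 : 0 <= 3584 * u * INR k * l) by (apply Rmult_le_pos; [apply Rmult_le_pos; lra|lra]).
      replace (448 * u * INR k * Ex1 * (2 * Ex2) * P2 * (4 * l)) with (3584 * u * INR k * l * (Ex1 * Ex2 * P2)) by ring.
      assert (3584 * u * INR k * l * (Ex1 * Ex2 * P2) <= 3584 * u * INR k * l * (y * E4 * exp ka)) by (apply Rmult_le_compat_l; auto).
      assert (y <= y * E4) by nra. nra.
    - replace (ly + 6 * l / w) with (ly + 25 / 6 * l / w + 11 / 6 * l / w) by (field; lra). rewrite !exp_plus. fold y E4.
      apply Rmult_le_compat_l; [apply Rmult_le_pos; lra|auto]. }
  assert (Main : Rabs (INR (count_kfree k N) - X / z) <= 4 * y + 448 * u * INR k * Ex1 * (2 * Ex2) * P2 * (4 * l)).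
  { apply (Rmult_le_reg_l y); [lra|]. eapply Rle_trans; [exact KS|].
    replace (y * Ef * exp (q * ln (X + y)) * P2 * Br) with (y * (Ef * exp (q * ln (X + y)) * P2 * Br)) by ring.
    assert (y * (Ef * exp (q * ln (X + y)) * P2 * Br) <= y * (448 * u * INR k * Ex1 * (2 * Ex2) * P2 * (4 * l))) by (apply Rmult_le_compat_l; lra).
    assert (y * INR D0 <= y * y) by (apply Rmult_le_compat_l; lra). nra. }
  assert (Xz : Rabs (X / z - x / z) <= 1).
  { replace (X / z - x / z) with (- ((x - X) * / z)) by (unfold Rdiv; ring). rewrite Rabs_Ropp.
    assert (0 < / z <= 1) by (split; [apply Rinv_0_lt_compat; lra|rewrite <- Rinv_1; apply Rinv_le_contravar; lra]).
    rewrite Rabs_pos_eq by nra. nra. }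
  replace (INR (count_kfree k N) - x / z) with ((INR (count_kfree k N) - X / z) + (X / z - x / z)) by ring.
  eapply Rle_trans; [apply Rabs_triang|]. lra.
Qed.

(** Since 2.302 * 23.147 > 53, this supplies the hypothesis on ln ly in [kfree_bound]. *)
Lemma ly_threshold x c Y : 3 <= c -> 23.147 <= Y -> Rpower 10 (c * Rpower 10 Y) <= x ->
  0 < x /\ 0 < ln x / c /\ 2.302 * Y <= ln (ln x / c).
Proof.
  intros Hc HY H. destruct (threshold x c Y ltac:(lra) ltac:(lra) H) as [X0 HL]. pose proof (exp_pos (2.302 * Y)) as P.
  assert (G : exp (2.302 * Y) <= ln x / c) by (apply (proj1 (Rle_div_r _ _ c ltac:(lra))); nra).
  repeat split; [auto|lra|]. rewrite <- (ln_exp (2.302 * Y)). apply ln_le; auto.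
Qed.

(** The second term of the exponent dominates 6 ln x / w: its coefficient is at least 7 (k + 1), and
    its iterated logarithm is at most w + 1 <= 7 w / 6. The first term is nonnegative, and the last
    contributes (ln x)^2, which outweighs 1/10. *)
Theorem kfree_explicit (RH : RiemannHypothesis) (k : nat) (x : R) : (2 <= k)%nat ->
     Rpower 10 ((INR k + 1) * Rpower 10 (23147/1000)) <= x ->
     Rabs (Qk k x - x / zeta_real k) <=
       1/10 * Rpower x (1 / (INR k + 1)) *
       exp (7525/1000 * ln x /
              (2 * (INR k + 1) * ln (ln (3 * exp 1 / 2 * Rpower x (1 / (2 * (INR k + 1))))))
            + (7492/1000 * INR k + 825/100) * ln x /
              ((INR k + 1) * ln (ln (3 * exp 1 / 2 * Rpower x (1 / (INR k + 1)))))
            + 2 * ln (ln x)).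
Proof.
  intros Hk H. pose proof (le_INR 2 k Hk) as K2. simpl in K2.
  destruct (ly_threshold x (INR k + 1) (23147 / 1000) ltac:(lra) ltac:(lra) H) as [X0 [Y0 W0]].
  set (ka := INR k + 1) in *. set (ly := ln x / ka) in *.
  assert (Lx : ln x = ka * ly) by (unfold ly; field; unfold ka; lra).
  eapply Rle_trans; [apply (kfree_bound RH k x ly Hk X0 Lx Y0); lra|].
  assert (Hw : 53 <= ln ly) by lra. set (w := ln ly) in *.
  pose proof (num_big w ltac:(lra)) as Bly. replace (exp w) with ly in Bly by (unfold w; rewrite exp_ln; auto).
  assert (R1 : Rpower x (1 / ka) = exp ly) by (unfold Rpower; f_equal; rewrite Lx; field; unfold ka; lra).
  assert (R2 : Rpower x (1 / (2 * ka)) = exp (ly / 2)) by (unfold Rpower; f_equal; rewrite Lx; field; unfold ka; lra).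
  rewrite R1, R2.
  assert (LB : forall v, v <= ln (3 * exp 1 / 2 * exp v) <= v + 2).
  { intros v. pose proof exp_1_lb as E1. pose proof exp_le_3 as E3. pose proof (exp_pos v). split.
    - rewrite <- (ln_exp v) at 1. apply ln_le; [auto|nra].
    - rewrite <- (ln_exp (v + 2)). apply ln_le; [nra|]. replace (v + 2) with (1 + 1 + v) by ring. rewrite !exp_plus.
      apply Rmult_le_compat_r; [lra|nra]. }
  destruct (LB ly) as [B1 B2]. destruct (LB (ly / 2)) as [B3 B4].
  set (v1 := ln (3 * exp 1 / 2 * exp ly)) in *. set (v2 := ln (3 * exp 1 / 2 * exp (ly / 2))) in *.
  assert (W2 : 0 < ln v2).
  { rewrite <- ln_1. apply ln_increasing; lra. }
  assert (W1 : w <= ln v1 <= w + 1).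
  { split; [unfold w; apply ln_le; lra|]. apply Rle_trans with (ln (ly * exp 1)); [apply ln_le; [lra|pose proof exp_1_lb; nra]|].
    rewrite ln_mult, ln_exp by (try apply exp_pos; lra). unfold w. lra. }
  assert (Lp : 0 < ln x) by (rewrite Lx; apply Rmult_lt_0_compat; [unfold ka|]; lra).
  assert (T1 : 0 <= 7525 / 1000 * ln x / (2 * ka * ln v2)).
  { apply Rdiv_le_0_compat; [lra|]. apply Rmult_lt_0_compat; [unfold ka; lra|auto]. }
  assert (T2 : 6 * ln x / w <= (7492 / 1000 * INR k + 825 / 100) * ln x / (ka * ln v1)).
  { rewrite Lx. replace ((7492 / 1000 * INR k + 825 / 100) * (ka * ly) / (ka * ln v1)) with ((7492 / 1000 * INR k + 825 / 100) * ly / ln v1) by (field; unfold ka; split; lra).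
    apply Rle_trans with (7 * ka * ly / ln v1).
    - apply (Rmult_le_reg_r (w * ln v1)); [nra|]. replace (6 * (ka * ly) / w * (w * ln v1)) with (ka * ly * (6 * ln v1)) by (field; lra).
      replace (7 * ka * ly / ln v1 * (w * ln v1)) with (ka * ly * (7 * w)) by (field; lra). apply Rmult_le_compat_l; [rewrite <- Lx; lra|lra].
    - apply Rmult_le_compat_r; [left; apply Rinv_0_lt_compat; lra|]. apply Rmult_le_compat_r; [lra|unfold ka; lra]. }
  set (t1 := 7525 / 1000 * ln x / (2 * ka * ln v2)) in *. set (t2 := (7492 / 1000 * INR k + 825 / 100) * ln x / (ka * ln v1)) in *.
  assert (L10 : 34000 <= ln x) by (rewrite Lx; unfold ka; nra).
  assert (E2 : 10 <= exp (2 * ln (ln x))).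
  { replace (2 * ln (ln x)) with (ln (ln x) + ln (ln x)) by ring. rewrite exp_plus, exp_ln by lra. nra. }
  rewrite !exp_plus. apply exp_le in T2. 
  assert (E1 : 1 <= exp t1) by (pose proof (exp_ineq1_le t1); lra).
  pose proof (exp_pos ly). pose proof (exp_pos (6 * ln x / w)).
  replace (1 / 10 * exp ly * (exp t1 * exp t2 * exp (2 * ln (ln x)))) with (exp ly * (exp t2 * (exp t1 * (exp (2 * ln (ln x)) / 10)))) by field.
  apply Rmult_le_compat_l; [lra|]. rewrite <- (Rmult_1_r (exp (6 * ln x / w))). apply Rmult_le_compat; [lra|lra|auto|]. nra.
Qed.

(** The third hypothesis says 6 / w <= be - 1/3, so that x^be alone covers the bound of
    [kfree_bound], while B (ln x)^2 >= 1. *)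
Lemma kfree_table (RH : RiemannHypothesis) be Y B x : 23.147 <= Y -> 0.05 <= B -> 6 <= (be - 1 / 3) * (2.302 * Y) ->
  0 <= be - 1 / 3 -> Rpower 10 (3 * Rpower 10 Y) <= x ->
  Rabs (Qk 2 x - x / zeta_real 2) <= B * Rpower x be * (ln x) ^ 2.
Proof.
  intros HY HB Hbe Hbe0 H. destruct (ly_threshold x 3 Y ltac:(lra) HY H) as [X0 [Y0 W0]].
  set (ly := ln x / 3) in *. assert (Lx : ln x = (INR 2 + 1) * ly) by (unfold ly; simpl; field).
  eapply Rle_trans; [apply (kfree_bound RH 2 x ly (Nat.le_refl _) X0 Lx Y0); lra|].
  set (w := ln ly) in *. pose proof (num_big w ltac:(lra)) as Bly. replace (exp w) with ly in Bly by (unfold w; rewrite exp_ln; auto).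
  assert (L3 : ln x = 3 * ly) by (unfold ly; field).
  assert (G : ly + 6 * ln x / w <= be * ln x).
  { assert (6 / w <= be - 1 / 3).
    { apply (proj2 (Rle_div_l _ _ w ltac:(lra))). eapply Rle_trans; [exact Hbe|]. apply Rmult_le_compat_l; lra. }
    replace (6 * ln x / w) with (6 / w * ln x) by (field; lra). 
    assert (6 / w * ln x <= (be - 1 / 3) * ln x) by (apply Rmult_le_compat_r; lra). lra. }
  apply exp_le in G. unfold Rpower. pose proof (exp_pos (be * ln x)).
  assert (1 <= B * (ln x) ^ 2) by (rewrite L3; nra). nra.
Qed.

Theorem kfree_table_all (RH : RiemannHypothesis) be Y B : In (be, Y, B) Q2_table ->
  forall x, Rpower 10 (3 * Rpower 10 Y) <= x -> Rabs (Qk 2 x - x / zeta_real 2) <= B * Rpower x be * (ln x) ^ 2.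
Proof.
  intros Hin x. cbn [Q2_table In] in Hin.
  repeat (destruct Hin as [E|Hin]; [inversion E; subst; apply kfree_table; auto; lra|]). destruct Hin.
Qed.

Theorem theorem2 :
  RiemannHypothesis ->
  (forall x : R, Rpower 10 (Rpower 10 (4487/1000)) <= x ->
     Rabs (Mertens x) <=
       6/10 * sqrt x *
       exp (52251/10000 * ln x / ln (ln (3 * exp 1 / 2 * sqrt x)) + ln (ln x)))
  /\
  (forall (k : nat) (x : R), (2 <= k)%nat ->
     Rpower 10 ((INR k + 1) * Rpower 10 (23147/1000)) <= x ->
     Rabs (Qk k x - x / zeta_real k) <=
       1/10 * Rpower x (1 / (INR k + 1)) *
       exp (7525/1000 * ln x /
              (2 * (INR k + 1) * ln (ln (3 * exp 1 / 2 * Rpower x (1 / (2 * (INR k + 1))))))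
            + (7492/1000 * INR k + 825/100) * ln x /
              ((INR k + 1) * ln (ln (3 * exp 1 / 2 * Rpower x (1 / (INR k + 1)))))
            + 2 * ln (ln x)))
  /\
  (forall (alpha X A : R), In (alpha, X, A) M_table ->
     forall x : R, Rpower 10 (Rpower 10 X) <= x ->
       Rabs (Mertens x) <= A * Rpower x alpha * ln x)
  /\
  (forall (beta Y B : R), In (beta, Y, B) Q2_table ->
     forall x : R, Rpower 10 (3 * Rpower 10 Y) <= x ->
       Rabs (Qk 2 x - x / zeta_real 2) <= B * Rpower x beta * (ln x) ^ 2).
Proof.
  intros RH. split; [exact (mertens_explicit RH)|]. split; [exact (kfree_explicit RH)|].
  split; [exact (mertens_table_all RH)|exact (kfree_table_all RH)].
Qed.
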